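(* Let $\{n_j\}_{j\in\mathbb N}\subset\mathbb N$ be any given lacunary sequence (i.e. $\liminf_{j\to\infty}n_{j+1}/n_j>1$). Then: (i) There exists $C_1>0$ such that for every measurable $F\subseteq\mathbb T$, every $g\in L^\infty(\mathbb T)$, and every measurable function $N:\mathbb T\to\{n_j\}_j$, the adjoint $C_{lac}^{*}$ of the linearized lacunary Carleson operator associated with $N$ satisfies $$\|\chi_F\,C_{lac}^{*}(g)\|_{L^1}\le C_1\,|F|\,\log\frac{4}{|F|}\,\|g\|_\infty .$$ (ii) There exists $C_2>0$ such that for every $\eta\in(0,1]$ there exists a measurable $F=F(\eta)\subseteq\mathbb T$ with $|F|=\eta$ such that $$\|C_{lac}(\chi_F)\|_{L^1}\ge C_2\,|F|\,\log\frac{4}{|F|}.$$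
   Context: $\mathbb T$ is the unit torus, identified with $[0,1)$; $\log=\log_2$; when $|F|=0$ the quantity $|F|\log\frac4{|F|}$ is $0$. The lacunary Carleson operator is $$C_{lac}f(x)=\sup_{j\in\mathbb N}\left|\,\mathrm{p.v.}\!\int_{\mathbb T}e^{2\pi i n_j(x-y)}\cot(\pi(x-y))f(y)\,dy\right| .$$ Given a measurable function $N:\mathbb T\to\{n_j\}_j$ (regarded as arbitrary and independent of the input function), the linearized lacunary Carleson operator is the linear operator $$T f(x)=\mathrm{p.v.}\!\int_{\mathbb T}\frac{1}{x-y}\,e^{-2\pi i N(x)y}f(y)\,dy ,$$ which is bounded on $L^2(\mathbb T)$, and $C_{lac}^{*}$ denotes its adjoint $T^*$ (with respect to the $L^2(\mathbb T)$ pairing). The constant $C_1$ does not depend on $N$. *)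

(* Defs.v *)
From HB Require Import structures.
From mathcomp Require Import all_boot all_order all_algebra.
From mathcomp Require Import complex.
From mathcomp Require Import all_classical all_reals all_analysis.

Set Implicit Arguments.
Unset Strict Implicit.
Unset Printing Implicit Defensive.
Import Order.TTheory GRing.Theory Num.Theory.
Import numFieldNormedType.Exports.
Local Open Scope classical_set_scope.
Local Open Scope ring_scope.
Local Open Scope complex_scope.

(* The real line equipped with the sigma-algebra of all Lebesgue measurable
   sets: this is the domain of [completed_lebesgue_measure]. With the Borel
   sigma-algebra, functions that are only defined almost everywhere (such as
   principal values) could fail to be measurable. *)
Definition lebR (R : realType) : measurableType _ :=
  caratheodory_type (mu_ext (@wlength R idfun)).

Section Defs.
Context {R : realType}.

Definition leb : {measure set (lebR R) -> \bar R} :=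
  completed_lebesgue_measure.

Notation mu := leb.

Definition torus : set (lebR R) := [set x : R | 0 <= x < 1].

(* Distance on R/Z between the classes of two points of [0, 1). *)
Definition tdist (x y : R) : R := Num.min `|x - y| (1 - `|x - y|).

(* A complex-valued function on the torus is a function on the line of which
   only the values on [0, 1) matter. *)
Definition cmeasurable (f : lebR R -> R[i]) : Prop :=
  measurable_fun torus (fun x => complex.Re (f x)) /\
  measurable_fun torus (fun x => complex.Im (f x)).

Definition Cintegral (D : set (lebR R)) (f : lebR R -> R[i]) : R[i] :=
  (\int[mu]_(x in D) complex.Re (f x)) +i* (\int[mu]_(x in D) complex.Im (f x)).

Definition eLnorm (p : \bar R) (f : lebR R -> \bar R) : \bar R :=
  'N[mu]_p[f \_ torus].

Definition cLnorm (p : \bar R) (f : lebR R -> R[i]) : \bar R :=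
  eLnorm p (fun x => (ComplexField.Normc.normc (f x))%:E).

Definition cLp (p : \bar R) (f : lebR R -> R[i]) : Prop :=
  cmeasurable f /\ (cLnorm p f < +oo)%E.

Definition pairing (f g : lebR R -> R[i]) : R[i] :=
  Cintegral torus (fun x => f x * conjc (g x)).

(* [S] is an adjoint of [T], viewed as operators on L^2(torus). Two adjoints
   of [T] agree almost everywhere on the torus. *)
Definition L2_adjoint (T S : (lebR R -> R[i]) -> (lebR R -> R[i])) : Prop :=
  forall f g, cLp 2%:E f -> cLp 2%:E g ->
    cLp 2%:E (S g) /\ pairing (T f) g = pairing f (S g).

(* p.v. integral over the torus of [h], singular at [x]: the limit as eps
   tends to 0+ of the integrals over { y | tdist x y > eps }. In both uses
   below the limit exists for almost every x when f is integrable; elsewhere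
   [lim] takes an unspecified value, on a null set of points x. *)
Definition pvint (x : R) (h : lebR R -> R[i]) : R[i] :=
  let I (eps : R) :=
    Cintegral [set y | torus y /\ eps < tdist x y] h in
  (lim (complex.Re (I eps) @[eps --> 0^'+])) +i* (lim (complex.Im (I eps) @[eps --> 0^'+])).

Definition cexp2pi (t : R) : R[i] := cos (2 * pi * t) +i* sin (2 * pi * t).

Definition cot (t : R) : R := cos t / sin t.

Definition carleson_lac (n : nat -> nat) (f : lebR R -> R[i]) (x : lebR R) :
    \bar R :=
  ereal_sup [set (ComplexField.Normc.normc
    (pvint x (fun y => cexp2pi ((n j)%:R * ((x : R) - (y : R)))
                       * (cot (pi * ((x : R) - (y : R))))%:C * f y)))%:E
    | j in [set: nat]].

Definition carleson_linear (N : lebR R -> nat) (f : lebR R -> R[i])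
    (x : lebR R) : R[i] :=
  pvint x (fun y => (((x : R) - (y : R))^-1)%:C
                    * cexp2pi (- ((N x)%:R * (y : R))) * f y).

Definition cindic (F : set (lebR R)) (x : lebR R) : R[i] := (\1_F x)%:C.

(* The ratio n_(j+1) / n_j is 0 when n_j = 0, so this forces n_j > 0 for all
   large j. *)
Definition lacunary (n : nat -> nat) : Prop :=
  (1 < limn_einf (fun j => ((n j.+1)%:R / (n j)%:R : R)%:E))%E.

(* |F| log_2 (4 / |F|); it is 0 when |F| = 0. *)
Definition LlogL (F : set (lebR R)) : R :=
  let m := fine (mu F) in m * (ln (4 / m) / ln 2).

End Defs.

(* Main.v *)
Require Import Defs.
From HB Require Import structures.
From mathcomp Require Import all_boot all_order all_algebra.
From mathcomp Require Import complex.
From mathcomp Require Import all_classical all_reals all_analysis.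
From mathcomp Require Import measurable_realfun ess_sup_inf.
From mathcomp Require Import ring lra zify.

(** Upper bound. Testing the adjoint against Lipschitz functions f with |f| <= 1 and using inner
    regularity to pass to indicator functions, it suffices to bound the L^1 norm of the linearized
    operator at f by C ((1 + l) ||f||_1 + e^-l) for every l >= 0, and to take l = - ln |F|. Dualizing
    against |g| <= 1 and using Young's inequality, this bound follows from the exponential
    integrability, uniformly in N, of y |-> int g(x) tr(2 pi N(x) y) K(x - y) dx, where tr is cos or
    sin and K truncates 1/t. The kernel K is an average of triadic cell kernels over shifted and
    dilated grids, so that by Jensen's inequality a Bellman function on the triadic tree handles
    the unmodulated kernel 1/t truncated at a scale that depends on x. For a lacunary sequence of
    frequencies a Riesz product replaces the exponential of the modulated sum by a product of
    hyperbolic cosines of its amplitudes, that is by an average over signs of unmodulated operators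
    truncated at the scales 1/N(x).

    Lower bound. Take F = [0, eta) and a single frequency m = n_j >= 1. The imaginary part of
    the operator is the convolution with a trigonometric polynomial of mean 1, hence the L^1 norm is
    at least eta. For small eta the real part is at least eta / (16 x) between 2 eta and
    1 / (16 m), which gives the logarithm. *)

(** The exponential bound must not depend on how [N] is chosen. A stopping argument handles the size
    of [N(x)] but not its phase, since [N] can correlate the phases of different points arbitrarily.
    Lacunarity removes the phases: group the points by frequency; when a phase of frequency [m] runs
    through half a period, the terms of much lower frequency hardly move, so the modulated terms act
    almost like independent variables. A sign that is constant on each group can be absorbed into
    [g], and this gives uniformity in [N]. Two obstacles shape the Riesz product. The ratio of
    neighbouring frequencies may be close to 1, and an amplitude varies on the same scale as its own
    phase; hence the factors are not orthogonal, and a correction subtracted from each of them keeps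
    the integrals of the partial products from growing. The amplitudes have no uniform bound, so
    they are clipped, and the excess goes into the hyperbolic cosines. Below the scale [1/N(x)] the
    phase is nearly constant and is frozen at [x]. The finitely many terms before the lacunary
    regime are treated one frequency at a time. *)

Set Implicit Arguments.
Unset Strict Implicit.
Unset Printing Implicit Defensive.
Import Order.TTheory GRing.Theory Num.Theory.
Import numFieldNormedType.Exports.
Local Open Scope classical_set_scope.
Local Open Scope ring_scope.

(** * Integration of bounded measurable functions *)

Section BoundedMeasurable.
Context d (T : measurableType d) (R : realType).
Implicit Types f g : T -> R.

(** Boundedness on the whole type, not only on a domain, makes the class stable under all operations
    used below and integrable over every set of finite measure, so that no integrability conditions
    have to be carried along. *)
Definition bmf f := measurable_fun setT f /\ exists M, forall x, `|f x| <= M.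

Lemma bmf_cst c : bmf (fun=> c).
Proof. by split; [exact: measurable_cst | exists `|c|]. Qed.

Lemma bmfD f g : bmf f -> bmf g -> bmf (fun x => f x + g x).
Proof.
move=> [mf [M hM]] [mg [N hN]]; split; first exact: measurable_funD.
by exists (M + N) => x; rewrite (le_trans (ler_normD _ _))// lerD.
Qed.

Lemma bmfM f g : bmf f -> bmf g -> bmf (fun x => f x * g x).
Proof.
move=> [mf [M hM]] [mg [N hN]]; split; first exact: measurable_funM.
by exists (M * N) => x; rewrite normrM ler_pM.
Qed.

Lemma bmfZ c f : bmf f -> bmf (fun x => c * f x).
Proof. exact: bmfM (bmf_cst c). Qed.

Lemma bmfN f : bmf f -> bmf (fun x => - f x).
Proof.
move=> /(bmfZ (-1)); rewrite (_ : (fun x => - f x) = fun x => -1 * f x)//.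
by apply/funext => x; rewrite mulN1r.
Qed.

Lemma bmfB f g : bmf f -> bmf g -> bmf (fun x => f x - g x).
Proof. by move=> bf bg; apply: bmfD => //; exact: bmfN. Qed.

Lemma bmf_sum (I : Type) (s : seq I) (P : pred I) (F : I -> T -> R) :
  (forall i, P i -> bmf (F i)) -> bmf (fun x => \sum_(i <- s | P i) F i x).
Proof.
move=> h; elim: s => [|i s ih].
  rewrite (_ : (fun _ => _) = fun=> 0); first exact: bmf_cst.
  by apply/funext => x; rewrite big_nil.
have -> : (fun x => \sum_(j <- i :: s | P j) F j x) =
   if P i then (fun x => F i x + \sum_(j <- s | P j) F j x)
   else (fun x => \sum_(j <- s | P j) F j x).
  by case: ifPn => Pi; apply/funext => x; rewrite big_cons ?Pi// (negbTE Pi).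
by case: ifPn => Pi //; apply: bmfD => //; exact: h.
Qed.

Lemma bmf_prod (I : Type) (s : seq I) (F : I -> T -> R) :
  (forall i, bmf (F i)) -> bmf (fun x => \prod_(i <- s) F i x).
Proof.
move=> h; elim: s => [|i s ih].
  rewrite (_ : (fun _ => _) = fun=> 1); first exact: bmf_cst.
  by apply/funext => x; rewrite big_nil.
rewrite (_ : (fun _ => _) = fun x => F i x * \prod_(j <- s) F j x).
  exact: bmfM.
by apply/funext => x; rewrite big_cons.
Qed.

Lemma bmf_norm f : bmf f -> bmf (fun x => `|f x|).
Proof.
move=> [mf [M hM]]; split; first exact: measurableT_comp.
by exists M => x; rewrite normr_id.
Qed.

Lemma bmf_expR f : bmf f -> bmf (fun x => expR (f x)).
Proof.
move=> [mf [M hM]]; split; first exact: measurableT_comp.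
exists (expR M) => x; rewrite ger0_norm ?expR_ge0// ler_expR.
exact: le_trans (ler_norm _) (hM x).
Qed.

Lemma bmf_indic (A : set T) : measurable A -> bmf (\1_A : T -> R).
Proof.
move=> mA; split; first exact: measurable_indic.
by exists 1 => x; rewrite indicE; case: (x \in A); rewrite ?normr0 ?normr1.
Qed.

Lemma bmf_bool (b : T -> bool) : measurable_fun setT b -> bmf (fun x => (b x)%:R).
Proof.
move=> mb; have -> : (fun x => (b x)%:R) = \1_[set x | b x] :> (T -> R).
  by apply/funext => x; rewrite indicE mem_setE.
apply: bmf_indic; have := mb measurableT [set true] I.
by rewrite setTI; congr (measurable _); apply/seteqP; split => x /=.
Qed.

End BoundedMeasurable.

Lemma bmf_comp d1 d2 (T1 : measurableType d1) (T2 : measurableType d2)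
    (R : realType) (f : T2 -> R) (phi : T1 -> T2) :
  bmf f -> measurable_fun setT phi -> bmf (fun x => f (phi x)).
Proof.
by move=> [mf [M hM]] mphi; split; [exact: measurableT_comp | exists M => x].
Qed.

Section BoundedIntegral.
Context d (T : measurableType d) (R : realType).
Variable mu : {measure set T -> \bar R}.
Implicit Types (f g : T -> R) (D : set T).

Definition findom D := measurable D /\ (mu D < +oo)%E.

Lemma bmf_integrable D f : findom D -> bmf f -> mu.-integrable D (EFin \o f).
Proof.
move=> [mD fD] [mf [M hM]].
apply: measurable_bounded_integrable => //; first exact: measurable_funTS.
exists `|M|; split => [|N MN x _]; first exact: num_real.
by rewrite /= (le_trans (hM x))// (le_trans (ler_norm _) (ltW MN)).
Qed.

Lemma bintD D f g : findom D -> bmf f -> bmf g ->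
  \int[mu]_(x in D) (f x + g x) = \int[mu]_(x in D) f x + \int[mu]_(x in D) g x.
Proof. by move=> h bf bg; rewrite RintegralD//; by [case: h | exact: bmf_integrable]. Qed.

Lemma bintB D f g : findom D -> bmf f -> bmf g ->
  \int[mu]_(x in D) (f x - g x) = \int[mu]_(x in D) f x - \int[mu]_(x in D) g x.
Proof. by move=> h bf bg; rewrite RintegralB//; by [case: h | exact: bmf_integrable]. Qed.

Lemma bintZ D c f : findom D -> bmf f ->
  \int[mu]_(x in D) (c * f x) = c * \int[mu]_(x in D) f x.
Proof. by move=> h bf; rewrite RintegralZl//; by [case: h | exact: bmf_integrable]. Qed.

Lemma bint_cst D c : findom D -> \int[mu]_(x in D) c = c * fine (mu D).
Proof. by move=> [mD _]; rewrite Rintegral_cst. Qed.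

Lemma bintN D f : findom D -> bmf f ->
  \int[mu]_(x in D) (- f x) = - \int[mu]_(x in D) f x.
Proof.
move=> h bf; rewrite -mulN1r -bintZ//; apply: eq_Rintegral => x _.
by rewrite mulN1r.
Qed.

Lemma bint_sum D (I : Type) (s : seq I) (P : pred I) (F : I -> T -> R) :
  findom D -> (forall i, P i -> bmf (F i)) ->
  \int[mu]_(x in D) (\sum_(i <- s | P i) F i x) =
  \sum_(i <- s | P i) \int[mu]_(x in D) F i x.
Proof.
move=> h bF; elim: s => [|i s ih].
  rewrite big_nil; under eq_Rintegral do rewrite big_nil.
  by rewrite bint_cst// mul0r.
rewrite big_cons; under eq_Rintegral do rewrite big_cons.
case: ifPn => Pi //; rewrite -ih bintD//; first exact: bF.
exact: bmf_sum.
Qed.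

Lemma le_bint D f g : findom D -> bmf f -> bmf g -> (forall x, D x -> f x <= g x) ->
  \int[mu]_(x in D) f x <= \int[mu]_(x in D) g x.
Proof. by move=> h bf bg fg; apply: le_Rintegral => //; by [case: h | exact: bmf_integrable]. Qed.

Lemma norm_bint D f : findom D -> bmf f ->
  `|\int[mu]_(x in D) f x| <= \int[mu]_(x in D) `|f x|.
Proof. by move=> h bf; apply: le_normr_Rintegral; by [case: h | exact: bmf_integrable]. Qed.

Lemma norm_bint_le D f g : findom D -> bmf f -> bmf g ->
  (forall x, D x -> `|f x| <= g x) ->
  `|\int[mu]_(x in D) f x| <= \int[mu]_(x in D) g x.
Proof.
move=> h bf bg fg; apply: (le_trans (norm_bint h bf)).
by apply: le_bint => //; exact: bmf_norm.
Qed.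

Lemma bint_setU A B f : findom A -> findom B -> [disjoint A & B] -> bmf f ->
  \int[mu]_(x in A `|` B) f x = \int[mu]_(x in A) f x + \int[mu]_(x in B) f x.
Proof.
move=> [mA fA] [mB fB] AB bf; rewrite Rintegral_setU//.
apply: bmf_integrable => //; split; first exact: measurableU.
by rewrite (le_lt_trans (measureU2 _ _ _))// lte_add_pinfty.
Qed.

Lemma bintE D f : findom D -> bmf f ->
  (\int[mu]_(x in D) (f x)%:E = (\int[mu]_(x in D) f x)%:E)%E.
Proof. by move=> [mD fD] bf; rewrite fineK// integrable_fin_num//; exact: bmf_integrable. Qed.

Lemma bint_mkcond D A f : measurable A ->
  \int[mu]_(x in D `&` A) f x = \int[mu]_(x in D) (f x * \1_A x).
Proof.
move=> mA; rewrite Rintegral_mkcondr; apply: eq_Rintegral => x _.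
by rewrite patch_indic.
Qed.

(* Tangent line at the mean. *)
Lemma jensen_expR D f : findom D -> fine (mu D) = 1 -> bmf f ->
  expR (\int[mu]_(x in D) f x) <= \int[mu]_(x in D) expR (f x).
Proof.
move=> h D1 bf; set m := \int[mu]_(x in D) f x.
have bm : bmf (fun x => expR m * (1 - m + f x)).
  by apply: bmfZ; apply: bmfD => //; exact: bmf_cst.
rewrite -[leLHS](_ : \int[mu]_(x in D) (expR m * (1 - m + f x)) = _).
  apply: le_bint => //; first exact: bmf_expR.
  move=> x _; rewrite -{2}(subrK m (f x)) expRD mulrC ler_wpM2r ?expR_ge0//.
  by apply: le_trans (expR_ge1Dx _); lra.
rewrite bintZ//; last by apply: bmfD => //; exact: bmf_cst.
by rewrite bintD// ?bint_cst// -/m ?D1; [ring | exact: bmf_cst].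
Qed.

End BoundedIntegral.


(** * Fubini's theorem for bounded functions *)

Section Swap.
Context d1 d2 (T1 : measurableType d1) (T2 : measurableType d2) (R : realType).
Implicit Types f : T1 -> T2 -> R.

Lemma bmf_fst f y : bmf (fun p => f p.1 p.2) -> bmf (fun x => f x y).
Proof. by move=> bf; apply: (bmf_comp (phi := fun x => (x, y)) bf); exact: measurable_fun_pair. Qed.

Lemma bmf_snd f x : bmf (fun p => f p.1 p.2) -> bmf (f x).
Proof. by move=> bf; apply: (bmf_comp (phi := fun y => (x, y)) bf); exact: measurable_fun_pair. Qed.

Lemma bmf_swap f : bmf (fun p => f p.1 p.2) -> bmf (fun p => f p.2 p.1).
Proof.
by move=> bf; apply: (bmf_comp (phi := fun p => (p.2, p.1)) bf); exact: measurable_swap.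
Qed.

Variables (m1 : {sigma_finite_measure set T1 -> \bar R})
  (m2 : {sigma_finite_measure set T2 -> \bar R}).

(** Tonelli's theorem asks for a nonnegative function on the whole product: adding a bound [M] of
    [|f|] and multiplying by the indicators of the two domains provides one. The extra constant is
    cancelled at the end. *)
Let shift f (M : R) (A1 : set T1) (A2 : set T2) p :=
  (((f p.1 p.2 + M) * \1_A1 p.1 * \1_A2 p.2))%:E.

Let shift_ge0 f M A1 A2 p : (forall q, `|f q.1 q.2| <= M) -> (0 <= shift f M A1 A2 p)%E.
Proof.
move=> hM; rewrite lee_fin; do 2 (apply: mulr_ge0 => //).
by have := hM p; rewrite ler_norml => /andP[]; lra.
Qed.

Let shift_meas f M A1 A2 : measurable A1 -> measurable A2 ->
  bmf (fun p => f p.1 p.2) -> measurable_fun setT (shift f M A1 A2).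
Proof.
move=> m1A m2A bf; apply/measurable_EFinP.
have b1 : bmf (fun p : T1 * T2 => \1_A1 p.1 : R).
  by apply: (bmf_comp (bmf_indic R m1A)); exact: measurable_fst.
have b2 : bmf (fun p : T1 * T2 => \1_A2 p.2 : R).
  by apply: (bmf_comp (bmf_indic R m2A)); exact: measurable_snd.
by case: (bmfM (bmfM (bmfD bf (bmf_cst _ M)) b1) b2).
Qed.

Let shift_int1 f M A1 A2 x : findom m2 A2 -> bmf (fun p => f p.1 p.2) ->
  (\int[m2]_y shift f M A1 A2 (x, y) =
   ((\int[m2]_(y in A2) f x y + M * fine (m2 A2)) * \1_A1 x)%:E)%E.
Proof.
move=> h bf; have bx := bmf_snd x bf.
transitivity (\int[m2]_(y in A2) ((\1_A1 x * (f x y + M)))%:E)%E.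
  rewrite [RHS]integral_mkcond; apply: eq_integral => y _.
  rewrite /shift/= patchE [\1_A2 _]indicE; case: (y \in A2); rewrite ?mulr1 ?mulr0//.
  by rewrite mulrC.
have bfM := bmfD bx (bmf_cst _ M).
rewrite bintE//; last exact: bmfZ.
by congr EFin; rewrite mulrC -bint_cst// -bintD//; [rewrite bintZ | exact: bmf_cst].
Qed.

Let shift_int2 f M A1 A2 y : findom m1 A1 -> bmf (fun p => f p.1 p.2) ->
  (\int[m1]_x shift f M A1 A2 (x, y) =
   ((\int[m1]_(x in A1) f x y + M * fine (m1 A1)) * \1_A2 y)%:E)%E.
Proof.
move=> h bf; have bx := bmf_fst y bf.
transitivity (\int[m1]_(x in A1) ((\1_A2 y * (f x y + M)))%:E)%E.
  rewrite [RHS]integral_mkcond; apply: eq_integral => x _.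
  rewrite /shift/= patchE [\1_A1 _]indicE; case: (x \in A1); rewrite ?mulr1 ?mulr0 ?mul0r//.
  by rewrite mulrC.
have bfM := bmfD bx (bmf_cst _ M).
rewrite bintE//; last exact: bmfZ.
by congr EFin; rewrite mulrC -bint_cst// -bintD//; [rewrite bintZ | exact: bmf_cst].
Qed.

Lemma bmf_bint (D2 : set T2) f : findom m2 D2 -> bmf (fun p => f p.1 p.2) ->
  bmf (fun x => \int[m2]_(y in D2) f x y).
Proof.
move=> h bf; have [_ [M hM]] := bf; split; last first.
  exists (M * fine (m2 D2)) => x; rewrite -bint_cst//.
  apply: norm_bint_le => //; [exact: bmf_snd | exact: bmf_cst |].
  by move=> y _; exact: (hM (x, y)).
have mT := @measurableT _ T1.
have := measurable_fun_fubini_tonelli_F (m2 := m2) (shift f M setT D2)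
  (shift_meas M mT (proj1 h) bf) (fun p => shift_ge0 _ _ _ hM).
rewrite (_ : fubini_F _ _ = fun x =>
    (\int[m2]_(y in D2) f x y + M * fine (m2 D2))%:E); last first.
  apply/funext => x; rewrite /fubini_F shift_int1//.
  by rewrite indicE in_setT mulr1.
move=> /measurable_EFinP mF.
rewrite (_ : (fun x => _) = fun x => (\int[m2]_(y in D2) f x y + M * fine (m2 D2))
   - M * fine (m2 D2)); last by apply/funext => x; rewrite addrK.
exact: measurable_funB.
Qed.

Lemma bint_swap (D1 : set T1) (D2 : set T2) f : findom m1 D1 -> findom m2 D2 ->
  bmf (fun p => f p.1 p.2) ->
  \int[m1]_(x in D1) \int[m2]_(y in D2) f x y =
  \int[m2]_(y in D2) \int[m1]_(x in D1) f x y.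
Proof.
move=> h1 h2 bf; have [_ [M hM]] := bf.
have bF := bmf_bint h2 bf.
have := fubini_tonelli (m1 := m1) (m2 := m2) (shift f M D1 D2)
  (shift_meas M (proj1 h1) (proj1 h2) bf) (fun p => shift_ge0 _ _ _ hM).
under eq_integral do rewrite shift_int1//.
under [X in _ = X -> _]eq_integral do rewrite shift_int2//.
have key d (T : measurableType d) (m : {measure set T -> \bar R}) D (g : T -> R) c :
    findom m D -> measurable_fun setT g -> (exists M, forall x, `|g x| <= M) ->
    (\int[m]_x ((g x + c) * \1_D x)%:E = (\int[m]_(x in D) g x + c * fine (m D))%:E)%E.
  move=> h mg bg; have {mg}bg : bmf g by [].
  transitivity (\int[m]_(x in D) (g x + c)%:E)%E.
    rewrite [RHS]integral_mkcond; apply: eq_integral => x _.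
    by rewrite patchE indicE; case: (x \in D); rewrite ?mulr1 ?mulr0.
  have bc := bmf_cst T c.
  by rewrite bintE//; [rewrite bintD// bint_cst | exact: bmfD].
rewrite key//; [|by case: bF..].
have [mG1 mG2] : bmf (fun y => \int[m1]_(x in D1) f x y).
  split; last first.
    exists (M * fine (m1 D1)) => y; rewrite -bint_cst//.
    apply: norm_bint_le => //; [exact: bmf_fst | exact: bmf_cst |].
    by move=> x _; exact: (hM (x, y)).
  have mT := @measurableT _ T2.
  have := measurable_fun_fubini_tonelli_G (m1 := m1) (shift f M D1 setT)
    (shift_meas M (proj1 h1) mT bf) (fun p => shift_ge0 _ _ _ hM).
  rewrite (_ : fubini_G _ _ = fun y =>
      (\int[m1]_(x in D1) f x y + M * fine (m1 D1))%:E); last first.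
    apply/funext => y; rewrite /fubini_G shift_int2//.
    by rewrite indicE in_setT mulr1.
  move=> /measurable_EFinP mF.
  rewrite (_ : (fun y => _) = fun y => (\int[m1]_(x in D1) f x y + M * fine (m1 D1))
     - M * fine (m1 D1)); last by apply/funext => y; rewrite addrK.
  exact: measurable_funB.
rewrite key// => -[].
by rewrite -!mulrA [fine (m2 D2) * _]mulrC => /addIr.
Qed.

End Swap.

(** * Affine changes of variables for Lebesgue measure *)

Section Affine.
Variable R : realType.
Notation lm := (@lebesgue_measure R).
Implicit Types f : measurableTypeR R -> R.

Lemma measurable_affine (s u : R) :
  measurable_fun setT (fun x : measurableTypeR R => s * x + u : measurableTypeR R).
Proof.
by apply: continuous_measurable_fun => x; apply: cvgD; [exact: cvgMr | exact: cvg_cst].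
Qed.

(** Uniqueness of Lebesgue measure: [|s|] times the image measure under the affine map gives each
    half-open interval its length. For [s < 0] the preimage of []a, b]] is closed on the other side,
    which leaves its length unchanged. *)
Lemma lebesgue_affine (s u : R) (A : set (measurableTypeR R)) : s != 0 -> measurable A ->
  (lm A = (`|s|)%:E * lm ((fun x => (s * x + u)%R) @^-1` A))%E.
Proof.
move=> s0 mA.
have mphi := measurable_affine s u.
pose mf := isMeasurableFun.Build _ _ _ _ _ mphi.
pose phi : {mfun measurableTypeR R >-> measurableTypeR R} := HB.pack (fun x : measurableTypeR R => s * x + u : measurableTypeR R) mf.
pose nu' : {measure set (measurableTypeR R) -> \bar R} :=
  mscale (NngNum (normr_ge0 s)) (pushforward lm phi).
rewrite (lebesgue_measure_unique (mu := nu' mphi))// => _ [[a b] _ <-] /=.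
rewrite /mscale /pushforward /= lebesgue_measure_itv/= lte_fin.
have [s_gt0|s_lt0] := ltP 0 s.
  rewrite [pushforward _ _ _](_ : _ = lm `]((a - u) / s), ((b - u) / s)]%classic); last first.
    congr (lm _); apply/seteqP; split => x; rewrite /= !in_itv/= ltr_pdivrMr// ler_pdivlMr//;
      by move=> /andP[? ?]; apply/andP; split; lra.
  rewrite lebesgue_measure_itv/= lte_fin ltr_pM2r ?invr_gt0// ltrD2r.
  case: ifPn => ab; last by rewrite mule0.
  by rewrite -!EFinB -EFinM gtr0_norm//; congr EFin; field.
have {}s_lt0 : s < 0 by rewrite lt_neqAle s0.
rewrite [pushforward _ _ _](_ : _ = lm `[((b - u) / s), ((a - u) / s)[%classic); last first.
  congr (lm _); apply/seteqP; split => x; rewrite /= !in_itv/= ltr_ndivlMr// ler_ndivrMr//;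
    by move=> /andP[? ?]; apply/andP; split; lra.
rewrite lebesgue_measure_itv/= lte_fin ltr_nM2r ?invr_lt0// ltrD2r.
case: ifPn => ab; last by rewrite mule0.
by rewrite -!EFinB -EFinM ltr0_norm//; congr EFin; field.
Qed.

Lemma findom_affine s u (D : set (measurableTypeR R)) : s != 0 ->
  findom lm D -> findom lm ((fun x => s * x + u) @^-1` D).
Proof.
move=> s0 [mD fD]; split.
  by have := measurable_affine s u measurableT mD; rewrite setTI.
have s1 : 0 < `|s| by rewrite normr_gt0.
rewrite ltey; apply/eqP => mE; move: fD.
by rewrite [X in (X < _)%E](lebesgue_affine u s0 mD) mE gt0_muley ?lte_fin// ltxx.
Qed.

Lemma bint_affine s u (D : set (measurableTypeR R)) f : s != 0 -> findom lm D -> bmf f ->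
  \int[lm]_(x in (fun x => s * x + u) @^-1` D) f (s * x + u) =
  `|s|^-1 * \int[lm]_(x in D) f x.
Proof.
move=> s0 hD bf; have [mf [M hM]] := bf; have hD' := findom_affine u s0 hD.
have mphi := measurable_affine s u.
have sn0 : `|s| != 0 by rewrite normr_eq0.
have M0 x : 0 <= f x + M.
  by have := hM x; rewrite ler_norml => /andP[]; lra.
pose mfm := isMeasurableFun.Build _ _ _ _ _ mphi.
pose phi : {mfun measurableTypeR R >-> measurableTypeR R} := HB.pack (fun x : measurableTypeR R => s * x + u : measurableTypeR R) mfm.
pose nu : {measure set (measurableTypeR R) -> \bar R} :=
  mscale (NngNum (normr_ge0 s)) (pushforward lm phi).
have bfM : bmf (fun x => f x + M) by apply: bmfD => //; exact: bmf_cst.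
have bfphi : bmf (fun x : measurableTypeR R => f (s * x + u)).
  exact: (bmf_comp (phi := fun x : measurableTypeR R => s * x + u : measurableTypeR R) bf).
have bfMphi : bmf (fun x : measurableTypeR R => f (s * x + u) + M).
  by apply: bmfD => //; exact: bmf_cst.
have mfM : measurable_fun D (fun x => (f x + M)%:E).
  by apply/measurable_EFinP; apply: measurable_funTS; case: bfM.
have key : (\int[lm]_(x in D) (f x + M)%:E =
  (`|s|)%:E * \int[lm]_(x in (fun x => (s * x + u)%R) @^-1` D) (f (s * x + u) + M)%:E)%E.
  rewrite (eq_measure_integral (nu mphi)); last first.
    move=> A mA _; exact: lebesgue_affine.
  rewrite ge0_integral_mscale//; last 2 first.
  - exact: (proj1 hD).
  - by move=> x _; rewrite lee_fin.
  congr (_ * _)%E; rewrite ge0_integral_pushforward//; first exact: (proj1 hD).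
  by move=> x _; rewrite lee_fin.
move: key; rewrite !bintE// -EFinM => -[].
have bM := bmf_cst (measurableTypeR R) M.
have e1 := bintD hD bf bM; have e2 := bintD hD' bfphi bM.
have e3 := congr1 fine (lebesgue_affine u s0 (proj1 hD)).
rewrite fineM// in e3; last by rewrite ge0_fin_numE//; case: hD'.
rewrite e1 e2 !bint_cst// e3 /= mulrDr mulrCA => /addIr ->.
by rewrite mulKf.
Qed.

End Affine.

(** * Integrals over compact intervals *)

Section IntervalIntegral.
Variable R : realType.
Notation lm := (@lebesgue_measure R).
Notation bmfR := (@bmf _ (measurableTypeR R) R).
Implicit Types (a b c : R) (f g : R -> R).

Definition itg a b f : R := \int[lm]_(x in `[a, b]) f x.

Lemma findom_itv (i : interval R) : (exists M, forall x, x \in i -> `|x| <= M) ->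
  findom lm [set` i].
Proof.
move=> [M hM]; split; first exact: measurable_itv.
apply: (@le_lt_trans _ _ (lm `[- M, M])).
  apply: le_measure; rewrite ?inE//; try exact: measurable_itv.
  by move=> x /hM; rewrite ler_norml/= in_itv.
by rewrite lebesgue_measure_itv/=; case: ifP => _; rewrite ltry.
Qed.

Lemma findom_cc a b : findom lm `[a, b].
Proof.
apply: findom_itv; exists (`|a| + `|b|) => x; rewrite in_itv/= ler_norml => /andP[ax xb].
have := ler_norm b; have := ler_norm (- a); rewrite normrN.
by have := normr_ge0 a; have := normr_ge0 b; move=> *; apply/andP; split; lra.
Qed.

Lemma findom_co a b : findom lm `[a, b[.
Proof.
apply: findom_itv; exists (`|a| + `|b|) => x; rewrite in_itv/= ler_norml => /andP[ax xb].
have := ler_norm b; have := ler_norm (- a); rewrite normrN.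
by have := normr_ge0 a; have := normr_ge0 b; move=> *; apply/andP; split; lra.
Qed.

Lemma fine_itv a b : a <= b -> fine (lm `[a, b]) = b - a.
Proof.
move=> ab; rewrite lebesgue_measure_itv/= lte_fin; case: ltP => // ba.
by rewrite (_ : b = a) ?subrr//; lra.
Qed.

Lemma eq_itg a b f g : (forall x, a <= x <= b -> f x = g x) -> itg a b f = itg a b g.
Proof. by move=> h; apply: eq_Rintegral => x; rewrite inE/= in_itv/=; exact: h. Qed.

Lemma itgD a b f g : bmfR f -> bmfR g -> itg a b (fun x => f x + g x) = itg a b f + itg a b g.
Proof. exact/bintD/findom_cc. Qed.

Lemma itgB a b f g : bmfR f -> bmfR g -> itg a b (fun x => f x - g x) = itg a b f - itg a b g.
Proof. exact/bintB/findom_cc. Qed.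

Lemma itgZ a b c f : bmfR f -> itg a b (fun x => c * f x) = c * itg a b f.
Proof. exact/bintZ/findom_cc. Qed.

Lemma itgN a b f : bmfR f -> itg a b (fun x => - f x) = - itg a b f.
Proof. exact/bintN/findom_cc. Qed.

Lemma itg_cst a b c : a <= b -> itg a b (fun=> c) = c * (b - a).
Proof. by move=> ab; rewrite /itg bint_cst ?fine_itv//; exact: findom_cc. Qed.

Lemma itg_sum a b (I : Type) (s : seq I) (P : pred I) (F : I -> R -> R) :
  (forall i, P i -> bmfR (F i)) ->
  itg a b (fun x => \sum_(i <- s | P i) F i x) = \sum_(i <- s | P i) itg a b (F i).
Proof. exact/bint_sum/findom_cc. Qed.

Lemma le_itg a b f g : bmfR f -> bmfR g -> (forall x, a <= x <= b -> f x <= g x) ->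
  itg a b f <= itg a b g.
Proof. by move=> bf bg h; apply: le_bint => //; exact: findom_cc. Qed.

Lemma norm_itg a b f : bmfR f -> `|itg a b f| <= itg a b (fun x => `|f x|).
Proof. exact/norm_bint/findom_cc. Qed.

Lemma norm_itg_le a b f g : bmfR f -> bmfR g -> (forall x, a <= x <= b -> `|f x| <= g x) ->
  `|itg a b f| <= itg a b g.
Proof.
move=> bf bg h; apply: le_trans (norm_itg _ _ bf) _.
by apply: le_itg => //; exact: bmf_norm.
Qed.

Lemma itg_ge0 a b f : (forall x, a <= x <= b -> 0 <= f x) -> 0 <= itg a b f.
Proof. by move=> h; apply: Rintegral_ge0 => x /=; rewrite in_itv; exact: h. Qed.

Lemma itg_le_cst a b c f : a <= b -> bmfR f -> (forall x, a <= x <= b -> f x <= c) ->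
  itg a b f <= c * (b - a).
Proof. by move=> ab bf h; rewrite -itg_cst//; apply: le_itg => //; exact: bmf_cst. Qed.

Lemma norm_itg_le_cst a b c f : a <= b -> bmfR f -> (forall x, a <= x <= b -> `|f x| <= c) ->
  `|itg a b f| <= c * (b - a).
Proof. by move=> ab bf h; rewrite -itg_cst//; apply: norm_itg_le => //; exact: bmf_cst. Qed.

Lemma itg_point a f : bmfR f -> itg a a f = 0.
Proof.
move=> bf; have [_ [M hM]] := bf; apply/eqP; rewrite -normr_le0.
have <- : M * (a - a) = 0 by rewrite subrr mulr0.
exact: norm_itg_le_cst.
Qed.

Lemma itg_co a b f : bmfR f -> \int[lm]_(x in `[a, b[) f x = itg a b f.
Proof.
move=> bf; rewrite /itg; apply: Rintegral_itv_bndo_bndc.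
by apply: bmf_integrable => //; exact: findom_co.
Qed.

Lemma itg_split b a c f : a <= b -> b <= c -> bmfR f -> itg a c f = itg a b f + itg b c f.
Proof.
move=> ab bc bf; rewrite -(itg_co a b)// /itg -bint_setU//.
- congr (\int[lm]_(x in _) f x); apply/seteqP; split => x /=; rewrite !in_itv/=.
    by move=> /andP[ax xc]; have [xb|bx] := ltP x b; [left; rewrite ax | right].
  by move=> [/andP[? ?]|/andP[? ?]]; apply/andP; split; lra.
- exact: findom_co.
- exact: findom_cc.
- apply/disj_setPS => x /= []; rewrite !in_itv/=; move=> /andP[_ h] /andP[]; lra.
Qed.

Lemma bmf_affine s u f : bmfR f -> bmfR (fun x => f (s * x + u)).
Proof.
move=> bf; apply: (bmf_comp (phi := fun x : measurableTypeR R => s * x + u : measurableTypeR R) bf).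
exact: measurable_affine.
Qed.

Lemma itg_affine s u a b f : 0 < s -> bmfR f ->
  itg a b (fun x => f (s * x + u)) = s^-1 * itg (s * a + u) (s * b + u) f.
Proof.
move=> s0 bf; rewrite -{2}(gtr0_norm s0) -(bint_affine u)//; [|by rewrite gt_eqF|exact: findom_cc].
congr (\int[lm]_(x in _) _); apply/seteqP.
by split => x /=; rewrite !in_itv/= !lerD2r !ler_pM2l.
Qed.

Lemma itg_shift u a b f : bmfR f -> itg a b (fun x => f (x + u)) = itg (a + u) (b + u) f.
Proof.
move=> bf; have := itg_affine u a b ltr01 bf; rewrite invr1 !mul1r => <-.
by apply: eq_itg => x _; rewrite mul1r.
Qed.

Lemma itg_opp a b f : bmfR f -> itg a b (fun x => f (- x)) = itg (- b) (- a) f.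
Proof.
move=> bf; have n0 : -1 != 0 :> R by rewrite oppr_eq0 oner_eq0.
transitivity (`|-1|^-1 * itg (- b) (- a) f); last by rewrite normrN1 invr1 mul1r.
rewrite /itg -(bint_affine 0 n0)//; last exact: findom_cc.
rewrite (_ : _ @^-1` _ = `[a, b]%classic); last first.
  apply/seteqP; split => x /=; rewrite !in_itv/=; lra.
by apply: eq_Rintegral => x _; rewrite mulN1r addr0.
Qed.

Lemma itg_support a b c d f : a <= c -> c <= d -> d <= b -> bmfR f ->
  (forall x, a <= x <= b -> ~~ (c <= x <= d) -> f x = 0) -> itg a b f = itg c d f.
Proof.
move=> ac cd db bf h.
have bg : bmfR (\1_`[c, d]) by apply: bmf_indic; exact: measurable_itv.
transitivity (itg a b (fun x => f x * \1_`[c, d] x)).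
  apply: eq_itg => x xab; rewrite indicE mem_setE in_itv/=.
  by have [xcd|xcd] := boolP (c <= x <= d); rewrite /= ?mulr1// h// mul0r.
rewrite /itg -bint_mkcond; last exact: measurable_itv.
congr (\int[lm]_(x in _) _); apply/seteqP; split => x /=; rewrite !in_itv/=; first by case.
by move=> /andP[? ?]; split; apply/andP; split; lra.
Qed.

Lemma bmf_continuous f : continuous f -> (exists M, forall x, `|f x| <= M) -> bmfR f.
Proof. by move=> cf hf; split => //; exact: continuous_measurable_fun. Qed.

Lemma lipschitz_continuous (L : R) f : (forall x y, `|f x - f y| <= L * `|x - y|) -> continuous f.
Proof.
move=> hf x; apply/cvgrPdist_le => e e0.
have L0 : 0 < `|L| + 1 by rewrite ltr_wpDl.
near=> y; apply: le_trans (hf x y) _.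
apply: (@le_trans _ _ ((`|L| + 1) * `|x - y|)).
  by rewrite ler_wpM2r// (le_trans (ler_norm _))// lerDl.
rewrite mulrC -ler_pdivlMr//; near: y.
by apply/nbhs_ballP; exists (e / (`|L| + 1)) => /= [|y]; [rewrite divr_gt0 | move/ltW].
Unshelve. all: by end_near. Qed.

Lemma bmf_lipschitz L f : (forall x y, `|f x - f y| <= L * `|x - y|) ->
  (exists M, forall x, `|f x| <= M) -> bmfR f.
Proof. by move=> /lipschitz_continuous; exact: bmf_continuous. Qed.

End IntervalIntegral.

(** * Triadic cells and the kernel 1/t *)

Section Cells.
Variable R : realType.
Notation bmfR := (@bmf _ (measurableTypeR R) R).
Implicit Types (a b t u v w z : R).

Definition flr z : R := (Num.floor z)%:~R.

Lemma flr_itv z : flr z <= z < flr z + 1.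
Proof. by have := floor_itv z; rewrite intrD. Qed.

Lemma flr_eq z (j : int) : j%:~R <= z < j%:~R + 1 -> flr z = j%:~R.
Proof. by move=> h; rewrite /flr; congr intmul; apply: floor_def; rewrite intrD. Qed.

Lemma flrDint z (j : int) : flr (z + j%:~R) = flr z + j%:~R.
Proof.
have := flr_itv z; rewrite {2}/flr -intrD => h; apply: flr_eq.
by rewrite intrD; move: h; rewrite /flr => /andP[? ?]; apply/andP; split; lra.
Qed.

Lemma flr01 z : 0 <= z < 1 -> flr z = 0.
Proof. by move=> h; apply: (@flr_eq z 0); rewrite add0r. Qed.

Lemma flr_eq0 z : flr z = 0 -> 0 <= z < 1.
Proof. by move=> h; have := flr_itv z; rewrite h add0r. Qed.

Lemma le_flr : {homo flr : x y / x <= y}.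
Proof. by move=> x y xy; rewrite ler_int le_floor. Qed.

Lemma measurable_flr : measurable_fun setT (flr : measurableTypeR R -> measurableTypeR R).
Proof.
apply: nondecreasing_measurable => //; exact: le_flr.
Qed.

(** The first digit of the fractional part of [z] in base 3, that is, the child to which [z] belongs
    within its cell. *)
Definition dig z := flr (3 * z) - 3 * flr z.

Lemma digDint z (j : int) : dig (z + j%:~R) = dig z.
Proof.
rewrite /dig flrDint mulrDr (_ : 3 * j%:~R = (3 * j)%:~R :> R); last by rewrite intrM.
by rewrite flrDint intrM; ring.
Qed.

Lemma dig01 z : 0 <= z < 1 ->
  dig z = if z < 1/3 then 0 else if z < 2/3 then 1 else 2.
Proof.
move=> z01; rewrite /dig (flr01 z01) mulr0 subr0.
move: z01 => /andP[z0 z1].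
case: ltP => z3; first by apply: flr01; apply/andP; split; lra.
case: ltP => z6; first by apply: (@flr_eq _ 1); apply/andP; split; lra.
by apply: (@flr_eq _ 2); apply/andP; split; lra.
Qed.

Lemma dig_cases z : [\/ dig z = 0, dig z = 1 | dig z = 2].
Proof.
rewrite -[z](subrK (flr z)) /flr digDint dig01.
  by case: ifP => _; [constructor | case: ifP => _; [constructor 2|constructor 3]].
by have := flr_itv z; rewrite /flr => /andP[? ?]; apply/andP; split; lra.
Qed.

(** On the digits 0, 1, 2 [alpha] takes the values 1, 0, -1 and [beta] the values 1, -2, 1: an
    antisymmetric and a symmetric function, both of mean zero over the children of a cell. *)
Definition alpha (d : R) := 1 - d.
Definition beta (d : R) := 3 * (d - 1) ^+ 2 - 2.

Definition samecell a b : R := (flr a == flr b)%:R.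
(** A Haar shift on triadic cells. Its average over translations must be odd in order to resemble
    [1/t], which calls for one antisymmetric and one symmetric factor of mean zero. With two
    children there is only one mean-zero function up to scaling, and its autocorrelation is even;
    hence base 3. *)
Definition cellker a b : R := samecell a b * alpha (dig a) * beta (dig b).

Lemma norm_alpha z : `|alpha (dig z)| <= 1.
Proof. by rewrite /alpha; case: (dig_cases z) => ->; rewrite ler_norml; lra. Qed.

Lemma norm_beta z : `|beta (dig z)| <= 2.
Proof. by rewrite /beta; case: (dig_cases z) => ->; rewrite ler_norml expr2; lra. Qed.

Lemma samecellDint a b (j : int) : samecell (a + j%:~R) (b + j%:~R) = samecell a b.
Proof. by rewrite /samecell !flrDint (inj_eq (addIr _)). Qed.

Section measurability.
Context d (T : measurableType d).
Implicit Types f g : T -> R.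

Lemma bmf_alpha f : measurable_fun setT f -> bmf (fun x => alpha (dig (f x))).
Proof.
move=> mf; split; last by exists 1 => x; exact: norm_alpha.
have m3f : measurable_fun setT (fun x => 3 * f x).
  by apply: measurable_funM => //; exact: measurable_cst.
have m1 := measurableT_comp measurable_flr m3f.
have m2 := measurableT_comp measurable_flr mf.
apply: measurable_funB; first exact: measurable_cst.
apply: measurable_funB => //.
by apply: measurable_funM => //; exact: measurable_cst.
Qed.

Lemma bmf_beta f : measurable_fun setT f -> bmf (fun x => beta (dig (f x))).
Proof.
move=> mf; have [ma _] := bmf_alpha mf.
split; last by exists 2 => x; exact: norm_beta.
rewrite (_ : (fun x => _) = fun x => 3 * (alpha (dig (f x))) ^+ 2 - 2); last first.
  by apply/funext => x; rewrite /alpha /beta; ring.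
apply: measurable_funB; last exact: measurable_cst.
apply: measurable_funM; first exact: measurable_cst.
exact: measurable_funX.
Qed.

Lemma bmf_samecell f g : measurable_fun setT f -> measurable_fun setT g ->
  bmf (fun x => samecell (f x) (g x)).
Proof.
move=> mf mg; apply: bmf_bool; apply: measurable_fun_eqr.
  exact: (measurableT_comp measurable_flr).
exact: (measurableT_comp measurable_flr).
Qed.

Lemma bmf_cellker f g : measurable_fun setT f -> measurable_fun setT g ->
  bmf (fun x => cellker (f x) (g x)).
Proof.
by move=> mf mg; apply: bmfM (bmf_beta mg); apply: bmfM (bmf_samecell mf mg) (bmf_alpha mf).
Qed.

End measurability.

Definition ico p q v : R := if (p <= v) && (v < q) then 1 else 0.

Lemma icoE p q v : ico p q v = \1_`[p, q[ v.
Proof. by rewrite indicE mem_setE in_itv/= /ico; case: (_ && _). Qed.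

Lemma bmf_ico p q : bmfR (ico p q).
Proof.
rewrite (_ : ico p q = \1_`[p, q[); first by apply: bmf_indic; exact: measurable_itv.
by apply/funext => v; exact: icoE.
Qed.

Lemma ico_in p q v : p <= v -> v < q -> ico p q v = 1.
Proof. by rewrite /ico => -> ->. Qed.

Lemma ico_out p q v : v < p \/ q <= v -> ico p q v = 0.
Proof. by case=> h; rewrite /ico; case: ifP => // /andP[]; lra. Qed.

Lemma icoM p q p' q' v : ico p q v * ico p' q' v = ico (Num.max p p') (Num.min q q') v.
Proof.
by rewrite /ico ge_max lt_min; do !case: (_ <= _); do !case: (_ < _); rewrite /= ?(mulr0, mul0r, mulr1).
Qed.

Lemma itg_ico a b p q : a <= b ->
  itg a b (ico p q) = Num.max 0 (Num.min b q - Num.max a p).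
Proof.
move=> ab; have bi := bmf_ico p q.
rewrite -itg_co//.
transitivity (\int[@lebesgue_measure R]_(v in `[a, b[) (1 * \1_`[p, q[ v)).
  by apply: eq_Rintegral => v _; rewrite mul1r icoE.
rewrite -bint_mkcond; last exact: measurable_itv.
rewrite (_ : _ `&` _ = `[Num.max a p, Num.min b q[%classic); last first.
  apply/seteqP; split => v /=; rewrite !in_itv/= ge_max lt_min.
    by move=> [/andP[-> ->] /andP[-> ->]].
  by move=> /andP[/andP[-> ->] /andP[-> ->]].
rewrite bint_cst; last exact: findom_co.
rewrite mul1r [X in fine X](lebesgue_measure_itv `[Num.max a p, Num.min b q[%R) /= lte_fin.
move: (Num.max a p) (Num.min b q) => x y; case: ltP => h /=.
  by rewrite max_r // subr_ge0 ltW.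
by rewrite max_l // subr_le0.
Qed.

Lemma itg_periodic (h : R -> R) b : bmfR h -> (forall v (j : int), h (v + j%:~R) = h v) ->
  itg 0 1 (fun w => h (w + b)) = itg 0 1 h.
Proof.
move=> bh per; pose r := b - flr b.
have /andP[r0 r1] : 0 <= r < 1.
  by have := flr_itv b; rewrite /r => /andP[? ?]; apply/andP; split; lra.
transitivity (itg 0 1 (fun w => h (w + r))).
  by apply: eq_itg => w _; rewrite -(per (w + r) (Num.floor b)) -addrA subrK.
rewrite itg_shift// add0r [1 + r]addrC (itg_split (b := 1))//; try lra.
have -> : itg 1 (r + 1) h = itg 0 r h.
  have := itg_shift 1 0 r bh; rewrite add0r => <-.
  by apply: eq_itg => v _; rewrite (per v 1).
by rewrite addrC -itg_split//; lra.
Qed.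

Definition tent t := Num.max 0 (1/3 - `|t|).

(** The cross-correlation of [alpha] and [beta] on a unit cell: two thirds of the cell correlate to
    a tent ([itg_thirds]), and the two tents centred at 0 cancel. *)
Definition kap t := 2 * tent (t - 1/3) - tent (t - 2/3) - 2 * tent (t + 1/3) + tent (t + 2/3).

Definition third (d z : R) := ico (d / 3) ((d + 1) / 3) z.

Lemma third_in d z : d <= 3 * z -> 3 * z < d + 1 -> third d z = 1.
Proof. by move=> ? ?; apply: ico_in; lra. Qed.

Lemma third_out d z : 3 * z < d \/ d + 1 <= 3 * z -> third d z = 0.
Proof. by move=> h; apply: ico_out; case: h => ?; [left|right]; lra. Qed.

Lemma itg_thirds t (d e : R) : 0 <= e -> e <= 2 ->
  itg 0 1 (fun v => third d (t + v) * third e v) = tent (t - (d - e)/3).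
Proof.
move=> e0 e2.
rewrite (eq_itg (g := ico (Num.max (d/3 - t) (e/3)) (Num.min ((d+1)/3 - t) ((e+1)/3)))).
  rewrite itg_ico// /tent; congr (Num.max 0 _).
  rewrite [Num.min 1 _]min_r; last by rewrite ge_min; apply/orP; right; lra.
  rewrite [Num.max 0 _]max_r; last by rewrite le_max; apply/orP; right; lra.
  by rewrite /Num.max /Num.min; do !(case: ltP => ?); case: (ger0P (t - (d - e)/3)) => ?; lra.
move=> v _; rewrite -icoM /third /ico lerBlDr ltrBrDr ![v + t]addrC.
by [].
Qed.

Lemma digE z : 0 <= z < 1 -> alpha (dig z) = third 0 z - third 2 z /\
  beta (dig z) = third 0 z - 2 * third 1 z + third 2 z.
Proof.
move=> z01; rewrite (dig01 z01) /alpha /beta; have [z0 z1] := andP z01.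
have [z3|z3] := ltP z (1/3).
  have -> : third 0 z = 1 by apply: third_in; lra.
  have -> : third 1 z = 0 by apply: third_out; left; lra.
  have -> : third 2 z = 0 by apply: third_out; left; lra.
  by split; ring.
have -> : third 0 z = 0 by apply: third_out; right; lra.
have [z6|z6] := ltP z (2/3).
  have -> : third 1 z = 1 by apply: third_in; lra.
  have -> : third 2 z = 0 by apply: third_out; left; lra.
  by split; ring.
have -> : third 1 z = 0 by apply: third_out; right; lra.
have -> : third 2 z = 1 by apply: third_in; lra.
by split; ring.
Qed.

Lemma itg_cellker t : itg 0 1 (fun v => cellker (t + v) v) = kap t.
Proof.
pose I d e v := third d (t + v) * third e v.
have bI d e : bmfR (I d e).
  apply: bmfM; last exact: bmf_ico.
  apply: (bmf_comp (phi := fun v : measurableTypeR R => t + v : measurableTypeR R) (bmf_ico _ _)).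
  by apply: measurable_funD; [exact: measurable_cst | exact: measurable_id].
have bZ c d e : bmfR (fun v => c * I d e v) by exact: bmfZ.
have b2 : bmfR (fun v => I 0 0 v - 2 * I 0 1 v) by exact: bmfB.
have b3 : bmfR (fun v => I 0 0 v - 2 * I 0 1 v + I 0 2 v) by exact: bmfD.
have b4 : bmfR (fun v => I 0 0 v - 2 * I 0 1 v + I 0 2 v - I 2 0 v) by exact: bmfB.
have b5 : bmfR (fun v => I 0 0 v - 2 * I 0 1 v + I 0 2 v - I 2 0 v + 2 * I 2 1 v) by exact: bmfD.
transitivity (itg 0 1 (fun v =>
    I 0 0 v - 2 * I 0 1 v + I 0 2 v - I 2 0 v + 2 * I 2 1 v - I 2 2 v)).
  (* The right endpoint is dropped because [v = 1] belongs to the next cell, where [digE] does not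
     apply. *)
  rewrite -!itg_co//; last 2 first.
  - exact: bmfB.
  - apply: (bmf_cellker (T := measurableTypeR R)); last exact: measurable_id.
    by apply: measurable_funD; [exact: measurable_cst | exact: measurable_id].
  apply: eq_Rintegral => v; rewrite inE/= in_itv/= => v01.
  have [av bv] := digE v01; rewrite /cellker /samecell (flr01 v01) bv /I.
  have [tv|tv] := boolP (0 <= t + v < 1).
    rewrite (flr01 tv) eqxx (proj1 (digE tv)) /=; ring.
  case: eqP => [/flr_eq0|_]; first by rewrite (negbTE tv).
  have out d : d = 0 \/ d = 2 -> third d (t + v) = 0.
    move=> hd; apply: third_out; move: tv; rewrite negb_and -ltNge -leNgt.
    by case: hd => -> /orP[?|?]; [left|right|left|right]; lra.
  rewrite (out 0); last by left.
  rewrite (out 2); last by right.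
  by rewrite !mul0r; ring.
rewrite itgB// itgD// itgB// itgD// itgB// !itgZ// !itg_thirds//; try lra.
rewrite /kap !subr0 !sub0r !subrr !mul0r.
have -> : t - (2 - 1) / 3 = t - 1/3 by lra.
have -> : t - (- (1) / 3) = t + 1/3 by lra.
have -> : t - (- (2) / 3) = t + 2/3 by lra.
by ring.
Qed.

Lemma itg_cellker_shift a b : itg 0 1 (fun w => cellker (a + w) (b + w)) = kap (a - b).
Proof.
rewrite -itg_cellker -[RHS](itg_periodic b).
- by apply: eq_itg => w _; congr (cellker _ _); ring.
- apply: (bmf_cellker (T := measurableTypeR R)); last exact: measurable_id.
  by apply: measurable_funD; [exact: measurable_cst | exact: measurable_id].
- by move=> v j; rewrite /cellker addrA samecellDint !digDint.
Qed.

Lemma itg_samecell_shift a b :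
  itg 0 1 (fun w => samecell (a + w) (b + w)) = Num.max 0 (1 - `|a - b|).
Proof.
have bS t : bmfR (fun v => samecell (t + v) v).
  apply: (bmf_samecell (T := measurableTypeR R)); last exact: measurable_id.
  by apply: measurable_funD; [exact: measurable_cst | exact: measurable_id].
transitivity (itg 0 1 (fun v => samecell (a - b + v) v)).
  rewrite -[RHS](itg_periodic b)//.
    by apply: eq_itg => w _; congr (samecell _ _); ring.
  by move=> v j; rewrite addrA samecellDint.
rewrite -itg_co//.
transitivity (\int[@lebesgue_measure R]_(v in `[0, 1[) ico (b - a) (1 + (b - a)) v).
  apply: eq_Rintegral => v; rewrite inE/= in_itv/= => v01; rewrite /samecell (flr01 v01).
  have [h|h] := boolP (0 <= a - b + v < 1).
    by rewrite (flr01 h) eqxx ico_in//; move: h => /andP[? ?]; lra.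
  case: eqP => [/flr_eq0|_]; first by rewrite (negbTE h).
  rewrite ico_out//; move: h; rewrite negb_and -ltNge -leNgt.
  by move=> /orP[?|?]; [left|right]; lra.
rewrite itg_co ?itg_ico//; last exact: bmf_ico.
congr (Num.max 0 _).
by rewrite /Num.max /Num.min; do !(case: ltP => ?); case: (ger0P (a - b)) => ?; lra.
Qed.

End Cells.

(** * The averaged kernel, its regularity and its Poisson-type majorant *)

Section Kernel.
Variable R : realType.
Notation bmfR := (@bmf _ (measurableTypeR R) R).
Implicit Types (a b t u h : R) (n k : nat).

Lemma tent_ge0 t : 0 <= tent t.
Proof. by rewrite /tent le_max lexx. Qed.

Lemma tent_le t : tent t <= 1/3.
Proof. by rewrite /tent ge_max; apply/andP; split; [lra | rewrite gerBl]. Qed.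

Lemma tent_out t : 1/3 <= `|t| -> tent t = 0.
Proof. by move=> h; rewrite /tent max_l// subr_le0. Qed.

Lemma tent_lip a b : `|tent a - tent b| <= `|a - b|.
Proof.
have h := ler_dist_dist a b; rewrite /tent; move: h.
move: `|a| `|b| `|a - b| => x y z; rewrite ler_norml => /andP[h1 h2].
have z0 : 0 <= z by lra.
by rewrite /Num.max; case: (ltP 0 (1/3 - x)) => ?; case: (ltP 0 (1/3 - y)) => ?;
  rewrite ler_norml; apply/andP; split; lra.
Qed.

Lemma tentN t : tent (- t) = tent t.
Proof. by rewrite /tent normrN. Qed.

Lemma kapN t : kap (- t) = - kap t.
Proof.
rewrite /kap -(tentN (- t - 1/3)) -(tentN (- t - 2/3)) -(tentN (- t + 1/3)) -(tentN (- t + 2/3)).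
have -> : - (- t - 1/3) = t + 1/3 by lra.
have -> : - (- t - 2/3) = t + 2/3 by lra.
have -> : - (- t + 1/3) = t - 1/3 by lra.
have -> : - (- t + 2/3) = t - 2/3 by lra.
by ring.
Qed.

Lemma kap_bound t : `|kap t| <= 2.
Proof.
rewrite /kap ler_norml.
have := tent_ge0 (t - 1/3); have := tent_ge0 (t - 2/3).
have := tent_ge0 (t + 1/3); have := tent_ge0 (t + 2/3).
have := tent_le (t - 1/3); have := tent_le (t - 2/3).
have := tent_le (t + 1/3); have := tent_le (t + 2/3).
by move=> *; apply/andP; split; lra.
Qed.

Lemma kap_lip a b : `|kap a - kap b| <= 6 * `|a - b|.
Proof.
have h c : `|tent (a + c) - tent (b + c)| <= `|a - b|.
  by apply: le_trans (tent_lip _ _) _; rewrite (_ : a + c - (b + c) = a - b)//; ring.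
rewrite /kap; have := h (- (1/3)); have := h (- (2/3)); have := h (1/3); have := h (2/3).
by rewrite !ler_norml => /andP[? ?] /andP[? ?] /andP[? ?] /andP[? ?]; apply/andP; split; lra.
Qed.

Lemma kap_out t : 1 <= `|t| -> kap t = 0.
Proof.
move=> t1; have h c : `|c| <= 2/3 -> tent (t + c) = 0.
  move=> hc; apply: tent_out.
  have := ler_normB (t + c) c; rewrite addrK; lra.
rewrite /kap !h; first by ring.
all: by rewrite ?normrN ger0_norm; lra.
Qed.

Lemma bmf_tent : bmfR (@tent R).
Proof.
apply: (bmf_lipschitz (L := 1)) => [x y|]; first by rewrite mul1r; exact: tent_lip.
by exists (1/3) => x; rewrite ger0_norm ?tent_ge0// tent_le.
Qed.

Lemma bmf_kap : bmfR (@kap R).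
Proof.
by apply: (bmf_lipschitz (L := 6)) => [x y|]; [exact: kap_lip | exists 2 => x; exact: kap_bound].
Qed.

Definition ckap : R := itg 0 1 (@kap R).

Lemma bmf_tent_shift c : bmfR (fun t => tent (t + c)).
Proof.
have := bmf_affine 1 c bmf_tent; rewrite (_ : (fun x => _) = fun t => tent (t + c))//.
by apply/funext => x; rewrite mul1r.
Qed.

(** On the positive half-line only the tents centred at 1/3 and 2/3 survive, with weights 2 and -1,
    so the integral of one tent remains. Its positivity makes the average of the cell kernels a
    nonzero multiple of [1/t]. *)
Lemma ckapE : ckap = itg (- (1/3)) (1/3) (@tent R).
Proof.
rewrite /ckap /kap.
have b1 := bmf_tent_shift (- (1/3)); have b2 := bmf_tent_shift (- (2/3)).
have b3 := bmf_tent_shift (1/3); have b4 := bmf_tent_shift (2/3).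
have z1 := bmfZ 2 b1; have z3 := bmfZ 2 b3.
have y1 := bmfB z1 b2; have y2 := bmfB y1 z3.
rewrite itgD// itgB// itgB// !itgZ//.
rewrite (eq_itg (f := fun t => tent (t + 1/3)) (g := fun=> 0)); last first.
  by move=> x ?; rewrite tent_out// ger0_norm; lra.
rewrite (eq_itg (f := fun t => tent (t + 2/3)) (g := fun=> 0)); last first.
  by move=> x ?; rewrite tent_out// ger0_norm; lra.
rewrite !itg_cst// !itg_shift//; try exact: bmf_tent.
have bt := bmf_tent.
have e a b : a <= - (1/3) -> 1/3 <= b -> itg a b (@tent R) = itg (- (1/3)) (1/3) (@tent R).
  move=> ha hb; apply: itg_support => //; first lra.
  move=> x _; rewrite negb_and -!ltNge => hx; apply: tent_out.
  by case/orP: hx => ?; [rewrite ltr0_norm | rewrite gtr0_norm]; lra.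
by rewrite !e; lra.
Qed.

Lemma ckap_gt0 : 0 < ckap.
Proof.
have bt := bmf_tent.
rewrite ckapE (itg_split (b := - (1/6)))//; try lra.
rewrite [X in _ + X](itg_split (b := 1/6))//; try lra.
have p a b : 0 <= itg a b (@tent R) by apply: itg_ge0 => x _; exact: tent_ge0.
apply: (@lt_le_trans _ _ (itg (- (1/6)) (1/6) (fun=> 1/6 : R))).
  by rewrite itg_cst; lra.
apply: (@le_trans _ _ (itg (- (1/6)) (1/6) (@tent R))); last first.
  by have := p (- (1/3)) (- (1/6)); have := p (1/6) (1/3); lra.
apply: le_itg => //; first exact: bmf_cst.
by move=> x hx; rewrite /tent le_max; apply/orP; right; case: (ger0P x) => ?; lra.
Qed.

Lemma itg_kap_far a b : 1 <= a -> a <= b -> itg a b (@kap R) = 0.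
Proof.
move=> a1 ab; rewrite (eq_itg (g := fun=> 0)) ?itg_cst ?mul0r//.
by move=> x ?; rewrite kap_out// ger0_norm; lra.
Qed.

Lemma itg_kap_le a b : a <= b -> `|itg a b (@kap R)| <= 2 * (b - a).
Proof. by move=> ab; apply: norm_itg_le_cst => // [|x _]; [exact: bmf_kap | exact: kap_bound]. Qed.

Lemma itg_kap_bound a b : 0 <= a -> a <= b -> `|itg a b (@kap R)| <= 2.
Proof.
move=> a0 ab; have [b1|b1] := lerP b 1; first by apply: le_trans (itg_kap_le ab) _; lra.
have [a1|a1] := lerP 1 a; first by rewrite itg_kap_far// normr0.
rewrite (itg_split (b := 1))//; try lra; last exact: bmf_kap.
rewrite (itg_kap_far (lexx 1)) ?addr0; last lra.
by apply: le_trans (itg_kap_le _) _; lra.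
Qed.

Lemma ckap_le : ckap <= 2.
Proof. by apply: le_trans (ler_norm _) (itg_kap_bound (lexx 0) ler01). Qed.

(* A truncation of [ckap / t] at scale [3^-n] which is an average of the kernels [cellker] over
   shifted and dilated triadic grids. *)
Definition Ker n t : R := \sum_(k < n) 3 ^+ k * itg 1 3 (fun s => kap (3 ^+ k * t * s)).

Lemma bmf_kap_scale c : bmfR (fun s => kap (c * s)).
Proof.
have := bmf_affine c 0 bmf_kap; rewrite (_ : (fun x => _) = fun s => kap (c * s))//.
by apply/funext => x; rewrite addr0.
Qed.

Lemma KerN n t : Ker n (- t) = - Ker n t.
Proof.
rewrite /Ker -sumrN; apply: eq_bigr => k _; rewrite -mulrN -itgN; last exact: bmf_kap_scale.
by congr (_ * _); apply: eq_itg => s _; rewrite -kapN; congr kap; ring.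
Qed.

Lemma exp3_gt0 k : 0 < 3 ^+ k :> R.
Proof. by rewrite exprn_gt0. Qed.

Lemma exp3_ge1 k : 1 <= 3 ^+ k :> R.
Proof. by rewrite exprn_ege1//; lra. Qed.

(* The scale integral over [1, 3] makes the sum over k telescope. *)
Lemma Ker_mul n t : 0 < t -> t * Ker n t = itg t (3 ^+ n * t) (@kap R).
Proof.
move=> t0; elim: n => [|n ih].
  by rewrite /Ker big_ord0 mulr0 expr0 mul1r itg_point//; exact: bmf_kap.
rewrite /Ker big_ord_recr/= mulrDr -/(Ker n t) ih.
have p := exp3_gt0 n; have c0 : 0 < 3 ^+ n * t by rewrite mulr_gt0.
have -> : itg 1 3 (fun s => kap (3 ^+ n * t * s)) =
    (3 ^+ n * t)^-1 * itg (3 ^+ n * t) (3 ^+ n.+1 * t) (@kap R).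
  have := itg_affine 0 1 3 c0 bmf_kap.
  rewrite mulr1 !addr0 (_ : 3 ^+ n * t * 3 = 3 ^+ n.+1 * t); last by rewrite exprS; ring.
  by move=> <-; apply: eq_itg => s _; rewrite addr0.
rewrite [RHS](itg_split (b := 3 ^+ n * t)).
- congr (_ + _); rewrite mulrA mulrA [t * _]mulrC divff ?mul1r//; lra.
- by rewrite ler_peMl ?exp3_ge1// ltW.
- by rewrite exprS -mulrA ler_peMl ?ltW//; lra.
- exact: bmf_kap.
Qed.

Lemma Ker_mul_bound n t : `|t| * `|Ker n t| <= 2.
Proof.
wlog t0 : t / 0 <= t.
  move=> h; have [/h//|t0] := leP 0 t; have := h (- t).
  by rewrite KerN !normrN; apply; lra.
move: t0; rewrite le_eqVlt => /predU1P[<-|t0]; first by rewrite normr0 mul0r.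
rewrite -normrM Ker_mul//; apply: itg_kap_bound; first exact: ltW.
by rewrite ler_peMl ?exp3_ge1// ltW.
Qed.

Lemma Ker_far n t : 1 <= `|t| -> Ker n t = 0.
Proof.
wlog t0 : t / 0 <= t.
  move=> h t1; have [t0|t0] := leP 0 t; first exact: h.
  by apply/eqP; rewrite -oppr_eq0 -KerN h ?normrN//; lra.
rewrite ger0_norm// => t1; apply: (@mulfI _ t); first by rewrite gt_eqF//; lra.
rewrite Ker_mul ?mulr0; last lra.
by rewrite itg_kap_far// ler_peMl ?exp3_ge1.
Qed.

Lemma Ker_stable n m t : (n <= m)%N -> 1 <= 3 ^+ n * `|t| -> Ker m t = Ker n t.
Proof.
move=> nm; wlog t0 : t / 0 <= t.
  move=> h t1; have [t0|t0] := leP 0 t; first exact: h.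
  by apply: oppr_inj; rewrite -!KerN h ?normrN//; lra.
rewrite ger0_norm// => t1.
have {}t0 : 0 < t.
  by rewrite lt_neqAle t0 andbT; apply/eqP => e; move: t1; rewrite -e mulr0; lra.
apply: (@mulfI _ t); first by rewrite gt_eqF.
have le : 3 ^+ n * t <= 3 ^+ m * t by rewrite ler_wpM2r ?(ltW t0)// ler_weXn2l//; lra.
rewrite !Ker_mul// (itg_split (b := 3 ^+ n * t))//; last exact: bmf_kap.
- by rewrite [X in _ + X]itg_kap_far ?addr0.
- by rewrite ler_peMl ?exp3_ge1// ltW.
Qed.

(** For [0 < t < 1], [t * Ker n t] is the integral of [kap] over [[t, 3^n t]]. As [kap] vanishes
    beyond 1, this is [ckap] minus the integral over [[0, t]], and the latter is at most [2 t]. *)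
Lemma Ker_asymp n t : 1 <= 3 ^+ n * `|t| -> `|Ker n t - ckap / t| <= 2.
Proof.
wlog t0 : t / 0 <= t.
  move=> h t1; have [t0|t0] := leP 0 t; first exact: h.
  have := h (- t); rewrite KerN normrN invrN mulrN -opprD normrN; apply => //; lra.
rewrite ger0_norm// => t1.
have {}t0 : 0 < t.
  by rewrite lt_neqAle t0 andbT; apply/eqP => e; move: t1; rewrite -e mulr0; lra.
have e3 := ckap_le; have e0 := ckap_gt0.
have [tge1|tlt1] := leP 1 t.
  rewrite (Ker_far n (t := t)) ?sub0r ?normrN; last by rewrite ger0_norm// ltW.
  rewrite ger0_norm; last first.
    by rewrite divr_ge0// ltW.
  by rewrite ler_pdivrMr//; lra.
have -> : Ker n t - ckap / t = - (itg 0 t (@kap R)) / t.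
  have bk := bmf_kap; apply: (@mulfI _ t); first by rewrite gt_eqF.
  rewrite mulrBr Ker_mul// /ckap (itg_split (b := t) (c := 1))//; try lra.
  rewrite (itg_split (b := 1) (c := 3 ^+ n * t))//; try lra.
  by rewrite (itg_kap_far (lexx 1))//; field; lra.
rewrite normrM normrN normfV (gtr0_norm t0) ler_pdivrMr//.
by apply: le_trans (itg_kap_le (ltW t0)) _; lra.
Qed.

Lemma itg_kap_scale_lip k t h :
  `|itg 1 3 (fun s => kap (3 ^+ k * (t + h) * s)) - itg 1 3 (fun s => kap (3 ^+ k * t * s))|
  <= 36 * (3 ^+ k * `|h|).
Proof.
have b1 := bmf_kap_scale (3 ^+ k * (t + h)); have b2 := bmf_kap_scale (3 ^+ k * t).
rewrite -itgB//; have p := exp3_gt0 k.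
have -> : 36 * (3 ^+ k * `|h|) = (18 * (3 ^+ k * `|h|)) * (3 - 1) by ring.
apply: norm_itg_le_cst; [lra | exact: bmfB | move=> s /andP[s1 s3]].
apply: le_trans (kap_lip _ _) _.
rewrite (_ : _ - _ = 3 ^+ k * h * s); last by ring.
rewrite !normrM (gtr0_norm p) (ger0_norm (_ : 0 <= s)); last lra.
rewrite (_ : 18 * _ = 6 * (3 ^+ k * `|h| * 3)); last by ring.
by rewrite ler_pM2l// ler_wpM2l// mulr_ge0 // ltW.
Qed.

(** The scales that matter near [t]: if [3^k |t| >= 2] and [3^k |h| <= 1], then [kap (3^k t s)] and
    [kap (3^k (t + h) s)] vanish for all [s >= 1]. *)
Definition act t k : R := if 3 ^+ k * `|t| < 2 then 1 else 0.

Lemma Ker_lip_act n t h : 3 ^+ n * `|h| <= 1 ->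
  `|Ker n (t + h) - Ker n t| <= 36 * `|h| * \sum_(k < n) 9 ^+ k * act t k.
Proof.
move=> hn; rewrite /Ker -sumrB mulr_sumr; apply: le_trans (ler_norm_sum _ _ _) _.
apply: ler_sum => k _; rewrite -mulrBr normrM.
have p := exp3_gt0 k; rewrite (gtr0_norm p) /act.
have hk : 3 ^+ k * `|h| <= 1.
  by apply: le_trans hn; rewrite ler_wpM2r// ler_weXn2l//; [lra | exact/ltnW].
case: ltP => ht.
  rewrite (_ : 36 * `|h| * (9 ^+ k * 1) = 3 ^+ k * (36 * (3 ^+ k * `|h|))).
    by rewrite ler_wpM2l ?itg_kap_scale_lip// ltW.
  rewrite (_ : 9 = 3 * 3 :> R) ?exprMn; last by ring.
  by ring.
have out (r : R) : 1 <= 3 ^+ k * `|r| -> itg 1 3 (fun s => kap (3 ^+ k * r * s)) = 0.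
  move=> hr; rewrite (eq_itg (g := fun=> 0)) ?itg_cst ?mul0r//; first lra.
  move=> s /andP[s1 _]; rewrite kap_out// !normrM (gtr0_norm p).
  by apply: le_trans hr _; rewrite ler_peMr// ?(le_trans s1)// ?ler_norm// mulr_ge0// ltW.
have hth : 1 <= 3 ^+ k * `|t + h|.
  have : `|t| <= `|t + h| + `|h| by have := ler_normB (t + h) h; rewrite addrK.
  by move=> /(ler_wpM2l (ltW p)); lra.
rewrite !mulr0 (out _ hth) out; last lra.
by rewrite subrr normr0 mulr0.
Qed.

(** The weights grow geometrically, so the last active scale governs the sum: it is [O(9^n)], and
    also [O(t^-2)] because an active scale has [9^k t^2 < 4]. The factor [1 + 9^n t^2] merges both
    bounds. *)
Lemma sum_act n t : (\sum_(k < n) 9 ^+ k * act t k) * (1 + 9 ^+ n * t ^+ 2) <= 5 * 9 ^+ n.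
Proof.
have p k : 0 < 9 ^+ k :> R by rewrite exprn_gt0.
have t2 := sqr_ge0 t.
have h1 m : 0 <= \sum_(k < m) 9 ^+ k * act t k <= 9 ^+ m / 8.
  elim: m => [|m /andP[a b]]; first by rewrite big_ord0 expr0; apply/andP; split; lra.
  rewrite big_ord_recr/= exprS; have := p m.
  by rewrite /act; case: ifP => _ *; apply/andP; split; lra.
have h2 : (\sum_(k < n) 9 ^+ k * act t k) * t ^+ 2 <= 9/2.
  elim: n => [|n ih]; first by rewrite big_ord0; lra.
  rewrite big_ord_recr/=; rewrite {2}/act; case: ltP => ht; last by rewrite mulr0 addr0.
  have q3 : 9 ^+ n * t ^+ 2 <= 4.
    have -> : 9 ^+ n * t ^+ 2 = (3 ^+ n * `|t|) ^+ 2.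
      rewrite exprMn real_normK ?num_real// -exprM mulnC exprM.
      by congr (_ ^+ _ * _); ring.
    have -> : 4 = 2 ^+ 2 :> R by ring.
    by rewrite lerXn2r// ?nnegrE ?mulr_ge0// ltW// exp3_gt0.
  have /andP[_ b] := h1 n; have := ler_wpM2r t2 b; lra.
have /andP[a b] := h1 n; have := ler_wpM2l (ltW (p n)) h2; have := p n.
rewrite mulrDr mulr1 [X in _ + X](_ : _ = 9 ^+ n * ((\sum_(k < n) 9 ^+ k * act t k) * t ^+ 2)).
  lra.
by ring.
Qed.

(** Up to a factor [pi], the Poisson kernel at height [1/m]. It controls the increments of [Ker]
    over steps shorter than [1/m] ([Ker_lip]) and, thanks to its slow decay, also its own increments
    ([qm_shift]); the Riesz product needs both. *)
Definition qm (m t : R) := m / (1 + (m * t) ^+ 2).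

Lemma qm_den m t : 1 <= 1 + (m * t) ^+ 2.
Proof. by rewrite lerDl sqr_ge0. Qed.

Lemma qm_ge0 m t : 0 <= m -> 0 <= qm m t.
Proof. by move=> m0; rewrite divr_ge0//; have := qm_den m t; lra. Qed.

Lemma qm_le m t : 0 <= m -> qm m t <= m.
Proof.
move=> m0; have d := qm_den m t; rewrite ler_pdivrMr; last lra.
by rewrite ler_peMr.
Qed.

Lemma Ker_lip n m t h : 3 ^+ n <= m -> m * `|h| <= 1 ->
  `|Ker n (t + h) - Ker n t| <= 180 * (m * `|h|) * qm m t.
Proof.
move=> nm mh; have p := exp3_gt0 n; have m0 : 0 < m by lra.
apply: le_trans (Ker_lip_act t _) _; first by apply: le_trans mh; rewrite ler_wpM2r.
have -> : 180 * (m * `|h|) * qm m t = 36 * `|h| * (5 * (m * qm m t)) by ring.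
rewrite ler_wpM2l// ?mulr_ge0//.
have t2 := sqr_ge0 t; have e9 : 9 ^+ n = 3 ^+ n * 3 ^+ n :> R.
  by rewrite -exprMn; congr (_ ^+ _); ring.
have d9 : 0 < 1 + 9 ^+ n * t ^+ 2.
  by rewrite ltr_wpDr// mulr_ge0// e9 mulr_ge0// ltW.
apply: (@le_trans _ _ (5 * 9 ^+ n / (1 + 9 ^+ n * t ^+ 2))).
  by rewrite ler_pdivlMr// sum_act.
rewrite -mulrA ler_pM2l// /qm (_ : m * (m / _) = m ^+ 2 / (1 + (m * t) ^+ 2)); last by rewrite mulrA expr2.
have dm := qm_den m t.
rewrite ler_pdivrMr// mulrAC ler_pdivlMr; last lra.
rewrite !mulrDr !mulr1 exprMn.
have : 3 ^+ n * 3 ^+ n <= m * m by rewrite ler_pM// ltW.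
by rewrite e9 expr2; move: (3 ^+ n) => z; rewrite -(expr2 z) -(expr2 m) => zm; lra.
Qed.

Lemma qm_shift m t h : 0 <= m -> m * `|h| <= 1 ->
  `|qm m (t + h) - qm m t| <= 2 * (m * `|h|) * qm m t.
Proof.
move=> m0 mh; set A := 1 + (m * t) ^+ 2; set B := 1 + (m * (t + h)) ^+ 2.
have A1 : 1 <= A := qm_den _ _; have B1 : 1 <= B := qm_den _ _.
have -> : qm m (t + h) - qm m t = - (m * h) * (m * (2 * (t + h) - h)) / B * qm m t.
  by rewrite /qm -/A -/B; have : A - B = - (m * h) * (m * (2 * (t + h) - h));
   [rewrite /A /B; ring | move=> <-; field; lra].
rewrite normrM (ger0_norm (qm_ge0 _ m0)) ler_wpM2r ?qm_ge0//.
rewrite normrM normfV (ger0_norm (_ : 0 <= B)); last lra.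
rewrite ler_pdivrMr; last lra.
rewrite normrM normrN normrM (ger0_norm m0).
rewrite (_ : 2 * (m * `|h|) * B = m * `|h| * (2 * B)); last by ring.
apply: ler_wpM2l; first by rewrite mulr_ge0.
have e : m * (2 * (t + h) - h) = 2 * (m * (t + h)) - m * h by ring.
rewrite e; set z := m * (t + h).
have : `|m * h| <= 1 by rewrite normrM ger0_norm.
have z2 := sqr_ge0 z; have := sqr_ge0 (z - 1); have := sqr_ge0 (z + 1).
rewrite /B -/z !sqrrD ler_norml => ? ? /andP[? ?].
by rewrite ler_norml; apply/andP; split; lra.
Qed.

Definition tent1 t : R := Num.max 0 (1 - `|t|).

Lemma tent1_01 t : 0 <= tent1 t <= 1.
Proof. by rewrite /tent1 le_max lexx ge_max ler01 gerBl normr_ge0. Qed.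

Lemma bmf_tent1_scale c : bmfR (fun s => tent1 (c * s)).
Proof.
apply: (bmf_comp (f := fun x : measurableTypeR R => tent1 x) (phi := fun s : measurableTypeR R => c * s : measurableTypeR R)).
  apply: (bmf_lipschitz (L := 1)) => [x y|]; last first.
    by exists 1 => x; have /andP[? ?] := tent1_01 x; rewrite ger0_norm.
  have := ler_dist_dist x y; rewrite mul1r /tent1.
  move: `|x| `|y| `|x - y| => a b z; rewrite ler_norml => /andP[h1 h2].
  have z0 : 0 <= z by lra.
  by rewrite /Num.max; case: (ltP 0 (1 - a)) => ?; case: (ltP 0 (1 - b)) => ?;
    rewrite ler_norml; apply/andP; split; lra.
by apply: measurable_funM => //; exact: measurable_cst.
Qed.

(** A positive companion of [Ker], coming from [samecell] instead of [cellker]. The second factor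
    [3^k] in [9^k] lets the finest scale dominate, so that [tentsum n / 3^n] looks like an
    approximate identity at scale [3^-n] and can majorize [qm]. *)
Definition tentsum n t : R := \sum_(k < n) 9 ^+ k * itg 1 3 (fun s => tent1 (3 ^+ k * t * s)).

(** If [u] lies between [9^k] and [9^(k+1)], the last condition forces [3^k |t| <= 1/6]; then the
    tent is at least 1/2 for all [s <= 3], and the scale [k] alone contributes at least [9^k]. *)
Lemma tentsum_ge n t u : 0 <= u -> u <= 9 ^+ n -> 36 * t ^+ 2 * u <= 1 ->
  u <= 9 * tentsum n t + 1.
Proof.
move=> u0; elim: n => [|n ih] un tu; first by rewrite /tentsum big_ord0 mulr0 add0r.
have p : 0 < 9 ^+ n :> R by rewrite exprn_gt0.
rewrite /tentsum big_ord_recr/= -/(tentsum n t).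
set J := itg _ _ _; have J0 : 0 <= J.
  by apply: itg_ge0 => s _; case/andP: (tent1_01 (3 ^+ n * t * s)).
have [un'|un'] := leP u (9 ^+ n).
  by apply: le_trans (ih un' tu) _; rewrite lerD2r mulrDr lerDl !mulr_ge0// ltW.
have S0 : 0 <= tentsum n t.
  apply: sumr_ge0 => k _; apply: mulr_ge0; first by rewrite exprn_ge0.
  by apply: itg_ge0 => s _; case/andP: (tent1_01 (3 ^+ k * t * s)).
suff J1 : 1 <= J.
  move: un; rewrite exprS; have := ler_wpM2l (ltW p) J1; lra.
have q : 3 ^+ n * `|t| <= 1/6.
  have : (6 * (3 ^+ n * `|t|)) ^+ 2 <= 1 ^+ 2.
    rewrite expr1n !exprMn real_normK ?num_real//.
    have <- : 9 ^+ n = (3 ^+ n) ^+ 2 :> R.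
      by rewrite -exprM mulnC exprM; congr (_ ^+ _); ring.
    apply: le_trans tu; rewrite (_ : 6 ^+ 2 * _ = 36 * t ^+ 2 * 9 ^+ n); last by ring.
    by apply: ler_wpM2l; [rewrite mulr_ge0 ?sqr_ge0 | exact: ltW].
  by rewrite ler_pXn2r ?nnegrE//; lra.
rewrite (_ : 1 = itg 1 3 (fun=> 1/2 : R)); last by rewrite itg_cst; lra.
apply: le_itg; [exact: bmf_cst | exact: bmf_tent1_scale |].
move=> s /andP[s1 s3]; rewrite /tent1 le_max; apply/orP; right.
rewrite !normrM (gtr0_norm (exp3_gt0 n)) (ger0_norm (_ : 0 <= s)); last lra.
have : 3 ^+ n * `|t| * s <= 1/6 * 3.
  by apply: ler_pM => //; lra.
by lra.
Qed.

Lemma qm_le_tentsum n m t : 1 <= m -> m <= 3 ^+ n -> 3 ^+ n <= 3 * m ->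
  qm m t <= 972 * (tentsum n t / 3 ^+ n) + 36.
Proof.
move=> m1 mn nm; have d := qm_den m t.
(* [u] is [m * qm m t / 36], the largest value that [tentsum_ge] accepts up to replacing [t^2] by
   [t^2 + m^-2]. In the end [972 = 36 * 9 * 3], with the last 3 from [3^n <= 3 m]. *)
pose u := m ^+ 2 / (36 * (1 + (m * t) ^+ 2)).
have d36 : 0 < 36 * (1 + (m * t) ^+ 2) by lra.
have m2 := sqr_ge0 m.
have u0 : 0 <= u by rewrite divr_ge0// ltW.
have mm : m ^+ 2 <= 9 ^+ n.
  have -> : 9 ^+ n = (3 ^+ n) ^+ 2 :> R by rewrite -exprM mulnC exprM; congr (_ ^+ _); ring.
  by rewrite lerXn2r// nnegrE; lra.
have un : u <= 9 ^+ n.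
  apply: le_trans mm; rewrite ler_pdivrMr// ler_peMr//; lra.
have tu : 36 * t ^+ 2 * u <= 1.
  rewrite /u mulrA ler_pdivrMr// mul1r exprMn; lra.
have := tentsum_ge u0 un tu.
have qE : qm m t = 36 * u / m by rewrite /qm /u; field; lra.
rewrite qE => h; have p := exp3_gt0 n; set S := tentsum n t in h *.
have S0 : 0 <= S.
  apply: sumr_ge0 => k _; apply: mulr_ge0; first by rewrite exprn_ge0.
  by apply: itg_ge0 => s _; case/andP: (tent1_01 (3 ^+ k * t * s)).
rewrite ler_pdivrMr; last lra.
have : 1 <= 3 * (m / 3 ^+ n) by rewrite mulrA ler_pdivlMr// mul1r.
move=> /(ler_wpM2l S0); rewrite (_ : 972 * (S / 3 ^+ n) = 324 * (S * (3 / 3 ^+ n))); last by field; lra.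
rewrite [(_ + 36) * m]mulrDl (_ : 324 * _ * m = 324 * (S * (3 * (m / 3 ^+ n)))); last by ring.
by lra.
Qed.

Lemma bmf_Ker n : bmfR (Ker n).
Proof.
apply: (@bmf_lipschitz _ (\sum_(k < n) 36 * 9 ^+ k)) => [x y|].
  rewrite mulr_suml /Ker -sumrB; apply: le_trans (ler_norm_sum _ _ _) _.
  apply: ler_sum => k _; rewrite -mulrBr normrM (gtr0_norm (exp3_gt0 k)).
  have := itg_kap_scale_lip k y (x - y); rewrite (_ : y + (x - y) = x); last by ring.
  move=> /(ler_wpM2l (ltW (exp3_gt0 k))) /le_trans; apply.
  rewrite (_ : 9 = 3 * 3 :> R) ?exprMn; last by ring.
  by rewrite le_eqVlt; apply/orP; left; apply/eqP; ring.
exists (\sum_(k < n) 3 ^+ k * (2 * (3 - 1))) => x.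
apply: le_trans (ler_norm_sum _ _ _) _; apply: ler_sum => k _.
rewrite normrM (gtr0_norm (exp3_gt0 k)); apply: ler_wpM2l; first exact/ltW/exp3_gt0.
by apply: norm_itg_le_cst; [lra | exact: bmf_kap_scale | move=> s _; exact: kap_bound].
Qed.

Lemma qm_lip m x y : 0 <= m -> `|qm m x - qm m y| <= 2 * m ^+ 2 * `|x - y|.
Proof.
move=> m0; set h := x - y; have xE : x = y + h by rewrite /h; ring.
have q0 := qm_ge0 y m0; have q1 := qm_le y m0.
have [mh|mh] := leP (m * `|h|) 1.
  rewrite xE; apply: le_trans (qm_shift y m0 mh) _.
  rewrite (_ : 2 * m ^+ 2 * `|h| = 2 * (m * `|h|) * m); last by ring.
  by rewrite ler_wpM2l// !mulr_ge0.
have p0 := qm_ge0 x m0; have p1 := qm_le x m0.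
have : m <= m * (m * `|h|) by rewrite ler_peMr// ltW.
by rewrite expr2 => ?; rewrite ler_norml; apply/andP; split; lra.
Qed.

Lemma bmf_qm m : 0 <= m -> bmfR (qm m).
Proof.
move=> m0; apply: (bmf_lipschitz (L := 2 * m ^+ 2)) => [x y|]; first exact: qm_lip.
by exists m => x; rewrite ger0_norm ?qm_ge0 ?qm_le.
Qed.

End Kernel.

Section ParametricIntervalIntegral.
Variable R : realType.
Notation RR := (measurableTypeR R).

Lemma bmf_itg d (T : measurableType d) (a b : R) (f : T -> R -> R) :
  bmf (fun p : T * RR => f p.1 p.2) -> bmf (fun x => itg a b (f x)).
Proof. exact: (bmf_bint (findom_cc a b)). Qed.

Lemma itg_bint_swap d (T : measurableType d) (nu : {sigma_finite_measure set T -> \bar R})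
    (D : set T) (a b : R) (f : R -> T -> R) :
  findom nu D -> bmf (fun p : RR * T => f p.1 p.2) ->
  itg a b (fun r => \int[nu]_(x in D) f r x) = \int[nu]_(x in D) itg a b (fun r => f r x).
Proof. move=> hD bf; exact: (bint_swap (findom_cc a b) hD). Qed.

Lemma itg_swap (a b c d : R) (f : R -> R -> R) :
  bmf (fun p : RR * RR => f p.1 p.2) ->
  itg a b (fun x => itg c d (f x)) = itg c d (fun y => itg a b (fun x => f x y)).
Proof. exact: (bint_swap (findom_cc a b) (findom_cc c d)). Qed.

End ParametricIntervalIntegral.

(** * Averages over translated and dilated grids *)

Section GridAverage.
Variables (R : realType) (d : measure_display) (T : measurableType d).
Variables (nu : {sigma_finite_measure set T -> \bar R}) (D : set T) (X : T -> R).
Hypotheses (hD : findom nu D) (mX : measurable_fun setT X).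
Notation RR := (measurableTypeR R).
Notation bmfR := (@bmf _ RR R).
Notation lm := (@lebesgue_measure R).

Lemma itg_periodic_scale (h : R -> R) (m : nat) : (0 < m)%N -> bmfR h ->
  (forall v (j : int), h (v + j%:~R) = h v) ->
  itg 0 1 (fun u => h (m%:R * u)) = itg 0 1 h.
Proof.
move=> m0 bh per; have mr0 : 0 < m%:R :> R by rewrite ltr0n.
have := itg_affine 0 0 1 mr0 bh; rewrite mulr0 mulr1 !addr0 => e.
transitivity (m%:R^-1 * itg 0 m%:R h); first by rewrite -e; apply: eq_itg => u _; rewrite addr0.
have -> : itg 0 m%:R h = m%:R * itg 0 1 h.
  elim: m {m0 mr0 e} => [|m ih]; first by rewrite mul0r itg_point.
  rewrite (itg_split (b := m%:R))// ?ler_nat// ih -natr1 mulrDl mul1r; congr (_ + _).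
  rewrite -(itg_periodic m%:R bh per) itg_shift// add0r addrC; congr itg.
by rewrite mulrA mulVf ?mul1r// gt_eqF.
Qed.

Variables (h : R -> R -> R) (hbar : R -> R).
Hypotheses (bh : bmf (fun p : RR * RR => h p.1 p.2))
  (hper : forall a b (j : int), h (a + j%:~R) (b + j%:~R) = h a b)
  (hhbar : forall a b, itg 0 1 (fun w => h (a + w) (b + w)) = hbar (a - b))
  (bhbar : forall c, bmfR (fun s => hbar (c * s))).
Variables (n : nat) (G : nat -> T -> R).
Hypothesis bG : forall k, bmf (G k).

Definition gridsum (s u y : R) : R :=
  \sum_(k < n) 3 ^+ k * \int[nu]_(x in D) (G k x * h (3 ^+ k * (s * X x + u)) (3 ^+ k * (s * y + u))).

Let bmf_cell d0 (S : measurableType d0) (s u y : S -> R) (xx : S -> T) k :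
  measurable_fun setT s -> measurable_fun setT u -> measurable_fun setT y ->
  measurable_fun setT xx ->
  bmf (fun p => G k (xx p) * h (3 ^+ k * (s p * X (xx p) + u p)) (3 ^+ k * (s p * y p + u p))).
Proof.
move=> ms mu my mx; apply: bmfM; first exact: (bmf_comp (bG k) mx).
have mXx := measurableT_comp mX mx.
have mc : measurable_fun setT (fun _ : S => 3 ^+ k : R) by exact: measurable_cst.
apply: (bmf_comp (phi := fun p => (3 ^+ k * (s p * X (xx p) + u p), 3 ^+ k * (s p * y p + u p))) bh).
apply: measurable_fun_pair; apply: measurable_funM => //;
  by apply: measurable_funD => //; exact: measurable_funM.
Qed.

Lemma bmf_gridsum d0 (S : measurableType d0) (s u y : S -> R) :
  measurable_fun setT s -> measurable_fun setT u -> measurable_fun setT y ->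
  bmf (fun p => gridsum (s p) (u p) (y p)).
Proof.
move=> ms mu my; apply: bmf_sum => k _; apply: bmfZ.
apply: (bmf_bint (f := fun p x => G k x * h (3 ^+ k * (s p * X x + u p)) (3 ^+ k * (s p * y p + u p))) hD).
apply: (@bmf_cell _ (S * T)%type (fun p => s p.1) (fun p => u p.1) (fun p => y p.1) snd).
- by apply: (measurableT_comp ms); exact: measurable_fst.
- by apply: (measurableT_comp mu); exact: measurable_fst.
- by apply: (measurableT_comp my); exact: measurable_fst.
- exact: measurable_snd.
Qed.

Let mcst (S : R) d0 (S0 : measurableType d0) : measurable_fun setT (fun _ : S0 => S : R).
Proof. exact: measurable_cst. Qed.

Let mscale_r d0 (S0 : measurableType d0) (r : S0 -> R) :
  measurable_fun setT r -> measurable_fun setT (fun p => 2 * r p + 1).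
Proof. by move=> mr; apply: measurable_funD => //; exact: measurable_funM. Qed.

(** The translation enters as [3^k u], which runs through exactly [3^k] periods of the diagonal
    translation while [u] runs through [[0, 1]]. *)
Lemma itg_cell_average (s a b : R) k :
  itg 0 1 (fun u => h (3 ^+ k * (s * a + u)) (3 ^+ k * (s * b + u))) = hbar (3 ^+ k * (a - b) * s).
Proof.
set hv := fun v => h (3 ^+ k * (s * a) + v) (3 ^+ k * (s * b) + v).
have bhv : bmfR hv.
  apply: (bmf_comp (phi := fun v : RR => (3 ^+ k * (s * a) + v, 3 ^+ k * (s * b) + v)) bh).
  by apply: measurable_fun_pair; apply: measurable_funD => //; exact: measurable_id.
transitivity (itg 0 1 hv).
  rewrite -(@itg_periodic_scale hv (3 ^ k))//.
  - by apply: eq_itg => u _; rewrite /hv natrX; congr (h _ _); ring.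
  - by rewrite expn_gt0.
  - by move=> v j; rewrite /hv !addrA hper.
by rewrite hhbar; congr hbar; ring.
Qed.

Lemma gridsum_average y :
  itg 0 1 (fun r => itg 0 1 (fun u => gridsum (2 * r + 1) u y)) =
  2^-1 * \sum_(k < n) 3 ^+ k *
    \int[nu]_(x in D) (G k x * itg 1 3 (fun s => hbar (3 ^+ k * (X x - y) * s))).
Proof.
(* Dilations [s] in [[1, 3]] are written [2 r + 1], so that both averages are over unit intervals as
   Jensen's inequality requires. This change of variables produces the factor [1/2]. *)
pose H k r u x := G k x * h (3 ^+ k * ((2 * r + 1) * X x + u)) (3 ^+ k * ((2 * r + 1) * y + u)).
have bH k d0 (S : measurableType d0) (r u : S -> R) (xx : S -> T) :
    measurable_fun setT r -> measurable_fun setT u -> measurable_fun setT xx ->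
    bmf (fun p => H k (r p) (u p) (xx p)).
  by move=> mr mu mx; exact: (bmf_cell k (mscale_r mr) mu (mcst y (S0 := S)) mx).
have bU k r : bmfR (fun u => \int[nu]_(x in D) H k r u x).
  apply: (bmf_bint hD); apply: (bH k _ (RR * T)%type (fun=> r) fst snd) => //.
have bR k : bmfR (fun r => itg 0 1 (fun u => \int[nu]_(x in D) H k r u x)).
  apply: (bmf_itg 0 1 (f := fun r u => \int[nu]_(x in D) H k r u x)).
  apply: (bmf_bint (f := fun (p : RR * RR) x => H k p.1 p.2 x) hD).
  apply: (bH k _ (RR * RR * T)%type (fun p => p.1.1) (fun p => p.1.2) snd).
  - exact: (measurableT_comp measurable_fst measurable_fst).
  - exact: (measurableT_comp measurable_snd measurable_fst).
  - exact: measurable_snd.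
have bX k : bmf (fun p : RR * T => itg 0 1 (fun u => H k p.1 u p.2)).
  apply: (bmf_itg 0 1 (f := fun (p : RR * T) u => H k p.1 u p.2)).
  apply: (bH k _ (RR * T * RR)%type (fun p => p.1.1) snd (fun p => p.1.2)).
  - exact: (measurableT_comp measurable_fst measurable_fst).
  - exact: measurable_snd.
  - exact: (measurableT_comp measurable_snd measurable_fst).
transitivity (\sum_(k < n) 3 ^+ k *
    itg 0 1 (fun r => itg 0 1 (fun u => \int[nu]_(x in D) H k r u x))).
  under [RHS]eq_bigr do rewrite -itgZ//.
  rewrite -itg_sum; last by move=> k _; apply: bmfZ.
  apply: eq_itg => r _; under [RHS]eq_bigr do rewrite -itgZ//.
  by rewrite -itg_sum// => k _; apply: bmfZ.
rewrite mulr_sumr; apply: eq_bigr => k _; rewrite mulrCA; congr (_ * _).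
transitivity (itg 0 1 (fun r => \int[nu]_(x in D) itg 0 1 (fun u => H k r u x))).
  apply: eq_itg => r _; apply: (itg_bint_swap 0 1 hD (f := fun u x => H k r u x)).
  by apply: (bH k _ (RR * T)%type (fun=> r) fst snd) => //.
rewrite (itg_bint_swap 0 1 hD (f := fun r x => itg 0 1 (fun u => H k r u x)))//.
have bGr : bmf (fun x => itg 0 1 (fun r => itg 0 1 (fun u => H k r u x))).
  apply: (bmf_itg 0 1 (f := fun x r => itg 0 1 (fun u => H k r u x))).
  exact: (bmf_swap (f := fun r x => itg 0 1 (fun u => H k r u x)) (bX k)).
have key x : itg 0 1 (fun r => itg 0 1 (fun u => H k r u x)) =
    2^-1 * (G k x * itg 1 3 (fun s => hbar (3 ^+ k * (X x - y) * s))).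
  have e := itg_affine 1 0 1 (ltr0Sn R 1) (bhbar (3 ^+ k * (X x - y))).
  rewrite (_ : 2 * 0 + 1 = 1) in e; last by ring.
  rewrite (_ : 2 * 1 + 1 = 3) in e; last by ring.
  rewrite mulrCA -e -itgZ; last first.
    exact: (bmf_affine 2 1 (bhbar (3 ^+ k * (X x - y)))).
  apply: eq_itg => r _; rewrite -itg_cell_average -itgZ//.
  apply: (bmf_comp (phi := fun u : RR => (3 ^+ k * ((2 * r + 1) * X x + u),
    3 ^+ k * ((2 * r + 1) * y + u))) bh).
  by apply: measurable_fun_pair; apply: measurable_funM => //; exact: measurable_funD.
transitivity (\int[nu]_(x in D) (2^-1 * (G k x * itg 1 3 (fun s => hbar (3 ^+ k * (X x - y) * s))))).
  by apply: eq_Rintegral => x _; exact: key.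
rewrite bintZ//.
have := bmfZ 2 bGr; congr bmf; apply/funext => x.
by rewrite key; field.
Qed.

(* Jensen's inequality moves the average over grids out of the exponential. *)
Lemma grid_average B :
  (forall s u, 1 <= s <= 3 -> 0 <= u <= 1 -> itg 0 1 (fun y => expR (gridsum s u y)) <= B) ->
  itg 0 1 (fun y => expR (2^-1 * \sum_(k < n) 3 ^+ k *
    \int[nu]_(x in D) (G k x * itg 1 3 (fun s => hbar (3 ^+ k * (X x - y) * s))))) <= B.
Proof.
move=> hB.
have f01 : fine (lm `[0, 1]) = 1 :> R by rewrite fine_itv//; lra.
have bG3 d0 (S : measurableType d0) (r u y : S -> R) :
    measurable_fun setT r -> measurable_fun setT u -> measurable_fun setT y ->
    bmf (fun p => gridsum (2 * r p + 1) (u p) (y p)).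
  by move=> mr mu my; exact: (bmf_gridsum (mscale_r mr) mu my).
have m11 := measurableT_comp (@measurable_fst _ _ RR RR) (@measurable_fst _ _ (RR * RR)%type RR).
have m12 := measurableT_comp (@measurable_snd _ _ RR RR) (@measurable_fst _ _ (RR * RR)%type RR).
have m2 := @measurable_snd _ _ (RR * RR)%type RR.
pose E y r u := gridsum (2 * r + 1) u y.
have bE1 y r : bmfR (fun u => E y r u) by apply: bG3.
have bE2 : bmf (fun p : RR * RR => itg 0 1 (fun u => E p.1 p.2 u)).
  apply: (bmf_itg 0 1 (f := fun (p : RR * RR) u => E p.1 p.2 u)).
  exact: (bG3 _ (RR * RR * RR)%type (fun p => p.1.2) snd (fun p => p.1.1)).
have bX2 : bmf (fun p : RR * RR => itg 0 1 (fun u => expR (E p.1 p.2 u))).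
  apply: (bmf_itg 0 1 (f := fun (p : RR * RR) u => expR (E p.1 p.2 u))).
  apply: bmf_expR.
  exact: (bG3 _ (RR * RR * RR)%type (fun p => p.1.2) snd (fun p => p.1.1)).
have bX3 : bmf (fun p : RR * RR => itg 0 1 (fun y => expR (E y p.1 p.2))).
  apply: (bmf_itg 0 1 (f := fun (p : RR * RR) y => expR (E y p.1 p.2))).
  apply: bmf_expR.
  exact: (bG3 _ (RR * RR * RR)%type (fun p => p.1.1) (fun p => p.1.2) snd).
apply: (@le_trans _ _ (itg 0 1 (fun y => itg 0 1 (fun r => itg 0 1 (fun u => expR (E y r u)))))).
  apply: le_itg.
  - have := bmf_itg 0 1 (f := fun y r => itg 0 1 (fun u => E y r u)) bE2.
    move=> /bmf_expR; congr bmf; apply/funext => y; congr expR; exact: gridsum_average.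
  - exact: (bmf_itg 0 1 (f := fun y r => itg 0 1 (fun u => expR (E y r u))) bX2).
  move=> y _; rewrite -gridsum_average.
  apply: (le_trans (jensen_expR (findom_cc 0 1) f01 _)).
    exact: (bmf_snd (f := fun y r => itg 0 1 (fun u => E y r u)) y bE2).
  apply: le_itg.
  - by apply: bmf_expR; exact: (bmf_snd (f := fun y r => itg 0 1 (fun u => E y r u)) y bE2).
  - exact: (bmf_snd (f := fun y r => itg 0 1 (fun u => expR (E y r u))) y bX2).
  by move=> r _; apply: (jensen_expR (findom_cc 0 1) f01); exact: bE1.
rewrite (itg_swap 0 1 0 1
  (f := fun y r => itg 0 1 (fun u => expR (E y r u))))//.
apply: (@le_trans _ _ (B * (1 - 0))); last by rewrite subr0 mulr1.
apply: itg_le_cst => //.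
  apply: (bmf_itg 0 1 (f := fun r y => itg 0 1 (fun u => expR (E y r u)))).
  exact: (bmf_swap (f := fun y r => itg 0 1 (fun u => expR (E y r u))) bX2).
move=> r /andP[r0 r1].
rewrite (itg_swap 0 1 0 1 (f := fun y u => expR (E y r u))); last first.
  by apply: bmf_expR; exact: (bG3 _ (RR * RR)%type (fun=> r) snd fst).
apply: (@le_trans _ _ (B * (1 - 0))); last by rewrite subr0 mulr1.
apply: itg_le_cst => //.
  exact: (bmf_snd (f := fun r u => itg 0 1 (fun y => expR (E y r u))) r bX3).
by move=> u u01; apply: hB => //; apply/andP; split; lra.
Qed.

End GridAverage.

(** * Bellman functions on the triadic tree *)

Section TriadicTree.
Variable R : realType.
Notation RR := (measurableTypeR R).
Notation bmfR := (@bmf _ RR R).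
Variables (s u : R) (n : nat).
Hypothesis (s1 : 1 <= s).

(** In this coordinate the cells of generation [k] are the intervals between consecutive integers,
    and passing to the next generation is multiplication by 3. *)
Definition psi k (y : R) : R := 3 ^+ k * (s * y + u).

Lemma psiS k y : psi k.+1 y = 3 * psi k y.
Proof. by rewrite /psi exprS mulrA. Qed.

Lemma measurable_psi k : measurable_fun setT (psi k : RR -> RR).
Proof.
apply: measurable_funM; first exact: measurable_cst.
by apply: measurable_funD => //; apply: measurable_funM => //; exact: measurable_cst.
Qed.

Variables (F : nat -> R -> R) (inc : nat -> R -> R -> R) (Psi : nat -> R -> R).
Hypotheses (bF : forall k, bmfR (F k))
  (FE : forall k y, F k y = inc k (flr (psi k y)) (dig (psi k y)))
  (step : forall k j, expR (inc k j 0) * Psi k.+1 (3 * j) +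
     expR (inc k j 1) * Psi k.+1 (3 * j + 1) + expR (inc k j 2) * Psi k.+1 (3 * j + 2)
     <= 3 * Psi k j)
  (last_ge1 : forall j, 1 <= Psi n j).

Definition cellind k (j y : R) : R := (flr (psi k y) == j)%:R.

Lemma bmf_cellind k j : bmfR (cellind k j).
Proof.
apply: bmf_bool; apply: measurable_fun_eqr; last exact: measurable_cst.
exact: (measurableT_comp (@measurable_flr R) (measurable_psi k)).
Qed.

Lemma cellind_ge0 k j y : 0 <= cellind k j y. Proof. exact: ler0n. Qed.

Lemma itg_cellind k j : itg 0 1 (cellind k j) <= (3 ^+ k)^-1.
Proof.
have p := exp3_gt0 R k; have s0 : 0 < s := lt_le_trans ltr01 s1.
have c0 : 0 < 3 ^+ k * s by rewrite mulr_gt0.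
apply: (@le_trans _ _ (itg 0 1 (fun y => ico j (j + 1) (3 ^+ k * s * y + 3 ^+ k * u)))).
  apply: le_itg; [exact: bmf_cellind | exact: (bmf_affine _ _ (bmf_ico _ _)) |].
  move=> y _; rewrite /cellind; case: eqP => [e|_]; last by rewrite /ico; case: ifP.
  have := flr_itv (psi k y); rewrite e /psi => /andP[? ?].
  by rewrite ico_in//; lra.
rewrite itg_affine//; last exact: bmf_ico.
rewrite itg_ico; last by rewrite lerD2r ler_pM2l//; lra.
rewrite mulr0 mulr1 add0r invfM -mulrA.
rewrite -[leRHS]mulr1; apply: ler_wpM2l; first by rewrite invr_ge0 ltW.
have s' : s^-1 <= 1 by rewrite invf_le1.
rewrite -[leRHS](mulr1 1); apply: ler_pM => //; first by rewrite invr_ge0 ltW.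
  by rewrite le_max lexx.
rewrite ge_max ler01/=.
set a := Num.min _ _; set b := Num.max _ _.
have : a <= j + 1 by rewrite ge_min lexx orbT.
have : j <= b by rewrite le_max lexx orbT.
by lra.
Qed.

(** Induction from the leaves to the root. Within a cell the increment [F k] depends on the digit
    alone, so it is constant on each of the three children and comes out of the integral there;
    [step] is the inequality that this recursion requires of [Psi]. *)
Lemma tree_bound m k j : (k + m = n)%N ->
  itg 0 1 (fun y => cellind k j y * expR (\sum_(k <= i < n) F i y)) <= (3 ^+ k)^-1 * Psi k j.
Proof.
have bS k' : bmfR (fun y => expR (\sum_(k' <= i < n) F i y)).
  by apply: bmf_expR; apply: bmf_sum.
elim: m k j => [|m ih] k j.
  rewrite addn0 => kn; have p := exp3_gt0 R k.
  have -> : itg 0 1 (fun y => cellind k j y * expR (\sum_(k <= i < n) F i y)) =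
      itg 0 1 (cellind k j).
    by apply: eq_itg => y _; rewrite -kn big_geq// expR0 mulr1.
  apply: le_trans (itg_cellind k j) _; rewrite ler_peMr ?invr_ge0 ?(ltW p)//.
  by rewrite kn.
rewrite addnS -addSn => kn; have kn' : (k < n)%N by rewrite -kn ltnS leq_addr.
pose t d y := expR (inc k j d) * (cellind k.+1 (3 * j + d) y * expR (\sum_(k.+1 <= i < n) F i y)).
have bt d : bmfR (t d) by apply: bmfZ; apply: bmfM => //; exact: bmf_cellind.
have t0 d y : 0 <= t d y by rewrite !mulr_ge0 ?expR_ge0 ?cellind_ge0.
have bt2 : bmfR (fun y => t 0 y + t 1 y) by exact: bmfD.
apply: (@le_trans _ _ (itg 0 1 (fun y => t 0 y + t 1 y + t 2 y))).
  apply: le_itg; [by apply: bmfM => //; exact: bmf_cellind | exact: bmfD |].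
  move=> y _; rewrite {1}/cellind; case: eqP => [e|_]; last by rewrite mul0r !addr_ge0.
  rewrite mul1r (big_ltn kn') expRD FE e; set dd := dig (psi k y).
  have te : t dd y = expR (inc k j dd) * expR (\sum_(k.+1 <= i < n) F i y).
    rewrite /t /cellind psiS -e (_ : 3 * flr (psi k y) + dd = flr (3 * psi k y)); last first.
      by rewrite /dd /dig; ring.
    by rewrite eqxx mul1r.
  rewrite -te; have := t0 0 y; have := t0 1 y; have := t0 2 y.
  by rewrite /dd; case: (dig_cases (psi k y)) => ->; lra.
rewrite !itgD// !itgZ//; try by apply: bmfM => //; exact: bmf_cellind.
have h d := ih k.+1 (3 * j + d) kn.
have h' d : expR (inc k j d) * itg 0 1 (fun y => cellind k.+1 (3 * j + d) y *
    expR (\sum_(k.+1 <= i < n) F i y)) <= (3 ^+ k.+1)^-1 * (expR (inc k j d) * Psi k.+1 (3 * j + d)).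
  by rewrite [leRHS]mulrCA ler_wpM2l ?expR_ge0.
have := h' 0; have := h' 1; have := h' 2; have := step k j.
rewrite addr0; have p : 0 < (3 ^+ k.+1)^-1 :> R by rewrite invr_gt0 exp3_gt0.
move=> /(ler_wpM2l (ltW p)); rewrite !mulrDr.
rewrite (_ : (3 ^+ k)^-1 * Psi k j = (3 ^+ k.+1)^-1 * (3 * Psi k j)); last first.
  by rewrite exprS; field; rewrite gt_eqF// exp3_gt0.
by lra.
Qed.

(** Since [s * y + u] stays in [[0, 4]], five root cells cover [[0, 1]]; the fifth is needed for the
    endpoint 4. *)
Lemma tree_total B : 0 <= u <= 1 -> s <= 3 -> (forall j, Psi 0 j <= B) ->
  itg 0 1 (fun y => expR (\sum_(i < n) F i y)) <= 5 * B.
Proof.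
move=> /andP[u0 u1] s3 hB.
have bS : bmfR (fun y => expR (\sum_(0 <= i < n) F i y)) by apply: bmf_expR; exact: bmf_sum.
have bC (j : 'I_5) : bmfR (fun y => cellind 0 j%:R y * expR (\sum_(0 <= i < n) F i y)).
  by apply: bmfM => //; exact: bmf_cellind.
apply: (@le_trans _ _ (itg 0 1 (fun y => \sum_(j < 5)
    cellind 0 j%:R y * expR (\sum_(0 <= i < n) F i y)))).
  apply: le_itg.
  - have := bS; congr bmf; apply/funext => y; by rewrite big_mkord.
  - exact: bmf_sum.
  move=> y /andP[y0 y1]; rewrite big_mkord -mulr_suml ler_peMl ?expR_ge0//.
  have sy0 : 0 <= s * y by rewrite mulr_ge0// (le_trans ler01).
  have sy3 : s * y <= 3 * 1 by apply: ler_pM => //; exact: le_trans ler01 s1.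
  have z0 : 0 <= psi 0 y by rewrite /psi expr0 mul1r; lra.
  have z4 : psi 0 y <= 4 by rewrite /psi expr0 mul1r; lra.
  have /andP[f0 f1] := flr_itv (psi 0 y).
  have hj (j : 'I_5) : flr (psi 0 y) = j%:R -> 1 <= \sum_(i < 5) cellind 0 i%:R y.
    move=> e; rewrite (bigD1 j)//= {1}/cellind e eqxx lerDl.
    by apply: sumr_ge0 => i _; exact: cellind_ge0.
  have [h|h1] := ltP (psi 0 y) 1.
    by apply: (hj (inord 0)); rewrite inordK//; apply: (@flr_eq _ _ 0); apply/andP; split; lra.
  have [h|h2] := ltP (psi 0 y) 2.
    by apply: (hj (inord 1)); rewrite inordK//; apply: (@flr_eq _ _ 1); apply/andP; split; lra.
  have [h|h3] := ltP (psi 0 y) 3.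
    by apply: (hj (inord 2)); rewrite inordK//; apply: (@flr_eq _ _ 2); apply/andP; split; lra.
  have [h|h5] := ltP (psi 0 y) 4.
    by apply: (hj (inord 3)); rewrite inordK//; apply: (@flr_eq _ _ 3); apply/andP; split; lra.
  by apply: (hj (inord 4)); rewrite inordK//; apply: (@flr_eq _ _ 4); apply/andP; split; lra.
rewrite itg_sum//; apply: (@le_trans _ _ (\sum_(j < 5) B)).
  apply: ler_sum => j _; apply: le_trans (tree_bound j%:R (add0n n)) _.
  by rewrite expr0 invr1 mul1r.
by rewrite sumr_const card_ord -(mulr_natl B).
Qed.

End TriadicTree.

(** * The Bellman function and its one-step inequality *)

Section Bellman.
Variable R : realType.

Lemma expR_quad (z : R) : z <= 1/2 -> expR z <= 1 + z + 2 * z ^+ 2.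
Proof.
move=> hz; have z1 : 0 < 1 - z by lra.
have e0 := expR_gt0 (- z); have := expR_ge1Dx (- z); rewrite -/(1 - z) => h.
have : expR z <= (1 - z)^-1.
  by rewrite -[expR z]invrK -expRN lef_pV2// posrE.
move=> h2; apply: (le_trans h2); rewrite -[leLHS]mul1r ler_pdivrMr//.
have z2 := sqr_ge0 z; have : 0 <= z ^+ 2 * (1/2 - z) by rewrite mulr_ge0//; lra.
have -> : (1 + z + 2 * z ^+ 2) * (1 - z) = 1 + 2 * (z ^+ 2 * (1/2 - z)) by field.
by lra.
Qed.

Lemma sq_mean_le (X0 X1 X2 x0 x1 x2 e0 e1 e2 : R) :
  `|X0 - x0| <= e0 -> `|X1 - x1| <= e1 -> `|X2 - x2| <= e2 ->
  `|X0| <= 1 -> `|X1| <= 1 -> `|X2| <= 1 -> `|x0| <= 1 -> `|x1| <= 1 -> `|x2| <= 1 ->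
  ((X0 + X1 + X2) / 3) ^+ 2 <= ((x0 + x1 + x2) / 3) ^+ 2 + 2 * ((e0 + e1 + e2) / 3).
Proof.
move=> d0 d1 d2 A0 A1 A2 a0 a1 a2; set X := _ / 3; set x := (x0 + x1 + x2) / 3.
have -> : X ^+ 2 = x ^+ 2 + (X - x) * (X + x) by ring.
rewrite lerD2l; apply: le_trans (ler_norm _) _; rewrite normrM [2 * _]mulrC.
have t (a b c : R) : `|a + b + c| <= `|a| + `|b| + `|c|.
  by apply: le_trans (ler_normD _ _) _; rewrite lerD2r ler_normD.
apply: ler_pM => //.
  have -> : X - x = (X0 - x0 + (X1 - x1) + (X2 - x2)) / 3 by rewrite /X /x; field.
  rewrite normrM [`|3^-1|]ger0_norm//; apply: ler_wpM2r => //.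
  by apply: le_trans (t _ _ _) _; apply: lerD => //; exact: lerD.
have -> : X + x = (X0 + x0 + (X1 + x1) + (X2 + x2)) / 3 by rewrite /X /x; field.
rewrite normrM [`|3^-1|]ger0_norm// ler_pdivrMr//.
apply: le_trans (t _ _ _) _; rewrite (_ : 2 * 3 = 1 + 1 + (1 + 1) + (1 + 1)); last by ring.
by do !apply: lerD; apply: le_trans (ler_normD _ _) _; exact: lerD.
Qed.

(** The arithmetic core of [bellman_step]: [v], [w], [z] are the distances between [x0], [x1], [x2],
    while [v'], [w'] are those of [q0], [q1] and of [q1], [q2], and [lo] is the mean stopped mass.
    [S] bounds the first-order term. The second-order term is at most
    [108 c^2 = 2 c^2 (1 + 4 + 1) 9], the squares of [beta] times the maximum 9 of [bell]. The right
    side is the gain from concavity and from the stopped mass. *)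
Lemma bellman_num (lo v w z v' w' c S : R) :
  0 <= lo -> lo <= 1 -> 0 <= v <= 2 -> 0 <= w <= 2 -> 0 <= v' <= 1 -> 0 <= w' <= 1 ->
  S <= (z / 3 + lo) / 20 * (2 * v + 2 * w + 6 * v' + 6 * w') ->
  c ^+ 2 <= ((z / 3 + lo) / 20) ^+ 2 ->
  S + 108 * c ^+ 2 <= (v ^+ 2 + w ^+ 2 + z ^+ 2) / 3 + (v' ^+ 2 + w' ^+ 2) / 3 + 6 * lo.
Proof.
move=> lo0 lo1 /andP[v0 v2] /andP[w0 w2] /andP[v0' v2'] /andP[w0' w2'] hS hc.
have hl : lo * (2 * v + 2 * w + 6 * v' + 6 * w') <= lo * 20 by apply: ler_wpM2l => //; lra.
have hll : lo ^+ 2 <= lo by rewrite expr2 ler_piMl.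
have n1 := sqr_ge0 (z - v); have n2 := sqr_ge0 (z - w); have n3 := sqr_ge0 (z - v').
have n4 := sqr_ge0 (z - w'); have n5 := sqr_ge0 (z / 3 - lo).
have n6 := sqr_ge0 z; have n7 := sqr_ge0 v; have n8 := sqr_ge0 w; have n9 := sqr_ge0 v'.
have n10 := sqr_ge0 w'.
by lra.
Qed.

(** The negative squares turn the spread among the children into a gain that pays for the
    exponentials. The linear part [6 q] drops when mass is stopped, which pays for the change of the
    averages. The constant 3 keeps the function in [[3, 9]] on [|x| <= q <= 1], so that the relative
    costs are under control. *)
Definition bell (x q : R) := 3 - x ^+ 2 - q ^+ 2 + 6 * q.

Lemma bell_bounds x q : `|x| <= q -> q <= 1 -> 3 <= bell x q <= 9.
Proof.
move=> xq q1; have q0 : 0 <= q := le_trans (normr_ge0 _) xq.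
have x2 : x ^+ 2 <= q ^+ 2 by rewrite -(real_normK (num_real x)) lerXn2r ?nnegrE.
have q2 : q ^+ 2 <= q by rewrite expr2 ler_piMl.
by have := sqr_ge0 x; have := sqr_ge0 q; rewrite /bell; move=> *; apply/andP; split; lra.
Qed.

Lemma bell_lip x q x' q' : `|x| <= q -> q <= 1 -> `|x'| <= q' -> q' <= 1 ->
  `|bell x q - bell x' q'| <= 2 * `|x - x'| + 6 * `|q - q'|.
Proof.
move=> xq q1 xq' q1'.
have q0 : 0 <= q := le_trans (normr_ge0 _) xq.
have q0' : 0 <= q' := le_trans (normr_ge0 _) xq'.
have -> : bell x q - bell x' q' = - (x - x') * (x + x') + (q - q') * (6 - (q + q')).
  by rewrite /bell; ring.
apply: le_trans (ler_normD _ _) _; rewrite !normrM normrN [2 * _]mulrC [6 * _]mulrC.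
apply: lerD; apply: ler_wpM2l => //; last by rewrite ger0_norm; lra.
by apply: le_trans (ler_normD _ _) _; lra.
Qed.

(* [X_d], [Q_d] are averages over the three children of a cell and [x_d], [q_d] the same
   averages after some mass has been stopped: the stopped mass is paid for by [6 * q]. *)
Lemma bellman_step (l x0 x1 x2 q0 q1 q2 X0 X1 X2 Q0 Q1 Q2 : R) :
  0 <= l <= 1/20 ->
  `|x0| <= q0 -> `|x1| <= q1 -> `|x2| <= q2 -> Q0 <= 1 -> Q1 <= 1 -> Q2 <= 1 ->
  `|X0 - x0| <= Q0 - q0 -> `|X1 - x1| <= Q1 - q1 -> `|X2 - x2| <= Q2 - q2 ->
  forall c, c = l * ((X0 - X2) / 3) ->
  expR (c * beta 0) * bell x0 q0 + expR (c * beta 1) * bell x1 q1 + expR (c * beta 2) * bell x2 q2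
  <= 3 * bell ((X0 + X1 + X2) / 3) ((Q0 + Q1 + Q2) / 3).
Proof.
move=> /andP[l0 l1] a0 a1 a2 b0 b1 b2 d0 d1 d2 c cE.
have e0 := le_trans (normr_ge0 _) d0; have e1 := le_trans (normr_ge0 _) d1.
have e2 := le_trans (normr_ge0 _) d2.
have f0 := le_trans (normr_ge0 _) a0; have f1 := le_trans (normr_ge0 _) a1.
have f2 := le_trans (normr_ge0 _) a2.
have q01 : q0 <= 1 by lra.
have q11 : q1 <= 1 by lra.
have q21 : q2 <= 1 by lra.
have beta0 : beta 0 = 1 :> R by rewrite /beta; ring.
have beta1 : beta 1 = -2 :> R by rewrite /beta; ring.
have beta2 : beta 2 = 1 :> R by rewrite /beta; ring.
pose lo := (Q0 - q0 + (Q1 - q1) + (Q2 - q2)) / 3.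
pose m := `|x0 - x2| / 3 + lo.
have lo0 : 0 <= lo by rewrite divr_ge0//; lra.
have lo1 : lo <= 1 by rewrite /lo; lra.
have cm : `|c| <= m / 20.
  rewrite cE normrM (ger0_norm l0) normrM [`|3^-1|]ger0_norm//.
  have : `|X0 - X2| <= `|x0 - x2| + 3 * lo.
    have -> : X0 - X2 = (x0 - x2) + (X0 - x0) - (X2 - x2) by ring.
    apply: le_trans (ler_normB _ _) _; apply: le_trans (lerD (ler_normD _ _) (lexx _)) _.
    by rewrite /lo; lra.
  move=> h; apply: (@le_trans _ _ (1/20 * ((`|x0 - x2| + 3 * lo) / 3))); last by rewrite /m; lra.
  by apply: ler_pM => //; lra.
have u2 : `|x0 - x2| <= 2.
  by apply: le_trans (ler_normB _ _) _; lra.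
have v2 : `|x0 - x1| <= 2 by apply: le_trans (ler_normB _ _) _; lra.
have w2 : `|x1 - x2| <= 2 by apply: le_trans (ler_normB _ _) _; lra.
have v1 : `|q0 - q1| <= 1 by clear - f0 f1 q01 q11; rewrite ler_norml; apply/andP; split; lra.
have w1 : `|q1 - q2| <= 1 by clear - f1 f2 q11 q21; rewrite ler_norml; apply/andP; split; lra.
have m0 : 0 <= m by rewrite /m addr_ge0// divr_ge0.
have c12 : `|c| <= 1/4 by rewrite /m in cm; clear - cm u2 lo1; lra.
have /andP[cl cr] : - (1/4) <= c <= 1/4 by rewrite -ler_norml.
have /andP[M0l M0r] := bell_bounds a0 q01; have /andP[M1l M1r] := bell_bounds a1 q11.
have /andP[M2l M2r] := bell_bounds a2 q21.
have L01 := bell_lip a0 q01 a1 q11; have L12 := bell_lip a1 q11 a2 q21.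
set M0 := bell x0 q0 in M0l M0r L01 *; set M1 := bell x1 q1 in M1l M1r L01 L12 *.
set M2 := bell x2 q2 in M2l M2r L12 *.
rewrite beta0 beta1 beta2 !mulr1.
have E1 : expR c <= 1 + c + 2 * c ^+ 2 by apply: expR_quad; clear - cr; lra.
have E2 : expR (c * -2) <= 1 + c * -2 + 2 * (c * -2) ^+ 2 by apply: expR_quad; clear - cl; lra.
have c2 := sqr_ge0 c.
have P0 : expR c * M0 <= (1 + c + 2 * c ^+ 2) * M0 by apply: ler_wpM2r => //; clear - M0l; lra.
have P1 : expR (c * -2) * M1 <= (1 + c * -2 + 2 * (c * -2) ^+ 2) * M1 by apply: ler_wpM2r => //; clear - M1l; lra.
have P2 : expR c * M2 <= (1 + c + 2 * c ^+ 2) * M2 by apply: ler_wpM2r => //; clear - M2l; lra.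
pose sg := 2 * `|x0 - x1| + 2 * `|x1 - x2| + 6 * `|q0 - q1| + 6 * `|q1 - q2|.
have S : c * (M0 - 2 * M1 + M2) <= m / 20 * sg.
  apply: le_trans (ler_norm _) _; rewrite normrM; apply: ler_pM => //.
  have -> : M0 - 2 * M1 + M2 = (M0 - M1) - (M1 - M2) by ring.
  by apply: le_trans (ler_normB _ _) _; clear - L01 L12; rewrite /sg; lra.
have T0 : c ^+ 2 * M0 <= c ^+ 2 * 9 by apply: ler_wpM2l.
have T1 : c ^+ 2 * M1 <= c ^+ 2 * 9 by apply: ler_wpM2l.
have T2 : c ^+ 2 * M2 <= c ^+ 2 * 9 by apply: ler_wpM2l.
have C2 : c ^+ 2 <= (m / 20) ^+ 2.
  by rewrite -(real_normK (num_real c)) lerXn2r// nnegrE// divr_ge0.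
have X01 : `|X0| <= 1 by rewrite -[X0](subrK x0); apply: le_trans (ler_normD _ _) _; clear - a0 d0 b0; lra.
have X11 : `|X1| <= 1 by rewrite -[X1](subrK x1); apply: le_trans (ler_normD _ _) _; clear - a1 d1 b1; lra.
have X21 : `|X2| <= 1 by rewrite -[X2](subrK x2); apply: le_trans (ler_normD _ _) _; clear - a2 d2 b2; lra.
have xx := sq_mean_le d0 d1 d2 X01 X11 X21 (le_trans a0 q01) (le_trans a1 q11) (le_trans a2 q21).
have nn (a : R) : 0 <= a -> a <= 1 -> `|a| <= 1 by move=> *; rewrite ger0_norm.
have Q00 : 0 <= Q0 by clear - e0 f0; lra.
have Q10 : 0 <= Q1 by clear - e1 f1; lra.
have Q20 : 0 <= Q2 by clear - e2 f2; lra.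
have ll (a : R) : 0 <= a -> `|a| <= a by move=> *; rewrite ger0_norm.
have qq := sq_mean_le (ll _ e0) (ll _ e1) (ll _ e2) (nn _ Q00 b0) (nn _ Q10 b1) (nn _ Q20 b2)
  (nn _ f0 q01) (nn _ f1 q11) (nn _ f2 q21).
set xb := (X0 + X1 + X2) / 3 in xx *; set qb := (Q0 + Q1 + Q2) / 3 in qq *.
rewrite -/lo in xx qq.
set xm := (x0 + x1 + x2) / 3 in xx; set qm' := (q0 + q1 + q2) / 3 in qq.
(* The variance of three numbers is a sum of squared differences. Of the [18 lo] gained from the
   linear part of [bell], [sq_mean_le] takes [6 lo] for [x] and [6 lo] for [q]. *)
have V : 3 * bell xb qb >= M0 + M1 + M2 + (`|x0 - x1| ^+ 2 + `|x1 - x2| ^+ 2 + `|x0 - x2| ^+ 2) / 3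
     + (`|q0 - q1| ^+ 2 + `|q1 - q2| ^+ 2) / 3 + 6 * lo.
  rewrite !real_normK ?num_real//.
  have h1 : 0 <= (q0 - q2) ^+ 2 := sqr_ge0 _.
  have h2 : (x0 - x1) ^+ 2 + (x1 - x2) ^+ 2 + (x0 - x2) ^+ 2 =
     3 * (x0 ^+ 2 + x1 ^+ 2 + x2 ^+ 2) - 9 * xm ^+ 2 by rewrite /xm; field.
  have h3 : (q0 - q1) ^+ 2 + (q1 - q2) ^+ 2 + (q0 - q2) ^+ 2 =
     3 * (q0 ^+ 2 + q1 ^+ 2 + q2 ^+ 2) - 9 * qm' ^+ 2 by rewrite /qm'; field.
  have h4 : 18 * qb = 6 * (q0 + q1 + q2) + 18 * lo by rewrite /qb /lo; field.
  by clear - h1 h2 h3 h4 xx qq lo0; rewrite /M0 /M1 /M2 /bell; lra.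
have N (a b : R) : `|a - b| <= 2 -> 0 <= `|a - b| <= 2 by move=> ->; rewrite normr_ge0.
have N' (a b : R) : `|a - b| <= 1 -> 0 <= `|a - b| <= 1 by move=> ->; rewrite normr_ge0.
have := bellman_num lo0 lo1 (N _ _ v2) (N _ _ w2) (N' _ _ v1) (N' _ _ w1) S C2.
by clear - P0 P1 P2 T0 T1 T2 V; lra.
Qed.

End Bellman.

Section DigitKernels.
Variable R : realType.
Implicit Types (a b j z : R).

Lemma ico_ge0 (p q v : R) : 0 <= ico p q v.
Proof. by rewrite /ico; case: ifP. Qed.

Lemma ico_split (j z : R) : ico j (j + 1) z =
  ico (3 * j) (3 * j + 1) (3 * z) + ico (3 * j + 1) (3 * j + 1 + 1) (3 * z)
  + ico (3 * j + 2) (3 * j + 2 + 1) (3 * z).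
Proof.
have [h|h] := ltP z j; first by rewrite !ico_out; [ring|left; lra..].
have [h1|h1] := leP (j + 1) z; first by rewrite !ico_out; [ring|right; lra..].
rewrite (ico_in h h1).
have [h2|h2] := ltP (3 * z) (3 * j + 1).
  by rewrite ico_in ?ico_out; [ring|left; lra|left; lra|lra|lra].
rewrite (ico_out (p := 3 * j)); last by right; lra.
have [h3|h3] := ltP (3 * z) (3 * j + 2).
  by rewrite ico_in ?ico_out; [ring|left; lra|lra|lra].
by rewrite ico_out ?ico_in; [ring|lra|lra|right; lra].
Qed.

Lemma samecell_ico (a b : R) : samecell a b = ico (flr b) (flr b + 1) a.
Proof.
rewrite /samecell; case: eqP => h.
  by have := flr_itv a; rewrite h => /andP[? ?]; rewrite ico_in.
rewrite ico_out//; have [h1|h1] := ltP a (flr b); [by left|right].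
rewrite leNgt; apply/negP => h2; apply: h; apply: (@flr_eq _ _ (Num.floor b)).
by rewrite -/(flr b) h1.
Qed.

(** In its first variable the kernel is the indicator of the first child minus that of the third, so
    that integrating it gives a difference of two cell masses. *)
Lemma cellker_ico (a b : R) : cellker a b =
  (ico (3 * flr b) (3 * flr b + 1) (3 * a) - ico (3 * flr b + 2) (3 * flr b + 2 + 1) (3 * a))
  * beta (dig b).
Proof.
rewrite /cellker; congr (_ * _); rewrite samecell_ico.
set j := flr b.
have [h|h] := boolP ((j <= a) && (a < j + 1)); last first.
  rewrite negb_and -ltNge -leNgt in h.
  rewrite (ico_out (p := j)) ?mul0r; last by case/orP: h; [left|right].
  by rewrite !ico_out ?subrr//; case/orP: h => ?; [left|right|left|right]; lra.
have /andP[h1 h2] := h; rewrite ico_in// mul1r.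
have -> : dig a = dig (a - j) by rewrite -{1}(subrK j a) /j /flr digDint.
have [-> _] : alpha (dig (a - j)) = third 0 (a - j) - third 2 (a - j) /\
    beta (dig (a - j)) = third 0 (a - j) - 2 * third 1 (a - j) + third 2 (a - j).
  by apply: digE; apply/andP; split; lra.
have e c : third c (a - j) = ico (3 * j + c) (3 * j + c + 1) (3 * a).
  by rewrite /third /ico; congr (if _ then _ else _); apply/andP/andP => -[? ?]; split; lra.
by rewrite !e addr0.
Qed.

End DigitKernels.

(** * Exponential integrability of kernels truncated at a variable scale *)

Section StoppedKernels.
Variables (R : realType) (d : measure_display) (T : measurableType d).
Variables (nu : {sigma_finite_measure set T -> \bar R}) (D : set T) (X : T -> R).
Hypotheses (hD : findom nu D) (mX : measurable_fun setT X)
  (hX : forall a b, a <= b -> \int[nu]_(x in D) ico a b (X x) <= b - a).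
Variables (n : nat) (kp : T -> nat).
Hypotheses (mkp : measurable_fun setT kp) (kpn : forall x, (kp x <= n)%N).
Notation RR := (measurableTypeR R).
Notation bmfR := (@bmf _ RR R).

Lemma bmf_natcomp (F : nat -> R) : bmf (fun x => F (kp x)).
Proof.
split; first by apply: (measurableT_comp (f := F)) => //.
exists (\sum_(i < n.+1) `|F i|) => x.
have h : (kp x < n.+1)%N by rewrite ltnS.
by rewrite (bigD1 (Ordinal h))//= lerDl sumr_ge0.
Qed.

Lemma bmf_stopped k : bmf (fun x => (k < kp x)%N%:R : R).
Proof. exact: (bmf_natcomp (fun i => (k < i)%N%:R)). Qed.

Lemma sum_stopped (m : nat) (F : nat -> R) : (m <= n)%N ->
  \sum_(k < n) (k < m)%N%:R * F k = \sum_(k < m) F k.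
Proof.
move=> mn; rewrite (big_ord_widen n (fun k => F k) mn) [RHS]big_mkcond/=.
by apply: eq_bigr => k _; case: ifP; rewrite ?mul1r ?mul0r.
Qed.

Lemma stopped_average (hb : R -> R) (H : T -> nat -> R) y : bmfR hb ->
  (forall k, bmf (fun x => H x k)) ->
  2^-1 * \sum_(k < n) 3 ^+ k * \int[nu]_(x in D)
     (H x k * (k < kp x)%N%:R * itg 1 3 (fun s => hb (3 ^+ k * (X x - y) * s))) =
  \int[nu]_(x in D) (2^-1 * \sum_(k < kp x) 3 ^+ k * H x k *
     itg 1 3 (fun s => hb (3 ^+ k * (X x - y) * s))).
Proof.
move=> bhb bH.
have bI k : bmf (fun x => itg 1 3 (fun s => hb (3 ^+ k * (X x - y) * s))).
  apply: (bmf_itg 1 3 (f := fun x s => hb (3 ^+ k * (X x - y) * s))).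
  apply: (bmf_comp (phi := fun p : T * RR => 3 ^+ k * (X p.1 - y) * p.2 : RR) bhb).
  apply: measurable_funM => //; apply: measurable_funM; first exact: measurable_cst.
  apply: measurable_funB; last exact: measurable_cst.
  exact: (measurableT_comp mX).
have bT k : bmf (fun x => H x k * (k < kp x)%N%:R * itg 1 3 (fun s => hb (3 ^+ k * (X x - y) * s))).
  by apply: bmfM => //; apply: bmfM => //; exact: bmf_stopped.
under eq_bigr do rewrite -bintZ//.
rewrite -bint_sum//; last by move=> k _; exact: bmfZ.
rewrite -bintZ//; last by apply: bmf_sum => k _; exact: bmfZ.
apply: eq_Rintegral => x _; congr (_ * _).
rewrite -(sum_stopped (fun k => 3 ^+ k * H x k * itg 1 3 (fun s => hb (3 ^+ k * (X x - y) * s))) (kpn x)).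
by apply: eq_bigr => k _; ring.
Qed.

Section grid.
Variables (s u : R).
Hypothesis (s1 : 1 <= s).

(** A cell average, normalized by [3^k] instead of [3^k s]. Since [hX] bounds the image of [nu]
    under [X] by Lebesgue measure and [s >= 1], the averages of functions with values in [[-1, 1]]
    stay in [[-1, 1]]. *)
Definition mass k j (f : T -> R) : R :=
  3 ^+ k * \int[nu]_(x in D) (f x * ico j (j + 1) (psi s u k (X x))).

Let bmass k j f : bmf f -> bmf (fun x => f x * ico j (j + 1) (psi s u k (X x))).
Proof.
move=> bf; apply: bmfM => //; apply: (bmf_comp (bmf_ico _ _)).
exact: (measurableT_comp (measurable_psi s u k)).
Qed.

Lemma le_mass k j f g : bmf f -> bmf g -> (forall x, f x <= g x) -> mass k j f <= mass k j g.
Proof.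
move=> bf bg fg; apply: ler_wpM2l; first by rewrite exprn_ge0.
by apply: le_bint => //; [exact: bmass|exact: bmass|move=> x _; rewrite ler_wpM2r ?ico_ge0].
Qed.

Lemma massZ k j c f : bmf f -> mass k j (fun x => c * f x) = c * mass k j f.
Proof.
move=> bf; rewrite /mass mulrCA -(bintZ c hD (bmass k j bf)).
by congr (_ * _); apply: eq_Rintegral => x _; rewrite mulrA.
Qed.

Lemma massD k j f g : bmf f -> bmf g -> mass k j (fun x => f x + g x) = mass k j f + mass k j g.
Proof.
move=> bf bg; rewrite /mass -mulrDr -bintD//; [|exact: bmass|exact: bmass].
by congr (_ * _); apply: eq_Rintegral => x _; rewrite mulrDl.
Qed.

Lemma massB k j f g : bmf f -> bmf g -> mass k j (fun x => f x - g x) = mass k j f - mass k j g.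
Proof.
move=> bf bg; rewrite /mass -mulrBr -bintB//; [|exact: bmass|exact: bmass].
by congr (_ * _); apply: eq_Rintegral => x _; rewrite mulrBl.
Qed.

Lemma mass_norm k j f g : bmf f -> bmf g -> (forall x, `|f x| <= g x) -> `|mass k j f| <= mass k j g.
Proof.
move=> bf bg fg; rewrite /mass normrM ger0_norm ?exprn_ge0//.
apply: ler_wpM2l; first by rewrite exprn_ge0.
apply: norm_bint_le; [exact: hD|exact: bmass|exact: bmass|move=> x _].
by rewrite normrM (ger0_norm (ico_ge0 _ _ _)) ler_wpM2r ?ico_ge0.
Qed.

Lemma mass_ge0 k j f : (forall x, 0 <= f x) -> 0 <= mass k j f.
Proof.
move=> f0; apply: mulr_ge0; first by rewrite exprn_ge0.
by apply: Rintegral_ge0 => x _; rewrite mulr_ge0 ?ico_ge0.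
Qed.

Lemma mass_cst1 k j : mass k j (fun=> 1) <= 1.
Proof.
have p := exp3_gt0 R k; have s0 : 0 < s := lt_le_trans ltr01 s1.
have c0 : 0 < 3 ^+ k * s by rewrite mulr_gt0.
rewrite /mass -ler_pdivlMl// mulr1.
pose a := (j - 3 ^+ k * u) / (3 ^+ k * s); pose b := (j + 1 - 3 ^+ k * u) / (3 ^+ k * s).
have ab : a <= b by rewrite ler_pM2r ?invr_gt0//; lra.
apply: (@le_trans _ _ (b - a)).
  apply: le_trans (hX ab); rewrite le_eqVlt; apply/orP; left; apply/eqP.
  apply: eq_Rintegral => x _; rewrite mul1r /ico /psi /a /b ler_pdivrMr// ltr_pdivlMr//.
  congr (if _ then _ else _).
  by apply/andP/andP => -[h1 h2]; split; lra.
have -> : b - a = (3 ^+ k)^-1 * s^-1 by rewrite /a /b; field; rewrite !gt_eqF.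
by rewrite ler_piMr ?invr_ge0 ?(ltW p)// invf_le1.
Qed.

Lemma mass_le1 k j f : bmf f -> (forall x, f x <= 1) -> mass k j f <= 1.
Proof. by move=> bf f1; apply: le_trans (mass_cst1 k j); apply: le_mass => //; exact: bmf_cst. Qed.

Lemma mass_split k j f : bmf f ->
  mass k j f = (mass k.+1 (3 * j) f + mass k.+1 (3 * j + 1) f + mass k.+1 (3 * j + 2) f) / 3.
Proof.
move=> bf; have b c := @bmass k.+1 c f bf.
have E : \int[nu]_(x in D) (f x * ico j (j + 1) (psi s u k (X x))) =
    \int[nu]_(x in D) (f x * ico (3 * j) (3 * j + 1) (psi s u k.+1 (X x))) +
    \int[nu]_(x in D) (f x * ico (3 * j + 1) (3 * j + 1 + 1) (psi s u k.+1 (X x))) +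
    \int[nu]_(x in D) (f x * ico (3 * j + 2) (3 * j + 2 + 1) (psi s u k.+1 (X x))).
  rewrite -!bintD//; last exact: bmfD.
  by apply: eq_Rintegral => x _; rewrite -!mulrDr ico_split psiS.
by rewrite /mass E exprS; field.
Qed.

Section sums.
Variable G : nat -> T -> R.
Hypothesis bG : forall k, bmf (G k).

Lemma cellker_term k y :
  3 ^+ k * \int[nu]_(x in D) (G k x * cellker (psi s u k (X x)) (psi s u k y)) =
  (mass k.+1 (3 * flr (psi s u k y)) (G k) - mass k.+1 (3 * flr (psi s u k y) + 2) (G k)) / 3
  * beta (dig (psi s u k y)).
Proof.
set j := flr _; set bd := beta _.
have b c := @bmass k.+1 c (G k) (bG k).
rewrite /mass -mulrBr -bintB// exprS.
have -> (I : R) : 3 * 3 ^+ k * I / 3 * bd = 3 ^+ k * (bd * I) by field.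
rewrite -bintZ//; last exact: bmfB.
by congr (_ * _); apply: eq_Rintegral => x _; rewrite cellker_ico -/j -/bd !psiS; ring.
Qed.

Lemma samecell_term k y :
  3 ^+ k * \int[nu]_(x in D) (G k x * samecell (psi s u k (X x)) (psi s u k y)) =
  mass k (flr (psi s u k y)) (G k).
Proof. by congr (_ * _); apply: eq_Rintegral => x _; rewrite samecell_ico. Qed.

Lemma bmf_cellker_term k :
  bmfR (fun y => 3 ^+ k * \int[nu]_(x in D) (G k x * cellker (psi s u k (X x)) (psi s u k y))).
Proof.
apply: bmfZ; apply: (bmf_bint (f := fun y x => G k x * cellker (psi s u k (X x)) (psi s u k y)) hD).
apply: bmfM; first by apply: (bmf_comp (bG k)); exact: measurable_snd.
apply: (bmf_cellker (T := (RR * T)%type)).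
  apply: (measurableT_comp (measurable_psi s u k)).
  by apply: (measurableT_comp mX); exact: measurable_snd.
by apply: (measurableT_comp (measurable_psi s u k)); exact: measurable_fst.
Qed.

Lemma bmf_samecell_term k :
  bmfR (fun y => 3 ^+ k * \int[nu]_(x in D) (G k x * samecell (psi s u k (X x)) (psi s u k y))).
Proof.
apply: bmfZ; apply: (bmf_bint (f := fun y x => G k x * samecell (psi s u k (X x)) (psi s u k y)) hD).
apply: bmfM; first by apply: (bmf_comp (bG k)); exact: measurable_snd.
apply: (bmf_samecell (T := (RR * T)%type)).
  apply: (measurableT_comp (measurable_psi s u k)).
  by apply: (measurableT_comp mX); exact: measurable_snd.
by apply: (measurableT_comp (measurable_psi s u k)); exact: measurable_fst.
Qed.

End sums.
End grid.

Section StoppedKernelExponential.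
Variables (g : T -> R) (l : R).
Hypotheses (bg : bmf g) (g1 : forall x, `|g x| <= 1) (hl : 0 <= l <= 1/20).

Let st k x : R := (k < kp x)%N%:R.
Let st01 k x : 0 <= st k x <= 1. Proof. by rewrite /st; case: (_ < _)%N; rewrite ?lexx ?ler01. Qed.
Let stS k x : st k.+1 x <= st k x.
Proof. by rewrite /st ler_nat; case: (ltnP k.+1 (kp x)) => // h; rewrite (ltn_trans _ h). Qed.

(** [kp x] acts as a stopping time: [x] contributes to the generations below [kp x] only. The state
    of a cell consists of the average of [g] and the average mass over the points still active;
    points that stop change the first average by at most the mass they remove, as [bellman_step]
    requires. The bound is five root cells times the maximum 9 of [bell]. *)
Lemma stopped_tree_exp s u : 1 <= s <= 3 -> 0 <= u <= 1 ->
  itg 0 1 (fun y => expR (gridsum nu D X (@cellker R) n (fun k x => l * g x * st k x) s u y)) <= 45.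
Proof.
move=> /andP[s1 s3] u01.
have bst k : bmf (st k) by exact: bmf_stopped.
have bgs k : bmf (fun x => g x * st k x) by exact: bmfM.
have bG k : bmf (fun x => l * g x * st k x) by apply: bmfM => //; exact: bmfZ.
have gs k x : `|g x * st k x| <= st k x.
  have /andP[a b] := st01 k x; rewrite normrM (ger0_norm a) -{2}(mul1r (st k x)).
  by rewrite ler_wpM2r.
pose F k y := 3 ^+ k * \int[nu]_(x in D) (l * g x * st k x * cellker (psi s u k (X x)) (psi s u k y)).
pose M := mass s u.
pose inc k j dd := l * ((M k.+1 (3 * j) (fun x => g x * st k x) -
  M k.+1 (3 * j + 2) (fun x => g x * st k x)) / 3) * beta dd.
pose Psi k j := bell (M k j (fun x => g x * st k x)) (M k j (st k)).
have -> : 45 = 5 * 9 :> R by ring.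
apply: (tree_total (u := u) (n := n) s1 (F := F) (inc := inc) (Psi := Psi)) => //.
- by move=> k; exact: (bmf_cellker_term s u bG).
- move=> k y; rewrite /F (cellker_term s u bG) /inc.
  have e : (fun x => l * g x * st k x) = fun x => l * (g x * st k x).
    by apply/funext => x; rewrite mulrA.
  by rewrite e !massZ//; congr (_ * _); rewrite /M; field.
- move=> k j.
  have S1 : M k j (fun x => g x * st k x) = (M k.+1 (3 * j) (fun x => g x * st k x) +
      M k.+1 (3 * j + 1) (fun x => g x * st k x) + M k.+1 (3 * j + 2) (fun x => g x * st k x)) / 3.
    exact: mass_split.
  have S2 : M k j (st k) = (M k.+1 (3 * j) (st k) + M k.+1 (3 * j + 1) (st k) +
      M k.+1 (3 * j + 2) (st k)) / 3 by exact: mass_split.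
  rewrite /Psi S1 S2.
  have A i : `|M k.+1 i (fun x => g x * st k.+1 x)| <= M k.+1 i (st k.+1).
    by apply: mass_norm => // x; exact: gs.
  have B i : M k.+1 i (st k) <= 1.
    by apply: mass_le1 => // x; case/andP: (st01 k x).
  have C i : `|M k.+1 i (fun x => g x * st k x) - M k.+1 i (fun x => g x * st k.+1 x)|
      <= M k.+1 i (st k) - M k.+1 i (st k.+1).
    rewrite /M -!massB//; apply: mass_norm; [exact: bmfB|exact: bmfB|move=> x].
    rewrite -mulrBr normrM [`|st k x - _|]ger0_norm ?subr_ge0//.
    by rewrite -[leRHS]mul1r ler_wpM2r// subr_ge0.
  exact: (bellman_step hl (A _) (A _) (A _) (B _) (B _) (B _) (C _) (C _) (C _) erefl).
- move=> j; rewrite /Psi; apply: (@le_trans _ _ 3); first by rewrite ler1n.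
  by case/andP: (bell_bounds (mass_norm s u n j (bgs n) (bst n) (gs n))
    (mass_le1 u s1 n j (bst n) (fun x => proj2 (andP (st01 n x))))).
- move=> j; rewrite /Psi.
  by case/andP: (bell_bounds (mass_norm s u 0 j (bgs 0%N) (bst 0%N) (gs 0%N))
    (mass_le1 u s1 0 j (bst 0%N) (fun x => proj2 (andP (st01 0%N x))))).
Qed.

(** Averaging [stopped_tree_exp] over grids; the factor [1/2] is the density of the dilation on
    [[1, 3]]. *)
Lemma stopped_Ker_exp :
  itg 0 1 (fun y => expR (l / 2 * \int[nu]_(x in D) (g x * Ker (kp x) (X x - y)))) <= 45.
Proof.
have bst k : bmf (st k) by exact: bmf_stopped.
have bG k : bmf (fun x => l * g x * st k x) by apply: bmfM => //; exact: bmfZ.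
have h1 := stopped_tree_exp.
have := @grid_average _ _ _ nu _ _ hD mX (@cellker R) (@kap R) _ _ (@itg_cellker_shift R) (@bmf_kap_scale R) n _ bG 45 h1.
rewrite (_ : (fun y => expR (2^-1 * _)) =
  fun y => expR (l / 2 * \int[nu]_(x in D) (g x * Ker (kp x) (X x - y)))).
  apply.
  - by apply: (bmf_cellker (T := (RR * RR)%type)); [exact: measurable_fst|exact: measurable_snd].
  - by move=> a b j; rewrite /cellker samecellDint !digDint.
apply/funext => y; congr expR.
rewrite (stopped_average y (bmf_kap R) (fun=> bmfZ l bg)).
have bK : bmf (fun x => g x * Ker (kp x) (X x - y)).
  apply: bmfM => //.
  rewrite (_ : (fun x => Ker (kp x) (X x - y)) =
    fun x => \sum_(i < n.+1) (kp x == i :> nat)%:R * Ker i (X x - y)).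
    apply: bmf_sum => i _; apply: bmfM; first exact: (bmf_natcomp (fun k => (k == i :> nat)%:R)).
    apply: (bmf_comp (phi := fun x => X x - y : RR) (bmf_Ker R i)).
    by apply: measurable_funB => //; exact: measurable_cst.
  apply/funext => x; have h : (kp x < n.+1)%N by rewrite ltnS.
  rewrite (bigD1 (Ordinal h))//= eqxx mul1r big1 ?addr0// => i /negP hi.
  by case: eqP => [e|_]; rewrite ?mul0r//; case: hi; apply/eqP/val_inj.
rewrite -bintZ//; apply: eq_Rintegral => x _; rewrite /Ker !mulr_sumr.
by apply: eq_bigr => k _; ring.
Qed.

End StoppedKernelExponential.

Section StoppedTentExponential.

Let w k x : R := (k < kp x)%N%:R * (3 ^+ k / 3 ^+ (kp x)).
(** The sum of the weights [w i x] over all generations [i >= k], in closed form (see [we]). It is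
    the budget for the increments still to come, and one plus its cell average serves as the Bellman
    function for the positive kernel. *)
Let e k x : R := (k < kp x)%N%:R * ((1 - 3 ^+ k / 3 ^+ (kp x)) / 2).

Let bw k : bmf (w k).
Proof. exact: (bmf_natcomp (fun i => (k < i)%N%:R * (3 ^+ k / 3 ^+ i))). Qed.

Let be k : bmf (e k).
Proof. exact: (bmf_natcomp (fun i => (k < i)%N%:R * ((1 - 3 ^+ k / 3 ^+ i) / 2))). Qed.

Let ratio k i : (k < i)%N -> 0 <= (3 ^+ k / 3 ^+ i : R) <= 1 / 3.
Proof.
move=> ki; have p := exp3_gt0 R k; have q := exp3_gt0 R i.
apply/andP; split; first by rewrite divr_ge0// ltW.
rewrite ler_pdivrMr//; have : 3 * 3 ^+ k <= 3 ^+ i :> R.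
  by rewrite -exprS ler_weXn2l//; lra.
by lra.
Qed.

Let we k x : e k x = w k x + e k.+1 x.
Proof.
rewrite /e /w; have q := exp3_gt0 R (kp x).
case: (ltnP k (kp x)) => h; last by rewrite ltnNge (leqW h) !mul0r addr0.
rewrite !mul1r; case: (ltnP k.+1 (kp x)) => h1.
  by rewrite mul1r exprS; field; rewrite gt_eqF.
have -> : kp x = k.+1 by apply/eqP; rewrite eqn_leq h1 h.
by rewrite mul0r addr0 exprS; field; rewrite gt_eqF// exp3_gt0.
Qed.

Let w_le k x : 0 <= w k x <= 1 / 3.
Proof. rewrite /w; case: (ltnP k (kp x)) => h.
  by have := ratio h; rewrite mulr1n => /andP[? ?]; apply/andP; split; lra.
by rewrite mulr0n mul0r; apply/andP; split; lra.
Qed.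

Let e_le k x : 0 <= e k x <= 1 / 2.
Proof.
rewrite /e; case: (ltnP k (kp x)) => h.
  by have := ratio h; rewrite mulr1n => /andP[? ?]; apply/andP; split; lra.
by rewrite mulr0n mul0r; apply/andP; split; lra.
Qed.

Lemma stopped_avg_tree_exp s u : 1 <= s <= 3 -> 0 <= u <= 1 ->
  itg 0 1 (fun y => expR (gridsum nu D X (@samecell R) n (fun k x => 3^-1 * (3 ^+ k / 3 ^+ kp x) *
    (k < kp x)%N%:R) s u y)) <= 10.
Proof.
move=> /andP[s1 s3] u01.
have bG k : bmf (fun x => (3^-1 : R) * (3 ^+ k / 3 ^+ kp x) * (k < kp x)%N%:R).
  exact: (bmf_natcomp (fun i => 3^-1 * (3 ^+ k / 3 ^+ i) * (k < i)%N%:R)).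
pose F k y := 3 ^+ k * \int[nu]_(x in D) (3^-1 * (3 ^+ k / 3 ^+ kp x) * (k < kp x)%N%:R *
  samecell (psi s u k (X x)) (psi s u k y)).
pose M := mass s u.
pose inc k j (dd : R) := 3^-1 * M k j (w k).
pose Psi k j := 1 + M k j (e k).
have -> : 10 = 5 * 2 :> R by ring.
have M1 k i f c : 0 <= c -> bmf f -> (forall x, 0 <= f x <= c) -> 0 <= M k i f <= c.
  move=> c0 bf hf; rewrite mass_ge0/=; last by move=> x; case/andP: (hf x).
  apply: (@le_trans _ _ (M k i (fun=> c * 1))).
    apply: le_mass => //; first exact: bmf_cst.
    by move=> x; rewrite mulr1; case/andP: (hf x).
  by rewrite /M massZ; [rewrite ler_piMr// mass_cst1 | exact: bmf_cst].
apply: (tree_total (u := u) (n := n) s1 (F := F) (inc := inc) (Psi := Psi)) => //.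
- by move=> k; exact: (bmf_samecell_term s u bG).
- move=> k y; rewrite /F (samecell_term s u (fun k x => (3^-1 : R) * (3 ^+ k / 3 ^+ kp x) * (k < kp x)%N%:R)) /inc /M.
  have ew : (fun x => 3^-1 * (3 ^+ k / 3 ^+ kp x) * (k < kp x)%N%:R) = fun x => 3^-1 * w k x.
    by apply/funext => x; rewrite /w; ring.
  by rewrite ew massZ.
- move=> k j; rewrite /Psi /inc.
  have -> : M k j (e k) = M k j (w k) + M k j (e k.+1).
    by rewrite /M -massD//; congr mass; apply/funext => x; exact: we.
  have S2 : M k j (e k.+1) = (M k.+1 (3 * j) (e k.+1) + M k.+1 (3 * j + 1) (e k.+1) +
      M k.+1 (3 * j + 2) (e k.+1)) / 3 by exact: mass_split.
  rewrite S2.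
  have c3 : 0 <= 1 / 3 :> R by lra.
  have c2 : 0 <= 1 / 2 :> R by lra.
  have /andP[w0 w3] := M1 k j (w k) _ c3 (bw k) (w_le k).
  have /andP[a0 a1] := M1 k.+1 (3 * j) _ _ c2 (be k.+1) (e_le k.+1).
  have /andP[b0 b1] := M1 k.+1 (3 * j + 1) _ _ c2 (be k.+1) (e_le k.+1).
  have /andP[d0 d1] := M1 k.+1 (3 * j + 2) _ _ c2 (be k.+1) (e_le k.+1).
  set W := M k j (w k) in w0 w3 *; set a := M _ (3 * j) _ in a0 a1 *.
  set b := M _ (3 * j + 1) _ in b0 b1 *; set c := M _ (3 * j + 2) _ in d0 d1 *.
  have q : expR (3^-1 * W) <= 1 + 3^-1 * W + 2 * (3^-1 * W) ^+ 2 by apply: expR_quad; lra.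
  have W2 : W ^+ 2 <= 1/3 * W by rewrite expr2 ler_wpM2r.
  have q' : expR (3^-1 * W) <= 1 + 2/3 * W by lra.
  set E := expR _ in q' *.
  have -> : E * (1 + a) + E * (1 + b) + E * (1 + c) = E * (1 + a + (1 + b) + (1 + c)) by ring.
  apply: (@le_trans _ _ ((1 + 2/3 * W) * (1 + a + (1 + b) + (1 + c)))).
    by apply: ler_wpM2r => //; lra.
  (* As the averages of [e] are at most 1/2, the factor [1 + 2/3 W] costs at most [2 W + W], which
     is the [3 W] released by the drop of the budget in the three children. *)
  have : W * (a + b + c) <= W * (3/2) by apply: ler_wpM2l => //; lra.
  by lra.
- move=> j; rewrite /Psi lerDl; apply: mass_ge0 => x.
  by case/andP: (e_le n x).
- move=> j; rewrite /Psi.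
  have c2 : 0 <= 1 / 2 :> R by lra.
  by have /andP[_ ?] := M1 0%N j (e 0%N) _ c2 (be 0%N) (e_le 0%N); lra.
Qed.

Lemma stopped_tentsum_exp :
  itg 0 1 (fun y => expR (6^-1 * \int[nu]_(x in D) (tentsum (kp x) (X x - y) / 3 ^+ kp x))) <= 10.
Proof.
have bG k : bmf (fun x => (3^-1 : R) * (3 ^+ k / 3 ^+ kp x) * (k < kp x)%N%:R).
  exact: (bmf_natcomp (fun i => 3^-1 * (3 ^+ k / 3 ^+ i) * (k < i)%N%:R)).
have bt1 : bmfR (@tent1 R).
  have := bmf_tent1_scale (1 : R); congr bmf; by apply/funext => x; rewrite mul1r.
have h1 := stopped_avg_tree_exp.
have := @grid_average _ _ _ nu _ _ hD mX (@samecell R) (@tent1 R) _ _ (@itg_samecell_shift R) (@bmf_tent1_scale R) n _ bG 10 h1.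
rewrite (_ : (fun y => expR (2^-1 * _)) =
  fun y => expR (6^-1 * \int[nu]_(x in D) (tentsum (kp x) (X x - y) / 3 ^+ kp x))).
  apply.
  - by apply: (bmf_samecell (T := (RR * RR)%type)); [exact: measurable_fst|exact: measurable_snd].
  - by move=> a b j; rewrite samecellDint.
apply/funext => y; congr expR.
rewrite (stopped_average y bt1 (H := fun x k => 3^-1 * (3 ^+ k / 3 ^+ kp x))); last first.
  by move=> k; exact: (bmf_natcomp (fun i => 3^-1 * (3 ^+ k / 3 ^+ i))).
have bK : bmf (fun x => tentsum (kp x) (X x - y) / 3 ^+ kp x).
  apply: bmfM; last exact: (bmf_natcomp (fun i => (3 ^+ i)^-1)).
  rewrite (_ : (fun x => tentsum (kp x) (X x - y)) =
    fun x => \sum_(i < n.+1) (kp x == i :> nat)%:R * tentsum i (X x - y)).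
    apply: bmf_sum => i _; apply: bmfM; first exact: (bmf_natcomp (fun k => (k == i :> nat)%:R)).
    apply: bmf_sum => k _; apply: bmfZ.
    apply: (bmf_itg 1 3 (f := fun x s => tent1 (3 ^+ k * (X x - y) * s))).
    apply: (bmf_comp (phi := fun p : T * RR => 3 ^+ k * (X p.1 - y) * p.2 : RR) bt1).
    apply: measurable_funM => //; apply: measurable_funM; first exact: measurable_cst.
    apply: measurable_funB; last exact: measurable_cst.
    exact: (measurableT_comp mX).
  apply/funext => x; have h : (kp x < n.+1)%N by rewrite ltnS.
  rewrite (bigD1 (Ordinal h))//= eqxx mul1r big1 ?addr0// => i /negP hi.
  by case: eqP => [ee|_]; rewrite ?mul0r//; case: hi; apply/eqP/val_inj.
rewrite -bintZ//; apply: eq_Rintegral => x _; rewrite /tentsum mulr_suml !mulr_sumr.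
apply: eq_bigr => k _; rewrite (_ : 9 = 3 * 3 :> R) ?exprMn; last by ring.
by field; rewrite gt_eqF// exp3_gt0.
Qed.

End StoppedTentExponential.
End StoppedKernels.

Ltac nonneg := repeat first [done | apply: sqr_ge0 | apply: exprn_ge0 | apply: normr_ge0
  | apply: expR_ge0 | apply: addr_ge0 | apply: mulr_ge0 | by apply: ltW].

(** * Riesz products *)

Section Clip.
Variable R : realType.

Definition clip (be x : R) : R := Num.max (- be) (Num.min be x).

Lemma clip_norm be x : 0 <= be -> `|clip be x| <= be.
Proof.
move=> b0; rewrite /clip ler_norml le_max lexx /= ge_max ge_min lexx /= andbT.
by lra.
Qed.

Lemma clip0 be : 0 <= be -> clip be 0 = 0.
Proof. by move=> b0; rewrite /clip min_r// max_r//; lra. Qed.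

Lemma clip_lip be x y : `|clip be x - clip be y| <= `|x - y|.
Proof.
have hmin (u v : R) : `|Num.min be u - Num.min be v| <= `|u - v|.
  have := ler_norm (u - v); have := ler_norm (v - u); rewrite (distrC v u) /Num.min => ? ?.
  by case: (ltP be u) => ?; case: (ltP be v) => ?; rewrite ler_norml; apply/andP; split; lra.
have hmax (u v : R) : `|Num.max (- be) u - Num.max (- be) v| <= `|u - v|.
  have := ler_norm (u - v); have := ler_norm (v - u); rewrite (distrC v u) /Num.max => ? ?.
  by case: (ltP (- be) u) => ?; case: (ltP (- be) v) => ?; rewrite ler_norml; apply/andP; split; lra.
exact: le_trans (hmax _ _) (hmin _ _).
Qed.

Lemma clip_cases be x : 0 <= be ->
  (`|x| <= be /\ clip be x = x) \/ (be <= `|x| /\ `|x - clip be x| = `|x| - be).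
Proof.
move=> b0; have [h|h] := leP `|x| be.
  by left; split=> //; move: h; rewrite ler_norml /clip => /andP[? ?]; rewrite min_r// max_r.
right; split; first exact: ltW.
case: (ger0P x) h => x0 h.
  by rewrite /clip min_l ?max_r; [rewrite ger0_norm ?subr_ge0 ?ltW|lra|exact: ltW].
rewrite /clip min_r ?max_l; [|lra|lra].
by rewrite ler0_norm; lra.
Qed.

Lemma prod_rel_diff (k : nat) (u v s : nat -> R) :
  (forall l, (l < k)%N -> 0 < u l) -> (forall l, (l < k)%N -> 0 <= s l) ->
  (forall l, (l < k)%N -> `|v l - u l| <= s l * u l) ->
  `|\prod_(l < k) v l - \prod_(l < k) u l| <= \prod_(l < k) u l * (expR (\sum_(l < k) s l) - 1).
Proof.
elim: k => [|k ih] hu hs hv; first by rewrite !big_ord0 expR0 subrr normr0 mulr0.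
have hk l : (l < k)%N -> (l < k.+1)%N by move=> /leqW.
have {}ih := ih (fun l h => hu l (hk l h)) (fun l h => hs l (hk l h)) (fun l h => hv l (hk l h)).
rewrite !big_ord_recr/=; set V := \prod_(l < k) v l in ih *; set U := \prod_(l < k) u l in ih *.
set E := expR (\sum_(l < k) s l) in ih.
have U0 : 0 < U by apply: prodr_gt0 => i _; apply: hu; exact/hk.
have uk := hu k (ltnSn k); have sk := hs k (ltnSn k); have vk := hv k (ltnSn k).
have E1 : 1 <= E.
  by rewrite -expR0 ler_expR; apply: sumr_ge0 => i _; apply: hs; exact/hk.
have -> : V * v k - U * u k = (V - U) * v k + U * (v k - u k) by ring.
apply: le_trans (ler_normD _ _) _; rewrite !normrM (gtr0_norm U0).
have vle : `|v k| <= (1 + s k) * u k.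
  rewrite -(subrK (u k) (v k)); apply: le_trans (ler_normD _ _) _.
  by rewrite (gtr0_norm uk); lra.
have e : 1 + s k <= expR (s k) := expR_ge1Dx _.
apply: (@le_trans _ _ (U * (E - 1) * ((1 + s k) * u k) + U * (s k * u k))).
  by apply: lerD; [apply: ler_pM | apply: ler_wpM2l => //; exact: ltW].
rewrite expRD -/E.
have -> : U * (E - 1) * ((1 + s k) * u k) + U * (s k * u k) = U * u k * (E * (1 + s k) - 1) by ring.
apply: ler_wpM2l; first by nonneg.
by rewrite lerD2r ler_wpM2l//; lra.
Qed.

Definition ch (x : R) := (expR x + expR (- x)) / 2.

Lemma chN x : ch (- x) = ch x.
Proof. by rewrite /ch opprK addrC. Qed.

Lemma ch_ge1 x : 1 + x ^+ 2 / 8 <= ch x.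
Proof.
wlog x0 : x / 0 <= x.
  move=> h; have [/h//|x0] := leP 0 x; have := h (- x).
  by rewrite sqrrN chN => h'; apply: h'; lra.
rewrite /ch; set v := x / 2; have v0 : 0 <= v by rewrite /v; lra.
have -> : x = v + v by rewrite /v; field.
rewrite opprD !expRD; set e := expR v; set f := expR (- v).
have ef : e * f = 1 by rewrite /e /f -expRD subrr expR0.
have e1 : 1 + v <= e := expR_ge1Dx _.
have f0 : 0 < f := expR_gt0 _.
have fv : f * (1 + v) <= 1.
  by have := ler_wpM2l (ltW f0) e1; rewrite [f * e]mulrC ef.
have f1 : f <= 1.
  by have := mulr_ge0 (ltW f0) v0; lra.
have : v ^+ 2 <= (e - f) ^+ 2 by rewrite lerXn2r// ?nnegrE; lra.
rewrite sqrrB -!expr2 ef expr2; have -> : (v + v) ^+ 2 = 4 * v ^+ 2 by ring.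
by lra.
Qed.

Lemma ch_sqr x : ch x ^+ 2 <= ch (2 * x).
Proof.
have ef : expR x * expR (- x) = 1 by rewrite -expRD subrr expR0.
have e1 : expR (2 * x) = expR x ^+ 2 by rewrite expr2 -expRD; congr expR; ring.
have e2 : expR (- (2 * x)) = expR (- x) ^+ 2 by rewrite expr2 -expRD; congr expR; ring.
rewrite /ch e1 e2; move: ef; move: (expR x) (expR (- x)) => e f ef.
by have := sqr_ge0 (e - f); lra.
Qed.

Lemma ch_ge_exp x : expR `|x| / 2 <= ch x.
Proof.
rewrite /ch ler_pM2r// ; case: (ger0P x) => x0; first by rewrite lerDl expR_ge0.
by rewrite lerDr expR_ge0.
Qed.

Lemma ch_gt0 x : 0 < ch x.
Proof. by rewrite divr_gt0// addr_gt0// expR_gt0. Qed.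

End Clip.

Section RieszProduct.
Variable R : realType.
Notation RR := (measurableTypeR R).
Notation bmfR := (@bmf _ RR R).
Variables (n : nat) (m : nat -> R) (c a p : nat -> R -> R) (L la : R).

(** Over a half-period of frequency [m l], an object living at scale [1 / m k] changes by a relative
    amount of order [rho k l]. For lacunary frequencies both rows and columns are bounded by a
    geometric series. *)
Definition rho k l : R := if (k <= l)%N then m k / m l else 0.

Hypotheses (L1 : 1 <= L) (la0 : 0 <= la) (laL : la <= (64 * L ^+ 5)^-1).
Hypotheses (m1 : forall i, (i < n)%N -> 1 <= m i)
  (mle : forall i j, (i <= j)%N -> (j < n)%N -> m i <= m j)
  (rho_col : forall l, (l < n)%N -> \sum_(k < n) rho k l <= L)
  (rho_row : forall k, (k < n)%N -> \sum_(l < n) rho k l <= L).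
Hypotheses (bc : forall i, bmfR (c i)) (ba : forall i, bmfR (a i)) (bp : forall i, bmfR (p i)).
Hypotheses (c1 : forall i y, `|c i y| <= 1)
  (c_half : forall i y, (i < n)%N -> c i (y + (2 * m i)^-1) = - c i y)
  (c_lip : forall i y t, (i < n)%N -> `|c i (y + t) - c i y| <= 8 * (m i * `|t|))
  (a_lip : forall i y t, (i < n)%N -> m i * `|t| <= 1 ->
     `|a i (y + t) - a i y| <= L * (m i * `|t|) * p i y)
  (p_lip : forall i y t, (i < n)%N -> m i * `|t| <= 1 ->
     `|p i (y + t) - p i y| <= L * (m i * `|t|) * p i y)
  (p0 : forall i y, (i < n)%N -> 0 <= p i y <= L)
  (a_out : forall i y, (i < n)%N -> ~~ (-1 <= y <= 2) -> a i y = 0).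

Let be : R := (32 * L ^+ 2)^-1.
(** Clipping, together with the smallness of [W], keeps every factor [zeta] between 1/2 and 2,
    whatever the size of the amplitude. *)
Let b i y := clip be (la * a i y).
(** The correction that makes the Riesz product one-sided: quadratic terms in the clipped amplitudes
    of frequencies up to [m i], for the interaction between factors, and linear terms in [p], for
    the variation of the amplitudes. It pays the error of [riesz_step] and is small enough to be
    compensated by the hyperbolic cosines and the exponential of [p]. *)
Let W i y := \sum_(k < n) rho k i * (8 * L * b k y ^+ 2 + L * la * p k y).
Let zeta i y := 1 + b i y * c i y - W i y.
Let Z k y := \prod_(l < k) zeta l y.

Let L0 : 0 < L. Proof. by apply: lt_le_trans L1. Qed.
Let L00 : 0 <= L. Proof. exact: ltW. Qed.
Let L2 : 1 <= L ^+ 2. Proof. by rewrite exprn_ege1. Qed.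
Let be0 : 0 <= be. Proof. by rewrite invr_ge0 mulr_ge0// exprn_ge0// ltW. Qed.
Let beL : be * L ^+ 2 = 32^-1.
Proof. by rewrite /be invfM -mulrA mulVf ?mulr1// gt_eqF// exprn_gt0. Qed.
Let be_le : be <= 32^-1. Proof. by rewrite -beL ler_peMr. Qed.
Let laL5 : la * L ^+ 5 <= 64^-1.
Proof.
have h : 0 < L ^+ 5 by rewrite exprn_gt0.
by rewrite -ler_pdivlMr// -invfM.
Qed.
Let laL3 : la * L ^+ 3 <= 64^-1.
Proof.
apply: le_trans laL5; rewrite (_ : la * L ^+ 5 = la * L ^+ 3 * L ^+ 2); last by ring.
by rewrite ler_peMr// mulr_ge0// exprn_ge0// ltW.
Qed.
Let mg i : (i < n)%N -> 0 < m i. Proof. by move=> /m1; lra. Qed.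

Let rho_ge0 k l : (k < n)%N -> (l < n)%N -> 0 <= rho k l.
Proof. by move=> kn ln; rewrite /rho; case: ifP => // _; rewrite divr_ge0// ltW// mg. Qed.

Let b_norm i y : `|b i y| <= be. Proof. exact: clip_norm. Qed.
Let b_sqr i y : b i y ^+ 2 <= be ^+ 2.
Proof. by rewrite -(real_normK (num_real (b i y))) lerXn2r// nnegrE. Qed.

Let W_ge0 i y : (i < n)%N -> 0 <= W i y.
Proof.
move=> iln; apply: sumr_ge0 => k _; apply: mulr_ge0; first exact: rho_ge0.
have /andP[pk _] := p0 y (ltn_ord k).
by nonneg.
Qed.

Let W_le i y : (i < n)%N -> W i y <= 1/4.
Proof.
move=> iln; have h : 8 * L * be ^+ 2 + L * la * L <= (4 * L)^-1.
  rewrite -(ler_pM2l (_ : 0 < 4 * L)) ?mulfV; [|by rewrite gt_eqF// mulr_gt0|by rewrite mulr_gt0].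
  have : be * (be * L ^+ 2) <= 32^-1 * 32^-1 by rewrite beL ler_wpM2r.
  by move: laL3; move=> ? ?; lra.
apply: (@le_trans _ _ (\sum_(k < n) rho k i * (4 * L)^-1)).
  apply: ler_sum => k _; apply: ler_wpM2l; first exact: rho_ge0.
  apply: le_trans h; have /andP[pk0 pk] := p0 y (ltn_ord k).
  apply: lerD; first by rewrite ler_wpM2l ?mulr_ge0 ?b_sqr// ltW.
  by rewrite ler_wpM2l// mulr_ge0// ltW.
rewrite -mulr_suml; apply: (@le_trans _ _ (L * (4 * L)^-1)).
  by rewrite ler_wpM2r ?rho_col// invr_ge0 mulr_ge0// ltW.
by rewrite invfM mulrA mulrC mulrA mulVf ?gt_eqF// mul1r; lra.
Qed.

Let bc_le i y : `|b i y * c i y| <= 32^-1.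
Proof.
rewrite normrM -[leRHS]mulr1; apply: ler_pM => //.
by apply: le_trans be_le; exact: b_norm.
Qed.

Let zeta_bounds i y : (i < n)%N -> 1/2 <= zeta i y <= 2.
Proof.
move=> iln; have := bc_le i y; have := W_ge0 y iln; have := W_le y iln.
by rewrite /zeta ler_norml => ? ? /andP[? ?]; apply/andP; split; lra.
Qed.

Let bb i : bmfR (b i).
Proof.
have [ma [M hM]] := ba i; split; last by exists be => y; exact: b_norm.
apply: measurable_maxr; first exact: measurable_cst.
apply: measurable_minr; first exact: measurable_cst.
by apply: measurable_funM => //; exact: measurable_cst.
Qed.

Let bW i : bmfR (W i).
Proof.
apply: bmf_sum => k _; apply: bmfZ; apply: bmfD; last exact: bmfZ.
by apply: bmfZ; rewrite (_ : (fun y => _) = fun y => b k y * b k y); [exact: bmfM|apply/funext => y; rewrite expr2].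
Qed.

Let bzeta i : bmfR (zeta i).
Proof. by apply: bmfB => //; apply: bmfD; [exact: bmf_cst | exact: bmfM]. Qed.

Let bZ k : bmfR (Z k).
Proof. exact: (bmf_prod _ (fun l : 'I_k => bzeta l)). Qed.

Let db i y t : (i < n)%N -> m i * `|t| <= 1 -> `|b i (y + t) - b i y| <= la * (L * (m i * `|t|) * p i y).
Proof.
move=> iln h; apply: le_trans (clip_lip _ _ _) _.
by rewrite -mulrBr normrM (ger0_norm la0) ler_wpM2l// a_lip.
Qed.

Let dW i y t : (i < n)%N -> (forall k, (k <= i)%N -> m k * `|t| <= 1) ->
  `|W i (y + t) - W i y| <= \sum_(k < n) rho k i * (2 * L ^+ 2 * la * (m k * `|t|) * p k y).
Proof.
move=> iln ht; rewrite /W -sumrB; apply: le_trans (ler_norm_sum _ _ _) _.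
apply: ler_sum => k _; rewrite -mulrBr normrM (ger0_norm (rho_ge0 _ _))//.
rewrite {1 2}/rho; case: ifP => [ki|_]; last by rewrite !mul0r.
have mt := ht k ki; have hd := db y (ltn_ord k) mt; have hp := p_lip y (ltn_ord k) mt.
have /andP[pk0 pk] := p0 y (ltn_ord k).
apply: ler_wpM2l; first by rewrite divr_ge0// ltW// mg.
set q := m k * `|t| * p k y.
have q0 : 0 <= q by rewrite !mulr_ge0// ltW// mg.
have -> : 2 * L ^+ 2 * la * (m k * `|t|) * p k y = 2 * L ^+ 2 * la * q by rewrite /q; ring.
have -> : 8 * L * b k (y + t) ^+ 2 + L * la * p k (y + t) - (8 * L * b k y ^+ 2 + L * la * p k y) =
  8 * L * ((b k (y + t) - b k y) * (b k (y + t) + b k y)) + L * la * (p k (y + t) - p k y) by ring.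
apply: le_trans (ler_normD _ _) _.
have A : `|8 * L * ((b k (y + t) - b k y) * (b k (y + t) + b k y))| <= L ^+ 2 * la * q.
  rewrite normrM [`|_ * (b k (y + t) + _)|]normrM (ger0_norm (_ : 0 <= 8 * L)); last by nonneg.
  have s4 : `|b k (y + t) + b k y| <= 1/8.
    apply: le_trans (ler_normD _ _) _; have := b_norm k y; have := b_norm k (y + t).
    by move: be_le; lra.
  have : `|b k (y + t) - b k y| * `|b k (y + t) + b k y| <= (la * (L * (m k * `|t|) * p k y)) * (1/8).
    exact: ler_pM.
  move=> /(ler_wpM2l (ltW L0)); rewrite /q; move: (m k * `|t|) => mt'.
  by rewrite expr2 => h; lra.
have B : `|L * la * (p k (y + t) - p k y)| <= L ^+ 2 * la * q.
  rewrite normrM (ger0_norm (_ : 0 <= L * la)); last by rewrite mulr_ge0// ltW.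
  apply: (@le_trans _ _ (L * la * (L * (m k * `|t|) * p k y))).
    by apply: ler_wpM2l => //; rewrite mulr_ge0// ltW.
  by rewrite le_eqVlt; apply/orP; left; apply/eqP; rewrite /q; ring.
by lra.
Qed.

Let sb M y := \sum_(l < n) rho l M * `|b l y|.
Let sp M y := \sum_(l < n) rho l M * p l y.

Let sum_widen M (F : nat -> R) : (M <= n)%N -> (forall l, (l < n)%N -> 0 <= F l) ->
  \sum_(l < M) F l <= \sum_(l < n) F l.
Proof.
move=> Mn F0; rewrite (big_ord_widen n F Mn) big_mkcond/=; apply: ler_sum => l _.
by case: ifP => // _; exact: F0.
Qed.

(** The factor [l] of the partial product changes relatively by [O(rho l M)] over a half-period of
    [m M]. The corrections [W l] are sums over lower frequencies themselves; the identity
    [rho k l * rho l M = rho k M] for [k <= l <= M], summed over [l], leaves one row sum of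
    [rho]. *)
Let ds M y h : (M < n)%N -> h = (2 * m M)^-1 ->
  `|Z M (y + h) - Z M y| <= Z M y * (expR (8 * sb M y + 3 * L ^+ 3 * la * sp M y) - 1).
Proof.
move=> Mn hE; have mM := mg Mn; have h0 : 0 < h by rewrite hE invr_gt0 mulr_gt0.
have mh k : (k <= M)%N -> m k * `|h| = rho k M / 2.
  by move=> kM; rewrite gtr0_norm// /rho kM hE; field; rewrite gt_eqF.
have mh1 k : (k <= M)%N -> m k * `|h| <= 1.
  move=> kM; rewrite gtr0_norm// hE ler_pdivrMr ?mulr_gt0// mul1r.
  by have := mle kM Mn; lra.
pose s l := 2 * (la * (L * (m l * `|h|) * p l y) + `|b l y| * (8 * (m l * `|h|)) +
   \sum_(k < n) rho k l * (2 * L ^+ 2 * la * (m k * `|h|) * p k y)).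
have lM l : (l < M)%N -> (l < n)%N by move=> lM; exact: ltn_trans lM Mn.
have pp k : (k < n)%N -> 0 <= p k y by move=> kn; case/andP: (p0 y kn).
have s0 l : (l < M)%N -> 0 <= s l.
  move=> h1; have ln := lM _ h1; have ml := mg ln; rewrite mulr_ge0// addr_ge0//.
    by rewrite addr_ge0// !mulr_ge0// ?pp// ltW.
  apply: sumr_ge0 => k _; rewrite mulr_ge0 ?rho_ge0//.
  by rewrite !mulr_ge0 ?pp// ?exprn_ge0// ltW// mg.
have Zy0 : 0 <= Z M y.
  apply: prodr_ge0 => l _; have /andP[? _] := zeta_bounds y (lM _ (ltn_ord l)); lra.
apply: (@le_trans _ _ (Z M y * (expR (\sum_(l < M) s l) - 1))).
  apply: (@prod_rel_diff _ M (zeta^~ y) (zeta^~ (y + h)) s) => [l lt|//|l lt].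
    by have /andP[? _] := zeta_bounds y (lM _ lt); lra.
  have ln := lM _ lt; have m1l := mh1 l (ltnW lt).
  have /andP[z2 _] := zeta_bounds y ln.
  apply: (@le_trans _ _ (s l * (1/2))); last by rewrite ler_wpM2l// s0.
  have -> : zeta l (y + h) - zeta l y = (b l (y + h) - b l y) * c l (y + h) +
     b l y * (c l (y + h) - c l y) - (W l (y + h) - W l y) by rewrite /zeta; ring.
  apply: le_trans (ler_normB _ _) _; apply: le_trans (lerD (ler_normD _ _) (lexx _)) _.
  rewrite /s mulrAC (_ : 2 * (1/2) = 1 :> R) ?mul1r; last by field.
  apply: lerD; last by apply: dW => // k kl; apply: mh1; exact: leq_trans kl (ltnW lt).
  rewrite !normrM; apply: lerD; last by rewrite ler_wpM2l// c_lip.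
  by rewrite -[leRHS]mulr1; apply: ler_pM => //; exact: db.
apply: ler_wpM2l => //; rewrite lerD2r ler_expR /s -mulr_sumr !big_split/=.
have rM k : (k < n)%N -> 0 <= rho k M by move=> kn; exact: rho_ge0.
have e1 : \sum_(l < M) la * (L * (m l * `|h|) * p l y) <= la * L / 2 * sp M y.
  rewrite /sp mulr_sumr; apply: le_trans (sum_widen (F := fun l => la * L / 2 * (rho l M * p l y)) (ltnW Mn) _).
    by apply: ler_sum => l _; rewrite (mh l (ltnW (ltn_ord l))); rewrite le_eqVlt; apply/orP; left; apply/eqP; field.
  by move=> l ln; rewrite !mulr_ge0 ?rM ?pp// ltW.
have e2 : \sum_(l < M) `|b l y| * (8 * (m l * `|h|)) <= 8 / 2 * sb M y.
  rewrite /sb mulr_sumr; apply: le_trans (sum_widen (F := fun l => 8 / 2 * (rho l M * `|b l y|)) (ltnW Mn) _).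
    by apply: ler_sum => l _; rewrite (mh l (ltnW (ltn_ord l))); rewrite le_eqVlt; apply/orP; left; apply/eqP; field.
  by move=> l ln; rewrite !mulr_ge0 ?rM.
have e3 : \sum_(l < M) \sum_(k < n) rho k l * (2 * L ^+ 2 * la * (m k * `|h|) * p k y)
    <= L ^+ 3 * la * sp M y.
  apply: (@le_trans _ _ (\sum_(l < M) \sum_(k < n) rho k l * (L ^+ 2 * la * (rho k M * p k y)))).
    apply: ler_sum => l _; apply: ler_sum => k _.
    rewrite {1 2}/rho; case: ifP => [kl|_]; last by rewrite !mul0r.
    rewrite mh; last by exact: leq_trans kl (ltnW (ltn_ord l)).
    by rewrite le_eqVlt; apply/orP; left; apply/eqP; field; rewrite gt_eqF// mg// lM.
  apply: (le_trans (sum_widen (F := fun l => \sum_(k < n) rho k l * (L ^+ 2 * la * (rho k M * p k y))) (ltnW Mn) _)).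
    move=> l ln; apply: sumr_ge0 => k _; rewrite mulr_ge0 ?rho_ge0//.
    by rewrite !mulr_ge0 ?rM ?pp// ?exprn_ge0// ltW.
  rewrite exchange_big/= /sp mulr_sumr; apply: ler_sum => k _; rewrite -mulr_suml.
  apply: (@le_trans _ _ (L * (L ^+ 2 * la * (rho k M * p k y)))).
    by apply: ler_wpM2r; [rewrite !mulr_ge0 ?rM ?pp// ?exprn_ge0// ltW | exact: rho_row].
  by rewrite le_eqVlt; apply/orP; left; apply/eqP; ring.
have sp0 : 0 <= sp M y by apply: sumr_ge0 => l _; rewrite mulr_ge0 ?rM ?pp.
have LL : L <= L ^+ 3 by rewrite (exprS L 2) ler_peMr// ltW.
have h1 := ler_wpM2r (mulr_ge0 la0 sp0) LL; rewrite !mulrA in h1.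
by lra.
Qed.

(** Because [c M] changes sign under the shift by its half-period [h], the integral of [f * c M]
    with [f = Z M * b M] is half that of [(f - f (y + h)) * c M]. The shift moves [f] only a little,
    and the term [- Z M * W M] of the new product pays for it. The interval [[-2, 3]] leaves room to
    move the support [[-1, 2]] of [f] by [h <= 1/2]. *)
Lemma riesz_step M : (M < n)%N -> itg (-2) 3 (Z M.+1) <= itg (-2) 3 (Z M).
Proof.
move=> Mn; pose h := (2 * m M)^-1; have mM := m1 Mn.
have h0 : 0 < h by rewrite invr_gt0; lra.
have h1 : h <= 1/2 by rewrite /h invf_ple ?posrE//; lra.
pose f y := Z M y * b M y.
have bf : bmfR f by exact: bmfM.
have fshift : bmfR (fun y => f (y + h)).
  by have := bmf_affine 1 h bf; congr bmf; apply/funext => y; rewrite mul1r.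
have cshift : bmfR (fun y => c M (y + h)).
  by have := bmf_affine 1 h (bc M); congr bmf; apply/funext => y; rewrite mul1r.
have fout y : ~~ (-1 <= y <= 2) -> f y = 0.
  by move=> yo; rewrite /f /b a_out// mulr0 clip0 ?mulr0.
have E1 : itg (-2) 3 (fun y => f y * c M y) = itg (-2) 3 (fun y => f (y + h) * c M (y + h)).
  rewrite (itg_shift h (-2) 3 (f := fun y => f y * c M y)); last exact: bmfM.
  rewrite (itg_support (c := -1) (d := 2)); [|lra..|exact: bmfM|by move=> y _ yo; rewrite fout ?mul0r].
  rewrite [RHS](itg_support (c := -1) (d := 2)); [by []|lra..|exact: bmfM|by move=> y _ yo; rewrite fout ?mul0r].
have E2 : itg (-2) 3 (fun y => f y * c M y) =
    2^-1 * itg (-2) 3 (fun y => (f y - f (y + h)) * c M y).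
  have -> : itg (-2) 3 (fun y => (f y - f (y + h)) * c M y) =
      itg (-2) 3 (fun y => f y * c M y + f (y + h) * c M (y + h)).
    by apply: eq_itg => y _; rewrite (c_half y Mn) -/h; ring.
  by rewrite itgD -?E1; [field|exact: bmfM|exact: bmfM].
have -> : itg (-2) 3 (Z M.+1) = itg (-2) 3 (fun y => Z M y - Z M y * W M y + f y * c M y).
  by apply: eq_itg => y _; rewrite /Z big_ord_recr/= -/(Z M y) /zeta /f; ring.
have bZW : bmfR (fun y => Z M y * W M y) by exact: bmfM.
rewrite itgD; [|exact: bmfB|exact: bmfM].
rewrite itgB// E2 -lerBrDl opprB [leRHS]addrC subrK -itgZ; last by apply: bmfM => //; exact: bmfB.
apply: le_trans (ler_norm _) _; apply: norm_itg_le => //.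
  by apply: bmfZ; apply: bmfM => //; exact: bmfB.
move=> y _; rewrite normrM ger0_norm ?invr_ge0// normrM.
have pp k : (k < n)%N -> 0 <= p k y by move=> kn; case/andP: (p0 y kn).
have pL k : (k < n)%N -> p k y <= L by move=> kn; case/andP: (p0 y kn).
have rM k : (k < n)%N -> 0 <= rho k M by move=> kn; exact: rho_ge0.
have ZM0 : 0 <= Z M y.
  apply: prodr_ge0 => l _.
  have /andP[? _] := zeta_bounds y (ltn_trans (ltn_ord l) Mn); lra.
have mhE : m M * `|h| = 1/2 by rewrite gtr0_norm// /h; field; lra.
have dbM : `|b M (y + h) - b M y| <= la * L / 2 * p M y.
  apply: le_trans (db y Mn _) _; first by rewrite mhE; lra.
  by rewrite mhE le_eqVlt; apply/orP; left; apply/eqP; field.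
have dZ := ds y Mn (erefl h).
set S := 8 * sb M y + 3 * L ^+ 3 * la * sp M y in dZ.
have sb0 : 0 <= sb M y by apply: sumr_ge0 => l _; rewrite mulr_ge0 ?rM.
have sp0 : 0 <= sp M y by apply: sumr_ge0 => l _; rewrite mulr_ge0 ?rM ?pp.
have sbL : sb M y <= L * be.
  apply: (@le_trans _ _ (\sum_(l < n) rho l M * be)).
    by apply: ler_sum => l _; rewrite ler_wpM2l ?rM ?b_norm.
  by rewrite -mulr_suml ler_wpM2r// rho_col.
have spL : sp M y <= L * L.
  apply: (@le_trans _ _ (\sum_(l < n) rho l M * L)).
    by apply: ler_sum => l _; rewrite ler_wpM2l ?rM ?pL.
  by rewrite -mulr_suml ler_wpM2r ?rho_col// ltW.
have Lbe : L * be <= 32^-1.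
  by rewrite -beL mulrC ler_wpM2l// expr2 ler_peMr// ltW.
have S0 : 0 <= S by rewrite addr_ge0 ?mulr_ge0// ?exprn_ge0// ltW.
have S12 : S <= 1/2.
  have : L ^+ 3 * la * sp M y <= 64^-1.
    apply: le_trans laL5; rewrite (_ : la * L ^+ 5 = L ^+ 3 * la * (L * L)); last by ring.
    by rewrite ler_wpM2l// mulr_ge0// exprn_ge0// ltW.
  by rewrite /S; lra.
have eS : expR S - 1 <= 2 * S.
  have := expR_quad S12; have : S ^+ 2 <= 1/2 * S by rewrite expr2 ler_wpM2r.
  by lra.
set q := la * L / 2 * p M y in dbM.
have q0 : 0 <= q by rewrite !mulr_ge0 ?pp// ltW.
have key : `|f y - f (y + h)| <= Z M y * (2 * S * `|b M y| + 2 * q).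
  have -> : f y - f (y + h) = - ((Z M (y + h) - Z M y) * b M (y + h) + Z M y * (b M (y + h) - b M y)).
    by rewrite /f; ring.
  rewrite normrN; apply: le_trans (ler_normD _ _) _; rewrite !normrM (ger0_norm ZM0).
  have bh : `|b M (y + h)| <= `|b M y| + q.
    rewrite -(subrK (b M y) (b M (y + h))); apply: le_trans (ler_normD _ _) _.
    by rewrite addrC lerD2l.
  apply: (@le_trans _ _ (Z M y * (2 * S) * (`|b M y| + q) + Z M y * q)).
    apply: lerD; last by rewrite ler_wpM2l.
    apply: ler_pM => //; apply: le_trans dZ _; by rewrite ler_wpM2l.
  have -> : Z M y * (2 * S) * (`|b M y| + q) + Z M y * q =
    Z M y * (2 * S * `|b M y| + (2 * S * q + q)) by ring.
  apply: ler_wpM2l => //; rewrite lerD2l; have := ler_wpM2r q0 S12; lra.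
have final : S * `|b M y| + q <= W M y.
  have Wge : W M y = 8 * L * (\sum_(k < n) rho k M * b k y ^+ 2) + L * la * sp M y.
    rewrite /W /sp !mulr_sumr -big_split/=; apply: eq_bigr => k _; ring.
  have rMM : rho M M = 1 by rewrite /rho leqnn divff// gt_eqF//; lra.
  pose B2 := \sum_(k < n) rho k M * b k y ^+ 2.
  have bM2 : b M y ^+ 2 <= B2.
    rewrite /B2 (bigD1 (Ordinal Mn))//= rMM mul1r lerDl sumr_ge0// => k _.
    by rewrite mulr_ge0 ?rM ?sqr_ge0.
  have B20 : 0 <= B2 by apply: le_trans bM2; exact: sqr_ge0.
  have pM : p M y <= sp M y.
    rewrite /sp (bigD1 (Ordinal Mn))//= rMM mul1r lerDl sumr_ge0// => k _.
    by rewrite mulr_ge0 ?rM ?pp.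
  have sbb : sb M y * `|b M y| <= B2 / 2 + L / 2 * b M y ^+ 2.
    rewrite /sb mulr_suml.
    apply: (@le_trans _ _ (\sum_(k < n) (rho k M * (b k y ^+ 2) / 2 + rho k M * (b M y ^+ 2 / 2)))).
      apply: ler_sum => k _; have := sqr_ge0 (`|b k y| - `|b M y|).
      rewrite sqrrB !real_normK ?num_real// => h2.
      have := ler_wpM2l (rM k (ltn_ord k)) (_ : `|b k y| * `|b M y| <= b k y ^+ 2 / 2 + b M y ^+ 2 / 2).
      by rewrite mulrDr !mulrA; apply; lra.
    rewrite big_split/= -!mulr_suml -/B2 lerD2l.
    have b2 : 0 <= b M y ^+ 2 / 2 by rewrite divr_ge0// sqr_ge0.
    by have := ler_wpM2r b2 (rho_col Mn); lra.
  have spb : 3 * L ^+ 3 * la * sp M y * `|b M y| <= 3/32 * (L * la * sp M y).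
    rewrite (_ : 3/32 = 3 * (be * L ^+ 2)); last by rewrite beL; field.
    rewrite (_ : 3 * (be * L ^+ 2) * (L * la * sp M y) = 3 * L ^+ 3 * la * sp M y * be); last by ring.
    by apply: ler_wpM2l; [nonneg | exact: b_norm].
  rewrite Wge -/B2 /S /q.
  have h1' : L * la * p M y <= L * la * sp M y by rewrite ler_wpM2l// mulr_ge0// ltW.
  have h2 : B2 <= L * B2 by rewrite ler_peMl.
  have h3 : L * b M y ^+ 2 <= L * B2 by rewrite ler_wpM2l// ltW.
  have h4 : 0 <= L * la * sp M y by rewrite !mulr_ge0// ltW.
  have h5 : 0 <= L * B2 by rewrite mulr_ge0// ltW.
  rewrite mulrDl -(mulrA 8); lra.
apply: (@le_trans _ _ (2^-1 * (Z M y * (2 * S * `|b M y| + 2 * q)))).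
  apply: ler_wpM2l; first by rewrite invr_ge0.
  by rewrite -[leRHS]mulr1; apply: ler_pM.
have -> : 2^-1 * (Z M y * (2 * S * `|b M y| + 2 * q)) = Z M y * (S * `|b M y| + q) by field.
exact: ler_wpM2l.
Qed.

Lemma riesz_total : itg (-2) 3 (Z n) <= 5.
Proof.
have : forall k, (k <= n)%N -> itg (-2) 3 (Z k) <= 5.
  elim=> [|k ih] kn.
    rewrite (eq_itg (g := fun=> 1)) ?itg_cst; [lra|lra|].
    by move=> y _; rewrite /Z big_ord0.
  by apply: le_trans (riesz_step kn) (ih (ltnW kn)).
exact.
Qed.

(* The clipped part is controlled by ζ itself, the excess |λa| - β by the hyperbolic cosine. *)
Lemma exp_le_zeta i y : (i < n)%N ->
  expR (la * a i y * c i y) <= zeta i y * expR (2 * W i y + 4 * b i y ^+ 2 + `|la * a i y - b i y|).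
Proof.
move=> iln; have /andP[z1 z2] := zeta_bounds y iln.
set x := b i y * c i y - W i y.
have zE : zeta i y = 1 + x by rewrite /zeta /x; ring.
have x12 : - x <= 1/2 by move: z1; rewrite zE; lra.
have w0 := W_ge0 y iln; have w4 := W_le y iln; have b2 := sqr_ge0 (b i y).
have bc2 : (b i y * c i y) ^+ 2 <= b i y ^+ 2.
  by rewrite exprMn ler_piMr// -(real_normK (num_real (c i y))) exprn_ile1.
have x2 : x ^+ 2 <= 2 * b i y ^+ 2 + 1/2 * W i y.
  have := sqr_ge0 (b i y * c i y + W i y).
  have : W i y ^+ 2 <= 1/4 * W i y by rewrite expr2 ler_wpM2r.
  by rewrite /x; move: bc2; move: (b i y * c i y) => v *; lra.
have ex : expR x <= zeta i y * expR (2 * x ^+ 2).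
  have q0 : 0 < 1 - x + 2 * x ^+ 2 by have := sqr_ge0 (x - 1/4); lra.
  have h : 1 - x + 2 * x ^+ 2 <= expR (2 * x ^+ 2 - x).
    by apply: le_trans (expR_ge1Dx _); lra.
  have x3 : 0 <= x ^+ 2 * (1 + 2 * x) by apply: mulr_ge0; [exact: sqr_ge0 | lra].
  have h2 : 1 <= zeta i y * (1 - x + 2 * x ^+ 2) by rewrite zE; lra.
  have h3 : 1 <= zeta i y * expR (2 * x ^+ 2 - x).
    by apply: le_trans h2 _; rewrite ler_wpM2l//; lra.
  have := ler_wpM2r (expR_ge0 x) h3.
  by rewrite mul1r -mulrA -expRD subrK.
have step : la * a i y * c i y <= x + W i y + `|la * a i y - b i y|.
  have -> : x + W i y + `|la * a i y - b i y| = b i y * c i y + `|la * a i y - b i y|.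
    by rewrite /x; ring.
  have -> : la * a i y * c i y = b i y * c i y + (la * a i y - b i y) * c i y by ring.
  rewrite lerD2l; apply: le_trans (ler_norm _) _.
  by rewrite normrM ler_piMr.
apply: (@le_trans _ _ (expR (x + W i y + `|la * a i y - b i y|))); first by rewrite ler_expR.
rewrite -addrA expRD; apply: le_trans (ler_wpM2r (expR_ge0 _) ex) _.
rewrite -mulrA -expRD; apply: ler_wpM2l; first lra.
by rewrite ler_expR; lra.
Qed.

Let th : R := 36 * L ^+ 2.

(** Below the clipping level the comparison is of second order: [20 L^2 z^2] against
    [(th z)^2 / 8 = 162 L^4 z^2]. Above it the left exponent is linear in [|z|] and stays below
    [|th z| - 1], so the growing half of the hyperbolic cosine suffices. The size of [th] serves
    both cases. *)
Lemma exp_le_ch i y :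
  expR (20 * L ^+ 2 * b i y ^+ 2 + `|la * a i y - b i y|) <= ch (th * (la * a i y)).
Proof.
rewrite /b; move: (la * a i y) => z.
case: (clip_cases z be0) => -[hz e]; rewrite e.
  rewrite subrr normr0 addr0; apply: le_trans (ch_ge1 _).
  have z2 : z ^+ 2 <= be ^+ 2 by rewrite -(real_normK (num_real z)) lerXn2r// nnegrE.
  have w1 : 20 * L ^+ 2 * z ^+ 2 <= 1/2.
    have : L ^+ 2 * z ^+ 2 <= L ^+ 2 * be ^+ 2 by rewrite ler_wpM2l// (le_trans ler01).
    have -> : L ^+ 2 * be ^+ 2 = be * L ^+ 2 * be by ring.
    by rewrite beL; move: be_le; lra.
  apply: le_trans (expR_quad w1) _; set w := 20 * L ^+ 2 * z ^+ 2 in w1 *.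
  have z20 := sqr_ge0 z.
  have w0 : 0 <= w by rewrite /w; nonneg.
  have w2 : w ^+ 2 <= 1/2 * w by rewrite expr2 ler_wpM2r.
  have : L ^+ 2 * z ^+ 2 <= L ^+ 2 * (L ^+ 2 * z ^+ 2).
    by rewrite ler_peMl// mulr_ge0// exprn_ge0.
  have -> : 1 + (th * z) ^+ 2 / 8 = 1 + 162 * (L ^+ 2 * (L ^+ 2 * z ^+ 2)) by rewrite /th; field.
  have wE : w = 20 * (L ^+ 2 * z ^+ 2) by rewrite /w; ring.
  rewrite wE in w0 w2 *; move: (L ^+ 2 * (L ^+ 2 * z ^+ 2)) w0 w2 => U.
  by move: (L ^+ 2 * z ^+ 2) => V; lra.
apply: le_trans (ch_ge_exp _).
have e2 : 1 <= expR 1 / 2 :> R by have := expR_ge1Dx (1 : R); lra.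
apply: (@le_trans _ _ (expR (`|th * z| - 1))).
  rewrite ler_expR normrM ger0_norm; last by rewrite /th; nonneg.
  have b2 : 20 * L ^+ 2 * clip be z ^+ 2 <= 20/32 * be.
    have c2 : clip be z ^+ 2 <= be ^+ 2.
      by rewrite -(real_normK (num_real (clip be z))) lerXn2r ?nnegrE ?clip_norm.
    have := ler_wpM2l (_ : 0 <= 20 * L ^+ 2) c2.
    rewrite (_ : 20 * L ^+ 2 * be ^+ 2 = 20 * (be * L ^+ 2) * be); last by ring.
    by rewrite beL => h; apply: le_trans (h _) _; [nonneg|lra].
  have h17 : 35 * L ^+ 2 * be <= 35 * L ^+ 2 * `|z| by rewrite ler_wpM2l//; nonneg.
  have hz' : `|z| <= L ^+ 2 * `|z| by rewrite ler_peMl.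
  have bb' : 35 * L ^+ 2 * be = 35/32 by rewrite -mulrA [_ * be]mulrC beL; lra.
  by rewrite /th; move: be0 be_le; lra.
rewrite -(ler_pM2r (expR_gt0 1)) -expRD subrK.
have := ler_wpM2l (expR_ge0 `|th * z|) e2; lra.
Qed.

(** With the exponent halved, the square of the integrand is at most [Z n * C * P], where [C] is the
    product of hyperbolic cosines and [P] the exponential of the [p i]. Hence it is at most
    [(Z n + C P) / 2], and [C P <= (C^2 + P^2) / 2]. [riesz_total] bounds the first term, and
    squaring doubles the arguments of the other two. *)
Lemma riesz_exp :
  itg 0 1 (fun y => expR (la / 2 * \sum_(i < n) a i y * c i y)) <=
  2^-1 * (5 + 2^-1 * itg 0 1 (fun y => \prod_(i < n) ch (72 * L ^+ 2 * la * a i y))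
            + 2^-1 * itg 0 1 (fun y => expR (4 * L ^+ 2 * la * \sum_(i < n) p i y))).
Proof.
have bA : bmfR (fun y => expR (la / 2 * \sum_(i < n) a i y * c i y)).
  by apply: bmf_expR; apply: bmfZ; apply: bmf_sum => i _; exact: bmfM.
have bC : bmfR (fun y => \prod_(i < n) ch (72 * L ^+ 2 * la * a i y)).
  apply: (bmf_prod _ (F := fun (i : 'I_n) y => ch (72 * L ^+ 2 * la * a i y))) => i.
  have be' := bmfZ (72 * L ^+ 2 * la) (ba i).
  apply: bmfM; last exact: bmf_cst.
  by apply: bmfD; apply: bmf_expR => //; exact: bmfN.
have bP : bmfR (fun y => expR (4 * L ^+ 2 * la * \sum_(i < n) p i y)).
  by apply: bmf_expR; apply: bmfZ; exact: bmf_sum.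
have Z0 y : 0 <= Z n y.
  by apply: prodr_ge0 => l _; have /andP[? _] := zeta_bounds y (ltn_ord l); lra.
apply: (@le_trans _ _ (itg 0 1 (fun y => 2^-1 * (Z n y + (2^-1 * \prod_(i < n) ch (72 * L ^+ 2 * la * a i y)
            + 2^-1 * expR (4 * L ^+ 2 * la * \sum_(i < n) p i y)))))).
  apply: le_itg => //.
    by apply: bmfZ; apply: bmfD => //; apply: bmfD; exact: bmfZ.
  move=> y _.
  set C := \prod_(i < n) ch (th * (la * a i y)).
  pose P := expR (2 * L ^+ 2 * la * \sum_(i < n) p i y).
  have CC : C ^+ 2 <= \prod_(i < n) ch (72 * L ^+ 2 * la * a i y).
    rewrite /C -prodrXl; apply: ler_prod => i _; rewrite sqr_ge0/=.
    apply: le_trans (ch_sqr _) _; rewrite le_eqVlt; apply/orP; left; apply/eqP.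
    by congr ch; rewrite /th; ring.
  have PP : P ^+ 2 = expR (4 * L ^+ 2 * la * \sum_(i < n) p i y).
    by rewrite /P expr2 -expRD; congr expR; ring.
  have C0 : 0 <= C by apply: prodr_ge0 => i _; exact/ltW/ch_gt0.
  have main : expR (la * \sum_(i < n) a i y * c i y) <= Z n y * (C * P).
    rewrite mulr_sumr expR_sum.
    apply: (@le_trans _ _ (\prod_(i < n) (zeta i y *
        expR (2 * W i y + 4 * b i y ^+ 2 + `|la * a i y - b i y|)))).
      by apply: ler_prod => i _; rewrite expR_ge0/= mulrA; exact: exp_le_zeta.
    rewrite big_split/= -/(Z n y) ler_wpM2l// -expR_sum.
    apply: (@le_trans _ _ (expR (\sum_(i < n) (20 * L ^+ 2 * b i y ^+ 2 + `|la * a i y - b i y|)) * P)).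
      rewrite /P -expRD ler_expR !big_split/= -!mulr_sumr.
      (* Summation over [i] brings in the row sums of [rho]. Twice this bound contributes [16 L^2]
         to the coefficient of [b^2], and [4 <= 4 L^2] completes the 20 of [exp_le_ch]. *)
      have WW : \sum_(i < n) W i y <= 8 * L ^+ 2 * (\sum_(i < n) b i y ^+ 2) + L ^+ 2 * la * \sum_(i < n) p i y.
        rewrite /W exchange_big/= !mulr_sumr -big_split/=; apply: ler_sum => k _.
        rewrite -mulr_suml; have /andP[pk0 _] := p0 y (ltn_ord k).
        apply: (@le_trans _ _ (L * (8 * L * b k y ^+ 2 + L * la * p k y))).
          by apply: ler_wpM2r; [nonneg | exact: rho_row].
        by rewrite le_eqVlt; apply/orP; left; apply/eqP; ring.
      have B0 : 0 <= \sum_(i < n) b i y ^+ 2 by apply: sumr_ge0 => i _; exact: sqr_ge0.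
      have := ler_wpM2r B0 L2; lra.
    rewrite ler_wpM2r ?expR_ge0// expR_sum /C.
    by apply: ler_prod => i _; rewrite expR_ge0/= exp_le_ch.
  set A := expR (la / 2 * _).
  have AA : A ^+ 2 = expR (la * \sum_(i < n) a i y * c i y).
    by rewrite /A expr2 -expRD; congr expR; field.
  have A0 : 0 <= A := expR_ge0 _.
  have P0 : 0 <= P := expR_ge0 _.
  have h1 : C * P <= 2^-1 * C ^+ 2 + 2^-1 * P ^+ 2 by have := sqr_ge0 (C - P); lra.
  rewrite -PP; set Z' := Z n y in main *.
  have h2 : A ^+ 2 <= (2^-1 * (Z' + C * P)) ^+ 2.
    rewrite AA; apply: (le_trans main); have := sqr_ge0 (Z' - C * P); lra.
  have h3 : A <= 2^-1 * (Z' + C * P).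
    by rewrite -(@ler_pXn2r _ 2)// nnegrE mulr_ge0 ?invr_ge0// addr_ge0 ?mulr_ge0// Z0.
  by apply: (le_trans h3); lra.
rewrite itgZ; last by apply: bmfD => //; apply: bmfD; exact: bmfZ.
rewrite itgD//; last by apply: bmfD; exact: bmfZ.
rewrite itgD ?itgZ//; try exact: bmfZ.
rewrite ler_wpM2l ?invr_ge0// -addrA lerD2r.
apply: le_trans riesz_total.
have n1 a' b' : 0 <= itg a' b' (Z n) by apply: itg_ge0.
rewrite (itg_split (a := -2) (b := 0) (c := 3))//; try lra.
rewrite (itg_split (a := 0) (b := 1) (c := 3))//; try lra.
by have := n1 (-2) 0; have := n1 1 3; lra.
Qed.

End RieszProduct.

Lemma expR_half_add (R : realType) (u v : R) : expR ((u + v) / 2) <= (expR u + expR v) / 2.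
Proof.
have e1 : expR u = expR (u / 2) ^+ 2 by rewrite expr2 -expRD; congr expR; field.
have e2 : expR v = expR (v / 2) ^+ 2 by rewrite expr2 -expRD; congr expR; field.
have -> : expR ((u + v) / 2) = expR (u / 2) * expR (v / 2) by rewrite -expRD; congr expR; field.
by rewrite e1 e2; have := sqr_ge0 (expR (u / 2) - expR (v / 2)); lra.
Qed.

(** The two kernels differ only for [|t| < 3^-k], a scale comparable with [1/m]. There the phase
    difference [e = O(m |t|)] cancels the singularity, so the product is [O(m)], and [qm m t] is
    itself of order [m]. *)
Lemma Ker_modulation_error (R : realType) k K (m e t : R) : (k <= K)%N ->
  0 <= m <= 3 * 3 ^+ k -> `|e| <= 8 * (m * `|t|) -> `|e * (Ker K t - Ker k t)| <= 320 * qm m t.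
Proof.
move=> kK /andP[m0 mk] he; have q0 : 0 <= qm m t by exact: qm_ge0.
have [t1|t1] := leP 1 (3 ^+ k * `|t|).
  by rewrite (Ker_stable kK t1) subrr mulr0 normr0; lra.
have Nt : m * `|t| <= 3 by have := ler_wpM2r (normr_ge0 t) mk; lra.
have v0 : 0 <= m * `|t| by apply: mulr_ge0.
rewrite normrM; apply: (@le_trans _ _ (8 * m * 4)).
  apply: (@le_trans _ _ (8 * (m * `|t|) * `|Ker K t - Ker k t|)); first exact: ler_wpM2r.
  have h1 := Ker_mul_bound K t; have h2 := Ker_mul_bound k t.
  have := ler_wpM2l (normr_ge0 t) (ler_normB (Ker K t) (Ker k t)); rewrite mulrDr => h.
  by have := ler_wpM2l m0 (_ : `|t| * `|Ker K t - Ker k t| <= 4); move=> /(_ ltac:(lra)); lra.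
rewrite /qm mulrA ler_pdivlMr; last by have := qm_den m t; lra.
have : (m * t) ^+ 2 <= 9.
  rewrite -real_normK ?num_real// normrM (ger0_norm m0).
  by have := ler_pM v0 v0 Nt Nt; rewrite expr2; lra.
by move=> /(ler_wpM2l m0); lra.
Qed.

Lemma itg_mean4 (R : realType) (f1 f2 f3 f4 : measurableTypeR R -> R) :
  bmf f1 -> bmf f2 -> bmf f3 -> bmf f4 -> itg 0 1 f1 <= 20 -> itg 0 1 f2 <= 45 ->
  itg 0 1 f3 <= 45 -> itg 0 1 f4 <= 20 -> itg 0 1 (fun y => 4^-1 * (f1 y + f2 y + f3 y + f4 y)) <= 33.
Proof.
move=> b1 b2 b3 b4; have b12 := bmfD b1 b2; have b123 := bmfD b12 b3; have b1234 := bmfD b123 b4.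
by rewrite (itgZ _ _ _ b1234) (itgD _ _ b123 b4) (itgD _ _ b12 b3) (itgD _ _ b1 b2); lra.
Qed.

(** * Exponential integrability for modulated kernels with lacunary frequencies *)

Section LacunaryClass.
Variables (R : realType) (d : measure_display) (T : measurableType d).
Variables (nu : {sigma_finite_measure set T -> \bar R}) (D : set T) (X : T -> R).
Hypotheses (hD : findom nu D) (D1 : fine (nu D) <= 1) (mX : measurable_fun setT X)
  (hX : forall a b, a <= b -> \int[nu]_(x in D) ico a b (X x) <= b - a)
  (X01 : forall x, D x -> 0 <= X x <= 1).
Notation RR := (measurableTypeR R).
Notation bmfR := (@bmf _ RR R).

Lemma bmf_shift_fun (f : R -> R) y : bmfR f -> bmf (fun x => f (X x - y)).
Proof.
move=> bf; apply: (bmf_comp (phi := fun x => X x - y : RR) bf).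
by apply: measurable_funB => //; exact: measurable_cst.
Qed.

Lemma bmf_shift_fun2 (f : R -> R) : bmfR f -> bmf (fun p : RR * T => f (X p.2 - p.1)).
Proof.
move=> bf; apply: (bmf_comp (phi := fun p : RR * T => X p.2 - p.1 : RR) bf).
apply: measurable_funB; last exact: measurable_fst.
by apply: (measurableT_comp mX); exact: measurable_snd.
Qed.

Lemma bint_tentsum_le n y : \int[nu]_(x in D) tentsum n (X x - y) <= 2 * 3 ^+ n.
Proof.
have bt k : bmfR (fun t => itg 1 3 (fun s => tent1 (3 ^+ k * t * s))).
  apply: (@bmf_itg R _ RR 1 3 (fun t s => tent1 (3 ^+ k * t * s))).
  have bt1 := bmf_tent1_scale (1 : R).
  rewrite (_ : (fun p => _) = fun p : RR * RR => tent1 (1 * (3 ^+ k * p.1 * p.2))); last first.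
    by apply/funext => p; rewrite mul1r.
  apply: (bmf_comp (phi := fun p : RR * RR => 3 ^+ k * p.1 * p.2 : RR) bt1).
  by apply: measurable_funM => //; apply: measurable_funM => //; exact: measurable_cst.
have bk k : bmf (fun x => itg 1 3 (fun s => tent1 (3 ^+ k * (X x - y) * s))).
  exact: (bmf_shift_fun y (bt k)).
rewrite /tentsum bint_sum//; last by move=> k _; exact: bmfZ.
apply: (@le_trans _ _ (\sum_(k < n) 4 * 3 ^+ k)); last first.
  elim: n => [|n ih]; first by rewrite big_ord0 expr0; lra.
  by rewrite big_ord_recr/= exprS; lra.
apply: ler_sum => k _; have p := exp3_gt0 R k; have q : 0 < (3 ^+ k)^-1 :> R by rewrite invr_gt0.
rewrite bintZ//.
apply: (@le_trans _ _ (9 ^+ k * (4 * (3 ^+ k)^-1))); last first.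
  rewrite (_ : 9 = 3 * 3 :> R) ?exprMn; last by ring.
  by rewrite le_eqVlt; apply/orP; left; apply/eqP; field; rewrite gt_eqF.
apply: ler_wpM2l; first by rewrite exprn_ge0.
have bi : bmf (fun x => ico (y - (3 ^+ k)^-1) (y + (3 ^+ k)^-1) (X x)).
  exact: (bmf_comp (bmf_ico _ _) mX).
apply: (@le_trans _ _ (\int[nu]_(x in D) (2 * ico (y - (3 ^+ k)^-1) (y + (3 ^+ k)^-1) (X x)))).
  apply: le_bint => //; first exact: bmfZ.
  move=> x _; rewrite /ico; case: ifPn => h.
    apply: le_trans (itg_le_cst (c := 1) _ _ _) _; [lra|exact: bmf_tent1_scale| |lra].
    by move=> s _; case/andP: (tent1_01 (3 ^+ k * (X x - y) * s)).
  rewrite mulr0 (eq_itg (g := fun=> 0)) ?itg_cst ?mul0r//; first lra.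
  move=> s /andP[s1 _]; rewrite /tent1 max_l// subr_le0 !normrM (gtr0_norm p).
  have hx : 1 <= 3 ^+ k * `|X x - y|.
    rewrite -ler_pdivrMl// mulr1 leNgt; apply: contra h; rewrite ltr_norml => /andP[? ?]; apply/andP; split; lra.
  by apply: le_trans hx _; rewrite ler_peMr// ?(le_trans s1) ?ler_norm// mulr_ge0// ltW.
rewrite bintZ//; have := hX (_ : y - (3 ^+ k)^-1 <= y + (3 ^+ k)^-1); move=> /(_ ltac:(lra)).
lra.
Qed.

Variables (n : nat) (M : nat -> nat) (L : R).
Let m i : R := (M i)%:R.
Hypotheses (L2000 : 2000 <= L)
  (M1 : forall i, (i < n)%N -> (0 < M i)%N)
  (Mlt : forall i j, (i < j)%N -> (j < n)%N -> (M i < M j)%N)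
  (rho_col : forall l, (l < n)%N -> \sum_(k < n) rho m k l <= L)
  (rho_row : forall k, (k < n)%N -> \sum_(l < n) rho m k l <= L).
Variables (N : T -> nat) (g : T -> R) (tr : R -> R) (K : nat) (C6 : R).
Hypothesis hC6 : 1000 * 1000 <= C6.
Hypotheses (mN : measurable_fun setT N) (NM : forall x, exists2 i, (i < n)%N & N x = M i).
Hypotheses (bg : bmf g) (g1 : forall x, `|g x| <= 1).
Hypotheses (tr1 : forall t, `|tr t| <= 1) (tr_lip : forall s t, `|tr s - tr t| <= `|s - t|)
  (tr_half : forall t, tr (t + pi) = - tr t).
Hypothesis (KM : forall i, (i < n)%N -> (trunc_log 3 (M i) <= K)%N).

Let kp x := trunc_log 3 (N x).
Let la : R := (C6 * L ^+ 5)^-1.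
Let ind i x : R := (N x == M i)%:R.
Let c i y := tr (2 * pi * m i * y).
Let a i y := \int[nu]_(x in D) (g x * ind i x * Ker (trunc_log 3 (M i)) (X x - y)).
Let p i y := \int[nu]_(x in D) (ind i x * qm (m i) (X x - y)).

Let Nmax := (\max_(i < n) M i)%N.
Let N_le x : (N x <= Nmax)%N.
Proof. by have [i iln ->] := NM x; exact: (leq_bigmax (Ordinal iln)). Qed.
Let kp_le x : (kp x <= K)%N.
Proof. by rewrite /kp; have [i iln ->] := NM x; exact: KM. Qed.
Let N_gt0 x : (0 < N x)%N. Proof. by have [i iln ->] := NM x; exact: M1. Qed.
Let mkp : measurable_fun setT kp. Proof. by apply: (measurableT_comp (f := trunc_log 3)). Qed.
Let M_inj i j : (i < n)%N -> (j < n)%N -> M i = M j -> i = j.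
Proof.
move=> iln jn e; case: (ltngtP i j) => // h.
  by have := Mlt h jn; rewrite e ltnn.
by have := Mlt h iln; rewrite e ltnn.
Qed.
Let m_ge1 i : (i < n)%N -> 1 <= m i. Proof. by move=> /M1; rewrite ler1n. Qed.
Let pw i : (i < n)%N -> 3 ^+ trunc_log 3 (M i) <= m i.
Proof. by move=> iln; rewrite -natrX ler_nat trunc_logP// M1. Qed.

Let bind i : bmf (ind i).
Proof. exact: (bmf_natcomp mN N_le (fun k => (k == M i)%:R)). Qed.

Let ind01 i x : 0 <= ind i x <= 1. Proof. by rewrite /ind; case: (_ == _); rewrite ?lexx ?ler01. Qed.

(* Only the summand with [M i = N x] survives. *)
Let sum_ind (F : nat -> R) x : \sum_(i < n) ind i x * F (M i) = F (N x).
Proof.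
have [j jn e] := NM x; rewrite (bigD1 (Ordinal jn))//= /ind e eqxx mul1r big1 ?addr0// => i /negP hi.
case: eqP => [h|_]; last by rewrite mul0r.
by case: hi; apply/eqP/val_inj => /=; apply: M_inj => //; exact: esym.
Qed.

Let bqm i : bmfR (qm (m i)). Proof. by apply: bmf_qm; exact: ler0n. Qed.

Let bga i y : bmf (fun x => g x * ind i x * Ker (trunc_log 3 (M i)) (X x - y)).
Proof. by apply: bmfM; [exact: bmfM | exact: (bmf_shift_fun y (bmf_Ker R _))]. Qed.
Let bpa i y : bmf (fun x => ind i x * qm (m i) (X x - y)).
Proof. by apply: bmfM => //; exact: (bmf_shift_fun y). Qed.

Let ba i : bmfR (a i).
Proof.
apply: (bmf_bint (T1 := RR) (f := fun y x => g x * ind i x * Ker (trunc_log 3 (M i)) (X x - y)) hD).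
apply: bmfM; last exact: bmf_shift_fun2 (bmf_Ker R _).
by apply: (bmf_comp (phi := @snd RR T) (bmfM bg (bind i))); exact: measurable_snd.
Qed.

Let bp i : bmfR (p i).
Proof.
apply: (bmf_bint (T1 := RR) (f := fun y x => ind i x * qm (m i) (X x - y)) hD).
apply: bmfM; last exact: bmf_shift_fun2.
by apply: (bmf_comp (phi := @snd RR T) (bind i)); exact: measurable_snd.
Qed.

Let bc i : bmfR (c i).
Proof.
apply: (bmf_lipschitz (L := 2 * pi * m i)) => [x y|]; last by exists 1 => y; exact: tr1.
apply: le_trans (tr_lip _ _) _; rewrite -mulrBr normrM ger0_norm// !mulr_ge0//.
exact: pi_ge0.
Qed.

Let a_lip i y t : (i < n)%N -> m i * `|t| <= 1 ->
  `|a i (y + t) - a i y| <= L * (m i * `|t|) * p i y.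
Proof.
move=> iln mt; rewrite /a -bintB//.
apply: (@le_trans _ _ (\int[nu]_(x in D) ((180 * (m i * `|t|)) * (ind i x * qm (m i) (X x - y))))).
  apply: norm_bint_le => //; [exact: bmfB|exact: bmfZ|move=> x _].
  have /andP[i0 _] := ind01 i x; have m0 : 0 <= m i := ler0n _ _.
  rewrite -mulrBr !normrM (ger0_norm i0).
  have := @Ker_lip R (trunc_log 3 (M i)) (m i) (X x - y) (- t) (pw iln); rewrite normrN => /(_ mt).
  rewrite (_ : X x - y - t = X x - (y + t)); last by ring.
  move=> h; rewrite -mulrA.
  apply: (@le_trans _ _ (ind i x * (180 * (m i * `|t|) * qm (m i) (X x - y)))).
    by rewrite -[leRHS]mul1r; apply: ler_pM => //; [nonneg | apply: ler_wpM2l].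
  by rewrite le_eqVlt; apply/orP; left; apply/eqP; ring.
rewrite bintZ// -/(p i y); apply: ler_wpM2r; last by apply: ler_wpM2r; [nonneg|move: L2000; lra].
apply: Rintegral_ge0 => x _; have /andP[i0 _] := ind01 i x.
by apply: mulr_ge0 => //; apply: qm_ge0; exact: ler0n.
Qed.

Let p_lip i y t : (i < n)%N -> m i * `|t| <= 1 ->
  `|p i (y + t) - p i y| <= L * (m i * `|t|) * p i y.
Proof.
move=> iln mt; rewrite /p -bintB//.
apply: (@le_trans _ _ (\int[nu]_(x in D) ((2 * (m i * `|t|)) * (ind i x * qm (m i) (X x - y))))).
  apply: norm_bint_le => //; [exact: bmfB|exact: bmfZ|move=> x _].
  have /andP[i0 _] := ind01 i x; have m0 : 0 <= m i := ler0n _ _.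
  rewrite -mulrBr !normrM (ger0_norm i0).
  have := @qm_shift R (m i) (X x - y) (- t) m0; rewrite normrN => /(_ mt).
  rewrite (_ : X x - y - t = X x - (y + t)); last by ring.
  move=> h; apply: (@le_trans _ _ (ind i x * (2 * (m i * `|t|) * qm (m i) (X x - y)))).
    exact: ler_wpM2l.
  by rewrite le_eqVlt; apply/orP; left; apply/eqP; ring.
rewrite bintZ// -/(p i y); apply: ler_wpM2r; last by apply: ler_wpM2r; [nonneg|move: L2000; lra].
apply: Rintegral_ge0 => x _; have /andP[i0 _] := ind01 i x.
by apply: mulr_ge0 => //; apply: qm_ge0; exact: ler0n.
Qed.

Let btentsum_fun k : bmfR (tentsum k).
Proof.
apply: bmf_sum => j _; apply: bmfZ.
apply: (@bmf_itg R _ RR 1 3 (fun t s => tent1 (3 ^+ j * t * s))).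
have bt1 := bmf_tent1_scale (1 : R).
rewrite (_ : (fun q => _) = fun q : RR * RR => tent1 (1 * (3 ^+ j * q.1 * q.2))); last first.
  by apply/funext => q; rewrite mul1r.
apply: (bmf_comp (phi := fun p : RR * RR => 3 ^+ j * p.1 * p.2 : RR) bt1).
by apply: measurable_funM => //; apply: measurable_funM => //; exact: measurable_cst.
Qed.

Let btentsum k y : bmf (fun x => tentsum k (X x - y)).
Proof.
exact: bmf_shift_fun.
Qed.

Let p0 i y : (i < n)%N -> 0 <= p i y <= L.
Proof.
move=> iln; apply/andP; split.
  apply: Rintegral_ge0 => x _; have /andP[i0 _] := ind01 i x.
  by apply: mulr_ge0 => //; apply: qm_ge0; exact: ler0n.
(* [qm_le_tentsum] and [bint_tentsum_le] bound the integral by [2 * 972 + 36 = 1980]. *)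
apply: le_trans L2000.
have [j h1 h2] : exists2 j, m i <= 3 ^+ j & 3 ^+ j <= 3 * m i.
  exists (trunc_log 3 (M i)).+1; first by rewrite -natrX ler_nat ltnW// trunc_log_ltn.
  by rewrite exprS ler_pM2l// pw.
have q := exp3_gt0 R j.
have [A [B [A0 B0 key fin]]] : exists A B : R, [/\ 0 <= A, 0 <= B,
    forall x, qm (m i) (X x - y) <= A * tentsum j (X x - y) + B & A * (2 * 3 ^+ j) + B <= 2000].
  exists (972 / 3 ^+ j), 36; split.
  - by apply: divr_ge0; [exact: ler0n | exact: ltW].
  - exact: ler0n.
  - move=> x; have := @qm_le_tentsum R j (m i) (X x - y) (m_ge1 iln) h1 h2; lra.
  - rewrite (_ : 972 / 3 ^+ j * (2 * 3 ^+ j) = 1944); last by field; rewrite gt_eqF.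
    by lra.
have bAt : bmf (fun x => A * tentsum j (X x - y)) by exact: bmfZ.
have bB := bmf_cst T B.
apply: (@le_trans _ _ (\int[nu]_(x in D) (A * tentsum j (X x - y) + B))).
  apply: le_bint => //; first exact: bmfD.
  move=> x _; apply: le_trans (key x).
  have /andP[i0 i1] := ind01 i x; rewrite ler_piMl//; apply: qm_ge0; exact: ler0n.
rewrite bintD// bintZ// bint_cst//.
have h3 := ler_wpM2l A0 (bint_tentsum_le j y).
have h4 := ler_wpM2l B0 D1.
by lra.
Qed.

Let a_out i y : (i < n)%N -> ~~ (-1 <= y <= 2) -> a i y = 0.
Proof.
move=> iln yo; rewrite /a.
transitivity (\int[nu]_(x in D) (0 : R)); last by rewrite bint_cst// mul0r.
apply: eq_Rintegral => x; rewrite inE => /X01 /andP[x0 x1].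
rewrite Ker_far ?mulr0//; move: yo; rewrite negb_and -!ltNge => /orP[h|h].
  by rewrite ger0_norm; lra.
by rewrite ler0_norm; lra.
Qed.

Let c_half i y : (i < n)%N -> c i (y + (2 * m i)^-1) = - c i y.
Proof.
move=> iln; rewrite /c -tr_half; congr tr; have := m_ge1 iln; move: (m i) => mi ?.
by field; lra.
Qed.

Let c_lip i y t : (i < n)%N -> `|c i (y + t) - c i y| <= 8 * (m i * `|t|).
Proof.
move=> iln; apply: le_trans (tr_lip _ _) _.
rewrite (_ : _ - _ = 2 * pi * (m i * t)); last by ring.
have pi4 : pi < 4 :> R by have := @pihalf_lt2 R; lra.
rewrite normrM ger0_norm; last by apply: mulr_ge0 => //; exact: pi_ge0.
rewrite normrM (ger0_norm (ler0n _ _)); apply: ler_wpM2r; first by nonneg.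
lra.
Qed.


Let L0 : 0 <= L. Proof. by move: L2000; lra. Qed.
Let C60 : 0 < C6.
Proof. by move: hC6; lra. Qed.
Let la0 : 0 <= la.
Proof. by rewrite invr_ge0; apply: mulr_ge0; [exact: ltW | exact: exprn_ge0]. Qed.
Let laL k : (k <= 5)%N -> 1000 * 1000 * (la * L ^+ k) <= 1.
Proof.
move=> k5; have L1 : 1 <= L by move: L2000; lra.
have Lk : L ^+ k <= L ^+ 5 by exact: ler_weXn2l.
have L5 : 0 < L ^+ 5 by rewrite exprn_gt0//; lra.
apply: (@le_trans _ _ (C6 * (la * L ^+ k))).
  by apply: ler_wpM2r => //; apply: mulr_ge0 => //; exact: exprn_ge0.
rewrite /la invfM mulrA mulrA divff ?mul1r; last by rewrite gt_eqF.
by rewrite ler_pdivrMl// mulr1.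
Qed.

Let P y := \int[nu]_(x in D) qm (N x)%:R (X x - y).

Let bqN y : bmf (fun x => qm (N x)%:R (X x - y)).
Proof.
rewrite (_ : (fun x => _) = fun x => \sum_(i < n) ind i x * qm (m i) (X x - y)); last first.
  by apply/funext => x; rewrite (sum_ind (fun k => qm k%:R (X x - y))).
by apply: bmf_sum => i _; exact: bpa.
Qed.

Let sum_p y : \sum_(i < n) p i y = P y.
Proof.
rewrite /p -bint_sum//; apply: eq_Rintegral => x _.
exact: (sum_ind (fun k => qm k%:R (X x - y))).
Qed.

Let bP : bmfR P.
Proof.
rewrite (_ : P = fun y => \sum_(i < n) p i y); first exact: bmf_sum.
by apply/funext => y; rewrite sum_p.
Qed.

(** Since [3^(kp x) <= N x < 3^(kp x + 1)], [qm (N x)] is dominated by the tent kernel stopped at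
    generation [kp x + 1]. The bound on [s] makes [s * 972] at most the exponent [1/6] of
    [stopped_tentsum_exp]. *)
Let P_exp s : 0 <= s <= 6000^-1 -> itg 0 1 (fun y => expR (s * P y)) <= 20.
Proof.
move=> /andP[s0 s1].
have nS x : ((kp x).+1 <= K.+1)%N by rewrite ltnS.
have mkS : measurable_fun setT (fun x => (kp x).+1) by apply: (measurableT_comp (f := S)).
have bb : bmf (fun x => (3 ^+ (kp x).+1)^-1 : R).
  exact: (bmf_natcomp mkS nS (fun k => (3 ^+ k)^-1)).
pose W y := \int[nu]_(x in D) (tentsum (kp x).+1 (X x - y) / 3 ^+ (kp x).+1).
have bts : bmf (fun q : RR * T => tentsum (kp q.2).+1 (X q.2 - q.1) / 3 ^+ (kp q.2).+1).
  rewrite (_ : (fun q => _) = fun q : RR * T => \sum_(i < n) ind i q.2 *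
      (tentsum (trunc_log 3 (M i)).+1 (X q.2 - q.1) / 3 ^+ (trunc_log 3 (M i)).+1)); last first.
    apply/funext => q; rewrite (sum_ind (fun k => tentsum (trunc_log 3 k).+1 (X q.2 - q.1) /
      3 ^+ (trunc_log 3 k).+1))//.
  apply: bmf_sum => i _; apply: bmfM; first exact: (bmf_comp (bind i) measurable_snd).
  apply: bmfM; last exact: bmf_cst.
  apply: bmf_shift_fun2; have := btentsum_fun (trunc_log 3 (M i)).+1; exact.
have bW : bmfR W.
  exact: (bmf_bint (T1 := RR) (f := fun y x => tentsum (kp x).+1 (X x - y) / 3 ^+ (kp x).+1) hD bts).
have W0 y : 0 <= W y.
  apply: Rintegral_ge0 => x _; rewrite divr_ge0 ?exprn_ge0//.
  apply: sumr_ge0 => k _; rewrite mulr_ge0 ?exprn_ge0//.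
  by apply: itg_ge0 => t _; case/andP: (tent1_01 (3 ^+ k * (X x - y) * t)).
have [A [B [A0 B0 key [A6 B6]]]] : exists A B : R, [/\ 0 <= A, 0 <= B,
    forall x y, qm (N x)%:R (X x - y) <= A * (tentsum (kp x).+1 (X x - y) / 3 ^+ (kp x).+1) + B &
    s * A <= 6^-1 /\ s * B <= 1/100].
  exists 972, 36; split; [exact: ler0n | exact: ler0n | | ].
    move=> x y; apply: qm_le_tentsum; first by rewrite ler1n.
      by rewrite -natrX ler_nat ltnW// trunc_log_ltn.
    by rewrite exprS ler_pM2l// -natrX ler_nat trunc_logP.
  split; first by have := ler_wpM2r (ler0n R 972) s1; lra.
  by have := ler_wpM2r (ler0n R 36) s1; lra.
have PW y : P y <= A * W y + B.
  have btx : bmf (fun x => tentsum (kp x).+1 (X x - y) / 3 ^+ (kp x).+1).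
    exact: (bmf_snd (f := fun (y : RR) x => tentsum (kp x).+1 (X x - y) / 3 ^+ (kp x).+1) y bts).
  have bAx := bmfZ A btx; have bB := bmf_cst T B.
  apply: (@le_trans _ _ (\int[nu]_(x in D) (A * (tentsum (kp x).+1 (X x - y) / 3 ^+ (kp x).+1) + B))).
    by apply: le_bint => //; exact: bmfD.
  rewrite bintD// bintZ// bint_cst//; have h4 := ler_wpM2l B0 D1.
  by rewrite /W; lra.
have eW := stopped_tentsum_exp hD mX hX mkS nS.
apply: (@le_trans _ _ (itg 0 1 (fun y => 2 * expR (6^-1 * W y)))).
  apply: le_itg; [exact/bmf_expR/bmfZ | apply: bmfZ; exact/bmf_expR/bmfZ | move=> y _].
  apply: (@le_trans _ _ (expR (s * B + 6^-1 * W y))).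
    rewrite ler_expR; have h1 := ler_wpM2l s0 (PW y).
    have h2 := ler_wpM2r (W0 y) A6; lra.
  rewrite expRD ler_wpM2r ?expR_ge0//.
  apply: le_trans (expR_quad _) _; first lra.
  have sB : 0 <= s * B by rewrite mulr_ge0.
  by have : (s * B) ^+ 2 <= 1/100 * (s * B); [rewrite expr2 ler_wpM2r | lra].
by rewrite itgZ; [rewrite /W; lra | exact/bmf_expR/bmfZ].
Qed.

Let bKkp (h : nat -> R -> R) : (forall k, bmfR (h k)) -> bmf (fun q : RR * T => h (kp q.2) (X q.2 - q.1)).
Proof.
move=> bh.
rewrite (_ : (fun q => _) = fun q : RR * T => \sum_(i < n) ind i q.2 *
    h (trunc_log 3 (M i)) (X q.2 - q.1)); last first.
  by apply/funext => q; rewrite (sum_ind (fun k => h (trunc_log 3 k) (X q.2 - q.1))).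
apply: bmf_sum => i _; apply: bmfM; first exact: (bmf_comp (bind i) measurable_snd).
exact: bmf_shift_fun2.
Qed.

Let bKer := bKkp (@bmf_Ker R).

Let bKer1 y : bmf (fun x => Ker (kp x) (X x - y)).
Proof. exact: (bmf_snd (f := fun (y : RR) x => Ker (kp x) (X x - y)) y bKer). Qed.

(** A product of hyperbolic cosines is the mean over all choices of one sign per frequency. As [a i]
    only integrates over the points with [N x = M i], a choice of signs amounts to changing the sign
    of [g] on these sets, and [stopped_Ker_exp] gives the same bound for every choice. *)
Lemma prod_ch_exp l : 0 <= l <= 1/20 -> itg 0 1 (fun y => \prod_(i < n) ch (l / 2 * a i y)) <= 45.
Proof.
move=> hl.
pose sg (b : bool) : R := if b then 1 else -1.
pose F (i : 'I_n) (b : bool) y := expR (sg b * (l / 2 * a i y)) / 2.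
have bF (f : {ffun 'I_n -> bool}) :
    bmfR (fun y => (2^-1) ^+ n * expR (\sum_(i < n) sg (f i) * (l / 2 * a i y))).
  by apply: bmfZ; apply: bmf_expR; apply: bmf_sum => i _; apply: bmfZ; exact: bmfZ.
have -> : itg 0 1 (fun y => \prod_(i < n) ch (l / 2 * a i y)) =
   itg 0 1 (fun y => \sum_(f : {ffun 'I_n -> bool}) (2^-1) ^+ n *
     expR (\sum_(i < n) sg (f i) * (l / 2 * a i y))).
  apply: eq_itg => y _.
  transitivity (\prod_(i < n) \sum_(b : bool) F i b y).
    apply: eq_bigr => i _; by rewrite big_bool/= /F /ch /sg mul1r mulN1r mulrDl.
  rewrite bigA_distr_bigA/=; apply: eq_bigr => f _.
  by rewrite /F big_split/= prodr_const card_ord expR_sum mulrC.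
rewrite itg_sum; last by move=> f _; exact: bF.
apply: (@le_trans _ _ (\sum_(f : {ffun 'I_n -> bool}) (2^-1) ^+ n * 45)); last first.
  rewrite sumr_const card_ffun card_bool card_ord -[leLHS]mulr_natl natrX mulrA -exprMn.
  by rewrite mulfV// expr1n mul1r.
apply: ler_sum => f _; rewrite itgZ; last first.
  by apply: bmf_expR; apply: bmf_sum => i _; apply: bmfZ; exact: bmfZ.
apply: ler_wpM2l; first by rewrite exprn_ge0// invr_ge0.
pose gs x := g x * \sum_(i < n) ind i x * sg (f i).
have bgs : bmf gs.
  by apply: bmfM => //; apply: bmf_sum => i _; apply: bmfM => //; exact: bmf_cst.
have gsE x : exists i : 'I_n, gs x = g x * sg (f i).
  have [j jn e] := NM x; exists (Ordinal jn); rewrite /gs; congr (_ * _).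
  rewrite (bigD1 (Ordinal jn))//= /ind e eqxx mul1r big1 ?addr0// => i /negP hi.
  case: eqP => [h|_]; last by rewrite mul0r.
  by case: hi; apply/eqP/val_inj => /=; apply: M_inj => //; exact: esym.
have gs1 x : `|gs x| <= 1.
  have [i ->] := gsE x; rewrite normrM /sg; case: (f i); rewrite ?normrN normr1 mulr1 //.
have := stopped_Ker_exp hD mX hX mkp kp_le bgs gs1 hl.
congr (_ <= _); apply: eq_itg => y _; congr expR.
transitivity (l / 2 * \sum_(i < n) sg (f i) * a i y); last first.
  by rewrite mulr_sumr; apply: eq_bigr => i _; ring.
congr (_ * _); under [RHS]eq_bigr do rewrite /a -bintZ//.
rewrite -bint_sum//; last by move=> i _; exact: bmfZ.
apply: eq_Rintegral => x _; rewrite /gs.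
transitivity (\sum_(i < n) g x * (ind i x * sg (f i)) * Ker (kp x) (X x - y)).
  by rewrite [g x * (\sum_(i < n) _)]mulr_sumr mulr_suml.
apply: eq_bigr => i _; rewrite /ind /kp; case: eqP => [->|_]; by rewrite ?mulr0 ?mul0r ?mulr0//; ring.
Qed.

(** [E1] keeps the kernel down to the scale [1/N(x)], where the phase oscillates: this is the sum
    for the Riesz product. At smaller scales the phase at [y] is replaced by the phase at [X x];
    then it belongs to [g'], and [E2 + E3] is the difference of two unmodulated operators, one
    truncated at generation [K] and one at [kp x]. [E4] is the error of this replacement, dominated
    by [P]. Convexity distributes the exponent over the four terms, and
    [(20 + 45 + 45 + 20) / 4 <= 33]. *)
Lemma class_exp :
  itg 0 1 (fun y => expR (la / 8 *
    \int[nu]_(x in D) (g x * tr (2 * pi * (N x)%:R * y) * Ker K (X x - y)))) <= 33.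
Proof.
have fin (u v : R) : u <= 45 -> v <= 20 -> 2^-1 * (5 + 2^-1 * u + 2^-1 * v) <= 20 by lra.
have fin2 (l e q : R) : 0 <= l -> e <= 320 * q -> l / 2 * e <= 160 * l * q.
  by move=> h1 /(ler_wpM2l h1); lra.
have fin3 (u v w z s t : R) : u <= (w + z) / 2 -> v <= (s + t) / 2 -> (u + v) / 2 <= 4^-1 * (w + z + s + t).
  by lra.
have la6 : 1000 * 1000 * la <= 1 by have := laL (leq0n 5); rewrite expr0 mulr1.
have la2 : 1000 * 1000 * (L ^+ 2 * la) <= 1 by have := @laL 2 isT; rewrite [la * _]mulrC.
have l20 : 0 <= 144 * L ^+ 2 * la <= 1/20.
  apply/andP; split; first by do 2 (apply: mulr_ge0 => //); exact: exprn_ge0.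
  by rewrite -mulrA; lra.
have hl : 0 <= la <= 1/20 by apply/andP; split => //; lra.
have l4 : 0 <= 4 * L ^+ 2 * la <= 6000^-1.
  apply/andP; split; first by do 2 (apply: mulr_ge0 => //); exact: exprn_ge0.
  by rewrite -mulrA; lra.
have l160 : 0 <= 160 * la <= 6000^-1 by apply/andP; split; [apply: mulr_ge0 | lra].
have L1 : 1 <= L by move: L2000; lra.
have laR : la <= (64 * L ^+ 5)^-1.
  have L5 : 0 < L ^+ 5 by rewrite exprn_gt0//; lra.
  rewrite /la lef_pV2; [|rewrite posrE; apply: mulr_gt0 => //..].
  by apply: ler_wpM2r; [exact: ltW | move: hC6; lra].
have pi8 : 2 * pi <= 8 :> R by have := @pihalf_lt2 R; lra.
have btr : bmfR tr.
  by apply: (bmf_lipschitz (L := 1)) => [x y|]; [rewrite mul1r | exists 1].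
have mNr : measurable_fun setT (fun x => (N x)%:R : R).
  by apply: (measurableT_comp (f := fun k : nat => k%:R : R)).
have bt (z : RR * T -> R) : measurable_fun setT z ->
    bmf (fun q : RR * T => tr (2 * pi * (N q.2)%:R * z q)).
  move=> mz; apply: (bmf_comp (phi := fun q : RR * T => 2 * pi * (N q.2)%:R * z q : RR) btr).
  apply: measurable_funM => //; apply: measurable_funM; first exact: measurable_cst.
  exact: (measurableT_comp mNr measurable_snd).
have mX2 := measurableT_comp mX (@measurable_snd _ _ RR T).
have bg2 : bmf (fun q : RR * T => g q.2) by apply: (bmf_comp bg); exact: measurable_snd.
pose g' x := g x * tr (2 * pi * (N x)%:R * X x).
have bg'2 : bmf (fun q : RR * T => g' q.2) by apply: bmfM => //; exact: bt.
have bg' : bmf g' := bmf_snd (f := fun (y : RR) x => g' x) 0 bg'2.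
have g'1 x : `|g' x| <= 1 by rewrite normrM -[leRHS]mulr1; apply: ler_pM.
have bK2 : bmf (fun q : RR * T => Ker K (X q.2 - q.1)) by exact: bmf_shift_fun2 (bmf_Ker R K).
pose E1 y := \sum_(i < n) a i y * c i y.
pose E2 y := \int[nu]_(x in D) (g' x * Ker K (X x - y)).
pose E3 y := \int[nu]_(x in D) (- g' x * Ker (kp x) (X x - y)).
pose e4 y x := g x * (tr (2 * pi * (N x)%:R * y) - tr (2 * pi * (N x)%:R * X x)) *
  (Ker K (X x - y) - Ker (kp x) (X x - y)).
pose E4 y := \int[nu]_(x in D) e4 y x.
have bt1 : bmf (fun q : RR * T => tr (2 * pi * (N q.2)%:R * q.1)) by exact: bt measurable_fst.
have b2 : bmf (fun q : RR * T => g' q.2 * Ker K (X q.2 - q.1)) by exact: bmfM.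
have b3 : bmf (fun q : RR * T => - g' q.2 * Ker (kp q.2) (X q.2 - q.1)) by apply: bmfM => //; exact: bmfN.
have b4 : bmf (fun q : RR * T => e4 q.1 q.2).
  by apply: bmfM; [apply: bmfM => //; apply: bmfB => //; exact: bt | exact: bmfB].
have bE1 : bmfR E1 by apply: bmf_sum => i _; exact: bmfM.
have bE2 : bmfR E2 by exact: (bmf_bint (T1 := RR) (f := fun y x => g' x * Ker K (X x - y)) hD b2).
have bE3 : bmfR E3 by exact: (bmf_bint (T1 := RR) (f := fun y x => - g' x * Ker (kp x) (X x - y)) hD b3).
have bE4 : bmfR E4 by exact: (bmf_bint (T1 := RR) (f := e4) hD b4).
have dec y : \int[nu]_(x in D) (g x * tr (2 * pi * (N x)%:R * y) * Ker K (X x - y)) =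
    E1 y + E2 y + E3 y + E4 y.
  have c1 : bmf (fun x => g x * tr (2 * pi * (N x)%:R * y) * Ker (kp x) (X x - y)).
    apply: bmfM; last exact: bKer1.
    by apply: bmfM => //; exact: (bmf_snd (f := fun (y : RR) x => tr (2 * pi * (N x)%:R * y)) y bt1).
  have c2 := bmf_snd (f := fun (y : RR) x => g' x * Ker K (X x - y)) y b2.
  have c3 := bmf_snd (f := fun (y : RR) x => - g' x * Ker (kp x) (X x - y)) y b3.
  have c4 := bmf_snd (f := e4) y b4.
  have -> : E1 y = \int[nu]_(x in D) (g x * tr (2 * pi * (N x)%:R * y) * Ker (kp x) (X x - y)).
    transitivity (\sum_(i < n) \int[nu]_(x in D) (c i y * (g x * ind i x * Ker (trunc_log 3 (M i)) (X x - y)))).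
      by apply: eq_bigr => i _; rewrite bintZ// mulrC.
    rewrite -bint_sum//; last by move=> i _; exact: bmfZ.
    apply: eq_Rintegral => x _.
    rewrite -mulrA -(sum_ind (fun k => tr (2 * pi * k%:R * y) * Ker (trunc_log 3 k) (X x - y))) mulr_sumr.
    by apply: eq_bigr => i _; rewrite /c; ring.
  rewrite -bintD// -bintD//; last exact: bmfD.
  rewrite -bintD//; last by apply: bmfD => //; exact: bmfD.
  by apply: eq_Rintegral => x _; rewrite /e4 /g'; ring.
have P0 y : 0 <= P y by apply: Rintegral_ge0 => x _; apply: qm_ge0; exact: ler0n.
have E4P y : E4 y <= 320 * P y.
  apply: le_trans (ler_norm _) _; rewrite -bintZ//; apply: norm_bint_le => //.
  - exact: (bmf_snd (f := e4) y b4).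
  - exact: bmfZ.
  move=> x _; rewrite /e4; set t := X x - y.
  rewrite -mulrA normrM -[leRHS]mul1r; apply: ler_pM; [by []|exact: normr_ge0|by []|].
  apply: Ker_modulation_error; [exact: kp_le|by rewrite ler0n -exprS -natrX ler_nat ltnW// trunc_log_ltn|].
  apply: le_trans (tr_lip _ _) _; rewrite (_ : _ - _ = - (2 * pi * ((N x)%:R * t))); last by rewrite /t; ring.
  rewrite normrN normrM ger0_norm; last by apply: mulr_ge0 => //; exact: pi_ge0.
  rewrite normrM (ger0_norm (ler0n _ _)); apply: ler_wpM2r; first by nonneg.
  exact: pi8.
have mle i j : (i <= j)%N -> (j < n)%N -> m i <= m j.
  rewrite leq_eqVlt => /orP[/eqP->//|ij] jn; rewrite ler_nat ltnW//; exact: Mlt.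
have c1 i y : `|c i y| <= 1 by exact: tr1.
have RZ := riesz_exp L1 la0 laR m_ge1 mle rho_col rho_row bc ba bp c1 c_half c_lip a_lip p_lip p0 a_out.
have F1 : itg 0 1 (fun y => expR (la / 2 * E1 y)) <= 20.
  apply: (le_trans RZ).
  have h1 := prod_ch_exp l20.
  have h2 : itg 0 1 (fun y => expR (4 * L ^+ 2 * la * P y)) <= 20 by exact: P_exp.
  have e1 : itg 0 1 (fun y => \prod_(i < n) ch (72 * L ^+ 2 * la * a i y)) =
      itg 0 1 (fun y => \prod_(i < n) ch (144 * L ^+ 2 * la / 2 * a i y)).
    by apply: eq_itg => y _; apply: eq_bigr => i _; congr ch; field.
  have e2 : itg 0 1 (fun y => expR (4 * L ^+ 2 * la * \sum_(i < n) p i y)) =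
      itg 0 1 (fun y => expR (4 * L ^+ 2 * la * P y)).
    by apply: eq_itg => y _; rewrite sum_p.
  by rewrite e1 e2; exact: fin.
have cK (x : T) : (K <= K)%N by [].
have F2 : itg 0 1 (fun y => expR (la / 2 * E2 y)) <= 45.
  exact: (stopped_Ker_exp hD mX hX (@measurable_cst _ _ T _ setT K) cK bg' g'1 hl).
have bg'N := bmfN bg'.
have g'N1 x : `|- g' x| <= 1 by rewrite normrN.
have F3 : itg 0 1 (fun y => expR (la / 2 * E3 y)) <= 45.
  exact: (stopped_Ker_exp hD mX hX mkp kp_le bg'N g'N1 hl).
have F4 : itg 0 1 (fun y => expR (la / 2 * E4 y)) <= 20.
  apply: (@le_trans _ _ (itg 0 1 (fun y => expR (160 * la * P y)))).
    apply: le_itg; [exact/bmf_expR/bmfZ | exact/bmf_expR/bmfZ | move=> y _].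
    by rewrite ler_expR; apply: fin2 => //; exact: E4P.
  exact: P_exp.
have bx h : bmfR h -> bmfR (fun y => expR (la / 2 * h y)) by move=> bh; exact/bmf_expR/bmfZ.
have x1 := bx _ bE1; have x2 := bx _ bE2; have x3 := bx _ bE3; have x4 := bx _ bE4.
have x12 := bmfD x1 x2; have x123 := bmfD x12 x3; have x1234 := bmfD x123 x4.
apply: (@le_trans _ _ (itg 0 1 (fun y => 4^-1 * (expR (la / 2 * E1 y) + expR (la / 2 * E2 y) +
    expR (la / 2 * E3 y) + expR (la / 2 * E4 y))))).
  apply: le_itg; [|exact: bmfZ|].
    under eq_fun do rewrite dec.
    by apply/bmf_expR/bmfZ; apply: bmfD => //; apply: bmfD => //; exact: bmfD.
  move=> y _; rewrite dec.
  have -> : la / 8 * (E1 y + E2 y + E3 y + E4 y) =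
    ((la / 2 * E1 y + la / 2 * E2 y) / 2 + (la / 2 * E3 y + la / 2 * E4 y) / 2) / 2 by field.
  apply: le_trans (expR_half_add _ _) _.
  by apply: fin3; exact: expR_half_add.
exact (itg_mean4 x1 x2 x3 x4 F1 F2 F3 F4).
Qed.

End LacunaryClass.

(** * Duality for lacunary frequencies *)

Section Trigonometric.
Variable R : realType.

Lemma MVT_lipschitz (f df : R -> R) : (forall x : R, is_derive x 1 f (df x)) -> (forall x, `|df x| <= 1) ->
  forall a b, `|f a - f b| <= `|a - b|.
Proof.
move=> h h1 a b; wlog ab : a b / a <= b.
  move=> W; have [|/ltW] := leP a b; first exact: W.
  by move=> /W; rewrite distrC [`|b - a|]distrC.
have [c _ e] : exists2 c, c \in `[a, b]%R & f b - f a = df c * (b - a).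
  apply: MVT_segment => //.
  apply: continuous_subspaceT => x; apply: differentiable_continuous.
  by apply/derivable1_diffP; have [] := h x.
by rewrite distrC [leRHS]distrC e normrM ler_piMl.
Qed.

(** What the argument uses of [cos] and [sin], so that real and imaginary parts of the phase share
    one proof. *)
Definition half_wave (tr : R -> R) := [/\ forall t, `|tr t| <= 1,
  forall s t, `|tr s - tr t| <= `|s - t| & forall t, tr (t + pi) = - tr t].

Lemma half_wave_cos : half_wave cos.
Proof.
split=> [t||t]; [|apply: MVT_lipschitz => t|exact: cosDpi].
  by rewrite ler_norml cos_geN1 cos_le1.
by rewrite normrN ler_norml sin_geN1 sin_le1.
Qed.

Lemma half_wave_sin : half_wave sin.
Proof.
split=> [t||t]; [|apply: MVT_lipschitz => t|exact: sinDpi].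
  by rewrite ler_norml sin_geN1 sin_le1.
by rewrite ler_norml cos_geN1 cos_le1.
Qed.

Lemma bmf_half_wave tr : half_wave tr -> @bmf _ (measurableTypeR R) R tr.
Proof.
by move=> [t1 tl _]; apply: (bmf_lipschitz (L := 1)) => [x y|]; [rewrite mul1r | exists 1].
Qed.

End Trigonometric.

Section LacunarySums.
Variables (R : realType) (r : R).
Hypothesis r1 : 1 < r.

Let r0 : 0 < r. Proof. exact: lt_trans ltr01 r1. Qed.
Let q1 : r^-1 < 1. Proof. by rewrite invf_lt1. Qed.
Let A1 : 1 <= (1 - r^-1)^-1.
Proof. by rewrite invf_ge1 ?subr_gt0// gerBl invr_ge0 ltW. Qed.
Let AE : 1 + r^-1 * (1 - r^-1)^-1 = (1 - r^-1)^-1.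
Proof.
have h : 1 - r^-1 != 0 by rewrite gt_eqF// subr_gt0.
by move: h; move: (r^-1) => q h; field.
Qed.

Lemma sum_indic_le n c : \sum_(k < n) (k == c :> nat)%:R <= 1 :> R.
Proof.
elim: n => [|n ih]; first by rewrite big_ord0.
rewrite big_ord_recr/=; case: eqP => [e|_]; last by rewrite addr0.
rewrite big1 ?add0r// => i _; case: eqP => // h; by have := ltn_ord i; rewrite h e ltnn.
Qed.

(** Consecutive column sums satisfy [S (l + 1) <= 1 + S l / r], and [(1 - r^-1)^-1] is the fixed
    point of this recursion. *)
Lemma lacunary_rho_col (m : nat -> R) n l : (forall i, 0 < m i) -> (forall i, r * m i <= m i.+1) ->
  \sum_(k < n) rho m k l <= (1 - r^-1)^-1.
Proof.
move=> m0 hm; elim: l => [|l ih].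
  apply: le_trans A1; apply: le_trans (sum_indic_le n 0); apply: ler_sum => k _.
  by rewrite /rho leqn0; case: eqP => // ->; rewrite divff// gt_eqF.
rewrite -AE addrC; apply: (@le_trans _ _ (r^-1 * \sum_(k < n) rho m k l + \sum_(k < n) (k == l.+1 :> nat)%:R)).
  rewrite mulr_sumr -big_split/=; apply: ler_sum => k _; rewrite /rho.
  rewrite [in leLHS]leq_eqVlt ltnS; case: eqP => [->|_] /=.
    by rewrite ltnn divff ?gt_eqF// mulr0 add0r.
  case: ifP => _; last by rewrite mulr0 add0r.
  rewrite addr0 mulrCA ler_wpM2l ?(ltW (m0 _))// -invfM lef_pV2 ?posrE ?mulr_gt0//.
by apply: lerD (sum_indic_le _ _); apply: ler_wpM2l => //; rewrite invr_ge0 ltW.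
Qed.

Lemma lacunary_rho_row (m : nat -> R) n k : (forall i, 0 < m i) -> (forall i, r * m i <= m i.+1) ->
  \sum_(l < n) rho m k l <= (1 - r^-1)^-1.
Proof.
elim: k m n => [|k ih] m [|n] m0 hm; rewrite ?big_ord0; [exact: le_trans A1| |exact: le_trans A1|].
- elim: n m m0 hm => [|n ih] m m0 hm.
    by rewrite big_ord_recl big_ord0 /rho/= divff ?addr0// gt_eqF.
  rewrite big_ord_recl {1}/rho/= divff ?gt_eqF// -AE lerD2l.
  apply: (@le_trans _ _ (r^-1 * \sum_(l < n.+1) rho (m \o S) 0 l)).
    rewrite mulr_sumr; apply: ler_sum => l _; rewrite /rho/= mulrA ler_wpM2r//.
      by rewrite invr_ge0 ltW.
    by rewrite ler_pdivlMl.
  by apply: ler_wpM2l; [rewrite invr_ge0 ltW | apply: ih => i /=].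
- rewrite big_ord_recl {1}/rho/= add0r.
  by apply: le_trans (ih (m \o S) n _ _) => [|i|i] //=; apply: ler_sum => l _; rewrite /rho.
Qed.

End LacunarySums.

(** * From exponential integrability to bounds by duality *)

Section LacunaryDual.
Variables (R : realType) (d : measure_display) (T : measurableType d).
Variables (nu : {sigma_finite_measure set T -> \bar R}) (D : set T) (X : T -> R).
Notation RR := (measurableTypeR R).
Notation bmfR := (@bmf _ RR R).

(** The transpose, applied to [g], of the linearized operator with kernel [Ker K], for one component
    [tr] of the phase. *)
Definition modop (tr : R -> R) K (N : T -> nat) (g : T -> R) (y : R) :=
  \int[nu]_(x in D) (g x * tr (2 * pi * (N x)%:R * y) * Ker K (X x - y)).

(* Young's inequality [a t <= a l + expR (t - l)] for [0 <= a <= 1]. *)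
Lemma dual_of_exp (f A : R -> R) th B l : 0 < th -> 0 <= l -> bmfR f -> (forall y, `|f y| <= 1) -> bmfR A ->
  itg 0 1 (fun y => expR (th * A y)) <= B -> itg 0 1 (fun y => expR (- (th * A y))) <= B ->
  itg 0 1 (fun y => `|f y| * `|A y|) <= th^-1 * (l * itg 0 1 (fun y => `|f y|) + 2 * B * expR (- l)).
Proof.
move=> th0 l0 bf f1 bA h1 h2; have bf' := bmf_norm bf; have bA' := bmf_norm bA.
have be1 : bmfR (fun y => expR (th * A y)) by exact/bmf_expR/bmfZ.
have be2 : bmfR (fun y => expR (- (th * A y))) by exact/bmf_expR/bmfN/bmfZ.
have be := bmfD be1 be2; have bel := bmfZ (expR (- l)) be; have bfl := bmfZ l bf'.
rewrite ler_pdivlMl// -itgZ; last exact: bmfM.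
apply: (@le_trans _ _ (itg 0 1 (fun y => l * `|f y| + expR (- l) * (expR (th * A y) + expR (- (th * A y)))))).
  apply: le_itg; [apply: bmfZ; exact: bmfM|exact: bmfD|move=> y _].
  have yg t a : 0 <= a <= 1 -> a * t <= l * a + expR (t - l).
    move=> /andP[a0 a1]; have e0 := expR_ge0 (t - l); have [tl|tl] := leP t l.
      by have := ler_wpM2l a0 tl; lra.
    have := expR_ge1Dx (t - l); have : a * (t - l) <= t - l by rewrite ler_piMl// subr_ge0 ltW.
    by lra.
  have a01 : 0 <= `|f y| <= 1 by rewrite normr_ge0 f1.
  rewrite mulrCA -{1}(gtr0_norm th0) -normrM.
  apply: le_trans (yg _ _ a01) _; rewrite lerD2l addrC expRD ler_wpM2l ?expR_ge0//.
  have [_|_] := ler0P (th * A y); first by rewrite lerDr expR_ge0.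
  by rewrite lerDl expR_ge0.
rewrite (itgD _ _ bfl bel) (itgZ _ _ _ bf') (itgZ _ _ _ be) (itgD _ _ be1 be2) lerD2l.
by have := ler_wpM2l (expR_ge0 (- l)) (lerD h1 h2); lra.
Qed.

Hypotheses (hD : findom nu D) (D1 : fine (nu D) <= 1) (mX : measurable_fun setT X)
  (hX : forall a b, a <= b -> \int[nu]_(x in D) ico a b (X x) <= b - a)
  (X01 : forall x, D x -> 0 <= X x <= 1).

Lemma bmf_modop_kernel tr K N g : half_wave tr -> measurable_fun setT N -> bmf g ->
  bmf (fun q : RR * T => g q.2 * tr (2 * pi * (N q.2)%:R * q.1) * Ker K (X q.2 - q.1)).
Proof.
move=> htr mN bg; apply: bmfM; last exact: (bmf_shift_fun2 mX (bmf_Ker R K)).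
apply: bmfM; first by apply: (bmf_comp bg); exact: measurable_snd.
apply: (bmf_comp (phi := fun q : RR * T => 2 * pi * (N q.2)%:R * q.1 : RR) (bmf_half_wave htr)).
apply: measurable_funM; last exact: measurable_fst.
apply: measurable_funM; first exact: measurable_cst.
apply: (measurableT_comp (f := fun k : nat => k%:R : R)) => //.
by apply: (measurableT_comp mN); exact: measurable_snd.
Qed.

Lemma bmf_modop tr K N g : half_wave tr -> measurable_fun setT N -> bmf g -> bmfR (modop tr K N g).
Proof.
move=> htr mN bg; exact: (bmf_bint (T1 := RR)
  (f := fun y x => g x * tr (2 * pi * (N x)%:R * y) * Ker K (X x - y)) hD (bmf_modop_kernel K htr mN bg)).
Qed.

Lemma bmf_modop_integrand tr K N g y : half_wave tr -> measurable_fun setT N -> bmf g ->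
  bmf (fun x => g x * tr (2 * pi * (N x)%:R * y) * Ker K (X x - y)).
Proof.
move=> htr mN bg; exact: (bmf_snd
  (f := fun (y : RR) x => g x * tr (2 * pi * (N x)%:R * y) * Ker K (X x - y)) y (bmf_modop_kernel K htr mN bg)).
Qed.

Lemma modopN tr K N g y : half_wave tr -> measurable_fun setT N -> bmf g ->
  modop tr K N (fun x => - g x) y = - modop tr K N g y.
Proof.
move=> htr mN bg; rewrite /modop -bintN//; last exact: bmf_modop_integrand.
by apply: eq_Rintegral => x _; rewrite !mulNr.
Qed.

Variables (M : nat -> nat) (r : R).
Hypotheses (r1 : 1 < r) (M0 : forall i, (0 < M i)%N) (hM : forall i, r * (M i)%:R <= (M i.+1)%:R).

Let Mlt i j : (i < j)%N -> (M i < M j)%N.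
Proof.
have h k : (M k < M k.+1)%N.
  by rewrite -(ltr_nat R); apply: lt_le_trans (hM k); rewrite ltr_pMl// ltr0n.
elim: j => // j ih; rewrite ltnS leq_eqVlt => /orP[/eqP->//|/ih ij]; exact: ltn_trans ij (h j).
Qed.

Lemma class_modop_exp : exists2 th : R, 0 < th & forall K N g tr, (M 0 <= 3 ^ K)%N ->
  measurable_fun setT N -> (forall x, exists i, N x = M i) -> (forall x, (N x <= 3 ^ K)%N) ->
  bmf g -> (forall x, `|g x| <= 1) -> half_wave tr ->
  itg 0 1 (fun y => expR (th * modop tr K N g y)) <= 33.
Proof.
pose L := Num.max 2000 ((1 - r^-1)^-1).
have L2000 : 2000 <= L by rewrite le_max lexx.
have [C6 hC6] : exists C6 : R, 1000 * 1000 <= C6 by exists (1000 * 1000).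
have C60 : 0 < C6 by lra.
have L0 : 0 < L by lra.
exists ((C6 * L ^+ 5)^-1 / 8).
  by rewrite divr_gt0// invr_gt0 mulr_gt0// exprn_gt0.
move=> K N g tr MK mN NM NK bg g1 [t1 tl th].
have exK : exists i, (3 ^ K < M i)%N.
  exists (3 ^ K)%N; elim: (3 ^ K)%N => [|k ih]; first exact: M0.
  by apply: leq_ltn_trans ih _; exact: Mlt.
(* Frequencies above [3^K] do not occur, so the class is finite: it consists of the [M i] with
   [i < n]. The final bound does not depend on [n]. *)
pose n := ex_minn exK; have [nK nmin] : (3 ^ K < M n)%N /\ forall i, (3 ^ K < M i)%N -> (n <= i)%N.
  by rewrite /n; case: ex_minnP.
have inK i : (i < n)%N -> (M i <= 3 ^ K)%N by move=> iln; rewrite leqNgt; apply: contraL iln => /nmin; rewrite -leqNgt.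
have NM' x : exists2 i, (i < n)%N & N x = M i.
  have [i e] := NM x; exists i => //; rewrite ltnNge; apply: contraL (NK x) => ni; rewrite -ltnNge e.
  apply: (leq_trans nK); move: ni; rewrite leq_eqVlt => /orP[/eqP->//|/Mlt /ltnW//].
have KM i : (i < n)%N -> (trunc_log 3 (M i) <= K)%N.
  by move=> /inK h; rewrite -(@trunc_expnK 3 K)// leq_trunc_log.
have m0 i : 0 < (M i)%:R :> R by rewrite ltr0n.
have LA : (1 - r^-1)^-1 <= L by rewrite le_max lexx orbT.
have rc l : (l < n)%N -> \sum_(k < n) rho (fun i => (M i)%:R) k l <= L.
  by move=> _; apply: le_trans LA; exact: lacunary_rho_col.
have rr k : (k < n)%N -> \sum_(l < n) rho (fun i => (M i)%:R) k l <= L.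
  by move=> _; apply: le_trans LA; exact: lacunary_rho_row.
have M1 i : (i < n)%N -> (0 < M i)%N by [].
have Mlt' i j : (i < j)%N -> (j < n)%N -> (M i < M j)%N by move=> /Mlt.
exact (class_exp hD D1 mX hX X01 L2000 M1 Mlt' rc rr hC6 mN NM' bg g1 t1 tl th KM).
Qed.

(** For one frequency the phase depends on [y] alone, leaves the integral and is at most 1 in
    modulus. What remains is the unmodulated operator truncated at the constant generation [K]. *)
Lemma single_modop_bound K v g tr f l : half_wave tr -> bmf g -> (forall x, `|g x| <= 1) -> bmfR f ->
  (forall y, `|f y| <= 1) -> 0 <= l ->
  itg 0 1 (fun y => `|f y| * `|modop tr K (fun=> v) g y|) <=
    4000 * (l * itg 0 1 (fun y => `|f y|) + expR (- l)).
Proof.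
have fin (p q : R) : 0 <= p -> 0 <= q -> 40 * (p + 2 * 45 * q) <= 4000 * (p + q) by lra.
move=> htr bg g1 bf f1 l0; have [t1 _ _] := htr.
pose A y := \int[nu]_(x in D) (g x * Ker K (X x - y)).
have bA : bmfR A.
  apply: (bmf_bint (T1 := RR) (f := fun y x => g x * Ker K (X x - y)) hD).
  apply: bmfM; last exact: (bmf_shift_fun2 mX (bmf_Ker R K)).
  by apply: (bmf_comp bg); exact: measurable_snd.
have bAy y : bmf (fun x => g x * Ker K (X x - y)) by apply: bmfM => //; exact: (bmf_shift_fun mX y (bmf_Ker R K)).
have hth : 0 <= (20^-1 : R) <= 1/20 by apply/andP; split; lra.
have cK (x : T) : (K <= K)%N by [].
have mK := @measurable_cst _ _ T _ setT K.
have e1 : itg 0 1 (fun y => expR (40^-1 * A y)) <= 45.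
  have := stopped_Ker_exp hD mX hX mK cK bg g1 hth; congr (_ <= _).
  by apply: eq_itg => y _; congr expR; rewrite /A; congr (_ * _); field.
have e2 : itg 0 1 (fun y => expR (- (40^-1 * A y))) <= 45.
  have g1N x : `|- g x| <= 1 by rewrite normrN.
  have := stopped_Ker_exp hD mX hX mK cK (bmfN bg) g1N hth; congr (_ <= _).
  apply: eq_itg => y _; congr expR; rewrite -mulrN /A -bintN//.
  congr (_ * _); first by field.
  by apply: eq_Rintegral => x _; rewrite mulNr.
have h40 : 0 < 40^-1 :> R by rewrite invr_gt0.
have := dual_of_exp h40 l0 bf f1 bA e1 e2 => h.
apply: (@le_trans _ _ (itg 0 1 (fun y => `|f y| * `|A y|))).
  apply: le_itg; [by apply: bmfM; [exact: bmf_norm|apply: bmf_norm; exact: bmf_modop]|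
    by apply: bmfM; exact: bmf_norm|move=> y _].
  apply: ler_wpM2l => //; rewrite (_ : modop _ _ _ _ _ = tr (2 * pi * v%:R * y) * A y).
    by rewrite normrM ler_piMl.
  by rewrite /A -bintZ//; apply: eq_Rintegral => x _; ring.
apply: le_trans h _; rewrite invrK.
have p1 : 0 <= l * itg 0 1 (fun y => `|f y|) by apply: mulr_ge0 => //; exact: itg_ge0.
exact: fin p1 (expR_ge0 _).
Qed.

Lemma modop_split tr K N g v y : half_wave tr -> measurable_fun setT N -> bmf g ->
  modop tr K N g y = modop tr K (fun x => if N x == v then M 0 else N x) (fun x => g x * (N x != v)%:R) y
    + modop tr K (fun=> v) (fun x => g x * (N x == v)%:R) y.
Proof.
move=> htr mN bg.
have mNv b : measurable_fun setT (fun x => (N x == v) == b) by apply: (measurableT_comp (f := fun k => (k == v) == b)).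
have b1 : bmf (fun x => g x * (N x == v)%:R).
  by apply: bmfM => //; apply: bmf_bool; apply: (measurableT_comp (f := fun k => k == v)).
have b2 : bmf (fun x => g x * (N x != v)%:R).
  by apply: bmfM => //; apply: bmf_bool; apply: (measurableT_comp (f := fun k => k != v)).
have mN' : measurable_fun setT (fun x => if N x == v then M 0 else N x).
  by apply: (measurableT_comp (f := fun k => if k == v then M 0 else k)).
rewrite /modop -bintD//; [|exact: (bmf_modop_integrand K y htr mN' b2)|
  exact: (bmf_modop_integrand K y htr (@measurable_cst _ _ T _ setT v) b1)].
apply: eq_Rintegral => x _; case: eqP => [->|_] /=; by rewrite !(mulr0, mulr1, mul0r, add0r, addr0).
Qed.

(** [s] lists the frequencies before the lacunary regime, about which nothing is known. The
    induction removes one value [v] at a time: the points with [N x = v] are left to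
    [single_modop_bound], and in the rest they receive weight 0 and the harmless frequency [M 0].
    Each value adds one multiple of [C]. *)
Lemma carleson_dual : exists2 C : R, 0 < C & forall (s : seq nat) K N g tr f l, (M 0 <= 3 ^ K)%N ->
  measurable_fun setT N -> (forall x, N x \in s \/ exists i, N x = M i) -> (forall x, (N x <= 3 ^ K)%N) ->
  bmf g -> (forall x, `|g x| <= 1) -> half_wave tr -> bmfR f -> (forall y, `|f y| <= 1) -> 0 <= l ->
  itg 0 1 (fun y => `|f y| * `|modop tr K N g y|) <=
    C * (size s).+1%:R * (l * itg 0 1 (fun y => `|f y|) + expR (- l)).
Proof.
have [th th0 hth] := class_modop_exp.
exists (Num.max 4000 (th^-1 * 66)); first by rewrite lt_max ltr0n.
set C := Num.max _ _; have C1 : 4000 <= C by rewrite le_max lexx.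
have C2 : th^-1 * 66 <= C by rewrite le_max lexx orbT.
move=> s K; elim: s => [|v s ih] N g tr f l MK mN Ns NK bg g1 htr bf f1 l0;
  have p1 : 0 <= l * itg 0 1 (fun y => `|f y|) by apply: mulr_ge0 => //; exact: itg_ge0.
all: have p2 := expR_ge0 (- l).
  have NM x : exists i, N x = M i by case: (Ns x).
  have e1 := hth K N g tr MK mN NM NK bg g1 htr.
  have e2 : itg 0 1 (fun y => expR (- (th * modop tr K N g y))) <= 33.
    have g1N x : `|- g x| <= 1 by rewrite normrN.
    have := hth K N _ tr MK mN NM NK (bmfN bg) g1N htr; congr (_ <= _).
    by apply: eq_itg => y _; congr expR; rewrite modopN// mulrN.
  have bA := bmf_modop K htr mN bg.
  apply: le_trans (dual_of_exp th0 l0 bf f1 bA e1 e2) _; rewrite mulr1.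
  apply: (@le_trans _ _ (th^-1 * 66 * (l * itg 0 1 (fun y => `|f y|) + expR (- l)))).
    rewrite -[leRHS]mulrA; apply: ler_wpM2l; first by rewrite invr_ge0 ltW.
    lra.
  by apply: ler_wpM2r C2; exact: addr_ge0.
pose N' x := if N x == v then M 0 else N x.
pose g' x := g x * (N x != v)%:R.
pose g0 x := g x * (N x == v)%:R.
have mN' : measurable_fun setT N' by apply: (measurableT_comp (f := fun k => if k == v then M 0 else k)).
have bg0 : bmf g0.
  by apply: bmfM => //; apply: bmf_bool; apply: (measurableT_comp (f := fun k => k == v)).
have bg' : bmf g'.
  by apply: bmfM => //; apply: bmf_bool; apply: (measurableT_comp (f := fun k => k != v)).
have g01 x : `|g0 x| <= 1 by rewrite /g0; case: eqP => _; rewrite ?mulr1 ?mulr0 ?normr0.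
have g'1 x : `|g' x| <= 1 by rewrite /g'; case: eqP => _; rewrite ?mulr1 ?mulr0 ?normr0.
have Ns' x : N' x \in s \/ exists i, N' x = M i.
  rewrite /N'; case: eqP => [_|ne]; first by right; exists 0%N.
  by have [] := Ns x; [rewrite inE => /orP[/eqP//|]; left|right].
have NK' x : (N' x <= 3 ^ K)%N by rewrite /N'; case: eqP.
have h1 := ih N' g' tr f l MK mN' Ns' NK' bg' g'1 htr bf f1 l0.
have h2 := single_modop_bound K v htr bg0 g01 bf f1 l0.
have bf' := bmf_norm bf.
have b1 : bmfR (fun y => `|f y| * `|modop tr K N' g' y|) by apply: bmfM => //; apply: bmf_norm; exact: bmf_modop.
have b2 : bmfR (fun y => `|f y| * `|modop tr K (fun=> v) g0 y|).
  by apply: bmfM => //; apply: bmf_norm; apply: bmf_modop => //; exact: measurable_cst.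
have b3 : bmfR (fun y => `|f y| * `|modop tr K N g y|) by apply: bmfM => //; apply: bmf_norm; exact: bmf_modop.
apply: (@le_trans _ _ (itg 0 1 (fun y => `|f y| * `|modop tr K N' g' y| + `|f y| * `|modop tr K (fun=> v) g0 y|))).
  apply: (le_itg b3 (bmfD b1 b2)) => y _.
  rewrite -mulrDr ler_wpM2l//; rewrite (modop_split K v y htr mN bg); exact: ler_normD.
rewrite (itgD _ _ b1 b2) /= -[(size s).+2%:R]natr1 [C * (_ + 1)]mulrDr mulr1 [leRHS]mulrDl; apply: lerD h1 _.
by apply: le_trans h2 _; apply: ler_wpM2r C1; exact: addr_ge0.
Qed.

End LacunaryDual.

Lemma lacunary_tail (R : realType) (n : nat -> nat) : lacunary (R := R) n ->
  exists (r : R) j0, 1 < r /\ forall j, (j0 <= j)%N -> (0 < n j)%N /\ r * (n j)%:R <= (n j.+1)%:R.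
Proof.
rewrite /lacunary limn_einf_lim; set u := fun j => _.
have -> : limn (einfs u) = ereal_sup (range (einfs u)) by apply/cvg_lim => //; exact: cvg_einfs_sup.
move=> /ereal_sup_gt[_ [j0 _ <-]] /= e1.
have {}e1 : (1 < ereal_inf (sdrop u j0))%E by exact: e1.
have he j : (j0 <= j)%N -> (ereal_inf (sdrop u j0) <= u j)%E.
  by move=> jj; apply: ereal_inf_lbound; exists j.
move: e1 he; case: (ereal_inf (sdrop u j0)) => [r| |] // r1 he; last first.
  by have := he j0 (leqnn _); rewrite leye_eq.
rewrite lte_fin in r1; exists r, j0; split => // j jj.
have := he j jj; rewrite /u lee_fin => h.
have nj : (0 < n j)%N.
  rewrite lt0n; apply/eqP => e; move: h; rewrite e invr0 mulr0; lra.
by split => //; rewrite -ler_pdivlMr// ltr0n.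
Qed.

(** * Principal values of Lipschitz functions *)

Section LebesgueTransfer.
Variable R : realType.
Notation lm := (@lebesgue_measure R).
Notation RR := (measurableTypeR R).
Notation bmfR := (@bmf _ RR R).
Notation sleb := (@completed_lebesgue_measure R : {sigma_finite_measure set (lebR R) -> \bar R}).

Lemma borel_lebR (A : set R) : @measurable _ RR A -> @measurable _ (lebR R) A.
Proof. exact: sub_caratheodory. Qed.

Lemma measurable_id_lebR : measurable_fun setT (id : lebR R -> RR).
Proof. by move=> _ A mA; rewrite setTI; exact: borel_lebR. Qed.

Lemma bmf_lebR (f : R -> R) : bmfR f -> @bmf _ (lebR R) R f.
Proof.
move=> [mf hf]; split; last exact: hf.
exact (measurableT_comp mf measurable_id_lebR).
Qed.

Lemma findom_lebR (D : set R) : findom lm D -> findom (@leb R) D.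
Proof. by move=> [mD fD]; split; [exact: borel_lebR|exact: fD]. Qed.

(** The identity map from the Lebesgue to the Borel sigma-algebra is measurable and carries the
    completed measure to Lebesgue measure, so this is a change of variables. It brings the Borel
    estimates to the torus. *)
Lemma integral_lebR (D : set R) (f : R -> \bar R) : @measurable _ RR D ->
  @measurable_fun _ _ RR _ D f -> (forall x, D x -> (0 <= f x)%E) ->
  (\int[@leb R]_(x in D) f x = \int[lm]_(x in D) f x)%E.
Proof.
move=> mD mf f0.
pose mid := isMeasurableFun.Build _ _ _ _ _ measurable_id_lebR.
pose phi : {mfun lebR R >-> RR} := HB.pack (id : lebR R -> RR) mid.
rewrite (eq_measure_integral (pushforward (@leb R) phi)) => [|A mA _]; last exact: erefl.
rewrite (ge0_integral_pushforward measurable_id_lebR)//.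
by move=> x; rewrite inE => /f0.
Qed.

Lemma Rintegral_lebR (D : set R) (f : R -> R) : findom lm D -> bmfR f ->
  \int[@leb R]_(x in D) f x = \int[lm]_(x in D) f x.
Proof.
move=> hD bf; have [mf [M hM]] := bf; have hD' := findom_lebR hD.
have M0 x : 0 <= f x + M by have := hM x; rewrite ler_norml => /andP[]; lra.
have bc := bmf_cst RR M.
have bfM := bmfD bf bc.
have e1 := bintD hD bf bc.
have e2 := bintD hD' (bmf_lebR bf) (bmf_lebR bc).
have e3 : \int[@leb R]_(x in D) (f x + M) = \int[lm]_(x in D) (f x + M).
  congr fine; apply: integral_lebR; first by case: hD.
    by apply/measurable_EFinP; apply: measurable_funTS; case: bfM.
  by move=> x _; rewrite lee_fin.
have e4 : \int[@leb R]_(x in D) M = \int[lm]_(x in D) M.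
  by rewrite (bint_cst M hD') (bint_cst M hD).
by move: e2; rewrite e3 e4 e1 => /addIr ->.
Qed.

Lemma torusE : @torus R = `[0, 1[%classic.
Proof. by apply/seteqP; split => x; rewrite /torus/= in_itv. Qed.

Lemma findom_torus : findom (@leb R) (@torus R).
Proof. rewrite torusE; apply: findom_lebR; exact: findom_co. Qed.

Lemma leb_torus : leb (@torus R) = 1%E.
Proof.
by rewrite torusE; have := lebesgue_measure_itv `[(0 : R), 1[; rewrite /= lte_fin ltr01 sube0.
Qed.

Lemma Rintegral_torus f : bmfR f -> \int[@leb R]_(x in @torus R) f x = itg 0 1 f.
Proof.
by move=> bf; rewrite torusE Rintegral_lebR ?itg_co//; exact: findom_co.
Qed.

Lemma torus_ico a b : a <= b -> \int[sleb]_(x in @torus R) ico a b x <= b - a.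
Proof.
move=> ab; rewrite (_ : \int[sleb]_(x in @torus R) ico a b x = itg 0 1 (ico a b)).
  by rewrite itg_ico//; rewrite ge_max subr_ge0 ab; apply: lerB; rewrite ?ge_min ?le_max lexx orbT.
exact: (Rintegral_torus (bmf_ico a b)).
Qed.

End LebesgueTransfer.

Section PrincipalValue.
Variable R : realType.
Notation RR := (measurableTypeR R).
Notation bmfR := (@bmf _ RR R).
Implicit Types (x y t eps : R).

Lemma measurable_inv : measurable_fun setT (fun t : RR => t^-1 : RR).
Proof.
have -> : [set: RR] = [set (0 : R)] `|` ~` [set (0 : R)] by rewrite setUv.
have m0 : @measurable _ RR [set (0 : R)] by exact: measurable_set1.
apply/measurable_funU => //; first exact: measurableC.
split; first exact: measurable_fun_set1.
apply: open_continuous_measurable_fun; first by apply: closed_openC; exact: closed_eq.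
by move=> t /set_mem /eqP t0; exact: inv_continuous.
Qed.

Definition hinv eps t : R := if eps < `|t| then t^-1 else 0.

Lemma bmf_hinv eps : 0 < eps -> bmfR (hinv eps).
Proof.
move=> e0; split.
  rewrite (_ : hinv eps = fun t : RR => (eps < `|t|)%R%:R * (t : R)^-1).
    apply: measurable_funM; last exact: measurable_inv.
    have [] // := @bmf_bool _ RR R (fun t : RR => eps < `|t|).
    apply: measurable_fun_ltr; first exact: measurable_cst.
    exact: normr_measurable.
  by apply/funext => t; rewrite /hinv; case: ifP => _; rewrite ?mul1r ?mul0r.
exists eps^-1 => t; rewrite /hinv; case: ifP => h; last by rewrite normr0 invr_ge0 ltW.
by rewrite normfV lef_pV2 ?posrE//; [exact: ltW | exact: lt_trans h].
Qed.

Lemma hinvN eps t : hinv eps (- t) = - hinv eps t.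
Proof. by rewrite /hinv normrN; case: ifP => _; rewrite ?oppr0// invrN. Qed.

Lemma bmf_translate (f : R -> R) x : bmfR f -> bmfR (fun t => f (x + t)).
Proof. by move=> bf; have := bmf_affine 1 x bf; under eq_fun do rewrite mul1r addrC. Qed.

Lemma bmf_reflect (f : R -> R) x : bmfR f -> bmfR (fun t => f (x - t)).
Proof. by move=> bf; have := bmf_affine (-1) x bf; under eq_fun do rewrite mulN1r addrC. Qed.

Variables (phi : R -> R) (La : R).
Hypotheses (bphi : bmfR phi) (phi_lip : forall x y, `|phi x - phi y| <= La * `|x - y|)
  (phi_supp : forall y, ~~ (0 <= y <= 1) -> phi y = 0).

Let La0 : 0 <= La.
Proof. by have := phi_lip 1 0; rewrite subr0 normr1 mulr1; exact: le_trans. Qed.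

Let bphiD x := bmf_translate x bphi.
Let bphiB x := bmf_reflect x bphi.

Lemma itg_full x (F : R -> R) : 0 <= x <= 1 -> bmfR F -> (forall y, ~~ (0 <= y <= 1) -> F y = 0) ->
  itg (-1) 1 (fun t => F (x + t)) = itg 0 1 F.
Proof.
move=> x01 bF hF; under [LHS]eq_itg do rewrite addrC.
rewrite itg_shift//; apply: itg_support => //; last by move=> y _; exact: hF.
all: move: x01 => /andP[? ?]; lra.
Qed.

Lemma itg_full_opp x (F : R -> R) : 0 <= x <= 1 -> bmfR F -> (forall y, ~~ (0 <= y <= 1) -> F y = 0) ->
  itg (-1) 1 (fun t => F (x - t)) = itg 0 1 F.
Proof.
move=> x01 bF hF; rewrite -(itg_full x01)// -[in LHS](opprK 1) -itg_opp ?opprK//; last exact: bmf_reflect.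
by apply: eq_itg => t _; rewrite opprK.
Qed.

(** Folding an odd kernel around [x] replaces [phi] by this difference, which is [O(|t|)]. A
    principal value thereby becomes an absolutely convergent integral. *)
Definition pvdiff x t := phi (x - t) - phi (x + t).

Lemma itg_odd_kernel x (k : R -> R) : 0 <= x <= 1 -> bmfR k -> (forall t, k (- t) = - k t) ->
  itg 0 1 (fun y => phi y * k (x - y)) =
  2^-1 * itg (-1) 1 (fun t => pvdiff x t * k t).
Proof.
move=> x01 bk kN; set F := fun y => phi y * k (x - y).
have bF : bmfR F.
  apply: bmfM => //; exact: bmf_reflect.
have hF y : ~~ (0 <= y <= 1) -> F y = 0 by move=> /phi_supp; rewrite /F => ->; rewrite mul0r.
have e1 := itg_full x01 bF hF; have e2 := itg_full_opp x01 bF hF.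
have bB : bmfR (fun t => phi (x - t) * k t) by exact: bmfM.
have bD : bmfR (fun t => phi (x + t) * k t) by exact: bmfM.
transitivity (2^-1 * (itg (-1) 1 (fun t => phi (x - t) * k t) - itg (-1) 1 (fun t => phi (x + t) * k t))); last first.
  by rewrite -itgB//; congr (_ * _); apply: eq_itg => t _; rewrite -mulrBl.
have -> : itg (-1) 1 (fun t => phi (x - t) * k t) = itg 0 1 F.
  by rewrite -e2; apply: eq_itg => t _; rewrite /F subKr.
have -> : itg (-1) 1 (fun t => phi (x + t) * k t) = - itg 0 1 F.
  rewrite -e1 -itgN; last exact: bmf_translate.
  by apply: eq_itg => t _; rewrite /F opprD addNKr kN mulrN opprK.
by rewrite opprK; field.
Qed.

Definition pvtrunc eps x := 2^-1 * itg (-1) 1 (fun t => pvdiff x t * hinv eps t).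
Definition pvval x := 2^-1 * itg (-1) 1 (fun t => pvdiff x t * t^-1).

Lemma pvdiff_le x t : `|pvdiff x t| <= 2 * La * `|t|.
Proof.
apply: (le_trans (phi_lip _ _)).
rewrite (_ : x - t - (x + t) = - (2 * t)) ?normrN ?normrM; last by ring.
by rewrite (gtr0_norm (ltr0n _ 2)) mulrCA mulrA.
Qed.

Lemma pvquot_le x t : `|pvdiff x t * t^-1| <= 2 * La.
Proof.
have [->|t0] := eqVneq t 0; first by rewrite invr0 mulr0 normr0 mulr_ge0.
by rewrite normrM normfV ler_pdivrMr ?normr_gt0// pvdiff_le.
Qed.

Lemma bmf_pvdiff x : bmfR (pvdiff x).
Proof. exact: bmfB. Qed.

Lemma bmf_pvquot x : bmfR (fun t => pvdiff x t * t^-1).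
Proof.
split; last by exists (2 * La) => t; exact: pvquot_le.
by apply: measurable_funM; [case: (bmf_pvdiff x) | exact: measurable_inv].
Qed.

Lemma pvtrunc_err eps x : 0 < eps -> `|pvtrunc eps x - pvval x| <= 3 * La * eps.
Proof.
move=> e0; rewrite /pvtrunc /pvval -mulrBr.
have b1 : bmfR (fun t => pvdiff x t * hinv eps t) by apply: bmfM; [exact: bmf_pvdiff | exact: bmf_hinv].
have b2 := bmf_pvquot x.
rewrite -itgB// normrM gtr0_norm//.
(* [ico] is half-open, so the interval is taken up to [2 * eps] to contain the point [eps]; hence
   the factor 3 in the bound. *)
have bi := bmfZ (2 * La) (bmf_ico (- eps) (2 * eps)).
have h t : -1 <= t <= 1 ->
    `|pvdiff x t * hinv eps t - pvdiff x t * t^-1| <= 2 * La * ico (- eps) (2 * eps) t.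
  move=> _; rewrite /hinv; case: ltP => ht.
    by rewrite subrr normr0 mulr_ge0 ?ico_ge0// mulr_ge0.
  rewrite mulr0 sub0r normrN ico_in ?mulr1 ?pvquot_le//; move: ht; rewrite ler_norml => /andP[? ?]; lra.
have := norm_itg_le (bmfB b1 b2) bi h.
rewrite itgZ; last exact: bmf_ico.
rewrite itg_ico// => /le_trans h2.
rewrite -ler_pdivlMl ?invr_gt0// invrK; apply: h2.
rewrite [leRHS](_ : _ = 2 * La * (3 * eps)); last by ring.
apply: ler_wpM2l; first by rewrite mulr_ge0.
have e3 : 0 <= 3 * eps by lra.
rewrite ge_max e3/=.
have : Num.min 1 (2 * eps) <= 2 * eps by rewrite ge_min lexx orbT.
have : - eps <= Num.max (- 1) (- eps) by rewrite le_max lexx orbT.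
lra.
Qed.

Lemma pvval_le x : `|pvval x| <= 2 * La.
Proof.
rewrite /pvval normrM gtr0_norm// ler_pdivrMl//.
apply: le_trans (norm_itg_le_cst _ (bmf_pvquot x) (fun t _ => pvquot_le x t)) _ => //.
lra.
Qed.

Let bnphi : bmfR (fun y => `|phi y|). Proof. exact: bmf_norm. Qed.
Let nphi_supp y : ~~ (0 <= y <= 1) -> `|phi y| = 0. Proof. by move=> /phi_supp ->; rewrite normr0. Qed.

(* For [|t| >= 3^-K] the kernels [ckap / t] and [Ker K t] differ by at most 2; below this
   scale both are [O(1 / |t|)], which the Lipschitz bound on [phi] makes harmless. *)
Lemma pvval_Ker K x : 0 <= x <= 1 ->
  `|ckap R * pvval x - itg 0 1 (fun y => phi y * Ker K (x - y))| <=
  2 * itg 0 1 (fun y => `|phi y|) + 16 * La * (3 ^+ K)^-1.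
Proof.
move=> x01; rewrite (itg_odd_kernel x01 (bmf_Ker R K) (KerN K)) /pvval mulrCA -mulrBr.
have b1 := bmf_pvquot x.
have b2 : bmfR (fun t => pvdiff x t * Ker K t) by apply: bmfM; [exact: bmf_pvdiff | exact: bmf_Ker].
rewrite -(itgZ _ _ _ b1) -(itgB _ _ (bmfZ _ b1) b2).
set e := (3 ^+ K)^-1.
have e0 : 0 < e by rewrite invr_gt0 exp3_gt0.
have bi := bmfZ (8 * La) (bmf_ico (- e) (2 * e)).
have bp := bmfD (bmf_reflect x bnphi) (bmf_translate x bnphi).
have h t : -1 <= t <= 1 -> `|ckap R * (pvdiff x t * t^-1) - pvdiff x t * Ker K t| <=
    2 * (`|phi (x - t)| + `|phi (x + t)|) + 8 * La * ico (- e) (2 * e) t.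
  move=> _; rewrite mulrCA -mulrBr normrM.
  have p1 : `|pvdiff x t| <= `|phi (x - t)| + `|phi (x + t)| by exact: ler_normB.
  have [ht|ht] := leP 1 (3 ^+ K * `|t|).
    apply: ler_wpDr; first by rewrite mulr_ge0 ?ico_ge0// mulr_ge0.
    rewrite mulrC; apply: ler_pM => //.
    by rewrite distrC; exact: Ker_asymp.
  apply: ler_wpDl; first by rewrite mulr_ge0// addr_ge0.
  have te : `|t| < e by rewrite -(ltr_pM2l (exp3_gt0 R K)) mulfV// gt_eqF// exp3_gt0.
  rewrite ico_in ?mulr1; last 2 first.
  - by move: te; rewrite ltr_norml => /andP[? _]; exact: ltW.
  - by move: te; rewrite ltr_norml => /andP[_ ?]; lra.
  apply: (@le_trans _ _ (2 * La * (`|t| * `|ckap R * t^-1 - Ker K t|))).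
    by rewrite mulrA; apply: ler_wpM2r (pvdiff_le x t).
  rewrite (_ : 8 * La = 2 * La * 4); last by ring.
  apply: ler_wpM2l; first by rewrite mulr_ge0.
  have k1 := Ker_mul_bound K t; have k2 := ckap_le R; have k3 := ckap_gt0 R.
  apply: (@le_trans _ _ (`|t| * (`|ckap R * t^-1| + `|Ker K t|))); first by apply: ler_wpM2l => //; exact: ler_normB.
  have : `|t| * `|ckap R * t^-1| <= 2.
    rewrite -normrM mulrCA; have [->|t0] := eqVneq t 0; first by rewrite mul0r mulr0 normr0.
    by rewrite mulfV// mulr1 gtr0_norm.
  rewrite mulrDr; lra.
have := norm_itg_le (bmfB (bmfZ _ b1) b2) (bmfD (bmfZ 2 bp) bi) h.
rewrite (itgD _ _ (bmfZ 2 bp) bi) (itgZ _ _ 2 bp) (itgZ _ _ _ (bmf_ico (- e) (2 * e))).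
rewrite (itgD _ _ (bmf_reflect x bnphi) (bmf_translate x bnphi)).
rewrite (itg_full x01 bnphi nphi_supp) (itg_full_opp x01 bnphi nphi_supp).
rewrite itg_ico//; set P := itg 0 1 _; set J := `|_| => hJ.
have : Num.max 0 (Num.min 1 (2 * e) - Num.max (- 1) (- e)) <= 3 * e.
  have e3 : 0 <= 3 * e by lra.
  rewrite ge_max e3/=.
  have : Num.min 1 (2 * e) <= 2 * e by rewrite ge_min lexx orbT.
  have : - e <= Num.max (- 1) (- e) by rewrite le_max lexx orbT.
  lra.
have La8 : 0 <= 8 * La by rewrite mulr_ge0.
move=> /(ler_wpM2l La8) hM.
have Le0 : 0 <= La * e by rewrite mulr_ge0// ltW.
rewrite normrM gtr0_norm// ler_pdivrMl//.
apply: (le_trans hJ); apply: (@le_trans _ _ (2 * (P + P) + 8 * La * (3 * e))); first by rewrite lerD2l.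
rewrite mulrDr; lra.
Qed.

End PrincipalValue.

Section ModulatedPrincipalValue.
Variable R : realType.
Notation RR := (measurableTypeR R).
Notation bmfR := (@bmf _ RR R).
Notation sleb := (@completed_lebesgue_measure R : {sigma_finite_measure set (lebR R) -> \bar R}).
Implicit Types (x y t eps : R).

Lemma lim_at_right0 (I : R -> R) (L c e0 : R) : 0 < e0 -> 0 <= c ->
  (forall eps, 0 < eps -> eps < e0 -> `|L - I eps| <= c * eps) -> lim (I eps @[eps --> 0^'+]) = L.
Proof.
move=> p0 c0 h; apply/cvg_lim => //; apply/cvgrPdist_le => e ep.
have c1 : 0 < c + 1 by rewrite ltr_wpDl.
near=> eps.
have eps0 : 0 < eps by near: eps; exact: nbhs_right_gt.
apply: le_trans (h eps eps0 _) _; first by near: eps; exact: nbhs_right_lt.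
apply: (@le_trans _ _ ((c + 1) * eps)); first by rewrite ler_wpM2r ?(ltW eps0)// lerDl.
by rewrite -ler_pdivlMl//; near: eps; apply: nbhs_right_le; rewrite mulr_gt0 ?invr_gt0.
Unshelve. all: by end_near.
Qed.

Lemma measurable_away x eps : measurable_fun setT (fun y : RR => eps < `|x - y|).
Proof.
apply: (@measurable_fun_ltr _ RR R setT (fun=> eps) (fun y => `|x - y|)) => //.
apply: continuous_measurable_fun; apply: (@lipschitz_continuous _ 1) => y y'.
rewrite mul1r; apply: (le_trans (ler_dist_dist _ _)).
by rewrite (_ : x - y - (x - y') = - (y - y')) ?normrN//; ring.
Qed.

Lemma bmf_away x eps : bmfR (fun y => (eps < `|x - y|)%R%:R).
Proof. exact: bmf_bool (measurable_away x eps). Qed.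

(** For [eps] below both [x] and [1 - x] the wrap-around term of [tdist] imposes no condition, so
    that the domain is the part of the torus with [|x - y| > eps]. *)
Lemma Rintegral_away (g G : R -> R) x eps : 0 < eps -> eps < x -> eps < 1 - x -> bmfR G ->
  (forall y, 0 <= y < 1 -> eps < `|x - y| -> g y = G y) ->
  (forall y, 0 <= y < 1 -> ~~ (eps < `|x - y|) -> G y = 0) ->
  \int[@leb R]_(y in [set y : R | torus y /\ eps < tdist x y]) g y = itg 0 1 G.
Proof.
move=> e0 ex ex1 bG h1 h2.
rewrite -Rintegral_torus//.
have mA : @measurable _ RR [set y : R | eps < `|x - y| ].
  rewrite -[X in measurable X]setTI; exact: (measurable_away x eps measurableT).
rewrite (_ : [set y | _] = @torus R `&` [set y : R | eps < `|x - y| ]); last first.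
  apply/seteqP; split => y /= [ty]; rewrite /tdist lt_min => h; split => //.
    by case/andP: h.
  rewrite h/=; move: ty; rewrite /torus/= => /andP[y0 y1].
  rewrite ltrBrDr -ltrBrDl ltr_norml; apply/andP; split; lra.
rewrite bint_mkcond; last exact: borel_lebR.
apply: eq_Rintegral => y /set_mem ty; rewrite indicE.
have [h|h] := boolP (eps < `|x - y|); first by rewrite mem_set// mulr1 h1.
by rewrite memNset ?mulr0 ?h2//; exact/negP.
Qed.

Lemma pvint_pvval (phi : R -> R) (La x : R) : bmfR phi -> (forall x y, `|phi x - phi y| <= La * `|x - y|) ->
  (forall y, ~~ (0 <= y <= 1) -> phi y = 0) -> 0 < x < 1 ->
  lim ((\int[@leb R]_(y in [set y : R | torus y /\ eps < tdist x y]) ((x - y)^-1 * phi y))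
    @[eps --> 0^'+]) = pvval phi x.
Proof.
move=> bphi phi_lip phi_supp /andP[x0 x1].
have x01 : 0 <= x <= 1 by rewrite !ltW.
have La0 : 0 <= 3 * La by have := phi_lip 1 0; rewrite subr0 normr1 mulr1 => /(le_trans (normr_ge0 _)); lra.
apply: (lim_at_right0 (e0 := Num.min x (1 - x)) (c := 3 * La)) => //; first by rewrite lt_min x0 subr_gt0.
move=> eps e0; rewrite lt_min => /andP[ex ex1].
have bh : bmfR (fun y => hinv eps (x - y)) by apply: bmf_reflect; exact: bmf_hinv.
rewrite (Rintegral_away e0 ex ex1 (bmfM bphi bh)).
- rewrite (itg_odd_kernel bphi phi_supp x01 (bmf_hinv e0) (hinvN eps)) distrC; exact: pvtrunc_err.
- by move=> y _ h; rewrite /hinv h mulrC.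
- by move=> y _ /negbTE h; rewrite /hinv h mulr0.
Qed.

Variables (f : R -> R) (Lf : R).
Hypotheses (f1 : forall y, `|f y| <= 1) (f_lip : forall x y, `|f x - f y| <= Lf * `|x - y|)
  (f_supp : forall y, ~~ (0 <= y <= 1) -> f y = 0).

Definition modf (tr : R -> R) (k : nat) y := tr (2 * pi * k%:R * y) * f y.

Let bf : bmfR f. Proof. by apply: (bmf_lipschitz f_lip); exists 1. Qed.

Lemma bmf_modf tr k : half_wave tr -> bmfR (modf tr k).
Proof.
move=> htr; apply: bmfM => //.
by have := bmf_affine (2 * pi * k%:R) 0 (bmf_half_wave htr); under eq_fun do rewrite addr0.
Qed.

Lemma modf_lip tr k x y : half_wave tr ->
  `|modf tr k x - modf tr k y| <= (2 * pi * k%:R + Lf) * `|x - y|.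
Proof.
move=> [tr1 trl _]; rewrite /modf; set u := 2 * pi * k%:R.
rewrite (_ : _ - _ = (tr (u * x) - tr (u * y)) * f x + tr (u * y) * (f x - f y)); last by ring.
rewrite [leRHS]mulrDl; apply: (le_trans (ler_normD _ _)); rewrite !normrM; apply: lerD.
  have u0 : 0 <= u by rewrite mulr_ge0// mulr_ge0// pi_ge0.
  rewrite -[leRHS]mulr1; apply: ler_pM => //.
  by apply: (le_trans (trl _ _)); rewrite -mulrBr normrM ger0_norm.
by rewrite -[leRHS]mul1r; apply: ler_pM.
Qed.

Lemma modf_supp tr k y : ~~ (0 <= y <= 1) -> modf tr k y = 0.
Proof. by move=> /f_supp; rewrite /modf => ->; rewrite mulr0. Qed.

Lemma modf_le tr k y : half_wave tr -> `|modf tr k y| <= `|f y|.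
Proof. by move=> [tr1 _ _]; rewrite normrM ler_piMl. Qed.

Lemma half_wave_opp tr : half_wave tr -> half_wave (fun t => - tr t :> R).
Proof.
move=> [h1 h2 h3]; split=> [t|s t|t]; rewrite ?normrN//; first by rewrite -opprD normrN.
by rewrite h3.
Qed.

Lemma carleson_linear_pvval N (x : lebR R) : 0 < (x : R) < 1 ->
  carleson_linear N (fun y => (f y)%:C%C) x =
  (pvval (modf cos (N x)) x +i* pvval (modf (fun t => - sin t) (N x)) x)%C.
Proof.
move=> x01; rewrite /carleson_linear /pvint.
have hc := half_wave_cos R; have hs := half_wave_opp (half_wave_sin R).
pose h (y : lebR R) := (((x : R) - (y : R))^-1)%:C%C * cexp2pi (- ((N x)%:R * (y : R))) * (f y)%:C%C.
rewrite -/h.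
have hRe y : complex.Re (h y) = ((x : R) - y)^-1 * modf cos (N x) y.
  rewrite /h /cexp2pi /modf /= mulrN cosN sinN !(mul0r, mulr0, subr0, addr0, oppr0).
  by rewrite -!mulrA.
have hIm y : complex.Im (h y) = ((x : R) - y)^-1 * modf (fun t => - sin t) (N x) y.
  rewrite /h /cexp2pi /modf /= mulrN cosN sinN !(mul0r, mulr0, subr0, addr0, add0r, oppr0).
  by rewrite -!mulrA.
congr (_ +i* _)%C.
- rewrite -(pvint_pvval (bmf_modf (N x) hc) (fun a b => modf_lip (N x) a b hc) (fun y => modf_supp cos (N x) (y:=y)) x01).
  rewrite (_ : (fun eps : R => complex.Re _) = fun eps =>
    \int[@leb R]_(y in [set y : R | torus y /\ eps < tdist x y]) (((x : R) - y)^-1 * modf cos (N x) y))//.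
  by apply/funext => eps; apply: eq_Rintegral => y _; exact: hRe.
- rewrite -(pvint_pvval (bmf_modf (N x) hs) (fun a b => modf_lip (N x) a b hs) (fun y => modf_supp _ (N x) (y:=y)) x01).
  rewrite (_ : (fun eps : R => complex.Im _) = fun eps =>
    \int[@leb R]_(y in [set y : R | torus y /\ eps < tdist x y]) (((x : R) - y)^-1 * modf (fun t => - sin t) (N x) y))//.
  by apply/funext => eps; apply: eq_Rintegral => y _; exact: hIm.
Qed.

End ModulatedPrincipalValue.

(** * The L^1 bound for the linearized operator on Lipschitz functions *)

Section LinearizedBound.
Variable R : realType.
Notation RR := (measurableTypeR R).
Notation bmfR := (@bmf _ RR R).
Notation bmfL := (@bmf _ (lebR R) R).
Notation sleb := (@completed_lebesgue_measure R : {sigma_finite_measure set (lebR R) -> \bar R}).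
Notation TT := (@torus R).
Implicit Types (x y t eps : R).

(* Unlike [Num.sg], this sign never vanishes. *)
Definition sgn (v : R) : R := if 0 <= v then 1 else -1.

Lemma norm_sgn v : `|sgn v| = 1.
Proof. by rewrite /sgn; case: ifP => _; rewrite ?normrN normr1. Qed.

Lemma sgn_mul v : sgn v * v = `|v|.
Proof. by rewrite /sgn; case: ltP => h; [rewrite mulN1r ltr0_norm | rewrite mul1r ger0_norm]. Qed.

Lemma bmf_sgn d (T : measurableType d) (h : T -> R) : bmf h -> bmf (fun z => sgn (h z)).
Proof.
move=> [mh _]; split; last by exists 1 => z; rewrite norm_sgn.
have -> : (fun z => sgn (h z)) = fun z => 2 * (0 <= h z)%R%:R - 1.
  by apply/funext => z; rewrite /sgn; case: (0 <= h z) => /=; ring.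
have b1 : bmf (fun z => (0 <= h z)%R%:R : R).
  by apply: bmf_bool; apply: measurable_fun_ler => //; exact: measurable_cst.
by case: (bmfB (bmfZ 2 b1) (bmf_cst T (1 : R))).
Qed.

Variables (N : lebR R -> nat) (mN : measurable_fun setT N).
Variables (f : R -> R) (Lf : R).
Hypotheses (f1 : forall y, `|f y| <= 1) (f_lip : forall x y, `|f x - f y| <= Lf * `|x - y|)
  (f_supp : forall y, ~~ (0 <= y <= 1) -> f y = 0).
Variables (tr : R -> R) (htr : half_wave tr).

Let bf : bmfR f. Proof. by apply: (bmf_lipschitz f_lip); exists 1. Qed.

Let mid : measurable_fun [set: lebR R] (id : lebR R -> RR) := @measurable_id_lebR R.

Lemma measurable_shear s : measurable_fun setT (fun p : lebR R * RR => (p.1 : R) + s * p.2 : RR).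
Proof.
apply: measurable_funD.
  exact (measurableT_comp mid measurable_fst).
by apply: measurable_funM; [exact: measurable_cst | exact: measurable_snd].
Qed.

Lemma bmf_modf_param : bmf (fun p : RR * lebR R => modf f tr (N p.2) p.1).
Proof.
apply: bmfM; last by apply: (bmf_comp (phi := fst) bf); exact: measurable_fst.
apply: (bmf_comp (phi := fun p : RR * lebR R => (2 * pi * (N p.2)%:R * (p.1 : R) : RR)) (bmf_half_wave htr)).
apply: measurable_funM; last exact: measurable_fst.
apply: measurable_funM; first exact: measurable_cst.
exact (measurableT_comp (f := fun k : nat => (k%:R : RR)) (fun _ _ _ => I) (measurableT_comp mN measurable_snd)).
Qed.

Lemma bmf_modf_shear s : bmf (fun p : lebR R * RR => modf f tr (N p.1) ((p.1 : R) + s * p.2)).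
Proof.
apply: (bmf_comp (phi := fun p : lebR R * RR => ((p.1 : R) + s * p.2 : RR, p.1)) bmf_modf_param).
by apply/measurable_fun_pairP; split; [exact: measurable_shear | exact: measurable_fst].
Qed.

Definition linpv (x : lebR R) := pvval (modf f tr (N x)) x.

Let lip k a b := modf_lip f1 f_lip k a b htr.
Let bphi k := bmf_modf f1 f_lip k htr.
Let supp k := fun y => @modf_supp R f f_supp tr k y.

Lemma bmf_pvtrunc_param eps : 0 < eps -> bmfL (fun x => pvtrunc (modf f tr (N x)) eps x).
Proof.
move=> e0; apply: bmfZ; apply: bmf_itg.
apply: bmfM; last by apply: (bmf_comp (phi := snd) (bmf_hinv e0)); exact: measurable_snd.
have b1 := bmf_modf_shear (-1); have b2 := bmf_modf_shear 1.
have := bmfB b1 b2; congr bmf; apply/funext => p.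
by rewrite mulN1r mul1r.
Qed.

(** A pointwise limit of the truncations at [1 / (k + 1)], whose kernels are bounded and jointly
    measurable. *)
Lemma measurable_linpv : measurable_fun setT linpv.
Proof.
have e0 k : 0 < k.+1%:R^-1 :> R by rewrite invr_gt0.
apply: (@measurable_fun_cvg _ (lebR R) R setT (fun k (x : lebR R) => pvtrunc (modf f tr (N x)) k.+1%:R^-1 x)).
  by move=> k; case: (bmf_pvtrunc_param (e0 k)).
move=> x _; apply/cvgrPdist_le => e e1.
set La := 2 * pi * (N x)%:R + Lf.
have hk k : `|linpv x - pvtrunc (modf f tr (N x)) k.+1%:R^-1 x| <= (3 * La) * k.+1%:R^-1.
  by rewrite distrC; exact: (pvtrunc_err (bphi (N x)) (lip (N x)) x (e0 k)).
near=> k; apply: le_trans (hk k) _.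
apply: (@le_trans _ _ ((`|3 * La| + 1) * k.+1%:R^-1)).
  by apply: ler_wpM2r; [rewrite ltW|rewrite ler_wpDr// ler_norm].
have p : 0 < `|3 * La| + 1 by rewrite ltr_wpDl.
rewrite -ler_pdivlMl//; apply: ltW; near: k.
have q : 0 < (`|3 * La| + 1)^-1 * e by rewrite mulr_gt0// invr_gt0.
exact: (near_infty_natSinv_lt (PosNum q)).
Unshelve. all: by end_near.
Qed.

Lemma linpv_le x : `|linpv x| <= 2 * (2 * pi * (N x)%:R + Lf).
Proof. exact: (pvval_le (bphi (N x)) (lip (N x))). Qed.

Let Lf0 : 0 <= Lf.
Proof. by have := f_lip 1 0; rewrite subr0 normr1 mulr1; exact: le_trans. Qed.

Lemma bmf_cutoff m : bmfL (fun x => (N x <= m)%N%:R).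
Proof. by apply: bmf_bool; apply: (measurableT_comp (f := fun k => (k <= m)%N)). Qed.

Lemma bmf_cutoff_linpv m : bmfL (fun x => (N x <= m)%N%:R * `|linpv x|).
Proof.
split.
  apply: measurable_funM; first exact: (proj1 (bmf_cutoff m)).
  apply: measurableT_comp; [exact: normr_measurable | exact: measurable_linpv].
exists (2 * (2 * pi * m%:R + Lf)) => x.
have La0 : 0 <= 2 * pi * m%:R + Lf by rewrite addr_ge0// mulr_ge0// mulr_ge0// pi_ge0.
rewrite normrM normr_nat normr_id; case: (leqP (N x) m) => h; last by rewrite mul0r mulr_ge0.
rewrite mul1r; apply: le_trans (linpv_le x) _; apply: ler_wpM2l => //.
by rewrite lerD2r ler_wpM2l ?mulr_ge0 ?pi_ge0// ler_nat.
Qed.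

Variables (s : seq nat) (M : nat -> nat) (C : R).
Hypothesis Ns : forall x, N x \in s \/ exists i, N x = M i.
Hypothesis dual : forall K N g, (M 0 <= 3 ^ K)%N ->
  measurable_fun setT N -> (forall x : lebR R, N x \in s \/ exists i, N x = M i) ->
  (forall x, (N x <= 3 ^ K)%N) -> bmfL g -> (forall x, `|g x| <= 1) ->
  itg 0 1 (fun y => `|f y| * `|modop sleb TT id tr K N g y|) <= C.

Let MK K (x : lebR R) := itg 0 1 (fun y => modf f tr (N x) y * Ker K ((x : R) - y)).

Lemma bmf_MK_kernel K : bmf (fun p : RR * lebR R => modf f tr (N p.2) p.1 * Ker K ((p.2 : R) - p.1)).
Proof. by apply: bmfM bmf_modf_param _; exact: (bmf_shift_fun2 mid (bmf_Ker R K)). Qed.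

Let bMK K : bmfL (MK K).
Proof. apply: bmf_itg; exact: (bmf_swap (f := fun (y : RR) (x : lebR R) => modf f tr (N x) y * Ker K ((x : R) - y)) (bmf_MK_kernel K)). Qed.

(** The dual bound is tested with the sign of the truncated operator. It requires [N <= 3^K]
    everywhere, so points with [N x > m] get weight 0 and frequency [M 0]. *)
Lemma truncated_dual m K : (m <= 3 ^ K)%N -> (M 0 <= 3 ^ K)%N ->
  \int[sleb]_(x in TT) ((N x <= m)%N%:R * `|MK K x|) <= C.
Proof.
move=> mK M0K.
pose N' (x : lebR R) := if (N x <= m)%N then N x else M 0.
pose g (x : lebR R) : R := (N x <= m)%N%:R * sgn (MK K x).
have mN' : measurable_fun setT N' by apply: (measurableT_comp (f := fun k => if (k <= m)%N then k else M 0)).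
have Ns' x : N' x \in s \/ exists i, N' x = M i by rewrite /N'; case: ifP => // _; right; exists 0%N.
have NK' x : (N' x <= 3 ^ K)%N by rewrite /N'; case: ifP => // h; exact: leq_trans h mK.
have bg : bmfL g.
  apply: bmfM.
    by apply: bmf_bool; apply: (measurableT_comp (f := fun k => (k <= m)%N)).
  exact: bmf_sgn.
have g1 x : `|g x| <= 1.
  by rewrite /g normrM normr_nat norm_sgn mulr1; case: (N x <= m)%N.
apply: le_trans (dual M0K mN' Ns' NK' bg g1).
have b2 := bmf_MK_kernel K.
have b3 : bmf (fun p : RR * lebR R => g p.2 * (modf f tr (N p.2) p.1 * Ker K ((p.2 : R) - p.1))).
  by apply: bmfM _ b2; apply: (bmf_comp (phi := snd) bg); exact: measurable_snd.
rewrite (_ : \int[sleb]_(x in TT) _ = \int[sleb]_(x in TT) itg 0 1 (fun y => g x * (modf f tr (N x) y * Ker K ((x : R) - y)))); last first.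
  apply: eq_Rintegral => x _; rewrite itgZ; last exact: (bmf_fst (f := fun (y : RR) (x : lebR R) => modf f tr (N x) y * Ker K ((x : R) - y)) x b2).
  by rewrite -/(MK K x) /g -mulrA sgn_mul.
rewrite -(itg_bint_swap 0 1 (findom_torus R) b3).
have bm : bmfR (modop sleb TT id tr K N' g) by exact: (bmf_modop (findom_torus R) mid).
apply: le_itg.
- exact: (bmf_bint (findom_torus R) b3).
- by apply: bmfM; exact: bmf_norm.
move=> y _; rewrite -normrM; apply: le_trans (ler_norm _).
rewrite /modop -bintZ; [|exact: findom_torus|]; last first.
  exact: (bmf_modop_integrand mid).
apply: le_bint; first exact: findom_torus.
- exact: (bmf_snd (f := fun (y : RR) (x : lebR R) => g x * (modf f tr (N x) y * Ker K ((x : R) - y))) y b3).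
- apply: bmfZ; exact: (bmf_modop_integrand mid).
move=> x _; rewrite /modf /N' /g; case: ifP => h; last by rewrite !mul0r mulr0.
by rewrite le_eqVlt; apply/orP; left; apply/eqP; rewrite /=; ring.
Qed.

Let P1 : R := itg 0 1 (fun y => `|f y|).

(** The cutoff at [m] gives all the functions [modf f tr (N x)] involved one common Lipschitz
    constant [La]. The error [16 La 3^-K] in [pvval_Ker] is then uniform in [x] and disappears as
    [K] grows. *)
Lemma truncated_linpv m :
  \int[sleb]_(x in TT) ((N x <= m)%N%:R * `|linpv x|) <= (ckap R)^-1 * (C + 2 * P1).
Proof.
rewrite ler_pdivlMl ?ckap_gt0//; apply/ler_addgt0Pl => e e0.
set La := 2 * pi * m%:R + Lf.
have La0 : 0 <= La by rewrite addr_ge0// mulr_ge0// mulr_ge0// pi_ge0.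
have [K [mK M0K eK]] : exists K, [/\ (m <= 3 ^ K)%N, (M 0 <= 3 ^ K)%N & 16 * La * (3 ^+ K)^-1 <= e].
  have [q hq] : exists q : nat, e^-1 * (16 * La) <= q%:R.
    exists (Num.truncn (e^-1 * (16 * La))).+1; apply/ltW; exact: truncnS_gt.
  have h3 k : (k <= 3 ^ k)%N by apply/ltnW/ltn_expl.
  exists (m + (M 0 + q))%N; split.
  - by apply: leq_trans (h3 m) _; rewrite leq_exp2l// leq_addr.
  - by apply: leq_trans (h3 _) _; rewrite leq_exp2l//; apply: leq_trans (leq_addr q _) (leq_addl _ _).
  rewrite ler_pdivrMr ?exp3_gt0// -ler_pdivrMl//; apply: le_trans hq _.
  rewrite -natrX ler_nat; apply: leq_trans (h3 q) _; rewrite leq_exp2l//.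
  exact: leq_trans (leq_addl _ _) (leq_addl _ _).
have bP := bmf_cutoff_linpv m.
have bM : bmfL (fun x => (N x <= m)%N%:R * `|MK K x|) by exact: (bmfM (bmf_cutoff m) (bmf_norm (bMK K))).
have hT := findom_torus R.
rewrite -(bintZ _ hT bP).
have bc := bmf_cst (lebR R) (2 * P1 + 16 * La * (3 ^+ K)^-1).
apply: (@le_trans _ _ (\int[sleb]_(x in TT) ((N x <= m)%N%:R * `|MK K x| + (2 * P1 + 16 * La * (3 ^+ K)^-1)))).
  apply: (le_bint hT (bmfZ _ bP) (bmfD bM bc)) => x tx; have x01 : 0 <= (x : R) <= 1 by move: tx; rewrite /torus/= => /andP[-> /ltW].
  have P0 : 0 <= P1 by exact: itg_ge0.
  case: (leqP (N x) m) => h; last first.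
    by rewrite !mul0r mulr0 add0r addr_ge0 ?mulr_ge0// invr_ge0 ltW ?exp3_gt0.
  rewrite !mul1r.
  have := pvval_Ker (bphi (N x)) (lip (N x)) (supp (N x)) K x01.
  rewrite -/(linpv x) -/(MK K x) => h1.
  have h2 : itg 0 1 (fun y => `|modf f tr (N x) y|) <= P1.
    by apply: le_itg => [||y _]; [exact: bmf_norm|exact: bmf_norm|exact: modf_le].
  have h3 : 16 * (2 * pi * (N x)%:R + Lf) * (3 ^+ K)^-1 <= 16 * La * (3 ^+ K)^-1.
    apply: ler_wpM2r; first by rewrite invr_ge0 ltW ?exp3_gt0.
    by apply: ler_wpM2l => //; rewrite lerD2r ler_wpM2l ?mulr_ge0 ?pi_ge0// ler_nat.
  have h4 := ler_normD (ckap R * linpv x - MK K x) (MK K x).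
  rewrite subrK normrM (gtr0_norm (ckap_gt0 R)) in h4.
  apply: le_trans h4 _; lra.
rewrite (bintD hT bM bc) (bint_cst _ hT) [X in fine X]leb_torus mulr1.
have := truncated_dual mK M0K; rewrite -/P1; lra.
Qed.

(** The bound of [truncated_linpv] does not involve the cutoff [m], which is therefore removed by
    monotone convergence; this admits unbounded [N]. *)
Lemma linpv_L1 : (\int[@leb R]_(x in TT) (`|linpv x|)%:E <= ((ckap R)^-1 * (C + 2 * P1))%:E)%E.
Proof.
pose G m (x : lebR R) := ((N x <= m)%N%:R * `|linpv x|)%:E.
have mG m : measurable_fun TT (G m).
  by apply/measurable_EFinP; apply: measurable_funTS; exact: (proj1 (bmf_cutoff_linpv m)).
have G0 m x : TT x -> (0 <= G m x)%E by move=> _; rewrite lee_fin mulr_ge0.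
have ndG x : TT x -> {homo G^~ x : a b / (a <= b)%N >-> (a <= b)%E}.
  move=> _ a b ab; rewrite lee_fin ler_wpM2r// ler_nat.
  by case: (leqP (N x) a) => // h; rewrite (leq_trans h ab).
have mT : measurable TT by case: (findom_torus R).
have cv := cvg_monotone_convergence (mu := @leb R) mT mG G0 ndG.
have lG x : limn (G^~ x) = (`|linpv x|)%:E.
  apply/cvg_lim => //; apply: cvg_near_cst; exists (N x) => //= m hm.
  by rewrite /G hm mul1r.
have -> : (\int[@leb R]_(x in TT) (`|linpv x|)%:E = \int[@leb R]_(x in TT) limn (G^~ x))%E.
  by apply: eq_integral => x _; rewrite lG.
rewrite -(cvg_lim _ cv)//; apply: lime_le; first exact: cvgP cv.
apply: nearW => m.
have hT := findom_torus R.
rewrite (bintE hT (bmf_cutoff_linpv m)) lee_fin; exact: truncated_linpv.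
Qed.

End LinearizedBound.

(** * From test functions to measurable sets *)

Section SetExtension.
Variable R : realType.
Notation lm := (@lebesgue_measure R).
Notation RR := (measurableTypeR R).
Notation bmfR := (@bmf _ RR R).
Notation TT := (@torus R).

Lemma min_lip (a b a' b' e : R) : `|a - a'| <= e -> `|b - b'| <= e -> `|Num.min a b - Num.min a' b'| <= e.
Proof.
rewrite !ler_norml => /andP[? ?] /andP[? ?].
by case: (leP a b) => ?; case: (leP a' b') => ?; apply/andP; split; lra.
Qed.

Lemma max0_lip (a a' e : R) : `|a - a'| <= e -> `|Num.max 0 a - Num.max 0 a'| <= e.
Proof.
rewrite !ler_norml => /andP[? ?].
by case: (leP 0 a) => ?; case: (leP 0 a') => ?; apply/andP; split; lra.
Qed.

Section Distance.
Variables (K : set R) (z0 : R).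
Hypothesis Kz0 : K z0.

Definition setdist y : R := inf [set `|y - z| | z in K].

Let hlb y : has_inf [set `|y - z| | z in K].
Proof. by split; [exists `|y - z0|, z0 | exists 0 => _ [z _ <-]; exact: normr_ge0]. Qed.

Lemma setdist_ge0 y : 0 <= setdist y.
Proof. by apply: lb_le_inf => [|_ [z _ <-] //]; case: (hlb y). Qed.

Lemma setdist_le y z : K z -> setdist y <= `|y - z|.
Proof. by move=> Kz; apply: ge_inf; [case: (hlb y) | exists z]. Qed.

Lemma setdist_lip x y : `|setdist x - setdist y| <= `|x - y|.
Proof.
have h a b : setdist a - setdist b <= `|a - b|.
  rewrite lerBlDr -lerBlDl; apply: lb_le_inf => [|_ [z Kz <-]]; first by case: (hlb b).
  rewrite lerBlDl; apply: le_trans (setdist_le a Kz) _.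
  by rewrite (_ : a - z = (a - b) + (b - z)) ?ler_normD//; ring.
by rewrite ler_norml h lerNl opprB distrC h.
Qed.

Lemma setdist0 y : K y -> setdist y = 0.
Proof.
move=> Ky; apply/eqP; rewrite eq_le setdist_ge0 andbT.
by have := setdist_le y Ky; rewrite subrr normr0.
Qed.

Lemma setdist_gt0 y : closed K -> ~ K y -> 0 < setdist y.
Proof.
move=> cK nK; have : nbhs y (~` K) by apply: open_nbhs_nbhs; split => //; exact: closed_openC.
move=> /nbhs_ballP[e /= e0 he]; apply: (lt_le_trans e0).
apply: lb_le_inf => [|_ [z Kz <-]]; first by case: (hlb y).
by rewrite leNgt; apply/negP => h; exact: (he z h Kz).
Qed.

(** The first term in the minimum tends to the indicator of [K]. The second makes the function
    vanish outside [[0, 1]] and is at least 1 for large [k] at each point of the open interval,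
    where [K] lies. *)
Definition bump (k : nat) y : R :=
  Num.max 0 (Num.min (1 - k%:R * setdist y) (k%:R * Num.min y (1 - y))).

Lemma bump01 k y : 0 <= bump k y <= 1.
Proof.
rewrite /bump le_max lexx/= ge_max ler01/= ge_min; apply/orP; left.
by rewrite lerBlDr lerDl mulr_ge0// setdist_ge0.
Qed.

Lemma bump_lip k x y : `|bump k x - bump k y| <= k%:R * `|x - y|.
Proof.
apply: max0_lip; apply: min_lip.
  rewrite (_ : 1 - _ - (1 - _) = - (k%:R * (setdist x - setdist y))); last by ring.
  by rewrite normrN normrM normr_nat ler_wpM2l// setdist_lip.
rewrite -mulrBr normrM normr_nat ler_wpM2l//; apply: min_lip => //.
by rewrite (_ : 1 - x - (1 - y) = - (x - y)) ?normrN//; ring.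
Qed.

Lemma bump_supp k y : ~~ (0 <= y <= 1) -> bump k y = 0.
Proof.
move=> h; apply/eqP; rewrite /bump eq_le le_max lexx/= andbT ge_max lexx/= ge_min.
apply/orP; right; rewrite mulr_ge0_le0// ge_min; move: h; rewrite negb_and -!ltNge subr_le0.
by move=> /orP[/ltW->|/ltW->]; rewrite ?orbT.
Qed.

Lemma bump_cvg y : closed K -> K `<=` [set y : R | 0 < y < 1] -> bump k y @[k --> \oo] --> (\1_K y : R).
Proof.
move=> cK K01; apply: cvg_near_cst; rewrite indicE.
have arch (e : R) : 0 < e -> \forall k \near \oo, 1 <= k%:R * e.
  move=> e0; exists (Num.truncn e^-1).+1 => // k /= hk.
  rewrite -ler_pdivrMr// div1r; apply/ltW; apply: (lt_le_trans (truncnS_gt _)).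
  by rewrite ler_nat.
have [Ky|nKy] := pselect (K y).
  rewrite mem_set//=; have /andP[y0 y1] := K01 y Ky.
  have w0 : 0 < Num.min y (1 - y) by rewrite lt_min y0 subr_gt0.
  apply: filterS (arch _ w0) => k hk; rewrite /bump setdist0// mulr0 subr0.
  by rewrite (min_idPl hk) (max_idPr ler01).
rewrite memNset//=; have d0 := setdist_gt0 cK nKy.
apply: filterS (arch _ d0) => k hk; apply/max_idPl.
by rewrite ge_min subr_le0 hk.
Qed.

End Distance.

Lemma Rintegral_dominated_cvg d (T : measurableType d) (nu : {measure set T -> \bar R}) (D : set T)
    (h_ : nat -> T -> R) (h u : T -> R) : measurable D -> nu.-integrable D (EFin \o u) ->
  (forall k, measurable_fun D (h_ k)) -> measurable_fun D h -> (forall k x, `|h_ k x| <= 1) ->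
  {ae nu, forall x, D x -> h_ ^~ x @ \oo --> h x} ->
  \int[nu]_(x in D) (h_ k x * u x) @[k --> \oo] --> \int[nu]_(x in D) (h x * u x).
Proof.
move=> mD iu mh_ mh h1 hae.
have mu : measurable_fun D u by apply/measurable_EFinP; exact: measurable_int iu.
have [] := @dominated_convergence d T R nu D mD (fun k x => (h_ k x * u x)%:E) (fun x => (h x * u x)%:E)
  (fun x => `|(u x)%:E|%E).
- by move=> k; apply/measurable_EFinP; exact: measurable_funM.
- by apply/measurable_EFinP; exact: measurable_funM.
- apply: filterS hae => x hx Dx; apply: cvg_EFin; first exact: nearW.
  by apply: cvgM (hx Dx) _; exact: cvg_cst.
- exact: integrable_abse.
- by apply: aeW => x k _; rewrite lee_fin normrM ler_piMl.
move=> ih _ hc; apply: fine_cvg; rewrite fineK//; exact: integrable_fin_num.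
Qed.

Variables (u : lebR R -> R) (A b : R).
Hypotheses (iu : (@leb R).-integrable TT (EFin \o u)) (A0 : 0 <= A) (b0 : 0 <= b).
Hypothesis Hu : forall (f : R -> R) Lf, (forall y, `|f y| <= 1) ->
  (forall x y, `|f x - f y| <= Lf * `|x - y|) -> (forall y, ~~ (0 <= y <= 1) -> f y = 0) ->
  `|\int[@leb R]_(x in TT) (f x * u x)| <= A * itg 0 1 (fun y => `|f y|) + b.

Let mTT : measurable TT. Proof. by case: (findom_torus R). Qed.

Let i1 : (@leb R).-integrable TT (EFin \o (fun=> 1 : R)).
Proof. exact: (bmf_integrable (findom_torus R) (bmf_cst _ 1)). Qed.

Lemma closed_integral_bound (K : set R) : closed K -> K `<=` [set y : R | 0 < y < 1] ->
  `|\int[@leb R]_(x in TT) (\1_K x * u x)| <= A * fine (leb K) + b.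
Proof.
move=> cK K01.
have mK : @measurable _ RR K by exact: closed_measurable.
have mK' := borel_lebR mK.
have KE : fine (leb K) = \int[@leb R]_(x in TT) (\1_K x * 1).
  transitivity (\int[@leb R]_(x in TT `&` K) (fun=> 1) x); last first.
    by rewrite bint_mkcond; [|exact: mK']; apply: eq_Rintegral => x _; rewrite mulrC.
  have -> : TT `&` K = K.
    apply/seteqP; split => x; first by case.
    by move=> Kx; split => //; have /andP[/ltW x0 x1] := K01 x Kx; rewrite /torus/= x0 x1.
  by rewrite Rintegral_cst// mul1r.
have [[z0 Kz0]|nK] := pselect (exists z, K z); last first.
  rewrite (_ : \int[_]_(x in _) _ = 0).
    by rewrite normr0 addr_ge0// mulr_ge0// fine_ge0.
  transitivity (\int[@leb R]_(x in TT) (0 : R)).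
    apply: eq_Rintegral => x _; rewrite indicE memNset ?mul0r// => Kx; by apply: nK; exists x.
  by rewrite Rintegral_cst// mul0r.
pose h k := bump K k : R -> R.
have h1 k x : `|h k x| <= 1.
  by have /andP[p q] := bump01 Kz0 k x; rewrite ger0_norm.
have bh k : bmfR (h k) by apply: (bmf_lipschitz (L := k%:R)) => [x y|]; [exact: (bump_lip Kz0 k x y) | exists 1].
have mh k : measurable_fun TT (h k) by apply: measurable_funTS; exact: (proj1 (bmf_lebR (bh k))).
have m1 : measurable_fun TT (\1_K : lebR R -> R) by exact: measurable_indic.
have cvh : {ae (@leb R), forall x, TT x -> h ^~ x @ \oo --> (\1_K x : R)}.
  by apply: aeW => x _; exact: (bump_cvg Kz0).
have c1 := Rintegral_dominated_cvg mTT iu mh m1 h1 cvh.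
have c2 := Rintegral_dominated_cvg mTT i1 mh m1 h1 cvh.
have c3 : (A * \int[@leb R]_(x in TT) (h k x * 1) + b) @[k --> \oo] --> A * fine (leb K) + b.
  by rewrite KE; apply: cvgD; [apply: cvgM => //; exact: cvg_cst | exact: cvg_cst].
have c4 := cvg_norm c1.
apply: (ler_cvg_to (c4 _) c3); apply: nearW => k.
have e : \int[@leb R]_(x in TT) (h k x * 1) = itg 0 1 (fun y => `|h k y|).
  rewrite -Rintegral_torus; last exact: bmf_norm.
  apply: eq_Rintegral => x _; rewrite mulr1 ger0_norm//.
  by have /andP[] := bump01 Kz0 k x.
rewrite e; apply: Hu (h1 k) (bump_lip Kz0 k) _ => y; exact: bump_supp.
Qed.

(** [E] is a Borel set up to a null set, and the Borel part is exhausted, up to a null set, by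
    finite unions of compact subsets, to which [closed_integral_bound] applies. The point 0 is
    removed first, so that these subsets lie in the open interval. Integrability of [u] permits the
    passage to the limit. *)
Lemma set_integral_bound (E : set (lebR R)) : measurable E -> E `<=` TT ->
  `|\int[@leb R]_(x in TT) (\1_E x * u x)| <= A * fine (leb E) + b.
Proof.
move=> mE ET.
have : completed_algebra_gen (@lebesgue_measure R) E.
  by rewrite -g_sigma_completed_algebra_genE completed_caratheodory_measurable.
move=> [B mB [Z [Z' [mZ' Z'0 ZZ']] BZ]].
pose B' := B `\` [set (0 : R)].
have mB' : @measurable _ RR B' by apply: measurableD mB _; exact: measurable_set1.
have B'E : B' `<=` E by move=> x [Bx _]; rewrite -BZ; left.
have EB' x : E x -> ~ B' x -> x = 0 \/ Z' x.
  rewrite -BZ => -[Bx|/ZZ' ?] nB; last by right.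
  by left; apply: contrapT => x0; apply: nB; split.
have B'01 : B' `<=` [set y : R | 0 < y < 1].
  move=> x B'x; have := ET _ (B'E _ B'x); rewrite /torus/= => /andP[x0 ->].
  rewrite andbT lt_neqAle x0 andbT eq_sym; apply/eqP => x00.
  by case: B'x => _; apply.
have fB' : (@lebesgue_measure R B' < +oo)%E.
  apply: (@le_lt_trans _ _ (@lebesgue_measure R `[0, 1])); last by case: (@findom_cc R 0 1).
  apply: le_measure; rewrite ?inE//.
  by move=> x /B'01 /andP[/ltW x0 /ltW x1]; rewrite /= in_itv/= x0 x1.
have e0 k : 0 < k.+1%:R^-1 :> R by rewrite invr_gt0.
have /choice[V hV] : forall k, exists V : set R, [/\ compact V, V `<=` B' & (@lebesgue_measure R (B' `\` V) < (k.+1%:R^-1)%:E)%E].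
  by move=> k; exact: lebesgue_regularity_inner.
pose W k := \big[setU/set0]_(i < k) V i.
have WB k : W k `<=` B' by move=> x; rewrite /W -bigcup_mkord => -[i _]; case: (hV i) => _ + _; exact.
have cW k : closed (W k).
  rewrite /W; elim/big_ind: _ => [|X Y|i _]; [exact: closed0|exact: closedU|].
  by apply: compact_closed; [exact: Rhausdorff | case: (hV i)].
have bW k : `|\int[@leb R]_(x in TT) (\1_(W k) x * u x)| <= A * fine (leb E) + b.
  have WK01 : W k `<=` [set y : R | 0 < y < 1] by apply: subset_trans B'01; exact: WB.
  apply: le_trans (closed_integral_bound (cW k) WK01) _; rewrite lerD2r ler_wpM2l//.
  have fE : (leb E < +oo)%E.
    apply: le_lt_trans (_ : leb TT < _)%E; last by case: (findom_torus R).
    by apply: le_measure; rewrite ?inE.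
  have WE : (leb (W k) <= leb E)%E.
    apply: le_measure; rewrite ?inE//; last exact: subset_trans (WB k) B'E.
    by apply: borel_lebR; exact: closed_measurable.
  by apply: fine_le => //; rewrite ge0_fin_numE//; exact: le_lt_trans fE.
pose Zu := (B' `\` \bigcup_k V k) `|` ([set 0] `|` Z').
have mV k : @measurable _ RR (V k) by apply: closed_measurable; apply: compact_closed; [exact: Rhausdorff | case: (hV k)].
have mB'' : @measurable _ RR (B' `\` \bigcup_k V k) by apply: measurableD mB' _; exact: bigcupT_measurable.
have n1 : @lebesgue_measure R (B' `\` \bigcup_k V k) = 0%E.
  apply/eqP; rewrite eq_le measure_ge0 andbT; apply/lee_addgt0Pr => e ee; rewrite add0e.
  have [k hk] : exists k : nat, k.+1%:R^-1 <= e.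
    exists (Num.truncn e^-1); rewrite -[leRHS]invrK lef_pV2 ?posrE ?invr_gt0//.
    exact/ltW/truncnS_gt.
  apply: (@le_trans _ _ (k.+1%:R^-1)%:E); last by rewrite lee_fin.
  apply: le_trans (ltW (_ : @lebesgue_measure R (B' `\` V k) < _)%E); last by case: (hV k).
  apply: le_measure; rewrite ?inE//; first by apply: measurableD.
  by move=> x [Bx nV]; split => // Vx; apply: nV; exists k.
have cvW : {ae (@leb R), forall x, TT x -> (fun k => \1_(W k) x : R) @ \oo --> (\1_E x : R)}.
  have [Y [mY Y0 ZY]] : (@leb R).-negligible Zu.
    apply: negligibleU; first by exists (B' `\` \bigcup_k V k); split => //; exact: borel_lebR.
    apply: negligibleU; last by exists Z'; split => //; exact: borel_lebR.
    exists [set (0 : R)]; split => //; last exact: (lebesgue_measure_set1 0).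
    by apply: borel_lebR; exact: measurable_set1.
  exists Y; split => //; move=> x /= nx; apply: ZY; apply: contrapT => nZ; apply: nx => _.
  apply: cvg_near_cst; have [Ex|nEx] := pselect (E x); last first.
    apply: nearW => k; rewrite !indicE !memNset// => /WB /B'E; exact: nEx.
  have [B'x|nB'x] := pselect (B' x); last first.
    by exfalso; apply: nZ; right; case: (EB' x Ex nB'x) => ?; [left|right].
  have [[i _ Vi]|nV] := pselect ((\bigcup_k V k) x); last by exfalso; apply: nZ; left.
  exists i.+1 => // k /= ik; rewrite !indicE !mem_set//.
  by rewrite /W -bigcup_mkord; exists i.
have mW k : measurable_fun TT (\1_(W k) : lebR R -> R).
  by apply: measurable_indic; apply: borel_lebR; exact: closed_measurable.
have mIE : measurable_fun TT (\1_E : lebR R -> R) by exact: measurable_indic.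
have W1 k x : `|\1_(W k) x : R| <= 1 by rewrite indicE; case: (x \in W k); rewrite /= ?normr1 ?normr0.
have c1 := cvg_norm (Rintegral_dominated_cvg mTT iu mW mIE W1 cvW).
by apply: (ler_cvg_to (c1 _) (cvg_cst _)); apply: nearW => k; exact: bW.
Qed.

End SetExtension.

(** * Complex-valued functions in L^p of the torus *)

Section ComplexLp.
Variable R : realType.
Notation TT := (@torus R).
Notation mu := (@leb R).
Notation normc := (@ComplexField.Normc.normc R).
Implicit Types (w : lebR R -> R[i]).

Definition sqmod w (x : lebR R) : R := complex.Re (w x) ^+ 2 + complex.Im (w x) ^+ 2.

Lemma normcE w x : normc (w x) = Num.sqrt (sqmod w x).
Proof. by rewrite /sqmod; case: (w x). Qed.

Lemma Re_le_normc (z : R[i]) : `|complex.Re z| <= normc z.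
Proof. by case: z => a b /=; rewrite -sqrtr_sqr ler_wsqrtr// lerDl sqr_ge0. Qed.

Lemma Im_le_normc (z : R[i]) : `|complex.Im z| <= normc z.
Proof. by case: z => a b /=; rewrite -sqrtr_sqr ler_wsqrtr// lerDr sqr_ge0. Qed.

Lemma normc_le_ReIm (z : R[i]) : normc z <= `|complex.Re z| + `|complex.Im z|.
Proof.
case: z => a b /=; rewrite -[leRHS](ger0_norm (addr_ge0 (normr_ge0 a) (normr_ge0 b))) -sqrtr_sqr.
rewrite ler_wsqrtr// sqrrD !real_normK ?num_real// addrAC lerDl mulrn_wge0// mulr_ge0//.
Qed.

Let mTT : measurable TT. Proof. by case: (findom_torus R). Qed.

Lemma measurable_sqmod w : cmeasurable w -> measurable_fun TT (sqmod w).
Proof. by move=> [m1 m2]; apply: measurable_funD; exact: measurable_funX. Qed.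

Lemma measurable_normc w : cmeasurable w -> measurable_fun TT (fun x => normc (w x)).
Proof.
move=> mw; under eq_fun do rewrite normcE.
apply: measurableT_comp; last exact: measurable_sqmod.
by apply: continuous_measurable_fun; exact: sqrt_continuous.
Qed.

Lemma cLnorm1E w : cLnorm 1%:E w = (\int[mu]_(x in TT) (normc (w x))%:E)%E.
Proof.
rewrite /cLnorm /eLnorm Lnorm1 [RHS]integral_mkcond.
apply: eq_integral => x _; rewrite /patch; case: ifP => _; last by rewrite abse0.
by rewrite gee0_abs// lee_fin normcE sqrtr_ge0.
Qed.

Lemma cLnorm2E w : cLnorm 2%:E w = ((\int[mu]_(x in TT) (sqmod w x)%:E) `^ (2^-1))%E.
Proof.
rewrite /cLnorm /eLnorm unlock /=; congr (_ `^ _)%E.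
rewrite [RHS]integral_mkcond.
apply: eq_integral => x _; rewrite /patch; case: ifP => _; last by rewrite abse0 poweR0r.
rewrite normcE /= ger0_norm ?sqrtr_ge0// -[2%R]/(2%:R) powR_mulrn ?sqrtr_ge0// sqr_sqrtr//.
by rewrite addr_ge0// sqr_ge0.
Qed.

Lemma cLp2_lty w : cLp 2%:E w -> (\int[mu]_(x in TT) (sqmod w x)%:E < +oo)%E.
Proof. by move=> [_]; rewrite cLnorm2E; apply: lty_poweRy; rewrite invr_eq0. Qed.

Lemma cLp2_integrable w : cLp 2%:E w -> mu.-integrable TT (EFin \o (fun x => complex.Re (w x))) /\
  mu.-integrable TT (EFin \o (fun x => complex.Im (w x))).
Proof.
move=> hw; have [[m1 m2] _] := hw; have h := cLp2_lty hw.
have h1 : mu.-integrable TT (fun x => (1 + sqmod w x)%:E).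
  apply/integrableP; split.
    by apply/measurable_EFinP; apply: measurable_funD => //; exact: measurable_sqmod.
  under eq_integral do rewrite gee0_abs ?lee_fin ?addr_ge0 ?sqr_ge0//.
  under eq_integral do rewrite EFinD.
  rewrite ge0_integralD//; last 2 first.
  - by move=> x _; rewrite lee_fin addr_ge0// sqr_ge0.
  - by apply/measurable_EFinP; apply: measurable_sqmod.
  rewrite integral_cst// mul1e lte_add_pinfty//; by case: (findom_torus R).
have sq (a : R) : `|a| <= 1 + a ^+ 2 by have := sqr_ge0 (`|a| - 1); rewrite -(real_normK (num_real a)); nra.
split; apply: (le_integrable mTT _ _ h1).
- by apply/measurable_EFinP.
- move=> x _; rewrite /= lee_fin [leRHS]ger0_norm ?addr_ge0 ?sqr_ge0//.
  by apply: le_trans (sq _) _; rewrite lerD2l lerDl sqr_ge0.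
- by apply/measurable_EFinP.
- move=> x _; rewrite /= lee_fin [leRHS]ger0_norm ?addr_ge0 ?sqr_ge0//.
  by apply: le_trans (sq _) _; rewrite lerD2l lerDr sqr_ge0.
Qed.

Lemma cLp2_bounded w (G : R) : cmeasurable w -> {ae mu, forall x, TT x -> normc (w x) <= G} -> cLp 2%:E w.
Proof.
move=> mw hG; split => //; rewrite cLnorm2E; apply: poweR_lty.
apply: (@le_lt_trans _ _ (\int[mu]_(x in TT) (G ^+ 2)%:E)%E); last first.
  by rewrite integral_cst// [X in (_ * X)%E]leb_torus mule1 ltry.
apply: ae_ge0_le_integral => //.
- by move=> x _; rewrite lee_fin addr_ge0// sqr_ge0.
- by apply/measurable_EFinP; apply: measurable_sqmod.
- by move=> x _; rewrite lee_fin sqr_ge0.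
apply: filterS hG => x hx Tx; rewrite lee_fin.
have s0 : 0 <= sqmod w x by rewrite addr_ge0// sqr_ge0.
rewrite -(sqr_sqrtr s0) -normcE ler_pXn2r ?nnegrE ?hx//.
  by rewrite normcE sqrtr_ge0.
by apply: le_trans (hx Tx); rewrite normcE sqrtr_ge0.
Qed.

Lemma cLnorm_infty w : cLp +oo%E w -> {ae mu, forall x, TT x -> normc (w x) <= fine (cLnorm +oo%E w)}.
Proof.
move=> [_ fw]; have w0 : (0 <= cLnorm +oo%E w)%E by exact: Lnorm_ge0.
have hT : (0 < mu [set: lebR R])%E.
  apply: (@lt_le_trans _ _ (mu TT)); first by rewrite leb_torus lte01.
  by apply: le_measure; rewrite ?inE.
have e : cLnorm +oo%E w = ess_sup mu (abse \o ((fun x => (normc (w x))%:E) \_ TT)).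
  by rewrite /cLnorm /eLnorm unlock hT.
have := ess_sup_ge mu (abse \o ((fun x => (normc (w x))%:E) \_ TT)); rewrite -e.
apply: filterS => x + Tx; rewrite /= /patch mem_set// -lee_fin fineK; last by rewrite ge0_fin_numE.
by apply: le_trans; rewrite lee_fin ler_norm.
Qed.

End ComplexLp.

(** * Pairings of the linearized operator with bounded functions *)

Section AdjointBound.
Variables (R : realType) (n : nat -> nat).
Hypothesis n_lac : lacunary (R := R) n.
Notation RR := (measurableTypeR R).
Notation bmfR := (@bmf _ RR R).
Notation TT := (@torus R).
Notation mu := (@leb R).
Notation normc := (@ComplexField.Normc.normc R).
Notation sleb := (@completed_lebesgue_measure R : {sigma_finite_measure set (lebR R) -> \bar R}).

Let mTT : measurable TT. Proof. by case: (findom_torus R). Qed.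

Definition test_function (f : R -> R) := [/\ forall y, `|f y| <= 1,
  exists Lf, forall x y, `|f x - f y| <= Lf * `|x - y| & forall y, ~~ (0 <= y <= 1) -> f y = 0].

Lemma lacunary_linpv : exists2 C : R, 0 < C & forall (N : lebR R -> nat) f tr l, measurable_fun setT N ->
  (forall x, exists j, N x = n j) -> test_function f -> half_wave tr -> 0 <= l ->
  (\int[mu]_(x in TT) (`|linpv N f tr x|)%:E <=
    (C * ((1 + l) * itg 0 1 (fun y => `|f y|) + expR (- l)))%:E)%E.
Proof.
have [r [j0 [r1 hj]]] := lacunary_tail n_lac.
pose M i := n (j0 + i)%N; pose s := [seq n j | j <- iota 0 j0].
have M0 i : (0 < M i)%N by have [] := hj (j0 + i)%N (leq_addr _ _).
have hM i : r * (M i)%:R <= (M i.+1)%:R by rewrite /M addnS; have [] := hj (j0 + i)%N (leq_addr _ _).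
have D1 : fine (sleb TT) <= 1 by rewrite [X in fine X]leb_torus.
have X01 (x : lebR R) : TT x -> 0 <= (x : R) <= 1 by rewrite /torus/= => /andP[-> /ltW].
have [C C0 hC] := carleson_dual (findom_torus R) D1 (@measurable_id_lebR R) (@torus_ico R) X01 r1 M0 hM.
have k0 := ckap_gt0 R.
(* [ckap] passes from the kernel [Ker] to [1/t], and the summand 2 is the [L^1] error of this
   passage. *)
exists ((ckap R)^-1 * (C * (size s).+1%:R + 2)).
  by rewrite mulr_gt0 ?invr_gt0// addr_gt0// mulr_gt0.
move=> N f tr l mN Nn [f1 [Lf f_lip] f_supp] htr l0.
have bf : bmfR f by apply: (bmf_lipschitz f_lip); exists 1.
have Ns x : N x \in s \/ exists i, N x = M i.
  have [j ->] := Nn x; have [jj|jj] := ltnP j j0; [left|right; exists (j - j0)%N].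
    by apply: map_f; rewrite mem_iota.
  by rewrite /M subnKC.
have dual K N' g : (M 0 <= 3 ^ K)%N ->
  measurable_fun setT N' -> (forall x : lebR R, N' x \in s \/ exists i, N' x = M i) ->
  (forall x, (N' x <= 3 ^ K)%N) -> @bmf _ (lebR R) R g -> (forall x, `|g x| <= 1) ->
  itg 0 1 (fun y => `|f y| * `|modop sleb TT id tr K N' g y|) <=
    C * (size s).+1%:R * (l * itg 0 1 (fun y => `|f y|) + expR (- l)).
  by move=> h1 h2 h3 h4 h5 h6; exact: (hC s K N' g tr f l h1 h2 h3 h4 h5 h6 htr bf f1 l0).
apply: le_trans (linpv_L1 mN f1 f_lip f_supp htr Ns dual) _.
rewrite lee_fin -[leRHS]mulrA; apply: ler_wpM2l; first by rewrite invr_ge0 ltW.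
set P := itg 0 1 _; set S := (size s).+1%:R; have e0 := expR_ge0 (- l).
have P0 : 0 <= P by exact: itg_ge0.
have CS : 0 <= C * S by rewrite mulr_ge0// ltW.
rewrite [leRHS]mulrDl; apply: lerD.
  by rewrite ler_wpM2l// lerD2r ler_wpM2r// lerDr.
have lP : 0 <= l * P by rewrite mulr_ge0.
by rewrite mulrDl mul1r; lra.
Qed.

(** The formula for [h] is required only inside the interval: at the endpoint 0 the principal value
    has not been identified. A single point affects neither measurability nor the integral. *)
Lemma norm_Rintegral_le (h P Q a c : lebR R -> R) (G B : R) : 0 <= G ->
  measurable_fun TT P -> measurable_fun TT Q -> measurable_fun TT a -> measurable_fun TT c ->
  {ae mu, forall x, TT x -> `|a x| <= G} -> {ae mu, forall x, TT x -> `|c x| <= G} ->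
  (\int[mu]_(x in TT) (`|P x|)%:E <= B%:E)%E -> (\int[mu]_(x in TT) (`|Q x|)%:E <= B%:E)%E ->
  (forall x, 0 < (x : R) < 1 -> h x = P x * a x + Q x * c x) ->
  `|\int[mu]_(x in TT) h x| <= G * (B + B).
Proof.
move=> G0 mP mQ ma mc ha hc hP hQ hE.
have m0 : @measurable _ (lebR R) [set (0 : R)] by apply: borel_lebR; exact: measurable_set1.
have mD : @measurable _ (lebR R) (TT `\` [set (0 : R)]) by exact: measurableD.
have TE : TT = [set (0 : R)] `|` (TT `\` [set (0 : R)]).
  apply/seteqP; split => x; last by case=> [->|[]//]; rewrite /torus/= lexx ltr01.
  by move=> Tx; have [->|x0] := pselect (x = (0 : R)); [left | right].
have mPQ : measurable_fun TT (fun x => P x * a x + Q x * c x).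
  by apply: measurable_funD; apply: measurable_funM.
have mh : measurable_fun TT h.
  rewrite [X in measurable_fun X _]TE; apply/measurable_funU => //; split; first exact: measurable_fun_set1.
  apply: (eq_measurable_fun (fun x => P x * a x + Q x * c x)); last exact: measurable_funS mPQ.
  move=> x /set_mem[]; rewrite /torus/= => /andP[x0 x1] /eqP n0; rewrite hE// x1 andbT lt_neqAle x0 andbT.
  by rewrite eq_sym.
have bound : (\int[mu]_(x in TT) (`|h x|)%:E <= (G * (B + B))%:E)%E.
  have aP x : TT x -> (0 <= (`|P x|)%:E)%E by move=> _; rewrite lee_fin.
  have aQ x : TT x -> (0 <= (`|Q x|)%:E)%E by move=> _; rewrite lee_fin.
  have nP : measurable_fun TT (fun x => (`|P x|)%:E) by apply/measurable_EFinP; exact: (measurableT_comp (@normr_measurable R setT) mP).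
  have nQ : measurable_fun TT (fun x => (`|Q x|)%:E) by apply/measurable_EFinP; exact: (measurableT_comp (@normr_measurable R setT) mQ).
  have nh : measurable_fun TT (fun x => (`|h x|)%:E) by apply/measurable_EFinP; exact: (measurableT_comp (@normr_measurable R setT) mh).
  have ah x : TT x -> (0 <= (`|h x|)%:E)%E by move=> _; rewrite lee_fin.
  have aS x : TT x -> (0 <= (`|P x|)%:E + (`|Q x|)%:E)%E by move=> _; rewrite -EFinD lee_fin addr_ge0.
  have aG x : TT x -> (0 <= G%:E * ((`|P x|)%:E + (`|Q x|)%:E))%E.
    by move=> _; rewrite -EFinD -EFinM lee_fin mulr_ge0// addr_ge0.
  have nS := emeasurable_funD nP nQ.
  have nG : measurable_fun TT (fun x => (G%:E * ((`|P x|)%:E + (`|Q x|)%:E)))%E.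
    exact: (emeasurable_funM (measurable_cst _) nS).
  apply: (@le_trans _ _ (\int[mu]_(x in TT) (G%:E * ((`|P x|)%:E + (`|Q x|)%:E)))%E); last first.
    rewrite (@ge0_integralZl_EFin _ _ _ mu TT mTT _ aS nS _ G0) (@ge0_integralD _ _ _ mu TT mTT _ _ aP nP aQ nQ).
    by rewrite EFinM EFinD; apply: lee_wpmul2l; [rewrite lee_fin | exact: leeD].
  apply: (ae_ge0_le_integral mTT ah nh aG nG).
  have n0 : {ae mu, forall x : lebR R, TT x -> 0 < (x : R) < 1}.
    exists [set (0 : R)]; split => //; first exact: (lebesgue_measure_set1 0).
    move=> x nx; apply: contrapT => x0; apply: nx; rewrite /torus/= => /andP[x1 ->].
    by rewrite andbT lt_neqAle x1 andbT eq_sym; apply/negP => /eqP.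
  near=> x => Tx.
  have x01 : 0 < (x : R) < 1 by move: Tx; near: x.
  have ax : `|a x| <= G by move: Tx; near: x.
  have cx : `|c x| <= G by move: Tx; near: x.
  rewrite hE// -EFinD -EFinM lee_fin mulrDr; apply: (le_trans (ler_normD _ _)).
  by rewrite !normrM; apply: lerD; rewrite mulrC ler_wpM2r.
have ih : mu.-integrable TT (EFin \o h).
  apply/integrableP; split; first by apply/measurable_EFinP.
  by apply: le_lt_trans bound _; rewrite ltry.
apply: le_trans (le_normr_Rintegral mTT ih) _.
rewrite -lee_fin; apply: le_trans bound.
rewrite /Rintegral fineK//; have /integrable_fin_num := integrable_norm ih; exact.
Unshelve. all: by end_near.
Qed.

Lemma linearized_pairing : exists2 C : R, 0 < C & forall (N : lebR R -> nat) f g l, measurable_fun TT N ->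
  (forall x, TT x -> exists j, N x = n j) -> test_function f -> cLp +oo%E g -> 0 <= l ->
  let z := pairing (carleson_linear N (fun y => (f y)%:C%C)) g in
  let B := C * ((1 + l) * itg 0 1 (fun y => `|f y|) + expR (- l)) in
  let G := fine (cLnorm +oo%E g) in
  `|complex.Re z| <= G * (B + B) /\ `|complex.Im z| <= G * (B + B).
Proof.
have [C C0 hC] := lacunary_linpv; exists C => // N f g l mN Nn tf hg l0.
pose N0 x := if x \in TT then N x else n 0.
have mN0 : measurable_fun setT N0.
  have -> : [set: lebR R] = TT `|` ~` TT by rewrite setUv.
  apply/measurable_funU; [exact: mTT|by apply: measurableC; exact: mTT|split].
    by apply: eq_measurable_fun mN => x xT; rewrite /N0 xT.
  apply: (eq_measurable_fun (cst (n 0))); last exact: measurable_cst.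
  by move=> x /set_mem nT; rewrite /N0 memNset.
have N0n x : exists j, N0 x = n j.
  rewrite /N0; case: ifP => [/set_mem/Nn//|_]; by exists 0%N.
have hc := half_wave_cos R; have hs := half_wave_opp (half_wave_sin R).
have b1 := hC N0 f _ l mN0 N0n tf hc l0; have b2 := hC N0 f _ l mN0 N0n tf hs l0.
have [f1 [Lf f_lip] f_supp] := tf.
have mP := measurable_funTS (D := TT) (measurable_linpv mN0 f1 f_lip hc).
have mQ := measurable_funTS (D := TT) (measurable_linpv mN0 f1 f_lip hs).
have hE (x : lebR R) : 0 < (x : R) < 1 -> carleson_linear N (fun y => (f y)%:C%C) x =
    (linpv N0 f cos x +i* linpv N0 f (fun t => - sin t) x)%C.
  move=> x01; rewrite (carleson_linear_pvval f1 f_lip f_supp N x01) /linpv /N0 mem_set//.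
  by move: x01 => /andP[/ltW x0 x1]; rewrite /torus/= x0 x1.
have [[ma mc] _] := hg; have gG := cLnorm_infty hg.
move=> z B G.
have G0 : 0 <= G by apply: fine_ge0; exact: Lnorm_ge0.
have ha : {ae mu, forall x, TT x -> `|complex.Re (g x)| <= G}.
  by apply: filterS gG => x h Tx; exact: le_trans (Re_le_normc _) (h Tx).
have hi : {ae mu, forall x, TT x -> `|complex.Im (g x)| <= G}.
  by apply: filterS gG => x h Tx; exact: le_trans (Im_le_normc _) (h Tx).
have hiN : {ae mu, forall x, TT x -> `|- complex.Im (g x)| <= G}.
  by apply: filterS hi => x h Tx; rewrite normrN; exact: h.
have mcN : measurable_fun TT (fun x => - complex.Im (g x)) by exact: measurable_funN.
split.
- apply: (norm_Rintegral_le G0 mP mQ ma mc ha hi b1 b2) => x x01.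
  by rewrite hE//; case: (g x) => a c /=; rewrite mulrN opprK.
- apply: (norm_Rintegral_le G0 mP mQ mcN ma hiN ha b1 b2) => x x01.
  by rewrite hE//; case: (g x) => a c /=.
Qed.

Section SetIntegralAbs.
Variables (u : lebR R -> R) (A b : R).
Hypotheses (iu : mu.-integrable TT (EFin \o u)) (A0 : 0 <= A) (b0 : 0 <= b).
Hypothesis Hu : forall f, test_function f ->
  `|\int[mu]_(x in TT) (f x * u x)| <= A * itg 0 1 (fun y => `|f y|) + b.

(** [F] is split by the sign of [u]. Each part is measurable and no larger than [F], whence the
    factor 2. *)
Lemma set_integral_abs (F : set (lebR R)) : measurable F -> F `<=` TT ->
  (\int[mu]_(x in TT) (\1_F x * `|u x|)%:E <= (2 * (A * fine (mu F) + b))%:E)%E.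
Proof.
move=> mF FT.
have mu0 : measurable_fun TT u by apply/measurable_EFinP; exact: measurable_int iu.
have bnd E : measurable E -> E `<=` TT -> `|\int[mu]_(x in TT) (\1_E x * u x)| <= A * fine (mu E) + b.
  move=> mE ET; apply: (set_integral_bound iu A0 b0 _ mE ET) => f Lf f1 f2 f3.
  by apply: Hu; split => //; exists Lf.
have iE (v : lebR R -> R) E : measurable_fun TT v -> (forall x, `|v x| = `|u x|) -> measurable E ->
    mu.-integrable TT (EFin \o (fun x => \1_E x * v x)).
  move=> mv vu mE; apply: (le_integrable mTT _ _ iu).
    apply/measurable_EFinP; apply: measurable_funM mv.
    exact: measurable_funTS (measurable_indic mE).
  move=> x _; rewrite /= lee_fin normrM vu indicE ler_piMl//.
  by case: (x \in E); rewrite /= ?normr0 ?normr1.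
pose E1 := F `&` (TT `&` u @^-1` [set v : R | 0 <= v]).
pose E2 := F `\` (TT `&` u @^-1` [set v : R | 0 <= v]).
have mS : measurable (TT `&` u @^-1` [set v : R | 0 <= v]).
  apply: mu0 => //; rewrite (_ : [set v : R | 0 <= v] = `[0, +oo[%classic); first exact: measurable_itv.
  by apply/seteqP; split => v; rewrite /= in_itv/= andbT.
have mE1 : measurable E1 by exact: measurableI.
have mE2 : measurable E2 by exact: measurableD.
have i0 := iE (fun x => `|u x|) F (measurableT_comp (@normr_measurable R setT) mu0) (fun x => normr_id _) mF.
have i1 := iE u E1 mu0 (fun x => erefl) mE1.
have i2 := iE u E2 mu0 (fun x => erefl) mE2.
rewrite -(fineK (integrable_fin_num mTT i0)) lee_fin.
rewrite (_ : fine _ = \int[mu]_(x in TT) (\1_E1 x * u x - \1_E2 x * u x)); last first.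
  apply: eq_Rintegral => x /set_mem Tx; rewrite !indicE.
  have [Fx|nFx] := pselect (F x); last first.
    by rewrite !memNset ?mul0r ?subrr//; case.
  rewrite (mem_set Fx) mul1r; case: (leP 0 (u x)) => ux.
    have e1 : E1 x by split.
    have e2 : ~ E2 x by case=> _; apply.
    by rewrite (mem_set e1) (memNset e2) mul0r subr0 mul1r ger0_norm.
  have e1 : ~ E1 x by case=> _ [_] /=; rewrite leNgt ux.
  have e2 : E2 x by split => //; case=> _ /=; rewrite leNgt ux.
  by rewrite (memNset e1) (mem_set e2) mul0r sub0r mul1r ltr0_norm.
rewrite (RintegralB mTT i1 i2).
have E1T : E1 `<=` TT by move=> x [/FT].
have E2T : E2 `<=` TT by move=> x [/FT].
have fF E : measurable E -> E `<=` F -> fine (mu E) <= fine (mu F).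
  move=> mE EF; have fT : (mu TT < +oo)%E by case: (findom_torus R).
  have h1 : (mu E <= mu F)%E by apply: le_measure; rewrite ?inE.
  have h2 : (mu F <= mu TT)%E by apply: le_measure; rewrite ?inE.
  apply: fine_le => //; rewrite ge0_fin_numE//; first exact: le_lt_trans h1 (le_lt_trans h2 fT).
  exact: le_lt_trans h2 fT.
have := bnd E1 mE1 E1T; have := bnd E2 mE2 E2T.
have : A * fine (mu E1) <= A * fine (mu F) by apply: ler_wpM2l => //; apply: fF => // x [].
have : A * fine (mu E2) <= A * fine (mu F) by apply: ler_wpM2l => //; apply: fF => // x [].
rewrite !ler_norml => ? ? /andP[? ?] /andP[? ?]; lra.
Qed.

End SetIntegralAbs.

End AdjointBound.

(** * The upper bound for the adjoint *)

Section AdjointTheorem.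
Variables (R : realType) (n : nat -> nat).
Hypothesis n_lac : lacunary (R := R) n.
Notation TT := (@torus R).
Notation mu := (@leb R).
Notation normc := (@ComplexField.Normc.normc R).

Let mTT : measurable TT. Proof. by case: (findom_torus R). Qed.

Lemma ln2_gt0 : 0 < ln 2 :> R.
Proof. by rewrite ln_gt0// ltr1n. Qed.

Lemma ln2_le1 : ln 2 <= 1 :> R.
Proof. by have := @le_ln1Dx R 1; rewrite (_ : 1 + 1 = 2)//; apply; lra. Qed.

Lemma cLp2_real (f : R -> R) : test_function f -> cLp 2%:E (fun y : lebR R => (f y)%:C%C).
Proof.
move=> [f1 [Lf f_lip] _].
have bf : @bmf _ (measurableTypeR R) R f by apply: (bmf_lipschitz f_lip); exists 1.
apply: (@cLp2_bounded _ _ 1).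
  split; first exact: measurable_funTS (proj1 (bmf_lebR bf)).
  exact: measurable_cst.
apply: aeW => x _ /=; rewrite expr0n /= addr0 sqrtr_sqr; exact: f1.
Qed.

Lemma integral_conj_mul (f : lebR R -> R) (w : lebR R -> R[i]) :
  complex.Re (pairing (fun y => (f y)%:C%C) w) = \int[mu]_(x in TT) (f x * complex.Re (w x)) /\
  complex.Im (pairing (fun y => (f y)%:C%C) w) = \int[mu]_(x in TT) (f x * - complex.Im (w x)).
Proof.
by split; apply: eq_Rintegral => x _; case: (w x) => a b /=; rewrite mul0r ?subr0 ?addr0.
Qed.

Theorem lacunary_adjoint_bound : exists C1 : R, 0 < C1 /\
     forall (F : set (lebR R)) (N : lebR R -> nat)
            (Clac_adj : (lebR R -> R[i]) -> (lebR R -> R[i]))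
            (g : lebR R -> R[i]),
       measurable F -> F `<=` torus ->
       measurable_fun torus N ->
       (forall x, torus x -> exists j, N x = n j) ->
       L2_adjoint (carleson_linear N) Clac_adj ->
       cLp +oo%E g ->
       (cLnorm 1%:E (fun x => (cindic F x * Clac_adj g x)%R)
          <= (C1 * LlogL F)%:E * cLnorm +oo%E g)%E.
Proof.
have [C C0 hC] := linearized_pairing n_lac.
(* One factor 2 from the two components of the phase in [linearized_pairing], one from the splitting
   by sign in [set_integral_abs], one from the real and imaginary parts of the adjoint. *)
exists (8 * C); split; first by rewrite mulr_gt0.
move=> F N S g mF FT mN Nn adj hg.
have [mg fg] := hg.
have Ge : cLnorm +oo%E g = (fine (cLnorm +oo%E g))%:E.
  by rewrite fineK// ge0_fin_numE//; exact: Lnorm_ge0.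
set G := fine (cLnorm +oo%E g) in Ge; rewrite Ge -EFinM.
have G0 : 0 <= G by apply: fine_ge0; exact: Lnorm_ge0.
have g2 : cLp 2%:E g by apply: (cLp2_bounded mg (cLnorm_infty hg)).
have [f0 [Lf0 f0_lip] f0_supp] : test_function (fun=> 0 : R).
  by split=> [y||//]; [rewrite normr0 | exists 0 => x y; rewrite subrr normr0 mul0r].
have t0 : test_function (fun=> 0 : R) by split => //; exists Lf0.
have [S2 _] := adj _ _ (cLp2_real t0) g2.
have [iu iv] := cLp2_integrable S2.
have [[mu0 mv0] _] := S2.
have bound l : 0 <= l -> (cLnorm 1%:E (fun x => (cindic F x * S g x)%R) <=
    (8 * C * G * ((1 + l) * fine (mu F) + expR (- l)))%:E)%E.
  move=> l0; set A := 2 * G * C * (1 + l); set b := 2 * G * C * expR (- l).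
  have GC : 0 <= 2 * G * C by rewrite mulr_ge0 ?(ltW C0)// mulr_ge0.
  have A0 : 0 <= A by rewrite mulr_ge0// addr_ge0.
  have b0 : 0 <= b by rewrite mulr_ge0// expR_ge0.
  have key f : test_function f ->
      `|\int[mu]_(x in TT) (f x * complex.Re (S g x))| <= A * itg 0 1 (fun y => `|f y|) + b /\
      `|\int[mu]_(x in TT) (f x * - complex.Im (S g x))| <= A * itg 0 1 (fun y => `|f y|) + b.
    move=> tf; have [_ e] := adj _ _ (cLp2_real tf) g2.
    have [<- <-] := integral_conj_mul f (S g); rewrite -e.
    have := hC N f g l mN Nn tf hg l0; rewrite -/G /=.
    rewrite (_ : G * _ = A * itg 0 1 (fun y => `|f y|) + b)//.
    by rewrite /A /b; ring.
  have hu := set_integral_abs iu A0 b0 (fun f tf => proj1 (key f tf)) mF FT.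
  have ivN : mu.-integrable TT (EFin \o (fun x => - complex.Im (S g x))).
    apply: (le_integrable mTT _ _ iv); first by apply/measurable_EFinP; exact: measurable_funN.
    by move=> x _; rewrite /= normrN.
  have hv := set_integral_abs ivN A0 b0 (fun f tf => proj2 (key f tf)) mF FT.
  rewrite cLnorm1E.
  pose a1 x := (\1_F x * `|complex.Re (S g x)|)%:E; pose a2 x := (\1_F x * `|- complex.Im (S g x)|)%:E.
  have mI : measurable_fun TT (\1_F : lebR R -> R) by exact: measurable_funTS (measurable_indic mF).
  have m1 : measurable_fun TT a1.
    by apply/measurable_EFinP; apply: measurable_funM mI _; exact: (measurableT_comp (@normr_measurable R setT) mu0).
  have m2 : measurable_fun TT a2.
    apply/measurable_EFinP; apply: measurable_funM mI _; apply: (measurableT_comp (@normr_measurable R setT)).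
    exact: measurable_funN.
  have p1 x : TT x -> (0 <= a1 x)%E by move=> _; rewrite lee_fin mulr_ge0.
  have p2 x : TT x -> (0 <= a2 x)%E by move=> _; rewrite lee_fin mulr_ge0.
  have nE x : normc (cindic F x * S g x) = \1_F x * normc (S g x).
    by rewrite ComplexField.Normc.normcM /cindic /= expr0n /= addr0 sqrtr_sqr ger0_norm.
  have m0 : measurable_fun TT (fun x => (normc (cindic F x * S g x))%:E).
    apply/measurable_EFinP; under eq_fun do rewrite nE.
    by apply: measurable_funM mI _; apply: measurable_normc; case: S2.
  have p0 x : TT x -> (0 <= (normc (cindic F x * S g x))%:E)%E.
    by move=> _; rewrite lee_fin nE (normcE (S g)) mulr_ge0 ?sqrtr_ge0// indicE.
  have p3 x : TT x -> (0 <= a1 x + a2 x)%E by move=> Tx; apply: adde_ge0; [exact: p1 | exact: p2].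
  apply: (@le_trans _ _ (\int[mu]_(x in TT) (a1 x + a2 x))%E).
    apply: (ae_ge0_le_integral mTT p0 m0 p3 (emeasurable_funD m1 m2)); apply: aeW => x _.
    by rewrite -EFinD lee_fin nE -mulrDr normrN ler_wpM2l// normc_le_ReIm.
  rewrite (@ge0_integralD _ _ _ mu TT mTT _ _ p1 m1 p2 m2).
  apply: le_trans (leeD hu hv) _; rewrite -EFinD lee_fin le_eqVlt; apply/orP; left; apply/eqP.
  by rewrite /A /b; ring.
have CG : 0 <= 8 * C * G by rewrite mulr_ge0// mulr_ge0// ltW.
have [m0|m0] := eqVneq (fine (mu F)) 0.
  rewrite /LlogL m0 mul0r mulr0 mul0r.
  apply/lee_addgt0Pr => e e0; rewrite add0e.
  have q0 : 0 < e / (8 * C * G + 1) by rewrite divr_gt0// ltr_wpDl.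
  have l0 : 0 <= Num.max 0 (- ln (e / (8 * C * G + 1))) by rewrite le_max lexx.
  apply: le_trans (bound _ l0) _; rewrite m0 mulr0 add0r lee_fin.
  apply: (@le_trans _ _ (8 * C * G * (e / (8 * C * G + 1)))).
    apply: ler_wpM2l => //; rewrite -[leRHS]lnK ?posrE// ler_expR.
    by rewrite lerNl le_max lexx orbT.
  by rewrite mulrCA ler_piMr ?(ltW e0)// ler_pdivrMr ?mul1r ?lerDl// ltr_wpDl.
have mge : 0 <= fine (mu F) by exact: fine_ge0.
have mp : 0 < fine (mu F) by rewrite lt_neqAle eq_sym m0.
have m1 : fine (mu F) <= 1.
  have fT : (mu TT < +oo)%E by case: (findom_torus R).
  have h2 : (mu F <= mu TT)%E by apply: le_measure; rewrite ?inE.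
  by rewrite -lee_fin fineK ?ge0_fin_numE// ?(le_lt_trans h2 fT)// -leb_torus.
have l0 : 0 <= - ln (fine (mu F)) by rewrite oppr_ge0 ln_le0.
apply: le_trans (bound _ l0) _; rewrite lee_fin opprK lnK ?posrE//.
rewrite /LlogL; set m := fine (mu F); set l := - ln m.
rewrite [leRHS](_ : _ = 8 * C * G * (m * (ln (4 / m) / ln 2))); last by ring.
apply: ler_wpM2l => //; rewrite (_ : (1 + l) * m + m = m * (2 + l)); last by ring.
apply: ler_wpM2l => //.
(* The binary logarithm of [4 / m] is [2 + l / ln 2], which is at least [2 + l] because
   [ln 2 <= 1]. *)
have -> : ln (4 / m) = 2 * ln 2 + l.
  rewrite ln_div ?posrE// (_ : 4 = 2 ^+ 2 :> R); last by rewrite -natrX.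
  by rewrite lnXn// mulr_natl.
have k0 := ln2_gt0; have k1 := ln2_le1.
rewrite ler_pdivlMr// mulrDl lerD2l.
by rewrite ler_piMr.
Qed.

End AdjointTheorem.

(** * The lower bound *)

Section DirichletKernel.
Variable R : realType.
Notation RR := (measurableTypeR R).
Notation bmfR := (@bmf _ RR R).
Implicit Types (t x y : R).

(** For [m >= 1] the modified Dirichlet kernel, whose highest mode has half weight; it equals
    [sin (2 pi m t) cot (pi t)]. Grouping neighbouring modes makes the proof of this identity a
    one-step induction. *)
Definition dirk (m : nat) t : R :=
  \sum_(k < m) (cos (2 * pi * k%:R * t) + cos (2 * pi * k.+1%:R * t)).

Lemma sin_cos_dirk m t : sin (2 * pi * (m%:R * t)) * cos (pi * t) = sin (pi * t) * dirk m t.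
Proof.
elim: m => [|m ih]; first by rewrite /dirk big_ord0 mul0r !mulr0 sin0 mul0r.
rewrite (_ : dirk m.+1 t = dirk m t + (cos (2 * pi * m%:R * t) + cos (2 * pi * m.+1%:R * t))); last first.
  by rewrite /dirk big_ord_recr.
rewrite [RHS]mulrDr -ih.
set a := 2 * pi * (m%:R * t); set b := pi * t.
have -> : 2 * pi * m%:R * t = a by rewrite /a; ring.
have -> : 2 * pi * m.+1%:R * t = a + b + b by rewrite /a /b -natr1; ring.
have -> : 2 * pi * (m.+1%:R * t) = a + b + b by rewrite /a /b -natr1; ring.
have e1 : sin a * cos b + sin b * cos a = sin (a + b) by rewrite sinD; ring.
have e2 : sin (a + b + b) * cos b - cos (a + b + b) * sin b = sin (a + b).
  by rewrite -sinB addrK.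
lra.
Qed.

Lemma bmf_cos (c : R) : bmfR (fun t => cos (c * t)).
Proof.
by have := bmf_affine c 0 (bmf_half_wave (half_wave_cos R)); under eq_fun do rewrite addr0.
Qed.

Lemma bmf_dirk m : bmfR (dirk m).
Proof. rewrite /dirk; apply: bmf_sum => k _; exact: (bmfD (bmf_cos _) (bmf_cos _)). Qed.

Lemma norm_dirk m t : `|dirk m t| <= 2 * m%:R.
Proof.
apply: (le_trans (ler_norm_sum _ _ _)).
apply: (@le_trans _ _ (\sum_(k < m) 2)); last by rewrite sumr_const card_ord mulr_natr.
apply: ler_sum => k _; apply: (le_trans (ler_normD _ _)).
have [c1 _ _] := half_wave_cos R.
by have := c1 (2 * pi * k%:R * t); have := c1 (2 * pi * k.+1%:R * t); lra.
Qed.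

(** Translation by [1 / (2 k)] changes the sign of the integrand, yet preserves the integral over a
    full period. *)
Lemma itg_cos_mode k y : (0 < k)%N -> itg 0 1 (fun x => cos (2 * pi * k%:R * (x - y))) = 0.
Proof.
move=> k0; set h := fun x => cos (2 * pi * k%:R * (x - y)).
have kn0 : k%:R != 0 :> R by rewrite pnatr_eq0 -lt0n.
have bh : bmfR h.
  have := bmf_affine 1 (- y) (bmf_cos (2 * pi * k%:R)).
  by under eq_fun do rewrite mul1r.
have hN x : h (x + (2 * k%:R)^-1) = - h x.
  by rewrite /h -cosDpi; congr cos; field.
have hp x : h (x + 1) = h x.
  have hm (m : nat) : h (x + m%:R * (2 * k%:R)^-1) = (-1) ^+ m * h x.
    elim: m => [|m ih]; first by rewrite mul0r addr0 expr0 mul1r.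
    by rewrite -natr1 mulrDl mul1r addrA hN ih exprS mulN1r mulNr.
  have := hm (2 * k)%N; rewrite natrM mulfV ?mulf_neq0// => ->.
  by rewrite exprM sqrrN expr1n expr1n mul1r.
have hpn x (m : nat) : h (x + m%:R) = h x.
  by elim: m => [|m ih]; [rewrite addr0 | rewrite -natr1 addrA hp ih].
have hpz x (j : int) : h (x + j%:~R) = h x.
  case: j => m; first by rewrite hpn.
  by have := hpn (x + (Negz m)%:~R) m.+1; rewrite NegzE mulrNz subrK => ->.
have e := itg_periodic (2 * k%:R)^-1 bh hpz.
have : itg 0 1 h = - itg 0 1 h.
  by rewrite -[LHS]e -itgN//; apply: eq_itg => x _; exact: hN.
lra.
Qed.

Lemma itg_dirk m y : (0 < m)%N -> itg 0 1 (fun x => dirk m (x - y)) = 1.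
Proof.
move=> m0.
have b k : bmfR (fun x => cos (2 * pi * k%:R * (x - y))).
  have := bmf_affine 1 (- y) (bmf_cos (2 * pi * k%:R)).
  by under eq_fun do rewrite mul1r.
rewrite /dirk itg_sum => [|k _]; last exact: (bmfD (b _) (b _)).
rewrite (bigD1 (Ordinal m0))//= big1 ?addr0 => [|k k0].
  rewrite (itgD _ _ (b _) (b _)) (@itg_cos_mode 1)// addr0.
  under eq_itg do rewrite mulr0 mul0r cos0.
  by rewrite itg_cst// mul1r subr0.
rewrite (itgD _ _ (b _) (b _)) !itg_cos_mode ?addr0//.
by rewrite lt0n; move: k0; apply: contra => /eqP k0; apply/eqP/val_inj.
Qed.

End DirichletKernel.

(** * The imaginary part: a lower bound by the measure *)

Section LowerBound.
Variables (R : realType) (n : nat -> nat) (j : nat).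
Hypothesis nj : (0 < n j)%N.
Notation RR := (measurableTypeR R).
Notation bmfR := (@bmf _ RR R).
Notation TT := (@torus R).
Notation mu := (@leb R).
Notation normc := (@ComplexField.Normc.normc R).
Notation m := (n j).

(** The integral of a nonnegative function is a supremum over the simple functions below it, so the
    comparison holds for arbitrary functions. It gives lower bounds for the norm of the supremum
    [carleson_lac] from measurable minorants. *)
Lemma ge0_integral_mono d (T : measurableType d) (nu : {measure set T -> \bar R}) (f g : T -> \bar R) :
  (forall x, 0 <= f x)%E -> (forall x, f x <= g x)%E -> (\int[nu]_x f x <= \int[nu]_x g x)%E.
Proof.
move=> f0 fg; have g0 x : (0 <= g x)%E by exact: le_trans (fg x).
rewrite (ge0_integralTE _ f0) (ge0_integralTE _ g0); apply: le_ereal_sup.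
by move=> _ [h hf <-]; exists h => // x; exact: le_trans (hf x) (fg x).
Qed.

Lemma eLnorm1_lower (h : R -> R) (f : lebR R -> \bar R) : bmfR h -> (forall x, 0 <= h x) ->
  (forall x : lebR R, TT x -> ((h x)%:E <= f x)%E) -> ((itg 0 1 h)%:E <= eLnorm 1%:E f)%E.
Proof.
move=> bh h0 hf; rewrite /eLnorm Lnorm1 -Rintegral_torus//.
rewrite -(bintE (findom_torus R) (bmf_lebR bh)) integral_mkcond.
apply: ge0_integral_mono => x; rewrite /patch; case: ifPn => Tx //.
  by rewrite lee_fin.
by apply: le_trans (hf x (set_mem Tx)) _; rewrite lee_abs.
by rewrite lee_abs.
Qed.

Variable eta : R.
Hypothesis eta01 : 0 < eta <= 1.
Definition initial : set (lebR R) := [set x : R | 0 <= x < eta].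

Lemma initialE : initial = `[0, eta[%classic.
Proof. by apply/seteqP; split => x; rewrite /initial/= in_itv. Qed.

Lemma initial_torus : initial `<=` TT.
Proof.
by move=> x; rewrite /initial /torus/= => /andP[-> h]; move: eta01 => /andP[_]; exact: lt_le_trans.
Qed.

Lemma leb_initial : leb initial = eta%:E.
Proof.
move: eta01 => /andP[e0 _].
by rewrite initialE; have := lebesgue_measure_itv `[(0 : R), eta[; rewrite /= lte_fin e0 sube0.
Qed.

Definition carleson_term (x : lebR R) : R[i] := pvint x (fun y => cexp2pi (m%:R * ((x : R) - (y : R)))
   * (cot (pi * ((x : R) - (y : R))))%:C%C * cindic initial y).

Lemma carleson_term_le x : ((normc (carleson_term x))%:E <= carleson_lac n (cindic initial) x)%E.
Proof. by apply: ereal_sup_ubound; exists j. Qed.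

Lemma Re_carleson_term x : complex.Re (carleson_term x) = lim ((\int[mu]_(y in [set y : R | torus y /\ eps < tdist x y])
  (cos (2 * pi * (m%:R * ((x : R) - y))) * cot (pi * ((x : R) - y)) * ico 0 eta y)) @[eps --> (0 : R)^'+]).
Proof.
rewrite /carleson_term /pvint.
pose h (y : lebR R) := cexp2pi (m%:R * ((x : R) - (y : R)))
   * (cot (pi * ((x : R) - (y : R))))%:C%C * cindic initial y.
have e : (fun eps : R => complex.Re (Cintegral [set y : R | torus y /\ eps < tdist x y] h)) = fun eps => \int[mu]_(y in [set y : R | torus y /\ eps < tdist x y])
  (cos (2 * pi * (m%:R * ((x : R) - y))) * cot (pi * ((x : R) - y)) * ico 0 eta y).
  apply/funext => eps; apply: eq_Rintegral => y _.
  by rewrite /h /cexp2pi /cindic icoE initialE /= !(mulr0, mul0r, subr0, addr0).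
by rewrite -e.
Qed.

Lemma Im_carleson_term x : complex.Im (carleson_term x) = lim ((\int[mu]_(y in [set y : R | torus y /\ eps < tdist x y])
  (sin (2 * pi * (m%:R * ((x : R) - y))) * cot (pi * ((x : R) - y)) * ico 0 eta y)) @[eps --> (0 : R)^'+]).
Proof.
rewrite /carleson_term /pvint.
pose h (y : lebR R) := cexp2pi (m%:R * ((x : R) - (y : R)))
   * (cot (pi * ((x : R) - (y : R))))%:C%C * cindic initial y.
have e : (fun eps : R => complex.Im (Cintegral [set y : R | torus y /\ eps < tdist x y] h)) = fun eps => \int[mu]_(y in [set y : R | torus y /\ eps < tdist x y])
  (sin (2 * pi * (m%:R * ((x : R) - y))) * cot (pi * ((x : R) - y)) * ico 0 eta y).
  apply/funext => eps; apply: eq_Rintegral => y _.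
  by rewrite /h /cexp2pi /cindic icoE initialE /= !(mulr0, mul0r, subr0, addr0, add0r).
by rewrite -e.
Qed.

Definition dirk_avg x : R := itg 0 1 (fun y => ico 0 eta y * dirk m (x - y)).

(** The sine cancels the pole of the cotangent, so the principal value is an ordinary integral. Its
    part near the diagonal is [O(m eps)] because the kernel is at most [2 m]. *)
Lemma Im_carleson_dirk x : 0 < x < 1 -> complex.Im (carleson_term x) = dirk_avg x.
Proof.
move=> /andP[x0 x1]; rewrite Im_carleson_term.
have bd : bmfR (fun y => dirk m (x - y)) by apply: bmf_reflect; exact: bmf_dirk.
have bF := bmfM (bmf_ico 0 eta) bd.
apply: (lim_at_right0 (e0 := Num.min x (1 - x)) (c := 6 * m%:R)) => //.
  by rewrite lt_min x0 subr_gt0.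
move=> eps e0; rewrite lt_min => /andP[ex ex1].
have ba := bmf_away x eps.
rewrite (Rintegral_away e0 ex ex1 (bmfM bF ba)); last 2 first.
- move=> y /andP[y0 y1] h; rewrite h mulr1 mulrC; congr (_ * _).
  rewrite /cot mulrA sin_cos_dirk mulrAC mulfV ?mul1r//.
  have sp t : 0 < t -> t < 1 -> sin (pi * t) != 0 :> R.
    move=> t0 t1; rewrite gt_eqF// sin_gt0_pi// mulr_gt0 ?pi_gt0//=.
    by rewrite -[ltRHS]mulr1 ltr_pM2l// pi_gt0.
  case: (ltP 0 (x - y)) => xy; first by apply: sp => //; lra.
  rewrite -oppr_eq0 -sinN -mulrN; apply: sp; last lra.
  rewrite oppr_gt0 lt_neqAle xy andbT; apply: contraTneq h => ->.
  by rewrite normr0 -leNgt ltW.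
- by move=> y _ /negbTE ->; rewrite mulr0.
rewrite /dirk_avg -(itgB _ _ bF (bmfM bF ba)).
have bi := bmfZ (2 * m%:R) (bmf_ico (x - eps) (x + 2 * eps)).
apply: le_trans (norm_itg_le (bmfB bF (bmfM bF ba)) bi _) _; last first.
  rewrite itgZ; last exact: bmf_ico.
  rewrite (_ : 6 * m%:R * eps = 2 * m%:R * (3 * eps)); last by ring.
  apply: ler_wpM2l; first by rewrite mulr_ge0.
  rewrite itg_ico// ge_max; apply/andP; split; first by rewrite mulr_ge0 ?ltW.
  have : Num.min 1 (x + 2 * eps) <= x + 2 * eps by rewrite ge_min lexx orbT.
  have : x - eps <= Num.max 0 (x - eps) by rewrite le_max lexx orbT.
  lra.
move=> y _; case: (ltP eps `|x - y|) => h; rewrite ?mulr1 ?mulr0.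
  by rewrite subrr normr0 mulr_ge0 ?ico_ge0// mulr_ge0.
rewrite subr0 [ico (x - eps) _ _]ico_in ?mulr1; last 2 first.
- by move: h; rewrite ler_norml => /andP[? ?]; lra.
- by move: h; rewrite ler_norml => /andP[? ?]; lra.
rewrite normrM -[leRHS]mul1r; apply: ler_pM => //; last exact: norm_dirk.
by rewrite ger0_norm ?ico_ge0// icoE indicE; case: (_ \in _).
Qed.

Lemma itg_dirk_avg : itg 0 1 dirk_avg = eta.
Proof.
move: eta01 => /andP[e0 e1].
rewrite /dirk_avg itg_swap; last first.
  apply: bmfM.
    by apply: (bmf_comp (phi := fun p : RR * RR => p.2) (bmf_ico 0 eta)); exact: measurable_snd.
  apply: (bmf_comp (phi := fun p : RR * RR => p.1 - p.2 : RR) (bmf_dirk R m)).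
  by apply: measurable_funB; [exact: measurable_fst | exact: measurable_snd].
transitivity (itg 0 1 (ico 0 eta)).
  apply: eq_itg => y _; rewrite itgZ ?itg_dirk ?mulr1//.
  by have := bmf_affine 1 (- y) (bmf_dirk R m); under eq_fun do rewrite mul1r.
by rewrite itg_ico// (max_idPl (lexx 0)) (min_idPr e1) subr0 (max_idPr (ltW e0)).
Qed.

Lemma bmf_dirk_avg : bmfR dirk_avg.
Proof.
apply: bmf_itg; apply: bmfM.
  by apply: (bmf_comp (phi := fun p : RR * RR => p.2) (bmf_ico 0 eta)); exact: measurable_snd.
apply: (bmf_comp (phi := fun p : RR * RR => p.1 - p.2 : RR) (bmf_dirk R m)).
by apply: measurable_funB; [exact: measurable_fst | exact: measurable_snd].
Qed.

Lemma carleson_norm_ge : (eta%:E <= eLnorm 1%:E (carleson_lac n (cindic initial)))%E.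
Proof.
have bI : bmfR (\1_(`]0, 1]%classic : set R)) by apply: bmf_indic; exact: measurable_itv.
have bd := bmf_norm bmf_dirk_avg.
(* The point 0, where [Im_carleson_dirk] says nothing, is removed from the minorant without changing
   its integral. *)
pose h x := `|dirk_avg x| * \1_(`]0, 1]%classic : set R) x.
have bh : bmfR h by exact: bmfM.
have h0 x : 0 <= h x by rewrite mulr_ge0// indicE.
have hle (x : lebR R) : TT x -> ((h x)%:E <= carleson_lac n (cindic initial) x)%E.
  move=> Tx; apply: le_trans (carleson_term_le x); rewrite lee_fin /h indicE.
  have nn : 0 <= normc (carleson_term x) by apply: le_trans (Re_le_normc _).
  have [x0|x0] := eqVneq (x : R) 0; first by rewrite memNset ?mulr0// /= in_itv/= x0 ltxx.
  have x01 : 0 < (x : R) < 1.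
    by move: Tx; rewrite /torus/= => /andP[p ->]; rewrite andbT lt_neqAle p andbT eq_sym.
  rewrite mem_set ?mulr1; last by move: x01 => /andP[p q]; rewrite /= in_itv/= p ltW.
  rewrite -Im_carleson_dirk//; exact: Im_le_normc.
apply: le_trans (eLnorm1_lower bh h0 hle); rewrite lee_fin -itg_dirk_avg.
apply: (le_trans (ler_norm _)); apply: (le_trans (norm_itg 0 1 bmf_dirk_avg)).
rewrite le_eqVlt; apply/orP; left; apply/eqP.
rewrite [RHS]/itg -bint_mkcond; last exact: measurable_itv.
rewrite (_ : _ `&` _ = `]0, 1]%classic); last first.
  apply/seteqP; split => x /=; rewrite !in_itv/=; first by case.
  by move=> /andP[p ->]; rewrite p (ltW p).
rewrite Rintegral_itv_obnd_cbnd//; apply: bmf_integrable => //; apply: findom_itv; exists 1 => x.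
by rewrite in_itv/= ler_norml => /andP[? ?]; apply/andP; split; lra.
Qed.

End LowerBound.

(** * The real part: logarithmic growth for small sets *)

Section LogarithmicGrowth.
Variable R : realType.
Notation RR := (measurableTypeR R).
Notation bmfR := (@bmf _ RR R).
Implicit Types (x y t z : R).

Lemma cos_ge z : 1 - `|z| <= cos z.
Proof.
have [_ cl _] := half_wave_cos R; have := cl 0 z.
by rewrite cos0 sub0r normrN ler_norml => /andP[_]; lra.
Qed.

Lemma sin_le z : 0 <= z -> sin z <= z.
Proof.
move=> z0; have [_ sl _] := half_wave_sin R; have := sl z 0.
by rewrite sin0 !subr0 (ger0_norm z0); exact: le_trans (ler_norm _).
Qed.

Lemma sin_ge_half z : 0 < z -> z <= 1 / 4 -> z / 2 <= sin z.
Proof.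
move=> z0 z1.
have [c] : exists2 c, c \in `[0, z]%R & sin z - sin 0 = cos c * (z - 0).
  apply: MVT_segment; first exact: ltW.
  by apply: continuous_subspaceT => x; exact: continuous_sin.
rewrite in_itv/= => /andP[c0 cz]; rewrite sin0 !subr0 => ->.
have := cos_ge c; rewrite ger0_norm// => h; nra.
Qed.

Lemma pi_le4 : pi <= 4 :> R.
Proof. by have := @pihalf_lt2 R; lra. Qed.

Lemma itg_inv (eta a b : R) : 0 < eta -> eta < a -> a < b -> itg a b (hinv eta) = ln b - ln a.
Proof.
move=> e0 ea ab; have a0 := lt_trans e0 ea.
have h : (\int[@lebesgue_measure R]_(x in `[a, b]) (x^-1)%:E = (ln b)%:E - (ln a)%:E)%E.
  apply: (continuous_FTC2 (f := fun x => x^-1) (F := @ln R)) => //.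
  - apply/continuous_in_subspaceT => x; rewrite mem_setE in_itv/= => /andP[ax _].
    by apply: inv_continuous; rewrite gt_eqF// (lt_le_trans a0 ax).
  - split.
    + move=> x; rewrite in_itv/= => /andP[ax _].
      by have [] := is_derive1_ln (lt_trans a0 ax).
    + by apply: cvg_at_right_filter; exact: continuous_ln.
    + by apply: cvg_at_left_filter; apply: continuous_ln; exact: lt_trans ab.
  - move=> x; rewrite in_itv/= => /andP[ax _]; rewrite derive1E.
    by have [_ ->] := is_derive1_ln (lt_trans a0 ax).
rewrite /itg /Rintegral (_ : (\int[_]_(x in _) _ = (ln b)%:E - (ln a)%:E)%E)//.
rewrite -h; apply: eq_integral => x; rewrite mem_setE in_itv/= => /andP[ax _].
by rewrite /hinv ifT// gtr0_norm ?(lt_le_trans ea ax)// (lt_le_trans a0 ax).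
Qed.

Variables (n : nat -> nat) (j : nat) (eta : R).
Hypotheses (nj : (0 < n j)%N) (eta0 : 0 < eta).
Notation m := (n j).
Hypothesis eta_small : eta * (32 * m%:R) ^+ 2 <= 1.
Notation b := ((16 * m%:R)^-1 : R).

Let m1 : 1 <= m%:R :> R. Proof. by rewrite ler1n. Qed.

Let m32 : 32 <= 32 * m%:R :> R. Proof. by rewrite -[leLHS]mulr1 ler_wpM2l. Qed.

Let eta_m : eta * (32 * m%:R) < 1.
Proof. have p : 0 < eta * (32 * m%:R) by rewrite mulr_gt0// mulr_gt0// ltr0n.
have X32 := m32.
move: eta_small; rewrite expr2 mulrA; move: (eta * (32 * m%:R)) p (32 * m%:R) X32 => q q0 X X32; nra. Qed.

Let b0 : 0 < b. Proof. by rewrite invr_gt0 mulr_gt0// ltr0n. Qed.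

Let bm : m%:R * b = 1 / 16.
Proof. by rewrite invfM; field; rewrite pnatr_eq0 -lt0n. Qed.

Let eta01 : 0 < eta <= 1.
Proof.
rewrite eta0/=; apply/ltW; apply: le_lt_trans eta_m.
by rewrite ler_peMr ?(ltW eta0)//; apply: le_trans m32; rewrite ler1n.
Qed.

Let bge : 2 * eta < b.
Proof. rewrite -[ltRHS]div1r ltr_pdivlMr; last by rewrite mulr_gt0// ltr0n.
by rewrite (_ : 2 * eta * (16 * m%:R) = eta * (32 * m%:R))//; ring. Qed.

Let ble : b <= 1 / 16.
Proof. by rewrite -[leLHS]mul1r -bm ler_wpM2r// ltW. Qed.

(** For [t <= 1 / (16 m)] both cosines are far from their zeros: [2 pi m t <= 1/2] and [pi t <= 1/4]
    make them at least 1/2 and 3/4. With [sin (pi t) <= 4 t] the quotient is at least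
    [3 / (32 t)]. *)
Lemma kernel_bounds t : eta < t -> t <= b ->
  (16 * t)^-1 <= cos (2 * pi * (m%:R * t)) * cot (pi * t) /\
  `|cos (2 * pi * (m%:R * t)) * cot (pi * t)| <= eta^-1.
Proof.
move=> et tb; have t0 := lt_trans eta0 et.
have p0 := pi_gt0 R; have p4 := pi_le4; have p2 := pi_ge2 R.
have pt0 : 0 < pi * t by rewrite mulr_gt0.
have pt1 : pi * t <= 1 / 4.
  by apply: (@le_trans _ _ (4 * (1 / 16))); [apply: ler_pM => //; [exact: ltW|exact: ltW|exact: le_trans tb ble]|lra].
have mt0 : 0 < m%:R * t by rewrite mulr_gt0// ltr0n.
have mt : m%:R * t <= 1 / 16 by rewrite -bm ler_wpM2l.
have z1 : 2 * pi * (m%:R * t) <= 1 / 2.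
  by apply: (@le_trans _ _ (2 * 4 * (1 / 16))); [apply: ler_pM => //; [by rewrite mulr_ge0 ?ltW|exact: ltW|by rewrite ler_wpM2l]|lra].
have z0 : 0 <= 2 * pi * (m%:R * t) by rewrite mulr_ge0 ?ltW// mulr_gt0.
have c1 := cos_ge (2 * pi * (m%:R * t)); rewrite (ger0_norm z0) in c1.
have c2 := cos_ge (pi * t); rewrite (gtr0_norm pt0) in c2.
have s1 := sin_le (ltW pt0); have s2 := sin_ge_half pt0 pt1.
have s0 : 0 < sin (pi * t) by lra.
have c3 := cos_le1 (2 * pi * (m%:R * t)); have c4 := cos_le1 (pi * t).
set C := cos (2 * pi * _) in c1 c3 *; rewrite /cot.
set c := cos (pi * t) in c2 c4 *; set s := sin (pi * t) in s0 s1 s2 *.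
have C1 : 1 / 2 <= C by lra.
have c5 : 3 / 4 <= c by lra.
have Cc : 3 / 8 <= C * c by nra.
have Cc1 : C * c <= 1 by nra.
split.
  rewrite mulrA ler_pdivlMr// mulrC ler_pdivrMr; last by rewrite mulr_gt0.
  have : pi * t <= 4 * t by rewrite ler_wpM2r// ltW.
  nra.
rewrite mulrA ger0_norm; last by rewrite divr_ge0 ?(ltW s0)//; lra.
rewrite ler_pdivrMr// -ler_pdivrMl ?invr_gt0// invrK.
have : eta <= s.
  have : 2 * t <= pi * t by rewrite ler_wpM2r// ltW.
  lra.
nra.
Qed.

(** For [y] in [[0, eta[] the difference [x - y] stays in []eta, b]], away from the singularity.
    There the kernel is at least [1 / (16 x)], and the set has length [eta]. *)
Lemma Re_carleson_ge x : 2 * eta <= x -> x <= b -> eta / 16 * x^-1 <= complex.Re (carleson_term n j eta x).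
Proof.
move=> ex xb; have p0 := eta0.
have x0 : 0 < x by lra.
have x1 : 0 < 1 - x by have := ble; lra.
pose k t := cos (2 * pi * (m%:R * t)) * cot (pi * t).
pose G y := k (x - y) * ico 0 eta y.
have rng y : 0 <= y -> y < eta -> eta < x - y /\ x - y <= b by move=> ? ?; split; lra.
have mk' : @measurable_fun _ _ RR RR setT k.
  apply: measurable_funM.
    have -> : (fun t => cos (2 * pi * (m%:R * t)) : R) = fun t => cos (2 * pi * m%:R * t).
      by apply/funext => t; rewrite !mulrA.
    exact: (proj1 (bmf_cos (2 * pi * m%:R))).
  apply: measurable_funM; first exact: (proj1 (bmf_cos pi)).
  apply: (measurableT_comp (@measurable_inv R)).
  have := bmf_affine pi 0 (bmf_half_wave (half_wave_sin R)); under eq_fun do rewrite addr0.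
  by case.
have bG : bmfR G.
  split.
    apply: measurable_funM; last exact: (proj1 (bmf_ico 0 eta)).
    apply: (measurableT_comp mk').
    have := measurable_affine (-1 : R) x; congr (measurable_fun _ _).
    by apply/funext => y; rewrite mulN1r addrC.
  exists eta^-1 => y; rewrite /G; have [/andP[y0 ye]|h] := boolP ((0 <= y) && (y < eta)).
    rewrite ico_in// mulr1; have [h1 h2] := rng y y0 ye.
    by have [_] := kernel_bounds h1 h2.
  rewrite /ico (negbTE h) mulr0 normr0 invr_ge0; exact: ltW.
rewrite Re_carleson_term.
(* Once [eps < eta], the excluded neighbourhood of [x] does not meet the set, so the truncated
   integrals are constant in [eps]; hence the error constant 0. *)
rewrite (lim_at_right0 (e0 := Num.min eta (1 - x)) (c := 0) (L := itg 0 1 G)) //.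
- rewrite (_ : _ * _ = (16 * x)^-1 * itg 0 1 (ico 0 eta)); last first.
    move: eta01 => /andP[_ e1].
    rewrite itg_ico// (max_idPl (lexx 0)) (min_idPr e1) subr0 (max_idPr (ltW eta0)).
    by field; rewrite gt_eqF.
  rewrite -itgZ; last exact: bmf_ico.
  apply: le_itg => //; first exact: bmfZ (bmf_ico _ _).
  move=> y _; rewrite /G; have [/andP[y0 ye]|h] := boolP ((0 <= y) && (y < eta)).
    rewrite ico_in// !mulr1; have [h1 h2] := rng y y0 ye.
    have [+ _] := kernel_bounds h1 h2; apply: le_trans.
    have xy : 0 < x - y by exact: lt_trans eta0 h1.
    by rewrite lef_pV2 ?posrE ?mulr_gt0// ler_wpM2l// lerBlDr lerDl.
  by rewrite /ico (negbTE h) !mulr0.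
- by rewrite lt_min eta0.
move=> eps e0; rewrite lt_min => /andP[ee ex1].
have ex' : eps < x by lra.
rewrite mul0r (Rintegral_away e0 ex' ex1 bG) ?subrr ?normr0//.
move=> y /andP[y0 _]; rewrite -leNgt ler_norml => /andP[_ h].
by rewrite /G ico_out ?mulr0//; right; lra.
Qed.

Lemma carleson_norm_log :
  ((eta / 16 * (ln b - ln (2 * eta)))%:E <= eLnorm 1%:E (carleson_lac n (cindic (initial eta))))%E.
Proof.
have b2 := bmfM (bmf_hinv eta0) (bmf_ico (2 * eta) b).
pose h x := eta / 16 * (hinv eta x * ico (2 * eta) b x).
have bh : bmfR h by exact: bmfZ.
have e16 : 0 <= eta / 16 by rewrite divr_ge0// ltW.
have hE x : 2 * eta <= x -> x < b -> h x = eta / 16 * x^-1.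
  move=> ? ?; rewrite /h ico_in// mulr1 /hinv.
  have ex : eta < x by move: eta0 => ?; lra.
  by rewrite ifT// gtr0_norm// (lt_trans eta0).
have h0 x : 0 <= h x.
  have [/andP[p q]|nh] := boolP ((2 * eta <= x) && (x < b)).
    by rewrite hE// mulr_ge0// invr_ge0 (le_trans _ p)// mulr_ge0// ltW.
  by rewrite /h /ico (negbTE nh) !mulr0.
have hle (x : lebR R) : torus x -> ((h x)%:E <= carleson_lac n (cindic (initial eta)) x)%E.
  move=> Tx; apply: le_trans (carleson_term_le n j eta x); rewrite lee_fin.
  have [/andP[p q]|nh] := boolP ((2 * eta <= (x : R)) && ((x : R) < b)).
    rewrite hE//; apply: le_trans (Re_carleson_ge p (ltW q)) _.
    by apply: le_trans (ler_norm _) _; exact: Re_le_normc.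
  rewrite /h /ico (negbTE nh) !mulr0; exact: le_trans (Re_le_normc _).
apply: le_trans (eLnorm1_lower bh h0 hle); rewrite lee_fin itgZ//; apply: ler_wpM2l => //.
rewrite -(itg_inv eta0 _ bge); last by move: eta0 => ?; lra.
have bE := bmf_hinv eta0.
rewrite le_eqVlt; apply/orP; left; apply/eqP.
rewrite -itg_co// [RHS]/itg; under [RHS]eq_Rintegral do rewrite icoE.
rewrite -bint_mkcond; last exact: measurable_itv.
congr (\int[_]_(x in _) _); apply/seteqP; split => x /=; rewrite !in_itv/=; last by case.
move=> /andP[p q]; rewrite p q; split => //; apply/andP; split.
  by apply: le_trans p; rewrite mulr_ge0// ltW.
by apply: ltW (lt_le_trans q _); have := ble; lra.
Qed.

End LogarithmicGrowth.

Theorem carleson_lower_bound (R : realType) (n : nat -> nat) : lacunary (R := R) n ->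
  exists C2 : R, 0 < C2 /\
     forall eta : R, 0 < eta <= 1 ->
       exists F : set (lebR R),
         [/\ measurable F, F `<=` torus,
             leb F = eta%:E &
             ((C2 * LlogL F)%:E <= eLnorm 1%:E (carleson_lac n (cindic F)))%E].
Proof.
move=> n_lac; have [r [j [_ hj]]] := lacunary_tail n_lac.
have [nj _] := hj j (leqnn j).
have k0 := ln2_gt0 R.
set X : R := 32 * (n j)%:R.
have X1 : 32 <= X by rewrite -[leLHS]mulr1 ler_wpM2l// ler1n.
have X0 : 0 < X by apply: lt_le_trans X1.
have lX0 : 5 * ln 2 <= ln X.
  rewrite (_ : 5 * ln 2 = ln 32); first by rewrite ler_ln ?posrE.
  by rewrite (_ : 32 = 2 ^+ 5 :> R) ?lnXn ?mulr_natl// -natrX.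
have D0 : 0 < 64 + 2 * ln 2 + 2 * ln X by lra.
(* The summand [2 ln 2 + 2 ln X] bounds [ln (4 / eta)] when [eta X^2 > 1]. In the other case
   [64 = 16 * 4] is used: 16 from [carleson_norm_log], 4 from the comparison [h3] below. *)
exists (ln 2 / (64 + 2 * ln 2 + 2 * ln X)); split; first exact: divr_gt0.
move=> eta eta01; have /andP[e0 e1] := eta01.
exists (initial eta); split.
- by rewrite initialE; apply: borel_lebR; exact: measurable_itv.
- exact: initial_torus.
- exact: leb_initial.
rewrite /LlogL leb_initial//=.
have -> : ln (4 / eta) = 2 * ln 2 - ln eta.
  rewrite ln_div ?posrE// (_ : 4 = 2 ^+ 2 :> R); last by rewrite -natrX.
  by rewrite lnXn// mulr_natl.
rewrite (_ : _ * (eta * _) = eta * ((2 * ln 2 - ln eta) / (64 + 2 * ln 2 + 2 * ln X))); last first.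
  by field; rewrite !gt_eqF.
have l0 : 0 <= - ln eta by rewrite oppr_ge0 ln_le0.
(* For [eta] bounded below the logarithm is bounded, and the bound by the measure is enough.
   Otherwise [ln eta <= - 2 ln X], so that losing [ln X] from the logarithm costs only a constant
   factor. *)
have [big|small] := ltP 1 (eta * X ^+ 2).
  apply: le_trans (carleson_norm_ge nj eta01); rewrite lee_fin ler_piMr ?(ltW e0)//.
  rewrite ler_pdivrMr// mul1r.
  have : 0 <= ln (eta * X ^+ 2) by rewrite ln_ge0// ltW.
  rewrite lnM ?posrE ?exprn_gt0// lnXn// mulr2n => h; lra.
apply: le_trans (carleson_norm_log nj e0 small); rewrite lee_fin.
have h1 : ln (eta * X ^+ 2) <= 0 by rewrite ln_le0.
rewrite lnM ?posrE ?exprn_gt0// lnXn// mulr2n in h1.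
have m0 : 0 < (n j)%:R :> R by rewrite ltr0n.
have h2 : ln (16 * (n j)%:R)^-1 - ln (2 * eta) = - ln X - ln eta.
  rewrite lnV ?posrE ?mulr_gt0// (_ : X = 2 * (16 * (n j)%:R)); last by rewrite /X; ring.
  have a1 : ln (2 * eta) = ln 2 + ln eta by rewrite lnM ?posrE.
  have a2 : ln (2 * (16 * (n j)%:R)) = ln 2 + ln (16 * (n j)%:R) :> R by rewrite lnM ?posrE ?mulr_gt0.
  by rewrite a1 a2; ring.
rewrite h2 -mulrA; apply: ler_wpM2l; first exact: ltW.
rewrite ler_pdivrMr//.
set lX := ln X in h1 lX0 D0 *; set le := ln eta in h1 l0 *.
have h3 : 2 * ln 2 - le <= 4 * (- lX - le) by lra.
have h4 : 0 <= - lX - le by lra.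
apply: (le_trans h3); rewrite -mulrA [leRHS]mulrC -mulrA.
have : 64 * (- lX - le) <= (- lX - le) * (64 + 2 * ln 2 + 2 * lX).
  by rewrite mulrC; apply: ler_wpM2l => //; lra.
lra.
Qed.

Theorem theoremB (R : realType) (n : nat -> nat) (n_lac : lacunary (R := R) n) :
  (exists C1 : R, 0 < C1 /\
     forall (F : set (lebR R)) (N : lebR R -> nat)
            (Clac_adj : (lebR R -> R[i]) -> (lebR R -> R[i]))
            (g : lebR R -> R[i]),
       measurable F -> F `<=` torus ->
       measurable_fun torus N ->
       (forall x, torus x -> exists j, N x = n j) ->
       L2_adjoint (carleson_linear N) Clac_adj ->
       cLp +oo%E g ->
       (cLnorm 1%:E (fun x => (cindic F x * Clac_adj g x)%R)
          <= (C1 * LlogL F)%:E * cLnorm +oo%E g)%E)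
  /\
  (exists C2 : R, 0 < C2 /\
     forall eta : R, 0 < eta <= 1 ->
       exists F : set (lebR R),
         [/\ measurable F, F `<=` torus,
             leb F = eta%:E &
             ((C2 * LlogL F)%:E <= eLnorm 1%:E (carleson_lac n (cindic F)))%E]).
Proof.
by split; [exact: lacunary_adjoint_bound | exact: carleson_lower_bound].
Qed.
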